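(* Let $0<\theta<\pi/2$. Suppose $\{\varphi^0_\theta,\varphi^1_\theta,\varphi^2_\theta,\varphi^3_\theta\}\in(L^2(\mathbb{R}))^4$ satisfies, for every $j\in\{0,1,2,3\}$ (indices mod 4, so $\varphi^{-1}_\theta=\varphi^3_\theta$, $\varphi^4_\theta=\varphi^0_\theta$), $\varphi^j_\theta(t)=SD_\theta\varphi^{j-1}_\theta(t)$ for $t<-a$, $\varphi^j_\theta(t)=D_\theta S\varphi^{j+1}_\theta(t)$ for $t>a$, and $\varphi^j_\theta(t)=0$ for $-a<t<a$. Then $\varphi^j_\theta=0$ for all $j\in\{0,1,2,3\}$.
   Context: Fix $a>0$ and $k>0$. Square roots are principal ($\mathrm{Arg}\in(-\pi,\pi]$), $R(w,z)=(w^2+z^2)^{1/2}$, $h(x_1,x_2)=\frac{ikx_1}{2}\frac{H_1^{(1)}(kR(x_1,x_2))}{R(x_1,x_2)}$. $\tau_\theta(s)=-a+(s+a)e^{i\theta}$ for $s<-a$, $s$ for $|s|\le a$, $a+(s-a)e^{i\theta}$ for $s>a$. $S\psi(t)=\psi(-t)$, and $D_\theta\psi(t)=\int_{\mathbb{R}}h(\tau_\theta(t)-a,a-\tau_\theta(s))\psi(s)\tau_\theta'(s)\,\mathrm{d}s$ for $t>a$, $D_\theta\psi(t)=0$ for $t\le a$. *)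

(* Defs.v *)
From HB Require Import structures.
From mathcomp Require Import all_boot all_order all_algebra.
From mathcomp Require Import all_classical all_reals all_analysis.
From mathcomp Require Import complex.

Set Implicit Arguments.
Unset Strict Implicit.
Unset Printing Implicit Defensive.

Import Order.TTheory GRing.Theory Num.Theory.
Import numFieldNormedType.Exports.
Local Open Scope classical_set_scope.
Local Open Scope ring_scope.
Local Open Scope complex_scope.

Section Defs.
Variable R : realType.
Local Notation C := R[i].
Local Notation Re := (@complex.Re R).
Local Notation Im := (@complex.Im R).

(** Principal argument, with values in (-pi, pi]. *)
Definition carg (z : C) : R :=
  let x := Re z in let y := Im z in
  if 0 < x then atan (y / x)
  else if x < 0 then (if 0 <= y then atan (y / x) + pi else atan (y / x) - pi)
  else if 0 < y then pi / 2
  else if y < 0 then - (pi / 2)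
  else 0.

Definition cmod (z : C) : R := Num.sqrt (Re z ^+ 2 + Im z ^+ 2).

Definition cexp (z : C) : C :=
  (expR (Re z) * cos (Im z)) +i* (expR (Re z) * sin (Im z)).
Definition clog (z : C) : C := (ln (cmod z)) +i* (carg z).

Definition csqrt (z : C) : C := if z == 0 then 0 else cexp (clog z / 2%:R).

Definition clim (u : nat -> C) : C :=
  (limn (fun n => Re (u n))) +i* (limn (fun n => Im (u n))).
Definition cseries (u : nat -> C) : C := clim (fun n => \sum_(m < n) u m).

(** Harmonic numbers H_n = sum_{m=1}^n 1/m, Euler's constant, and the
    digamma function at positive integers: psi(n+1) = -gamma + H_n. *)
Definition harmonic (n : nat) : R := \sum_(1 <= m < n.+1) (m%:R)^-1.
Definition euler_gamma : R := limn (fun n => harmonic n - ln (n%:R)).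
Definition digamma_succ (n : nat) : R := - euler_gamma + harmonic n.

(** Bessel function of the first kind of order 1 (DLMF 10.2.2). *)
Definition besselJ1 (z : C) : C :=
  cseries (fun m => ((-1) ^+ m * (z / 2%:R) ^+ (2 * m).+1)
                    / ((m`!)%:R * ((m.+1)`!)%:R)).

(** Bessel function of the second kind of order 1, principal branch
    (DLMF 10.8.1 with n = 1). *)
Definition besselY1 (z : C) : C :=
  - ((2%:R)%:C / ((pi : R)%:C * z))
  + ((2%:R / pi : R)%:C) * clog (z / 2%:R) * besselJ1 z
  - (z / ((2%:R * pi : R)%:C))
    * cseries (fun m => ((digamma_succ m + digamma_succ m.+1 : R)%:C)
                        * (- (z ^+ 2) / 4%:R) ^+ m
                        / ((m`!)%:R * ((m.+1)`!)%:R)).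

Definition hankel1 (z : C) : C := besselJ1 z + 'i * besselY1 z.

Definition Rw (w z : C) : C := csqrt (w ^+ 2 + z ^+ 2).

Definition hker (k : R) (x1 x2 : C) : C :=
  ('i * k%:C * x1 / 2%:R) * hankel1 (k%:C * Rw x1 x2) / Rw x1 x2.

Definition eith (th : R) : C := (cos th) +i* (sin th).

(** The complex scaling path tau_theta and its derivative (which is defined
    except at s = -a, a; the value at these two points is irrelevant). *)
Definition tau (a th s : R) : C :=
  if s < - a then (- a)%:C + (s + a)%:C * eith th
  else if a < s then a%:C + (s - a)%:C * eith th
  else s%:C.
Definition dtau (a th s : R) : C :=
  if s < - a then eith th else if a < s then eith th else 1.

Definition cintegral (f : R -> C) : C :=
  (Rintegral lebesgue_measure setT (fun s => Re (f s)))
  +i* (Rintegral lebesgue_measure setT (fun s => Im (f s))).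

Definition Sop (psi : R -> C) : R -> C := fun t => psi (- t).
Definition Dop (a k th : R) (psi : R -> C) : R -> C := fun t =>
  if a < t then
    cintegral (fun s => hker k (tau a th t - a%:C) (a%:C - tau a th s)
                        * psi s * dtau a th s)
  else 0.

Definition L2 (f : R -> C) : Prop :=
  measurable_fun setT (fun x => Re (f x)) /\
  measurable_fun setT (fun x => Im (f x)) /\
  (\int[lebesgue_measure]_x ((Re (f x) ^+ 2 + Im (f x) ^+ 2)%:E) < +oo)%E.

End Defs.

(* Main.v *)
(** Along the scaled path the squared distance [rho = w^2 + z^2] lies in the open
    upper half-plane, where [hker k w z = C0 w \int_0^oo exp(i rho u / 4 + i k^2 / u) du].
    Hence the kernel decays exponentially and, as a function of the two real path
    parameters, solves a complex-scaled Helmholtz equation.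

    Let [p_j y = phi_j (a + y)] and [n_j y = phi_j (- a - y)] for [y > 0]. The system says
    that these are the traces, on two half-lines, of fields [u] generated by the data of
    the neighbouring index. For such a field consider the flux [Im \int conj(u) u_2] along
    a half-line, [u_2] being the derivative transverse to it.
    - In the strip between the two half-lines the flux is monotone, because its derivative
      is [- sin(2 th) \int |u_1|^2]; so [flux (p, n) + flux (n, p) <= 0].
    - In a corner the two fields of consecutive indices are reflections of each other
      (this is the semigroup property of the Dirichlet Poisson kernel of the scaled
      equation), and an energy identity gives [flux + flux' >= 0] with equality only for
      zero fields.
    Each flux occurs once in a strip and once in a corner, so summing over the four indices
    forces all of them to vanish.

    The flux identities need data that are bounded and O(sqrt y) at the corner. Data in L^2
    are brought to this form by the integral equation itself: near the corner its kernel is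
    close to the Poisson kernel, a contraction for the weight [sqrt y + d / sqrt y]. *)

Require Import Defs.
From HB Require Import structures.
From mathcomp Require Import all_boot all_order all_algebra.
From mathcomp Require Import all_classical all_reals all_analysis.
From mathcomp Require Import measurable_realfun complex ring lra.
Set Implicit Arguments.
Unset Strict Implicit.
Unset Printing Implicit Defensive.
Import Order.TTheory GRing.Theory Num.Theory.
Import numFieldNormedType.Exports.
Local Open Scope classical_set_scope.
Local Open Scope ring_scope.
Local Open Scope complex_scope.

(** * Complex-valued functions of a real variable *)

Section cplx.
Context {R : realType}.
Local Notation C := R[i].
Local Notation Re := (@complex.Re R).
Local Notation Im := (@complex.Im R).
Implicit Types (x y z w : C) (r s t : R).

(** The kernel is given by power series with a logarithm, from which no decay and no estimate along
    the path can be read. The oscillatory integral supplies both; that it equals [hker] is a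
    connection problem, solved by inserting a parameter [s] and showing that integral and series
    satisfy the same second-order equation in [s] with the same behaviour at [s = 0].

    The signs come from the scaling: lengths along the half-lines carry the factor [e = eith th],
    lengths across the gap [2 * a] do not. In the strip one direction is scaled, and only the
    gradient along it survives, with [Im (e ^- 2) = - sin (2 th)]. In the corner both directions are
    scaled; then the whole energy appears with the factor [- sin th], and the boundary term of
    Green's identity is the flux density of the other pair.

    The exponent 1/2 in the weight serves two purposes: it makes the gradient integrable at the
    corner, and the Poisson kernel maps [sqrt y] and its inverse to [1 / sqrt 2] times themselves.
    The number 3/4 is an upper bound for this that has an elementary primitive, and it leaves room
    for the factor 7/6 by which the true kernel may exceed the Poisson kernel. *)

Lemma ReD x y : Re (x + y) = Re x + Re y. Proof. by case: x; case: y. Qed.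
Lemma ImD x y : Im (x + y) = Im x + Im y. Proof. by case: x; case: y. Qed.
Lemma ReN x : Re (- x) = - Re x. Proof. by case: x. Qed.
Lemma ImN x : Im (- x) = - Im x. Proof. by case: x. Qed.
Lemma ReM x y : Re (x * y) = Re x * Re y - Im x * Im y.
Proof. by case: x; case: y. Qed.
Lemma ImM x y : Im (x * y) = Re x * Im y + Im x * Re y.
Proof. by case: x; case: y. Qed.
Lemma ReC r : Re r%:C = r. Proof. by []. Qed.
Lemma ImC r : Im r%:C = 0. Proof. by []. Qed.
Lemma ReJ x : Re x^* = Re x. Proof. by case: x. Qed.
Lemma ImJ x : Im x^* = - Im x. Proof. by case: x. Qed.
Lemma Re0 : Re 0 = 0. Proof. by []. Qed.
Lemma Im0 : Im 0 = 0. Proof. by []. Qed.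
Lemma Re1 : Re 1 = 1. Proof. by []. Qed.
Lemma Im1 : Im 1 = 0. Proof. by []. Qed.
Definition ReImE := (ReD, ImD, ReN, ImN, ReM, ImM, ReC, ImC, ReJ, ImJ, Re0, Im0, Re1, Im1).

Lemma eq_ReIm x y : Re x = Re y -> Im x = Im y -> x = y.
Proof. by case: x; case: y => /= ? ? ? ? -> ->. Qed.

Lemma cmodE x : cmod x = Normc.normc x. Proof. by case: x. Qed.
Lemma cmodM x y : cmod (x * y) = cmod x * cmod y.
Proof. by rewrite !cmodE Normc.normcM. Qed.
Lemma cmodV x : cmod x^-1 = (cmod x)^-1.
Proof. by rewrite !cmodE Normc.normcV. Qed.
Lemma ler_cmodD x y : cmod (x + y) <= cmod x + cmod y.
Proof. by rewrite !cmodE; exact: le_normcD. Qed.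
Lemma cmodN x : cmod (- x) = cmod x.
Proof. by rewrite !cmodE; exact: normcN. Qed.
Lemma ler_cmodB x y : cmod (x - y) <= cmod x + cmod y.
Proof. by rewrite -(cmodN y) ler_cmodD. Qed.
Lemma cmod_ge0 x : 0 <= cmod x. Proof. exact: sqrtr_ge0. Qed.
Lemma cmod0 : cmod 0 = 0 :> R. Proof. by rewrite cmodE Normc.normc0. Qed.
Lemma cmod_eq0 x : cmod x = 0 -> x = 0.
Proof. by rewrite cmodE => /Normc.eq0_normc. Qed.
Lemma cmodJ x : cmod x^* = cmod x.
Proof. by case: x => u v; rewrite /cmod /= sqrrN. Qed.
Lemma cmodC r : cmod r%:C = `|r|.
Proof. by rewrite /cmod /= expr0n addr0 sqrtr_sqr. Qed.
Lemma cmod1 : cmod 1 = 1 :> R. Proof. by rewrite (cmodC 1) normr1. Qed.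
Lemma cmodi : cmod 'i = 1 :> R.
Proof. by rewrite /cmod /= expr0n add0r expr1n sqrtr1. Qed.
Lemma cmodX x n : cmod (x ^+ n) = cmod x ^+ n.
Proof. by elim: n => [|n IH]; rewrite ?expr0 ?cmod1// !exprS cmodM IH. Qed.
Lemma cmod_sqr x : cmod x ^+ 2 = Re x ^+ 2 + Im x ^+ 2.
Proof. by rewrite /cmod sqr_sqrtr// addr_ge0// sqr_ge0. Qed.
Lemma Re_le_cmod x : `|Re x| <= cmod x.
Proof. by rewrite /cmod -(sqrtr_sqr (Re x)) ler_sqrt ?lerDl ?addr_ge0 ?sqr_ge0. Qed.
Lemma Im_le_cmod x : `|Im x| <= cmod x.
Proof. by rewrite /cmod -(sqrtr_sqr (Im x)) ler_sqrt ?lerDr ?addr_ge0 ?sqr_ge0. Qed.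
Lemma cmod_leD x : cmod x <= `|Re x| + `|Im x|.
Proof.
have -> : x = (Re x)%:C + 'i * (Im x)%:C by rewrite -complexE.
rewrite (le_trans (ler_cmodD _ _))// cmodM cmodi mul1r !cmodC.
by case: x => u v /=; rewrite ?(mul0r, mul1r, mulr0, addr0, add0r, subr0).
Qed.
Lemma mulcJ_cmod x : x^* * x = (cmod x ^+ 2)%:C.
Proof. by rewrite cmod_sqr; case: x => u v; apply: eq_ReIm => /=; ring. Qed.

Lemma cexpD x y : cexp (x + y) = cexp x * cexp y.
Proof.
rewrite /cexp; apply: eq_ReIm => /=; rewrite !ReImE /= expRD ?cosD ?sinD; ring.
Qed.
Lemma cexp0 : cexp 0 = 1 :> C.
Proof. by rewrite /cexp /= expR0 cos0 sin0 mulr0 mulr1. Qed.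
Lemma cmod_cexp x : cmod (cexp x) = expR (Re x).
Proof.
rewrite /cmod /cexp /= !exprMn -mulrDr cos2Dsin2 mulr1 sqrtr_sqr.
by rewrite ger0_norm ?expR_ge0.
Qed.
Lemma cexp_neq0 x : cexp x != 0.
Proof.
apply/eqP => h; have := cmod_cexp x; rewrite h cmod0 => /esym/eqP.
by rewrite gt_eqF ?expR_gt0.
Qed.

Definition cder (F : R -> C) (t : R) (D : C) :=
  is_derive t 1 (Re \o F) (Re D) /\ is_derive t 1 (Im \o F) (Im D).

Lemma cder_eq F t D D' : cder F t D -> D = D' -> cder F t D'.
Proof. by move=> + <-. Qed.

Lemma cder_cst (c : C) t : cder (fun=> c) t 0.
Proof. by split; exact: is_derive_cst. Qed.

Lemma cder_real (f : R -> R) t d : is_derive t 1 f d -> cder (fun s => (f s)%:C) t d%:C.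
Proof. by move=> fd; split => //=; exact: is_derive_cst. Qed.

Lemma cder_id t : cder (fun s => s%:C) t 1.
Proof. by apply: cder_real; exact: is_derive_id. Qed.

Lemma cderD F G t D E : cder F t D -> cder G t E -> cder (fun s => F s + G s) t (D + E).
Proof.
move=> [a b] [c d]; split.
  rewrite (_ : _ \o _ = (Re \o F) + (Re \o G)); last by apply/funext => s /=; rewrite ReD.
  by rewrite ReD; exact: is_deriveD.
rewrite (_ : _ \o _ = (Im \o F) + (Im \o G)); last by apply/funext => s /=; rewrite ImD.
by rewrite ImD; exact: is_deriveD.
Qed.

Lemma cderM F G t D E : cder F t D -> cder G t E ->
  cder (fun s => F s * G s) t (D * G t + F t * E).
Proof.
move=> [a b] [c d]; split.
  rewrite (_ : _ \o _ = (Re \o F) * (Re \o G) - (Im \o F) * (Im \o G)); last first.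
    by apply/funext => s /=; rewrite ReM.
  apply: is_derive_eq (is_deriveB (is_deriveM a c) (is_deriveM b d)) _.
  by rewrite ReD !ReM /GRing.scale /=; ring.
rewrite (_ : _ \o _ = (Re \o F) * (Im \o G) + (Im \o F) * (Re \o G)); last first.
  by apply/funext => s /=; rewrite ImM.
apply: is_derive_eq (is_deriveD (is_deriveM a d) (is_deriveM b c)) _.
by rewrite ImD !ImM /GRing.scale /=; ring.
Qed.

Lemma cderZ (c : C) F t D : cder F t D -> cder (fun s => c * F s) t (c * D).
Proof. by move=> h; apply: cder_eq (cderM (cder_cst c t) h) _; rewrite mul0r add0r. Qed.

Lemma cderN F t D : cder F t D -> cder (fun s => - F s) t (- D).
Proof.
move=> h; rewrite (_ : (fun s => _) = fun s => -1 * F s); last by apply/funext => s; rewrite mulN1r.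
by apply: cder_eq (cderZ _ h) _; rewrite mulN1r.
Qed.

Lemma cderB F G t D E : cder F t D -> cder G t E -> cder (fun s => F s - G s) t (D - E).
Proof. by move=> h1 h2; apply: cderD => //; exact: cderN. Qed.

Lemma cderJ F t D : cder F t D -> cder (fun s => (F s)^*) t D^*.
Proof.
move=> [a b]; split.
  by rewrite (_ : _ \o _ = Re \o F) ?ReJ//; apply/funext => s /=; rewrite ReJ.
rewrite (_ : _ \o _ = - (Im \o F)); last by apply/funext => s /=; rewrite ImJ.
by rewrite ImJ; exact: is_deriveN.
Qed.

Lemma cderX F t D n : cder F t D -> cder (fun s => F s ^+ n) t (n%:R * F t ^+ n.-1 * D).
Proof.
move=> h; elim: n => [|n IH].
  by rewrite !mul0r; exact: cder_cst.
rewrite (_ : (fun s => _) = fun s => F s * F s ^+ n); last by apply/funext => s; rewrite exprS.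
apply: cder_eq (cderM h IH) _ => /=.
case: n {IH} => [|n] /=; first by rewrite !expr0; ring.
by rewrite exprS -[n.+2%:R]natr1; ring.
Qed.

Lemma cder_cexp F t D : cder F t D -> cder (fun s => cexp (F s)) t (D * cexp (F t)).
Proof.
move=> [a b]; split.
  have c := is_derive1_comp (is_derive_expR (Re (F t))) a.
  have d := is_derive1_comp (is_derive_cos (Im (F t))) b.
  apply: is_derive_eq (is_deriveM c d) _.
  by rewrite ReM /cexp /= /GRing.scale /=; ring.
have c := is_derive1_comp (is_derive_expR (Re (F t))) a.
have d := is_derive1_comp (is_derive_sin (Im (F t))) b.
apply: is_derive_eq (is_deriveM c d) _.
by rewrite ImM /cexp /= /GRing.scale /=; ring.
Qed.

Lemma cder_comp F (f : R -> R) t D d : is_derive t 1 f d -> cder F (f t) D ->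
  cder (fun s => F (f s)) t (d%:C * D).
Proof.
move=> fd [a b]; split.
  by apply: is_derive_eq (is_derive1_comp a fd) _; rewrite ReM /=; ring.
by apply: is_derive_eq (is_derive1_comp b fd) _; rewrite ImM /=; ring.
Qed.

Lemma near_eq_cder F G t D : {near t, F =1 G} -> cder F t D -> cder G t D.
Proof.
move=> FG [a b]; split.
- apply: (near_eq_is_derive _ a); near=> s => /=; congr (complex.Re _); by near: s.
- apply: (near_eq_is_derive _ b); near=> s => /=; congr (complex.Im _); by near: s.
Unshelve. all: by end_near. Qed.

Lemma cder_cvg F t D : cder F t D -> (Re \o F) s @[s --> t] --> Re (F t) /\ (Im \o F) s @[s --> t] --> Im (F t).
Proof.
move=> [[a _] [b _]]; split.
  by have /derivable1_diffP/differentiable_continuous := a.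
by have /derivable1_diffP/differentiable_continuous := b.
Qed.
End cplx.

(** * Derivatives of real functions with explicit values *)

Section rder.
Context {R : realType}.
Implicit Types (f g : R -> R) (x a b c : R).

Lemma rder_eq f x a b : is_derive x 1 f a -> a = b -> is_derive x 1 f b.
Proof. by move=> + <-. Qed.

Lemma rderC c x : is_derive x 1 (fun=> c) 0.
Proof. exact: is_derive_cst. Qed.

Lemma rderI x : is_derive x 1 (fun s : R => s) 1.
Proof. exact: is_derive_id. Qed.

Lemma rderD f g x a b : is_derive x 1 f a -> is_derive x 1 g b ->
  is_derive x 1 (fun s => f s + g s) (a + b).
Proof. by move=> ? ?; exact: is_deriveD. Qed.

Lemma rderN f x a : is_derive x 1 f a -> is_derive x 1 (fun s => - f s) (- a).
Proof. by move=> ?; exact: is_deriveN. Qed.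

Lemma rderB f g x a b : is_derive x 1 f a -> is_derive x 1 g b ->
  is_derive x 1 (fun s => f s - g s) (a - b).
Proof. by move=> ? ?; exact: is_deriveB. Qed.

Lemma rderM f g x a b : is_derive x 1 f a -> is_derive x 1 g b ->
  is_derive x 1 (fun s => f s * g s) (a * g x + f x * b).
Proof.
move=> ? ?; apply: is_derive_eq (is_deriveM _ _) _.
by rewrite /GRing.scale /=; ring.
Qed.

Lemma rderZ c f x a : is_derive x 1 f a -> is_derive x 1 (fun s => c * f s) (c * a).
Proof. by move=> ?; exact: is_deriveZ. Qed.

Lemma rderX n f x a : is_derive x 1 f a ->
  is_derive x 1 (fun s => f s ^+ n) (n%:R * f x ^+ n.-1 * a).
Proof.
move=> fa; elim: n => [|n IH].
  by rewrite !mul0r; exact: rderC.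
rewrite (_ : (fun s => _) = fun s => f s * f s ^+ n); last by apply/funext => s; rewrite exprS.
apply: rder_eq (rderM fa IH) _ => /=.
case: n {IH} => [|n] /=; first by rewrite !expr0; ring.
by rewrite exprS -[n.+2%:R]natr1; ring.
Qed.

Lemma rderV f x a : is_derive x 1 f a -> f x != 0 ->
  is_derive x 1 (fun s => (f s)^-1) (- a / f x ^+ 2).
Proof.
move=> fa f0; apply: is_derive_eq (is_deriveV f0 fa) _.
by rewrite /GRing.scale /= mulrC mulrN mulNr.
Qed.

Lemma rder_comp f g x a b : is_derive x 1 g b -> is_derive (g x) 1 f a ->
  is_derive x 1 (fun s => f (g s)) (a * b).
Proof. by move=> gb fa; exact: (@is_derive1_comp R f g x a b fa gb). Qed.
End rder.

(** * Integrals of complex-valued functions *)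

Section cintegration.
Context {R : realType}.
Local Notation C := R[i].
Local Notation Re := (@complex.Re R).
Local Notation Im := (@complex.Im R).
Local Notation mu := (@lebesgue_measure R).

Definition intg (A : set R) (f : R -> R) := mu.-integrable A (EFin \o f).
Definition cmeas (A : set R) (F : R -> C) :=
  measurable_fun A (Re \o F) /\ measurable_fun A (Im \o F).
Definition cintg (A : set R) (F : R -> C) := intg A (Re \o F) /\ intg A (Im \o F).
Definition cint (A : set R) (F : R -> C) : C :=
  (\int[mu]_(x in A) Re (F x)) +i* (\int[mu]_(x in A) Im (F x)).

Lemma intg_meas A (f : R -> R) : intg A f -> measurable_fun A f.
Proof. by move=> /measurable_int /measurable_EFinP. Qed.

Lemma intg_le A (f g : R -> R) : measurable A -> measurable_fun A f -> intg A g ->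
  (forall x, A x -> `|f x| <= g x) -> intg A f.
Proof.
move=> mA mf ig fg; apply: (le_integrable _ _ _ ig) => //.
  exact/measurable_EFinP.
by move=> x Ax /=; rewrite lee_fin (le_trans (fg x Ax))// ler_norm.
Qed.

Lemma cintg_meas A F : cintg A F -> cmeas A F.
Proof. by move=> [/intg_meas ? /intg_meas ?]. Qed.

Lemma cintg_le A F g : measurable A -> cmeas A F -> intg A g ->
  (forall x, A x -> cmod (F x) <= g x) -> cintg A F.
Proof.
move=> mA [m1 m2] ig Fg; split; apply: (intg_le mA _ ig) => // x Ax.
  exact: (le_trans (Re_le_cmod _) (Fg x Ax)).
exact: (le_trans (Im_le_cmod _) (Fg x Ax)).
Qed.

Lemma intgD A (f g : R -> R) : measurable A -> intg A f -> intg A g -> intg A (fun x => f x + g x).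
Proof.
move=> mA fi gi; rewrite /intg.
rewrite (_ : _ \o _ = ((EFin \o f) \+ (EFin \o g))%E) //.
exact: integrableD.
Qed.

Lemma intgB A (f g : R -> R) : measurable A -> intg A f -> intg A g -> intg A (fun x => f x - g x).
Proof.
move=> mA fi gi; rewrite /intg.
rewrite (_ : _ \o _ = ((EFin \o f) \- (EFin \o g))%E) //.
exact: integrableB.
Qed.

Lemma intgZ A (r : R) (f : R -> R) : measurable A -> intg A f -> intg A (fun x => r * f x).
Proof.
move=> mA fi; rewrite /intg.
rewrite (_ : _ \o _ = (fun x => r%:E * (EFin \o f) x)%E) //.
exact: integrableZl.
Qed.

Lemma intg_norm A (f : R -> R) : measurable A -> intg A f -> intg A (fun x => `|f x|).
Proof.
move=> mA fi.
have := integrable_abse fi; rewrite /intg; congr (integrable _ _ _).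
Qed.

Lemma intg_subset A B (f : R -> R) : measurable A -> measurable B -> B `<=` A -> intg A f -> intg B f.
Proof. by move=> mA mB BA; apply: integrableS. Qed.

Lemma cintD A F G : measurable A -> cintg A F -> cintg A G ->
  cint A (fun x => F x + G x) = cint A F + cint A G.
Proof.
move=> mA [a b] [c d]; apply: eq_ReIm; rewrite /cint ?ReD ?ImD /=.
  by rewrite -RintegralD//; apply: eq_Rintegral => x _; rewrite ReD.
by rewrite -RintegralD//; apply: eq_Rintegral => x _; rewrite ImD.
Qed.

Lemma cintgD A F G : measurable A -> cintg A F -> cintg A G -> cintg A (fun x => F x + G x).
Proof.
move=> mA [a b] [c d]; split.
  rewrite (_ : _ \o _ = fun x => (Re \o F) x + (Re \o G) x); first exact: intgD.
  by apply/funext => x /=; rewrite ReD.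
rewrite (_ : _ \o _ = fun x => (Im \o F) x + (Im \o G) x); first exact: intgD.
by apply/funext => x /=; rewrite ImD.
Qed.

Lemma cintgZ A (c : C) F : measurable A -> cintg A F -> cintg A (fun x => c * F x).
Proof.
move=> mA [a b]; split.
  rewrite (_ : _ \o _ = fun x => Re c * (Re \o F) x - Im c * (Im \o F) x).
    by apply: intgB => //; exact: intgZ.
  by apply/funext => x /=; rewrite ReM.
rewrite (_ : _ \o _ = fun x => Re c * (Im \o F) x + Im c * (Re \o F) x).
  by apply: intgD => //; exact: intgZ.
by apply/funext => x /=; rewrite ImM.
Qed.

Lemma cintZ A (c : C) F : measurable A -> cintg A F ->
  cint A (fun x => c * F x) = c * cint A F.
Proof.
move=> mA [a b]; apply: eq_ReIm; rewrite /cint ?ReM ?ImM /=.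
  rewrite -!RintegralZl// -RintegralB//; try exact: intgZ.
  by apply: eq_Rintegral => x _; rewrite ReM.
rewrite -!RintegralZl// -RintegralD//; try exact: intgZ.
by apply: eq_Rintegral => x _; rewrite ImM.
Qed.

Lemma eq_cint A F G : (forall x, A x -> F x = G x) -> cint A F = cint A G.
Proof.
by move=> FG; congr (_ +i* _); apply: eq_Rintegral => x /set_mem Ax; rewrite FG.
Qed.

Lemma eq_cintg A F G : measurable A -> (forall x, A x -> F x = G x) -> cintg A F -> cintg A G.
Proof.
move=> mA FG [a b]; split.
  by apply: eq_integrable a => // x /set_mem Ax /=; rewrite FG.
by apply: eq_integrable b => // x /set_mem Ax /=; rewrite FG.
Qed.

Lemma cintB A F G : measurable A -> cintg A F -> cintg A G ->
  cint A (fun x => F x - G x) = cint A F - cint A G.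
Proof.
move=> mA iF iG.
rewrite (_ : (fun x => _) = fun x => F x + -1 * G x); last first.
  by apply/funext => x; rewrite mulN1r.
by rewrite cintD// ?cintZ// ?mulN1r//; exact: cintgZ.
Qed.

Lemma cintgB A F G : measurable A -> cintg A F -> cintg A G -> cintg A (fun x => F x - G x).
Proof.
move=> mA iF iG.
rewrite (_ : (fun x => _) = fun x => F x + -1 * G x); last first.
  by apply/funext => x; rewrite mulN1r.
by apply: cintgD => //; exact: cintgZ.
Qed.

(** Pairing with the conjugate of [z] makes the square of the modulus the real part of an integral.
    Unlike separate bounds of real and imaginary parts, this loses no factor 2. *)
Lemma cint_le A F g : measurable A -> cintg A F -> intg A g ->
  (forall x, A x -> cmod (F x) <= g x) -> cmod (cint A F) <= \int[mu]_(x in A) g x.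
Proof.
move=> mA iF ig Fg; set z := cint A F.
have g0 : 0 <= \int[mu]_(x in A) g x.
  by apply: Rintegral_ge0 => x Ax; rewrite (le_trans (cmod_ge0 _) (Fg x Ax)).
have := cmod_ge0 z; rewrite le_eqVlt => /predU1P[<-//|z0].
rewrite -(ler_pM2l z0).
have -> : cmod z * cmod z = Re (z^* * z) by rewrite mulcJ_cmod expr2.
rewrite /z -cintZ// -/z /cint /= -RintegralZl//.
apply: le_Rintegral => //; [by case: (cintgZ z^* mA iF)|exact: intgZ|].
move=> x Ax; rewrite (le_trans (ler_norm _))// (le_trans (Re_le_cmod _))//.
by rewrite cmodM cmodJ ler_wpM2l ?cmod_ge0 ?Fg.
Qed.

Lemma cmeasM A F G : cmeas A F -> cmeas A G -> cmeas A (fun x => F x * G x).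
Proof.
move=> [a b] [c d]; split.
  rewrite (_ : _ \o _ = (Re \o F) \* (Re \o G) \- (Im \o F) \* (Im \o G)).
    by apply: measurable_funB; exact: measurable_funM.
  by apply/funext => x /=; rewrite ReM.
rewrite (_ : _ \o _ = (Re \o F) \* (Im \o G) \+ (Im \o F) \* (Re \o G)).
  by apply: measurable_funD; exact: measurable_funM.
by apply/funext => x /=; rewrite ImM.
Qed.

Lemma cmeasD A F G : cmeas A F -> cmeas A G -> cmeas A (fun x => F x + G x).
Proof.
move=> [a b] [c d]; split.
  rewrite (_ : _ \o _ = (Re \o F) \+ (Re \o G)); first exact: measurable_funD.
  by apply/funext => x /=; rewrite ReD.
rewrite (_ : _ \o _ = (Im \o F) \+ (Im \o G)); first exact: measurable_funD.
by apply/funext => x /=; rewrite ImD.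
Qed.

Lemma cmeas_cst A (c : C) : cmeas A (fun=> c).
Proof. by split; exact: measurable_cst. Qed.

Lemma cmeas_real A (f : R -> R) : measurable_fun A f -> cmeas A (fun x => (f x)%:C).
Proof. by move=> mf; split => //=; exact: measurable_cst. Qed.

Lemma cmeas_subset A B F : measurable A -> B `<=` A -> cmeas A F -> cmeas B F.
Proof. by move=> mA BA [a b]; split; exact: measurable_funS BA _. Qed.

Lemma cmeas_cmod A F : cmeas A F -> measurable_fun A (fun x => cmod (F x)).
Proof.
move=> [a b]; rewrite (_ : (fun x => _) =
  fun x => Num.sqrt ((Re \o F) x ^+ 2 + (Im \o F) x ^+ 2))//.
apply: (@measurableT_comp _ _ _ _ _ _ (@Num.sqrt R)) => //.
  by apply: continuous_measurable_fun => //; exact: sqrt_continuous.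
by apply: measurable_funD; exact: measurable_funX.
Qed.

Lemma cder_cmeas (A : set R) F F' : open A -> (forall x, A x -> cder F x (F' x)) -> cmeas A F.
Proof.
move=> oA dF; split; apply: open_continuous_measurable_fun => // x /set_mem Ax.
  by have [? _] := cder_cvg (dF x Ax).
by have [_ ?] := cder_cvg (dF x Ax).
Qed.

Lemma cint_cder A (F F' : R -> R -> C) (t u v : R) g : measurable A -> u < t < v ->
  (forall s, u < s < v -> cintg A (F s)) ->
  (forall s y, u < s < v -> A y -> cder (F^~ y) s (F' s y)) ->
  intg A g -> (forall s y, u < s < v -> A y -> cmod (F' s y) <= g y) ->
  cder (fun s => cint A (F s)) t (cint A (F' t)).
Proof.
move=> mA tuv iF dF ig Fg.
have It : `]u, v[%classic t by rewrite /= in_itv.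
(* A majorant that is nonnegative everywhere; [g] itself is known to be so on [A] only. *)
have gn y : 0 <= `|g y| by [].
have ign : intg A (fun y => `|g y|) by exact: intg_norm.
have H (P : C -> R) : (forall s, u < s < v -> intg A (P \o F s)) ->
    (forall s y, u < s < v -> A y -> is_derive s 1 (fun s => P (F s y)) (P (F' s y))) ->
    (forall z, `|P z| <= cmod z) ->
    is_derive t 1 (fun s => \int[mu]_(y in A) P (F s y)) (\int[mu]_(y in A) P (F' t y)).
  move=> iP dP Pc.
  pose f s y := P (F s y).
  have h1 x : `]u, v[%classic x -> mu.-integrable A (EFin \o f x).
    by rewrite /= in_itv => /iP.
  have h2 x y : `]u, v[%classic x -> A y -> derivable (f^~ y) x 1.
    by rewrite /= in_itv => xuv Ay; case: (dP x y xuv Ay).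
  have h2' x y : `]u, v[%classic x -> A y -> partial1of2 f x y = P (F' x y).
    rewrite /= in_itv => xuv Ay; rewrite partial1of2E.
    by case: (dP x y xuv Ay).
  have h3 x y : `]u, v[%classic x -> A y -> `|partial1of2 f x y| <= `|g y|.
    move=> xI Ay; rewrite h2'//; move: xI; rewrite /= in_itv => xuv.
    by rewrite (le_trans (Pc _))// (le_trans (Fg _ _ xuv Ay))// ler_norm.
  have dd : derivable (fun x => \int[mu]_(y in A) f x y) t 1.
    have := @derivable_under_integral R _ _ mu f A mA t u v It h1 h2 _ gn ign h3.
    by [].
  apply: (DeriveDef dd); rewrite -derive1E (@differentiation_under_integral R _ _ mu f A mA t u v It h1 h2 _ gn ign h3).
  by apply: eq_Rintegral => y /set_mem Ay; rewrite h2'.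
split.
- apply: H; last by move=> z; exact: Re_le_cmod.
    by move=> s /iF[].
  by move=> s y suv Ay; case: (dF s y suv Ay).
- apply: H; last by move=> z; exact: Im_le_cmod.
    by move=> s /iF[].
  by move=> s y suv Ay; case: (dF s y suv Ay).
Qed.

Definition ccvg (u : nat -> C) (l : C) :=
  (Re (u n) @[n --> \oo] --> Re l) /\ (Im (u n) @[n --> \oo] --> Im l).

Lemma Rint_dcvg A (f : nat -> R -> R) (l g : R -> R) : measurable A ->
  (forall n, measurable_fun A (f n)) -> 
  (forall x, A x -> f n x @[n --> \oo] --> l x) -> intg A g ->
  (forall n x, A x -> `|f n x| <= g x) ->
  intg A l /\ (\int[mu]_(x in A) f n x @[n --> \oo] --> \int[mu]_(x in A) l x).
Proof.
move=> mA mf fl ig fg.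
have fl' x : A x -> (f n x)%:E @[n --> \oo] --> (l x)%:E.
  by move=> Ax; apply: cvg_EFin; [exact: nearW|exact: fl].
have ml : measurable_fun A (EFin \o l).
  by apply/measurable_EFinP; exact: measurable_fun_cvg mf fl.
have fa : \forall x \ae mu, A x -> (fun n => (EFin \o f n) x) @ \oo --> (EFin \o l) x.
  by apply: aeW => x Ax; exact: fl'.
have ga : \forall x \ae mu, forall n : nat, A x -> (`|(EFin \o f n) x| <= (EFin \o g) x)%E.
  by apply: aeW => x n Ax; rewrite lee_fin fg.
have mf' n : measurable_fun A (EFin \o f n) by exact/measurable_EFinP.
have [il _ h] := @dominated_convergence _ _ R mu A mA (fun n => EFin \o f n) (EFin \o l) (EFin \o g) mf' ml fa ig ga.
split => //.
rewrite /Rintegral; apply: fine_cvg; rewrite fineK//.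
exact: integrable_fin_num.
Qed.

Lemma cint_dcvg A (F : nat -> R -> C) (L : R -> C) g : measurable A ->
  (forall n, cmeas A (F n)) -> (forall x, A x -> ccvg (F^~ x) (L x)) -> intg A g ->
  (forall n x, A x -> cmod (F n x) <= g x) ->
  cintg A L /\ ccvg (fun n => cint A (F n)) (cint A L).
Proof.
move=> mA mF FL ig Fg.
have [a b] := @Rint_dcvg A (fun n => Re \o F n) (Re \o L) g mA (fun n => (mF n).1)
  (fun x Ax => (FL x Ax).1) ig (fun n x Ax => le_trans (Re_le_cmod _) (Fg n x Ax)).
have [c d] := @Rint_dcvg A (fun n => Im \o F n) (Im \o L) g mA (fun n => (mF n).2)
  (fun x Ax => (FL x Ax).2) ig (fun n x Ax => le_trans (Im_le_cmod _) (Fg n x Ax)).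
by split; split.
Qed.

Lemma FTC_closed (f F : R -> R) (a b : R) : a < b ->
  (forall x, a <= x <= b -> is_derive x 1 F (f x)) ->
  (forall x, a <= x <= b -> {for x, continuous f}) ->
  intg `[a, b]%classic f /\ \int[mu]_(x in `[a, b]) f x = F b - F a.
Proof.
move=> ab dF cf.
have cF x : a <= x <= b -> {for x, continuous F}.
  move=> /dF[d _]; apply/differentiable_continuous; exact/derivable1_diffP.
have cwf : {within `[a, b], continuous f}.
  by apply: continuous_in_subspaceT => x /set_mem; rewrite /= in_itv; exact: cf.
split.
  by apply: continuous_compact_integrable => //; exact: segment_compact.
have := @continuous_FTC2 R f F a b ab cwf.
rewrite /Rintegral => -> //.
  split.
  - by move=> x; rewrite in_itv /= => /andP[/ltW ? /ltW ?]; case: (dF x) => //; apply/andP.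
  - by apply/cvg_at_right_filter/cF; rewrite lexx ltW.
  - by apply/cvg_at_left_filter/cF; rewrite lexx ltW.
move=> x; rewrite in_itv /= => /andP[/ltW ? /ltW ?]; rewrite derive1E.
by case: (dF x) => //; apply/andP.
Qed.

(** The cut-offs of [f] to the intervals are dominated by [|f|], which reduces the claim to compact
    intervals. Only the limits of [F] along the exhaustion enter, so [F] may be undefined or
    singular at the ends. *)
Lemma FTC_exhaust (A : set R) (f F : R -> R) (a b : nat -> R) (l0 l1 : R) :
  measurable A -> (forall n, a n < b n) -> (forall n, `[a n, b n] `<=` A) ->
  (forall x, A x -> \forall n \near \oo, a n <= x <= b n) ->
  (forall x, A x -> is_derive x 1 F (f x)) ->
  (forall x, A x -> {for x, continuous f}) -> intg A f ->
  F (a n) @[n --> \oo] --> l0 -> F (b n) @[n --> \oo] --> l1 ->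
  \int[mu]_(x in A) f x = l1 - l0.
Proof.
move=> mA ab abA exh dF cf If Fa Fb.
have mI n : measurable `[a n, b n] by exact: measurable_itv.
pose fn n x := f x * \1_(`[a n, b n]) x.
have [_ h] : intg A f /\ (\int[mu]_(x in A) fn n x @[n --> \oo] --> \int[mu]_(x in A) f x).
  apply: (@Rint_dcvg A fn f (fun x => `|f x|)) => //.
  - move=> n; apply: measurable_funM; first exact: intg_meas.
    exact: measurable_indic.
  - move=> x Ax; apply: cvg_near_cst.
    have := exh x Ax; apply: filterS => n; rewrite /fn indicE => xI.
    by rewrite mem_set ?mulr1//= in_itv.
  - exact: intg_norm.
  - move=> n x Ax; rewrite /fn normrM indicE.
    by case: (_ \in _); rewrite ?normr1 ?mulr1// normr0 mulr0.
have E n : \int[mu]_(x in A) fn n x = F (b n) - F (a n).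
  rewrite (_ : \int[mu]_(x in A) fn n x = \int[mu]_(x in `[a n, b n]) f x).
    have := @FTC_closed f F (a n) (b n) (ab n); case => //.
    - by move=> x xI; apply/dF/(abA n); rewrite /= in_itv.
    - by move=> x xI; apply/cf/(abA n); rewrite /= in_itv.
  rewrite Rintegral_mkcond [RHS]Rintegral_mkcond; apply: eq_Rintegral => x _.
  rewrite !patchE /fn indicE.
  case: ifPn => [xA|xA]; case: ifPn => xI; rewrite ?mulr1 ?mulr0//.
  by move: xA; rewrite notin_setE; case; apply/(abA n)/set_mem.
have h2 : \int[mu]_(x in A) fn n x @[n --> \oo] --> l1 - l0.
  by under eq_fun do rewrite E; exact: cvgB.
exact: (cvg_unique _ h h2).
Qed.

(** Fatou: the integrals over the intervals are increments of [F], hence at most [2 * B]. This is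
    the source of the integrability that [FTC_exhaust] asks for. *)
Lemma ge0_FTC_exhaust (A : set R) (f F : R -> R) (a b : nat -> R) (B : R) :
  measurable A -> (forall n, a n < b n) -> (forall n, `[a n, b n] `<=` A) ->
  (forall x, A x -> \forall n \near \oo, a n <= x <= b n) ->
  (forall x, A x -> is_derive x 1 F (f x)) ->
  (forall x, A x -> {for x, continuous f}) -> measurable_fun A f ->
  (forall x, A x -> 0 <= f x) ->
  (forall x, A x -> `|F x| <= B) -> intg A f.
Proof.
move=> mA ab abA exh dF cf mf f0 FB.
have mI n : measurable `[a n, b n] by exact: measurable_itv.
pose fn n x := (f x * \1_(`[a n, b n]) x)%:E.
have mfn n : measurable_fun A (fn n).
  apply/measurable_EFinP; apply: measurable_funM => //.
have fn0 n x : A x -> (0 <= fn n x)%E.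
  by move=> Ax; rewrite lee_fin mulr_ge0 ?f0// indicE.
have E n : (\int[mu]_(x in A) fn n x = (F (b n) - F (a n))%:E)%E.
  have [i h] : intg `[a n, b n]%classic f /\ \int[mu]_(x in `[a n, b n]) f x = F (b n) - F (a n).
    apply: FTC_closed => //.
    - by move=> x xI; apply/dF/(abA n); rewrite /= in_itv.
    - by move=> x xI; apply/cf/(abA n); rewrite /= in_itv.
  rewrite -h /Rintegral fineK; last exact: integrable_fin_num.
  rewrite [LHS]integral_mkcond [RHS]integral_mkcond; apply: eq_integral => x _.
  rewrite !patchE /fn indicE.
  case: ifPn => [xA|xA]; case: ifPn => xI; rewrite ?mulr1 ?mulr0//.
  by move: xA; rewrite notin_setE; case; apply/(abA n)/set_mem.
apply/integrableP; split; first exact/measurable_EFinP.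
have -> : (\int[mu]_(x in A) `|(EFin \o f) x| = \int[mu]_(x in A) limn_einf (fn^~ x))%E.
  apply: eq_integral => x /set_mem Ax /=; rewrite ger0_norm ?f0//.
  have h : fn n x @[n --> \oo] --> (f x)%:E.
    apply: cvg_near_cst; have := exh x Ax; apply: filterS => n xI.
    by rewrite /fn indicE mem_set ?mulr1//= in_itv.
  by rewrite (cvg_limn_einf_sup h).1.
apply: (le_lt_trans (fatou mu mA mfn fn0)).
rewrite (@le_lt_trans _ _ (B + B)%:E) ?ltry//.
rewrite limn_einf_lim; apply: lime_le; first exact: is_cvg_einfs.
apply: nearW => n; apply: (@le_trans _ _ (\int[mu]_(x in A) fn n x)%E).
  by rewrite /einfs /=; apply: ereal_inf_lbound; exists n => //=.
rewrite E lee_fin.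
have Aa : A (a n) by apply: (abA n); rewrite /= in_itv /= lexx ltW.
have Ab : A (b n) by apply: (abA n); rewrite /= in_itv /= lexx ltW.
by rewrite (le_trans (ler_norm _))// (le_trans (ler_normB _ _))// lerD ?FB.
Qed.
End cintegration.

(** * Exhaustions of the half-line and explicit integrals *)

Section majorants.
Context {R : realType}.
Local Notation C := R[i].
Local Notation Re := (@complex.Re R).
Local Notation Im := (@complex.Im R).
Local Notation mu := (@lebesgue_measure R).

Definition ccont (F : R -> C) (x : R) :=
  {for x, continuous (Re \o F)} /\ {for x, continuous (Im \o F)}.

Lemma cder_ccont (F : R -> C) t D : cder F t D -> ccont F t.
Proof. by move=> /cder_cvg[]. Qed.

Lemma ccvg_le (u : nat -> C) (l : C) (r : nat -> R) :
  (forall n, cmod (u n - l) <= r n) -> r n @[n --> \oo] --> 0 -> ccvg u l.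
Proof.
move=> ur r0.
have H (P : C -> R) : (forall x y, P (x - y) = P x - P y) -> (forall z, `|P z| <= cmod z) ->
    P (u n) @[n --> \oo] --> P l.
  move=> Pb Pc; apply/subr_cvg0.
  have h n : - r n <= P (u n) - P l <= r n.
    by rewrite -Pb -ler_norml (le_trans (Pc _) (ur n)).
  apply: (@squeeze_cvgr _ _ _ _ (fun n => - r n) r) => //; first exact: nearW.
  by rewrite -oppr0; exact: cvgN.
split; apply: H.
- by move=> x y; rewrite ReD ReN.
- exact: Re_le_cmod.
- by move=> x y; rewrite ImD ImN.
- exact: Im_le_cmod.
Qed.

Lemma ccvg_unique (u : nat -> C) (l l' : C) : ccvg u l -> ccvg u l' -> l = l'.
Proof.
by move=> [a b] [c d]; apply: eq_ReIm; [exact: (cvg_unique _ a c)|exact: (cvg_unique _ b d)].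
Qed.

Lemma cint_FTC (A : set R) (F F' : R -> C) (a b : nat -> R) (l0 l1 : C) :
  measurable A -> (forall n, a n < b n) -> (forall n, `[a n, b n] `<=` A) ->
  (forall x, A x -> \forall n \near \oo, a n <= x <= b n) ->
  (forall x, A x -> cder F x (F' x)) -> (forall x, A x -> ccont F' x) ->
  cintg A F' -> ccvg (F \o a) l0 -> ccvg (F \o b) l1 -> cint A F' = l1 - l0.
Proof.
move=> mA ab abA exh dF cF [i1 i2] [a1 a2] [b1 b2]; apply: eq_ReIm.
  rewrite ReD ReN /cint /=.
  exact: (@FTC_exhaust R A (Re \o F') (Re \o F) a b _ _ mA ab abA exh
    (fun x Ax => proj1 (dF x Ax)) (fun x Ax => proj1 (cF x Ax)) i1 a1 b1).
rewrite ImD ImN /cint /=.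
exact: (@FTC_exhaust R A (Im \o F') (Im \o F) a b _ _ mA ab abA exh
  (fun x Ax => proj2 (dF x Ax)) (fun x Ax => proj2 (cF x Ax)) i2 a2 b2).
Qed.

(** The exhaustion of a half-line used throughout. The shifts give [lo c 0 < hi c 0] and
    [lo 0 n <= 1 <= hi 0 n]. *)
Definition lo (c : R) (n : nat) : R := c + n.+1%:R^-1.
Definition hi (c : R) (n : nat) : R := c + n.+2%:R.

Lemma lo_cvg c : lo c n @[n --> \oo] --> c.
Proof.
rewrite -[X in _ --> X]addr0; apply: cvgD; first exact: cvg_cst.
exact: cvg_harmonic.
Qed.

Lemma exh_ray (c : R) : [/\ (forall n, lo c n < hi c n), (forall n, `[lo c n, hi c n] `<=` `]c, +oo[) &
  (forall x, `]c, +oo[%classic x -> \forall n \near \oo, lo c n <= x <= hi c n)].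
Proof.
split.
- move=> n; rewrite ltrD2l (@le_lt_trans _ _ 1)// ?ltr1n//.
  by rewrite invf_le1// ler1n.
- move=> n x; rewrite /= !in_itv/= andbT => /andP[+ _].
  by apply: lt_le_trans; rewrite ltrDl invr_gt0.
- move=> x; rewrite /= in_itv /= andbT => cx.
  near=> n; apply/andP; split.
    have xc : 0 < x - c by rewrite subr_gt0.
    rewrite /lo -lerBrDl -[leRHS]invrK lef_pV2 ?posrE ?invr_gt0//.
    rewrite (@le_trans _ _ n%:R)// ?ler_nat//.
    by near: n; exact: nbhs_infty_ger.
  rewrite /hi -lerBlDl (@le_trans _ _ n%:R)// ?ler_nat//; last exact: leqW.
  by near: n; exact: nbhs_infty_ger.
Unshelve. all: by end_near. Qed.

Lemma exh_line : [/\ (forall n, - n.+1%:R < n.+1%:R :> R), (forall n, `[- n.+1%:R, n.+1%:R : R] `<=` setT) &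
  (forall x : R, setT x -> \forall n \near \oo, - n.+1%:R <= x <= n.+1%:R)].
Proof.
split => //.
- by move=> n; rewrite (@lt_trans _ _ 0)// oppr_lt0.
- move=> x _; near=> n; rewrite -ler_norml (@le_trans _ _ n%:R)// ?ler_nat//.
  by near: n; exact: nbhs_infty_ger.
Unshelve. all: by end_near. Qed.

Lemma cont_derive (f : R -> R) (x d : R) : is_derive x 1 f d -> {for x, continuous f}.
Proof. by move=> [/derivable1_diffP/differentiable_continuous]. Qed.

Lemma meas_ray (c : R) (f : R -> R) : (forall x, c < x -> {for x, continuous f}) ->
  measurable_fun `]c, +oo[ f.
Proof.
move=> cf; apply: open_continuous_measurable_fun => // x /set_mem.
by rewrite /= in_itv /= andbT; exact: cf.
Qed.

Lemma expRN_le (x : R) : 0 < x -> expR (- x) <= x^-1.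
Proof.
move=> x0; rewrite expRN lef_pV2 ?posrE ?expR_gt0//.
by rewrite (le_trans _ (expR_ge1Dx _))// lerDr.
Qed.

Lemma hiV_cvg (K : R) : K / hi 0 n @[n --> \oo] --> 0.
Proof.
rewrite -[X in _ --> X](mulr0 K); apply: cvgM; first exact: cvg_cst.
have h : (n.+2%:R^-1 : R) @[n --> \oo] --> 0.
  have := @cvg_harmonic R; rewrite -(cvg_shiftS (harmonic : nat -> R)).
  exact.
by apply: cvg_trans h; apply: near_eq_cvg; near=> n; rewrite /hi add0r.
Unshelve. all: by end_near. Qed.

Lemma loV_cvg (K : R) : K * lo 0 n @[n --> \oo] --> 0.
Proof.
rewrite -[X in _ --> X](mulr0 K); apply: cvgM; first exact: cvg_cst.
exact: (@lo_cvg 0).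
Qed.

Lemma cvg0_le (u r : nat -> R) (l : R) : (forall n, `|u n - l| <= r n) ->
  r n @[n --> \oo] --> 0 -> u n @[n --> \oo] --> l.
Proof.
move=> ur r0; apply/subr_cvg0; apply: (@squeeze_cvgr _ _ _ _ (fun n => - r n) r) => //.
  by apply: nearW => n; rewrite -ler_norml.
by rewrite -oppr0; exact: cvgN.
Qed.

Lemma hi_gt0 n : 0 < hi 0 n :> R. Proof. by rewrite /hi add0r. Qed.
Lemma lo_gt0 n : 0 < lo 0 n :> R. Proof. by rewrite /lo add0r invr_gt0. Qed.

Lemma is_derive_expNM (v x : R) :
  is_derive x 1 (fun u => expR (- (v * u))) (- v * expR (- (v * x))).
Proof.
apply: rder_eq (rder_comp (rderN (rderZ v (rderI x))) (is_derive_expR _)) _.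
by rewrite mulr1 mulrC.
Qed.

Lemma intg_expR (v : R) : 0 < v -> intg `]0, +oo[%classic (fun u => expR (- (v * u))) /\
  \int[mu]_(u in `]0, +oo[) expR (- (v * u)) = v^-1.
Proof.
move=> v0; have [h1 h2 h3] := exh_ray 0.
pose F u := - v^-1 * expR (- (v * u)).
have dF (x : R) : is_derive x 1 F (expR (- (v * x))).
  apply: is_derive_eq (is_deriveZ (- v^-1) (is_derive_expNM v x)) _.
  by rewrite /GRing.scale /= mulrA mulrNN mulVf ?mul1r// gt_eqF.
have cf (x : R) : {for x, continuous (fun u => expR (- (v * u)))}.
  exact: cont_derive (is_derive_expNM v x).
have If : intg `]0, +oo[%classic (fun u => expR (- (v * u))).
  apply: (@ge0_FTC_exhaust R _ _ F _ _ (v^-1) _ h1 h2 h3) => //.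
  - by apply: meas_ray => x _; exact: cf.
  - move=> x; rewrite /= in_itv /= andbT => x0.
    rewrite /F mulNr normrN ger0_norm; last by rewrite mulr_ge0 ?invr_ge0 ?expR_ge0 ?(ltW v0).
    by rewrite ler_piMr ?invr_ge0 ?ltW// -expR0 ltr_expR oppr_lt0 mulr_gt0.
split => //.
rewrite (@FTC_exhaust R _ _ F _ _ (- v^-1) 0 _ h1 h2 h3) ?sub0r ?opprK//.
- have : F (lo 0 n) @[n --> \oo] --> F 0.
    by apply: cvg_comp (@lo_cvg 0) _; exact: cont_derive (dF 0).
  by rewrite {2}/F mulr0 oppr0 expR0 mulr1.
- apply: (@cvg0_le _ (fun n => v^-2 / hi 0 n)); last exact: hiV_cvg.
  move=> n; rewrite subr0 normrM normrN.
  rewrite ![`|_|]ger0_norm ?expR_ge0 ?invr_ge0 ?(ltW v0)//.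
  rewrite expr2 invfM -!mulrA ler_wpM2l ?invr_ge0 ?(ltW v0)//.
  by rewrite -invfM expRN_le// mulr_gt0// hi_gt0.
Qed.

Lemma poisson_integral (t c : R) : 0 < t -> intg setT (fun s => t / (t ^+ 2 + (s - c) ^+ 2)) /\
  \int[mu]_s (t / (t ^+ 2 + (s - c) ^+ 2)) = pi.
Proof.
move=> t0; have [h1 h2 h3] := exh_line.
have tn0 : t != 0 by rewrite gt_eqF.
pose F s := atan (t^-1 * s + - (t^-1 * c)).
have dF (x : R) : is_derive x 1 F (t / (t ^+ 2 + (x - c) ^+ 2)).
  apply: rder_eq (rder_comp (rderD (rderZ _ (rderI x)) (rderC _ x)) (is_derive1_atan _)) _.
  have h : t ^+ 2 + (x - c) ^+ 2 != 0.
    by rewrite gt_eqF// ltr_wpDr ?sqr_ge0 ?exprn_gt0.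
  have -> : 1 + (t^-1 * x - t^-1 * c) ^+ 2 = (t ^+ 2 + (x - c) ^+ 2) / t ^+ 2 by field.
  by field; rewrite h tn0.
have cf (x : R) : {for x, continuous (fun s => t / (t ^+ 2 + (s - c) ^+ 2))}.
  apply: (@cont_derive _ _ (- (t * (2 * (x - c))) / (t ^+ 2 + (x - c) ^+ 2) ^+ 2)).
  have h : t ^+ 2 + (x - c) ^+ 2 != 0.
    by rewrite gt_eqF// ltr_wpDr ?sqr_ge0 ?exprn_gt0.
  have d1 : is_derive x 1 (fun s => t ^+ 2 + (s - c) ^+ 2) (2 * (x - c)).
    apply: rder_eq (rderD (rderC _ x) (rderX 2 (rderB (rderI x) (rderC c x)))) _.
    by rewrite /=; ring.
  by apply: rder_eq (rderZ t (rderV d1 h)) _; field.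
have If : intg setT (fun s => t / (t ^+ 2 + (s - c) ^+ 2)).
  apply: (@ge0_FTC_exhaust R _ _ F _ _ (pi / 2) _ h1 h2 h3) => //.
  - by apply: continuous_measurable_fun => x; exact: cf.
  - by move=> x _; rewrite divr_ge0 ?(ltW t0)// addr_ge0 ?sqr_ge0.
  - by move=> x _; rewrite ler_norml ltW ?atan_gtNpi2//= ltW// atan_ltpi2.
split => //.
have tv : 0 < t^-1 by rewrite invr_gt0.
have hy : (t^-1 * n.+1%:R + - (t^-1 * c)) @[n --> \oo] --> +oo.
  apply/cvgryPge => A; near=> n.
  rewrite -lerBlDr opprK -ler_pdivrMl// invrK.
  rewrite (@le_trans _ _ n%:R)// ?ler_nat//.
  by near: n; exact: nbhs_infty_ger.
have hy' : (t^-1 * n.+1%:R + (t^-1 * c)) @[n --> \oo] --> +oo.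
  apply/cvgryPge => A; near=> n.
  rewrite -lerBlDr -ler_pdivrMl// invrK.
  rewrite (@le_trans _ _ n%:R)// ?ler_nat//.
  by near: n; exact: nbhs_infty_ger.
rewrite (@FTC_exhaust R _ _ F _ _ (- (pi / 2)) (pi / 2) _ h1 h2 h3)//.
- by field.
- rewrite (_ : (fun n => _) = fun n => - atan (t^-1 * n.+1%:R + (t^-1 * c))).
    by apply: cvgN; exact: (cvg_comp _ _ hy' (@cvgy_atan R)).
  by apply/funext => n; rewrite /F -atanN; congr atan; ring.
- exact: (cvg_comp _ _ hy (@cvgy_atan R)).
Unshelve. all: by end_near. Qed.

End majorants.

(** * Poisson integrals of half powers *)

Section halfpower.
Context {R : realType}.
Local Notation mu := (@lebesgue_measure R).

(* Both primitives are written in r = sqrt (y / x); the integrands dominate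
   2 r ^ 2 / (1 + r ^ 4) and 2 / (1 + r ^ 4), and their total masses 3 pi / 4
   stay below pi, which is what makes the corner operator a contraction. *)
Definition prim2 (r : R) := (r / (1 + r ^+ 2) + atan r) / 2.
Definition prim3 (r : R) := r / (1 + r ^+ 2) ^+ 2 / 4 + 3 / 4 * prim2 r.
Definition prim4 (r : R) := r / (1 + r ^+ 2) ^+ 3 / 6 + 5 / 6 * prim3 r.

Lemma opr2_gt0 (r : R) : 0 < 1 + r ^+ 2.
Proof. by rewrite ltr_wpDr ?sqr_ge0. Qed.
Lemma opr2_neq0 (r : R) : 1 + r ^+ 2 != 0.
Proof. by rewrite gt_eqF ?opr2_gt0. Qed.

Lemma der_opr2 (r : R) : is_derive r 1 (fun s => 1 + s ^+ 2) (2 * r).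
Proof. by apply: rder_eq (rderD (rderC 1 r) (rderX 2 (rderI r))) _ => /=; ring. Qed.

Lemma der_prim2 (r : R) : is_derive r 1 prim2 ((1 + r ^+ 2) ^- 2).
Proof.
have h := opr2_neq0 r.
have d := rderM (rderD (rderM (rderI r) (rderV (der_opr2 r) h)) (is_derive1_atan r)) (rderC 2^-1 r).
by apply: rder_eq d _; field.
Qed.

Lemma der_prim3 (r : R) : is_derive r 1 prim3 ((1 + r ^+ 2) ^- 3).
Proof.
have h := opr2_neq0 r.
have d0 := rderX 2 (der_opr2 r).
have h0 : (1 + r ^+ 2) ^+ 2 != 0 by rewrite expf_neq0.
have d := rderD (rderM (rderM (rderI r) (rderV d0 h0)) (rderC 4^-1 r)) (rderZ (3 / 4) (der_prim2 r)).
by apply: rder_eq d _ => /=; field.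
Qed.

Lemma der_prim4 (r : R) : is_derive r 1 prim4 ((1 + r ^+ 2) ^- 4).
Proof.
have h := opr2_neq0 r.
have d0 := rderX 3 (der_opr2 r).
have h0 : (1 + r ^+ 2) ^+ 3 != 0 by rewrite expf_neq0.
have d := rderD (rderM (rderM (rderI r) (rderV d0 h0)) (rderC 6^-1 r)) (rderZ (5 / 6) (der_prim3 r)).
by apply: rder_eq d _ => /=; field.
Qed.

Definition Q1 (r : R) := 2 * (atan r - prim2 r) + 8 * (prim2 r - 2 * prim3 r + prim4 r).
Definition Q2 (r : R) := 2 * prim2 r + 8 * (prim3 r - prim4 r).

(** Put [s = 2 * r ^+ 2 / (1 + r ^+ 2) ^+ 2], which is at most 1/2. Then
    [1 + r ^+ 4 = (1 + r ^+ 2) ^+ 2 * (1 - s)], and the chord bound [(1 - s)^-1 <= 1 + 2 * s] turns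
    [2 * r ^+ 2 / (1 + r ^+ 4)] and [2 / (1 + r ^+ 4)] into [q1] and [q2], whose primitives need
    [atan r] as the only transcendental function. *)
Definition q1 (r : R) := 2 * r ^+ 2 / (1 + r ^+ 2) ^+ 2 + 8 * r ^+ 4 / (1 + r ^+ 2) ^+ 4.
Definition q2 (r : R) := 2 / (1 + r ^+ 2) ^+ 2 + 8 * r ^+ 2 / (1 + r ^+ 2) ^+ 4.

Lemma der_Q1 (r : R) : is_derive r 1 Q1 (q1 r).
Proof.
have h := opr2_neq0 r.
have d := rderD (rderZ 2 (rderB (is_derive1_atan r) (der_prim2 r)))
  (rderZ 8 (rderD (rderB (der_prim2 r) (rderZ 2 (der_prim3 r))) (der_prim4 r))).
by apply: rder_eq d _; rewrite /q1; field.
Qed.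

Lemma der_Q2 (r : R) : is_derive r 1 Q2 (q2 r).
Proof.
have h := opr2_neq0 r.
have d := rderD (rderZ 2 (der_prim2 r)) (rderZ 8 (rderB (der_prim3 r) (der_prim4 r))).
by apply: rder_eq d _; rewrite /q2; field.
Qed.

Lemma q1_ge (r : R) : 2 * r ^+ 2 / (1 + r ^+ 4) <= q1 r.
Proof.
have h := opr2_gt0 r; have h4 : 0 < 1 + r ^+ 4 by rewrite ltr_wpDr ?exprn_even_ge0.
rewrite -subr_ge0 (_ : _ - _ = 4 * r ^+ 4 * (1 - r ^+ 2) ^+ 2 / ((1 + r ^+ 2) ^+ 4 * (1 + r ^+ 4))).
  apply: divr_ge0; last by rewrite mulr_ge0 ?exprn_ge0 ?(ltW h) ?(ltW h4).
  by apply: mulr_ge0; [apply: mulr_ge0 => //; exact: exprn_even_ge0|exact: sqr_ge0].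
by rewrite /q1; field; rewrite !gt_eqF.
Qed.

Lemma q2_ge (r : R) : 2 / (1 + r ^+ 4) <= q2 r.
Proof.
have h := opr2_gt0 r; have h4 : 0 < 1 + r ^+ 4 by rewrite ltr_wpDr ?exprn_even_ge0.
rewrite -subr_ge0 (_ : _ - _ = 4 * r ^+ 2 * (1 - r ^+ 2) ^+ 2 / ((1 + r ^+ 2) ^+ 4 * (1 + r ^+ 4))).
  apply: divr_ge0; last by rewrite mulr_ge0 ?exprn_ge0 ?(ltW h) ?(ltW h4).
  by apply: mulr_ge0; [apply: mulr_ge0 => //; exact: exprn_even_ge0|exact: sqr_ge0].
by rewrite /q2; field; rewrite !gt_eqF.
Qed.

Lemma eps_le (r : R) n : 0 < r -> 0 <= r / (1 + r ^+ 2) ^+ n.+1 <= r^-1.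
Proof.
move=> r0; have h := opr2_gt0 r.
apply/andP; split; first by rewrite divr_ge0 ?exprn_ge0 ?(ltW h) ?(ltW r0).
rewrite ler_pdivrMr ?exprn_gt0// ler_pdivlMl//.
have : 1 + r ^+ 2 <= (1 + r ^+ 2) ^+ n.+1.
  by rewrite ler_eXnr// lerDl sqr_ge0.
by apply: le_trans; rewrite -expr2 lerDr.
Qed.

(** The rational terms vanish at infinity, so the total mass is 3/2 times [pi / 2]. *)
Lemma Q1E (r : R) : Q1 r = 3 / 2 * atan r - r / (1 + r ^+ 2) ^+ 1 / 2
  - 7 / 3 * (r / (1 + r ^+ 2) ^+ 2) + 4 / 3 * (r / (1 + r ^+ 2) ^+ 3).
Proof. by have h := opr2_neq0 r; rewrite /Q1 /prim4 /prim3 /prim2; field. Qed.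

Lemma Q2E (r : R) : Q2 r = 3 / 2 * atan r + 3 / 2 * (r / (1 + r ^+ 2) ^+ 1)
  + 1 / 3 * (r / (1 + r ^+ 2) ^+ 2) - 4 / 3 * (r / (1 + r ^+ 2) ^+ 3).
Proof. by have h := opr2_neq0 r; rewrite /Q2 /prim4 /prim3 /prim2; field. Qed.

Lemma eps_cvg (r : nat -> R) n : (forall i, 0 < r i) -> r i @[i --> \oo] --> +oo ->
  r i / (1 + r i ^+ 2) ^+ n.+1 @[i --> \oo] --> 0.
Proof.
move=> r0 ry; apply: (@cvg0_le _ _ (fun i => (r i)^-1)).
  by move=> i; rewrite subr0; have /andP[? ?] := eps_le n (r0 i); rewrite ger0_norm.
by apply/gtr0_cvgV0 => //; exact: nearW.
Qed.

Lemma Q1_cvg (r : nat -> R) : (forall i, 0 < r i) -> r i @[i --> \oo] --> +oo ->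
  Q1 (r i) @[i --> \oo] --> 3 / 4 * pi.
Proof.
move=> r0 ry; under eq_fun do rewrite Q1E.
rewrite (_ : 3 / 4 * pi = 3 / 2 * (pi / 2) - 0 / 2 - 7 / 3 * 0 + 4 / 3 * 0); last by field.
have ha : atan (r i) @[i --> \oo] --> pi / 2 by exact: (cvg_comp _ _ ry (@cvgy_atan R)).
have c (z : R) : (fun=> z : R) @ \oo --> z by exact: cvg_cst.
by apply: cvgD; [apply: cvgB; [apply: cvgB|]|]; apply: cvgM => //; exact: eps_cvg.
Qed.

Lemma Q2_cvg (r : nat -> R) : (forall i, 0 < r i) -> r i @[i --> \oo] --> +oo ->
  Q2 (r i) @[i --> \oo] --> 3 / 4 * pi.
Proof.
move=> r0 ry; under eq_fun do rewrite Q2E.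
rewrite (_ : 3 / 4 * pi = 3 / 2 * (pi / 2) + 3 / 2 * 0 + 1 / 3 * 0 - 4 / 3 * 0); last by field.
have ha : atan (r i) @[i --> \oo] --> pi / 2 by exact: (cvg_comp _ _ ry (@cvgy_atan R)).
have c (z : R) : (fun=> z : R) @ \oo --> z by exact: cvg_cst.
by apply: cvgB; [apply: cvgD; [apply: cvgD|]|]; apply: cvgM => //; exact: eps_cvg.
Qed.

Definition rad (x c s : R) := Num.sqrt ((s - c) / x).

Lemma rad_gt0 (x c s : R) : 0 < x -> c < s -> 0 < rad x c s.
Proof. by move=> x0 cs; rewrite sqrtr_gt0 divr_gt0// subr_gt0. Qed.

Lemma sqr_rad (x c s : R) : 0 < x -> c < s -> s - c = x * rad x c s ^+ 2.
Proof.
move=> x0 cs; rewrite sqr_sqrtr ?divr_ge0 ?ltW ?subr_gt0//.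
by field; rewrite gt_eqF.
Qed.

Lemma der_rad (x c s : R) : 0 < x -> c < s -> is_derive s 1 (rad x c) (2 * x * rad x c s)^-1.
Proof.
move=> x0 cs.
have h : 0 < (s - c) / x by rewrite divr_gt0// subr_gt0.
have d := rder_comp (rderM (rderB (rderI s) (rderC c s)) (rderC x^-1 s)) (is_derive1_sqrt h).
apply: rder_eq d _; rewrite subr0 mulr0 addr0 mul1r -/(rad x c s).
by field; rewrite !gt_eqF// rad_gt0.
Qed.

(** The substitution [r = rad x c s], made on primitives: [(2 * x * r)^-1] is the derivative of
    [rad x c], so [Q] composed with it is a primitive of the integrand. The bound of [Q] gives
    integrability, its limit the value. *)
Lemma rad_substitution (Q q : R -> R) (L x c : R) : 0 < x ->
  (forall r : R, is_derive r 1 Q (q r)) -> (forall r : R, {for r, continuous q}) ->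
  (forall r, 0 <= q r) -> Q 0 = 0 ->
  (forall r : nat -> R, (forall i, 0 < r i) -> r i @[i --> \oo] --> +oo ->
     Q (r i) @[i --> \oo] --> L) ->
  (exists B, forall r, 0 < r -> `|Q r| <= B) ->
  intg `]c, +oo[%classic (fun s => q (rad x c s) * (2 * x * rad x c s)^-1) /\
  \int[mu]_(s in `]c, +oo[) (q (rad x c s) * (2 * x * rad x c s)^-1) = L.
Proof.
move=> x0 derQ cq q0 Q0 QL [B QB]; have [h1 h2 h3] := exh_ray c.
have ray (s : R) : `]c, +oo[%classic s -> c < s by rewrite /= in_itv /= andbT.
have dF (s : R) : c < s -> is_derive s 1 (fun s => Q (rad x c s)) (q (rad x c s) * (2 * x * rad x c s)^-1).
  by move=> cs; exact: rder_comp (der_rad x0 cs) (derQ _).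
have cr (s : R) : c < s -> {for s, continuous (rad x c)}.
  by move=> cs; exact: cont_derive (der_rad x0 cs).
have cf (s : R) : c < s -> {for s, continuous (fun s => q (rad x c s) * (2 * x * rad x c s)^-1)}.
  move=> cs; apply: cvgM; first exact: continuous_comp (cr s cs) (cq _).
  apply: cvgV; first by rewrite gt_eqF// !mulr_gt0// rad_gt0.
  by apply: cvgM; [exact: cvg_cst|exact: cr].
have If : intg `]c, +oo[%classic (fun s => q (rad x c s) * (2 * x * rad x c s)^-1).
  apply: (@ge0_FTC_exhaust R _ _ (fun s => Q (rad x c s)) _ _ B _ h1 h2 h3) => //.
  - by move=> s /ray; exact: dF.
  - by move=> s /ray; exact: cf.
  - exact: meas_ray.
  - by move=> s /ray cs; rewrite mulr_ge0// invr_ge0 !mulr_ge0 ?(ltW x0) ?sqrtr_ge0.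
  - by move=> s /ray cs; rewrite QB// rad_gt0.
split => //.
rewrite -[RHS]subr0; apply: (@FTC_exhaust R _ _ (fun s => Q (rad x c s)) _ _ 0 L _ h1 h2 h3) => //.
- by move=> s /ray; exact: dF.
- by move=> s /ray; exact: cf.
- have h0 : (lo c n - c) / x @[n --> \oo] --> (0 : R).
    rewrite -[X in _ --> X](mul0r x^-1); apply: cvgM; last exact: cvg_cst.
    by apply/subr_cvg0; exact: (@lo_cvg _ c).
  have hr : rad x c (lo c n) @[n --> \oo] --> Num.sqrt (0 : R).
    exact: (cvg_comp _ _ h0 (@sqrt_continuous R 0)).
  rewrite sqrtr0 in hr; rewrite -Q0.
  exact: (cvg_comp _ _ hr (cont_derive (derQ 0))).
- apply: QL.
    by move=> i; rewrite rad_gt0// /hi ltrDl.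
  apply/cvgryPge => A; near=> n.
  rewrite /rad /hi addrAC subrr add0r.
  rewrite (le_trans (ler_norm A))// -sqrtr_sqr ler_wsqrtr//.
  rewrite ler_pdivlMr// (@le_trans _ _ n%:R)// ?ler_nat; last exact: leqW.
  by near: n; exact: nbhs_infty_ger.
Unshelve. all: by end_near. Qed.

Lemma cont_q1 (r : R) : {for r, continuous q1}.
Proof.
have h := opr2_neq0 r.
have d := rderD (rderM (rderZ 2 (rderX 2 (rderI r))) (rderV (rderX 2 (der_opr2 r)) (expf_neq0 2 h)))
  (rderM (rderZ 8 (rderX 4 (rderI r))) (rderV (rderX 4 (der_opr2 r)) (expf_neq0 4 h))).
exact: cont_derive d.
Qed.

Lemma cont_q2 (r : R) : {for r, continuous q2}.
Proof.
have h := opr2_neq0 r.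
have d := rderD (rderM (rderC 2 r) (rderV (rderX 2 (der_opr2 r)) (expf_neq0 2 h)))
  (rderM (rderZ 8 (rderX 2 (rderI r))) (rderV (rderX 4 (der_opr2 r)) (expf_neq0 4 h))).
exact: cont_derive d.
Qed.

Lemma atan_bound (r : R) : `|atan r| <= 2.
Proof.
have h := @pihalf_lt2 R.
by rewrite ler_norml (le_trans (ltW (atan_ltpi2 r)) (ltW h)) andbT (le_trans _ (ltW (atan_gtNpi2 r)))// lerN2 ltW.
Qed.

Lemma eps_le1 (r : R) n : 0 < r -> 0 <= r / (1 + r ^+ 2) ^+ n.+1 <= 1.
Proof.
move=> r0; have h := opr2_gt0 r.
apply/andP; split; first by rewrite divr_ge0 ?exprn_ge0 ?(ltW h) ?(ltW r0).
rewrite ler_pdivrMr ?exprn_gt0// mul1r.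
have : 1 + r ^+ 2 <= (1 + r ^+ 2) ^+ n.+1.
  by rewrite ler_eXnr// lerDl sqr_ge0.
apply: le_trans; nra.
Qed.

(** After [s - c = x * r ^+ 2] the integrands become [2 * r ^+ 2 / (1 + r ^+ 4)] and
    [2 / (1 + r ^+ 4)], up to the factors [sqrt x] and its inverse. The exact value of both
    integrals is [pi / sqrt 2]. *)
Lemma poisson_sqrt_int (x c : R) : 0 < x ->
  [/\ intg `]c, +oo[%classic (fun s => x * Num.sqrt (s - c) / (x ^+ 2 + (s - c) ^+ 2)),
   \int[mu]_(s in `]c, +oo[) (x * Num.sqrt (s - c) / (x ^+ 2 + (s - c) ^+ 2)) <= 3 / 4 * pi * Num.sqrt x,
   intg `]c, +oo[%classic (fun s => x / Num.sqrt (s - c) / (x ^+ 2 + (s - c) ^+ 2)) &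
   \int[mu]_(s in `]c, +oo[) (x / Num.sqrt (s - c) / (x ^+ 2 + (s - c) ^+ 2)) <= 3 / 4 * pi / Num.sqrt x].
Proof.
move=> x0; pose w := Num.sqrt x; have w0 : 0 < w by rewrite sqrtr_gt0.
have xw : x = w ^+ 2 by rewrite sqr_sqrtr// ltW.
have ray (s : R) : `]c, +oo[%classic s -> c < s by rewrite /= in_itv /= andbT.
have q1_0 r : 0 <= q1 r.
  apply: le_trans (q1_ge r); apply: divr_ge0; first by rewrite mulr_ge0 ?sqr_ge0.
  by apply: addr_ge0 => //; exact: exprn_even_ge0.
have q2_0 r : 0 <= q2 r.
  apply: le_trans (q2_ge r); apply: divr_ge0 => //.
  by apply: addr_ge0 => //; exact: exprn_even_ge0.
have B1 : exists B, forall r, 0 < r -> `|Q1 r| <= B.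
  exists 10 => r r0; rewrite Q1E.
  have := atan_bound r; have := eps_le1 0 r0; have := eps_le1 1 r0; have := eps_le1 2 r0.
  move: (_ / _ ^+ 1) (_ / _ ^+ 2) (_ / _ ^+ 3) => e1 e2 e3.
  by rewrite !ler_norml => /andP[? ?] /andP[? ?] /andP[? ?] /andP[? ?]; apply/andP; split; lra.
have B2 : exists B, forall r, 0 < r -> `|Q2 r| <= B.
  exists 10 => r r0; rewrite Q2E.
  have := atan_bound r; have := eps_le1 0 r0; have := eps_le1 1 r0; have := eps_le1 2 r0.
  move: (_ / _ ^+ 1) (_ / _ ^+ 2) (_ / _ ^+ 3) => e1 e2 e3.
  by rewrite !ler_norml => /andP[? ?] /andP[? ?] /andP[? ?] /andP[? ?]; apply/andP; split; lra.
have Q10 : Q1 0 = 0 by rewrite Q1E atan0 !mul0r; ring.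
have Q20 : Q2 0 = 0 by rewrite Q2E atan0 !mul0r; ring.
have [i1 e1] := @rad_substitution Q1 q1 _ x c x0 der_Q1 cont_q1 q1_0 Q10 Q1_cvg B1.
have [i2 e2] := @rad_substitution Q2 q2 _ x c x0 der_Q2 cont_q2 q2_0 Q20 Q2_cvg B2.
have mA : measurable (`]c, +oo[%classic : set R) by [].
have cs (s : R) : {for s, continuous (fun s => Num.sqrt (s - c))}.
  apply: (@continuous_comp _ _ _ (fun s => s - c) (@Num.sqrt R)); last exact: sqrt_continuous.
  exact: cont_derive (rderB (rderI s) (rderC c s)).
have den (s : R) : 0 < x ^+ 2 + (s - c) ^+ 2 by rewrite ltr_wpDr ?sqr_ge0 ?exprn_gt0.
have cd (s : R) : {for s, continuous (fun s => (x ^+ 2 + (s - c) ^+ 2)^-1)}.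
  apply: cont_derive (rderV (rderD (rderC (x ^+ 2) s) (rderX 2 (rderB (rderI s) (rderC c s)))) _).
  by rewrite gt_eqF.
have E1 (s : R) : c < s -> 0 <= x * Num.sqrt (s - c) / (x ^+ 2 + (s - c) ^+ 2) <=
    w * (q1 (rad x c s) * (2 * x * rad x c s)^-1).
  move=> s0; have r0 := rad_gt0 x0 s0.
  rewrite divr_ge0 ?mulr_ge0 ?sqrtr_ge0 ?(ltW x0) ?(ltW (den s))//=.
  have -> : Num.sqrt (s - c) = w * rad x c s by rewrite (sqr_rad x0 s0) sqrtrM ?(ltW x0)// sqrtr_sqr ger0_norm ?(ltW r0).
  rewrite (sqr_rad x0 s0); move: (rad x c s) r0 => r r0.
  apply: (@le_trans _ _ (w * (2 * r ^+ 2 / (1 + r ^+ 4) * (2 * x * r)^-1))); last first.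
    by rewrite ler_wpM2l ?(ltW w0)// ler_wpM2r ?q1_ge// invr_ge0 !mulr_ge0 ?ltW.
  have h4 : 0 < 1 + r ^+ 4 by rewrite ltr_wpDr ?exprn_even_ge0.
  rewrite le_eqVlt; apply/orP; left; apply/eqP.
  have h5 : x ^+ 2 + (x * r ^+ 2) ^+ 2 != 0 by rewrite gt_eqF// ltr_wpDr ?sqr_ge0 ?exprn_gt0.
  by field; rewrite h5 !gt_eqF.
have E2 (s : R) : c < s -> 0 <= x / Num.sqrt (s - c) / (x ^+ 2 + (s - c) ^+ 2) <=
    w^-1 * (q2 (rad x c s) * (2 * x * rad x c s)^-1).
  move=> s0; have r0 := rad_gt0 x0 s0.
  rewrite divr_ge0 ?divr_ge0 ?sqrtr_ge0 ?(ltW x0) ?(ltW (den s))//=.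
  have -> : Num.sqrt (s - c) = w * rad x c s by rewrite (sqr_rad x0 s0) sqrtrM ?(ltW x0)// sqrtr_sqr ger0_norm ?(ltW r0).
  rewrite (sqr_rad x0 s0); move: (rad x c s) r0 => r r0.
  apply: (@le_trans _ _ (w^-1 * (2 / (1 + r ^+ 4) * (2 * x * r)^-1))); last first.
    by rewrite ler_wpM2l ?invr_ge0 ?(ltW w0)// ler_wpM2r ?q2_ge// invr_ge0 !mulr_ge0 ?ltW.
  have h4 : 0 < 1 + r ^+ 4 by rewrite ltr_wpDr ?exprn_even_ge0.
  rewrite le_eqVlt; apply/orP; left; apply/eqP.
  have h5 : x ^+ 2 + (x * r ^+ 2) ^+ 2 != 0 by rewrite gt_eqF// ltr_wpDr ?sqr_ge0 ?exprn_gt0.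
  by field; rewrite h5 !gt_eqF.
have I1 : intg `]c, +oo[%classic (fun s => x * Num.sqrt (s - c) / (x ^+ 2 + (s - c) ^+ 2)).
  apply: (intg_le mA _ (intgZ w mA i1)).
    apply: meas_ray => s _; apply: cvgM; last exact: cd.
    by apply: cvgM; [exact: cvg_cst|exact: cs].
  by move=> s /ray s0; have /andP[a b] := E1 s s0; rewrite ger0_norm.
have I2 : intg `]c, +oo[%classic (fun s => x / Num.sqrt (s - c) / (x ^+ 2 + (s - c) ^+ 2)).
  apply: (intg_le mA _ (intgZ w^-1 mA i2)).
    apply: meas_ray => s s0; apply: cvgM; last exact: cd.
    apply: cvgM; first exact: cvg_cst.
    by apply: cvgV; [rewrite gt_eqF// sqrtr_gt0 subr_gt0|exact: cs].
  by move=> s /ray s0; have /andP[a b] := E2 s s0; rewrite ger0_norm.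
split => //.
  rewrite -e1 mulrC -RintegralZl//; apply: le_Rintegral => //; first exact: intgZ.
  by move=> s /ray s0; have /andP[a b] := E1 s s0.
rewrite -e2 mulrC -RintegralZl//; apply: le_Rintegral => //; first exact: intgZ.
by move=> s /ray s0; have /andP[a b] := E2 s s0.
Qed.
End halfpower.

Ltac nonneg := solve [repeat first [ assumption | exact: sqr_ge0 | exact: cmod_ge0
  | exact: normr_ge0 | exact: expR_ge0 | exact: pi_ge0 | exact: ler0n | exact: ler01 | exact: sqrtr_ge0
  | (apply: ltW; assumption) | apply: mulr_ge0 | apply: addr_ge0 | apply: exprn_ge0
  | rewrite invr_ge0 ]].
Ltac pos := solve [repeat first [ assumption | exact: expR_gt0 | exact: pi_gt0 | exact: ltr01
  | exact: ltr0Sn | (rewrite exprn_gt0 //; assumption)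
  | apply: mulr_gt0 | (rewrite ltr_pwDl//; nonneg) | (rewrite ltr_wpDl//; nonneg) | apply: addr_gt0 | apply: exprn_gt0
  | rewrite invr_gt0 ]].

(** * The oscillatory integrals *)

Definition ic {R : realType} : R[i] := 'i%C.
Lemma Re_ic (R : realType) : complex.Re (@ic R) = 0. Proof. by []. Qed.
Lemma Im_ic (R : realType) : complex.Im (@ic R) = 1. Proof. by []. Qed.
Definition icE := (Re_ic, Im_ic).
Lemma cmod_ic (R : realType) : cmod (@ic R) = 1. Proof. exact: cmodi. Qed.
Lemma sqr_ic (R : realType) : ic ^+ 2 = -1 :> R[i]. Proof. exact: sqr_i. Qed.

Section oscint.
Context {R : realType}.
Local Notation C := R[i].
Local Notation Re := (@complex.Re R).
Local Notation Im := (@complex.Im R).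
Local Notation mu := (@lebesgue_measure R).
Local Notation Rp := (`]0, +oo[%classic : set R).
Variable k : R.
Hypothesis k0 : 0 < k.

Lemma Rp_gt0 (u : R) : Rp u -> 0 < u. Proof. by rewrite /= in_itv /= andbT. Qed.
Lemma mRp : measurable Rp. Proof. by []. Qed.
Lemma Rp_open : open Rp. Proof. exact: interval_open. Qed.

(* [osc m] is the integral of [u ^ m * exp (i rho u / 4 + i k ^ 2 / u)] over the half-line. *)
Definition osc_factor (rho : C) (u : R) : C :=
  cexp (ic * rho * (u / 4)%:C + ic * (k ^+ 2 / u)%:C).
Definition wosc (w : R -> R) (rho : C) : C := cint Rp (fun u => (w u)%:C * osc_factor rho u).
Definition osc (m : nat) (rho : C) : C := wosc (fun u => u ^+ m) rho.

Lemma cmodn n : cmod (n%:R : C) = n%:R.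
Proof. by rewrite -(rmorph_nat (real_complex R)) cmodC ger0_norm. Qed.

Lemma cmod_osc_factor rho u : cmod (osc_factor rho u) = expR (- (Im rho / 4 * u)).
Proof.
rewrite cmod_cexp; congr expR; rewrite !(icE, ReImE); ring.
Qed.

Lemma osc_factor_le1 rho u : 0 <= Im rho -> 0 < u -> cmod (osc_factor rho u) <= 1.
Proof.
move=> r0 u0; rewrite cmod_osc_factor -expR0 ler_expR oppr_le0 mulr_ge0 ?(ltW u0)//.
by rewrite divr_ge0.
Qed.

Lemma der_osc_factor rho (u : R) : 0 < u ->
  cder (osc_factor rho) u (((ic * rho / 4) - ic * (k ^+ 2 / u ^+ 2)%:C) * osc_factor rho u).
Proof.
move=> u0; apply: cder_cexp.
have d1 : cder (fun u => (u / 4)%:C) u (4^-1)%:C.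
  by apply: cder_real; apply: rder_eq (rderM (rderI u) (rderC _ u)) _; ring.
have d2 : cder (fun u => (k ^+ 2 / u)%:C) u (- (k ^+ 2 / u ^+ 2))%:C.
  apply: cder_real; apply: rder_eq (rderZ (k ^+ 2) (rderV (rderI u) _)) _; rewrite ?gt_eqF//.
  by field; rewrite gt_eqF.
apply: cder_eq (cderD (cderZ (ic * rho) d1) (cderZ ic d2)) _.
by field; rewrite fmorph_eq0 gt_eqF.
Qed.

Lemma osc_factor_cmeas rho : cmeas Rp (osc_factor rho).
Proof. by apply: (cder_cmeas Rp_open) => u /Rp_gt0; exact: der_osc_factor. Qed.

(** Half of the decay rate pays for the power: [t <= exp t] at [t = v * u / (2 * m)], raised to the
    power [m]. *)
Lemma powexp_le (m : nat) (v u : R) : 0 < v -> 0 < u ->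
  u ^+ m <= (2 * m%:R / v) ^+ m * expR (v / 2 * u).
Proof.
move=> v0 u0; case: m => [|m].
  by rewrite !expr0 mul1r -expR0 ler_expR !mulr_ge0 ?(ltW u0)// (ltW v0).
have h : u <= 2 * m.+1%:R / v * expR (v / 2 * u / m.+1%:R).
  have N0 : 0 < m.+1%:R :> R by rewrite ltr0n.
  move: (m.+1%:R) N0 => N N0.
  have : v / 2 * u / N <= expR (v / 2 * u / N).
    by rewrite (le_trans _ (expR_ge1Dx _))// lerDr.
  rewrite -(@ler_pM2l _ (2 * N / v)); last by rewrite divr_gt0// mulr_gt0.
  by apply: le_trans; rewrite le_eqVlt; apply/orP; left; apply/eqP; field; rewrite !gt_eqF.
have := @lerXn2r _ m.+1 _ _ _ _ h; rewrite !nnegrE (ltW u0) => /(_ isT)/=.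
move=> /(_ (le_trans (ltW u0) h)) /le_trans; apply.
rewrite exprMn ler_wpM2l ?exprn_ge0 ?divr_ge0 ?mulr_ge0 ?(ltW v0)//.
by rewrite -expRM_natl -mulr_natl mulrC divfK ?pnatr_eq0.
Qed.

Lemma pow1exp_le (m : nat) (v u : R) : 0 < v -> 0 < u ->
  (1 + u) ^+ m <= (1 + 2 * m%:R / v) ^+ m * expR (v / 2 * u).
Proof.
move=> v0 u0; case: m => [|m].
  by rewrite !expr0 mul1r -expR0 ler_expR !mulr_ge0 ?(ltW u0)// (ltW v0).
have cc : 0 <= 1 + 2 * m.+1%:R / v by rewrite addr_ge0// divr_ge0 ?(ltW v0)// mulr_ge0.
have h : 1 + u <= (1 + 2 * m.+1%:R / v) * expR (v / 2 * u / m.+1%:R).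
  have N0 : 0 < m.+1%:R :> R by rewrite ltr0n.
  move: (m.+1%:R) N0 cc => N N0 cc.
  have : 1 + v / 2 * u / N <= expR (v / 2 * u / N) by exact: expR_ge1Dx.
  move=> /(ler_wpM2l cc); apply: le_trans.
  have -> : (1 + 2 * N / v) * (1 + v / 2 * u / N) = 1 + u + 2 * N / v + v / 2 * u / N.
    by field; rewrite !gt_eqF.
  by rewrite -addrA lerDl addr_ge0// ?divr_ge0 ?mulr_ge0 ?(ltW v0) ?(ltW u0) ?(ltW N0)// invr_ge0.
have u1 : 0 <= 1 + u by rewrite addr_ge0// ltW.
have := @lerXn2r _ m.+1 _ _ _ _ h; rewrite !nnegrE u1 => /(_ isT)/=.
move=> /(_ (le_trans u1 h)) /le_trans; apply.
rewrite exprMn ler_wpM2l ?exprn_ge0//.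
by rewrite -expRM_natl -mulr_natl mulrC divfK ?pnatr_eq0.
Qed.

Lemma expR_half (v u : R) : expR (v / 2 * u) * expR (- (v * u)) = expR (- (v / 2 * u)).
Proof. by rewrite -expRD; congr expR; field. Qed.

Lemma wosc_cintg (w : R -> R) (rho : C) (K : R) m : 0 < Im rho -> measurable_fun Rp w ->
  (forall u, 0 < u -> `|w u| <= K * (1 + u) ^+ m) ->
  cintg Rp (fun u => (w u)%:C * osc_factor rho u).
Proof.
move=> r0 mw wK; set v := Im rho / 4; have v0 : 0 < v by rewrite divr_gt0.
have K0 : 0 <= K.
  have := wK 1 ltr01; have h : 0 < (1 + 1 : R) ^+ m by rewrite exprn_gt0// addr_gt0.
  by move=> /(le_trans (normr_ge0 _)); rewrite pmulr_lge0.
have v2 : 0 < v / 2 by rewrite divr_gt0.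
apply: (@cintg_le _ _ _ (fun u => (K * (1 + 2 * m%:R / v) ^+ m) * expR (- (v / 2 * u)))).
- exact: mRp.
- by apply: cmeasM; [exact: cmeas_real|exact: osc_factor_cmeas].
- by apply: intgZ; [exact: mRp|case: (intg_expR v2)].
- move=> u /Rp_gt0 u0; rewrite cmodM cmodC cmod_osc_factor -/v.
  apply: (le_trans (ler_wpM2r (expR_ge0 _) (wK u u0))).
  rewrite -expR_half mulrA ler_wpM2r ?expR_ge0// -mulrA ler_wpM2l//.
  exact: pow1exp_le.
Qed.

Lemma pow_cintg m rho : 0 < Im rho -> cintg Rp (fun u => (u ^+ m)%:C * osc_factor rho u).
Proof.
move=> r0; apply: (@wosc_cintg _ _ 1 m) => //.
move=> u u0; rewrite mul1r ger0_norm ?exprn_ge0 ?(ltW u0)// lerXn2r ?nnegrE ?addr_ge0 ?(ltW u0)//.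
by rewrite lerDr.
Qed.

Lemma der_alg (r' r E : C) (x u : R) :
  x%:C * ((ic * r' * (u / 4)%:C + ic * r * 0 + 0) * E) = ic / 4 * r' * ((x * u)%:C * E).
Proof. by field. Qed.

Definition osc_const (m : nat) : R := 2 * (2 * m%:R) ^+ m * 4 ^+ m.+1.

Lemma osc_const_ge0 m : 0 <= osc_const m.
Proof. by rewrite /osc_const !mulr_ge0// ?exprn_ge0// mulr_ge0. Qed.

(** The modulus of [osc_factor] decays at the rate [Im rho / 4]. The bound serves far out on the
    path, where [Im rho] is comparable to the squared distance. *)
Lemma osc_le m rho : 0 < Im rho -> cmod (osc m rho) <= osc_const m / Im rho ^+ m.+1.
Proof.
move=> r0; set v := Im rho / 4; have v0 : 0 < v by rewrite divr_gt0.
have v2 : 0 < v / 2 by rewrite divr_gt0.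
have [i e] := intg_expR v2.
have := @cint_le R Rp _ (fun u => (2 * m%:R / v) ^+ m * expR (- (v / 2 * u))) mRp (pow_cintg m r0) (intgZ _ mRp i).
move=> /(_ _)/le_trans; apply.
  move=> u /Rp_gt0 u0; rewrite cmodM cmodC ger0_norm ?exprn_ge0 ?(ltW u0)// cmod_osc_factor -/v.
  apply: (le_trans (ler_wpM2r (expR_ge0 _) (powexp_le m v0 u0))).
  by rewrite -expR_half mulrA.
rewrite RintegralZl// e le_eqVlt; apply/orP; left; apply/eqP.
rewrite /osc_const /v !expr_div_n !exprMn !exprS.
by field; rewrite ?expf_neq0 ?gt_eqF.
Qed.

Lemma cder_osc m (rho rho' : R -> C) (t p q nu K : R) : p < t < q -> 0 < nu ->
  (forall s, p < s < q -> cder rho s (rho' s)) ->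
  (forall s, p < s < q -> nu <= Im (rho s)) ->
  (forall s, p < s < q -> cmod (rho' s) <= K) ->
  cder (fun s => osc m (rho s)) t (ic / 4 * rho' t * osc m.+1 (rho t)).
Proof.
move=> pq nu0 dr rnu rK.
have r0 s : p < s < q -> 0 < Im (rho s) by move=> /rnu; exact: lt_le_trans.
pose F s u := (u ^+ m)%:C * osc_factor (rho s) u.
pose F' s u := (ic / 4 * rho' s) * ((u ^+ m.+1)%:C * osc_factor (rho s) u).
have v2 : 0 < nu / 4 / 2 by rewrite !divr_gt0.
have v0 : 0 < nu / 4 by rewrite divr_gt0.
have [i e] := intg_expR v2.
have -> : ic / 4 * rho' t * osc m.+1 (rho t) = cint Rp (F' t).
  by rewrite /F' cintZ//; exact/pow_cintg/r0.
apply: (@cint_cder R Rp F F' t p q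
  (fun u => K * ((2 * m.+1%:R / (nu / 4)) ^+ m.+1 * expR (- (nu / 4 / 2 * u)))) mRp pq).
- by move=> s /r0; exact: pow_cintg.
- move=> s u spq /Rp_gt0 u0.
  apply: cder_eq (cderZ _ (cder_cexp (cderD (cderM (cderZ ic (dr s spq)) (cder_cst _ s)) (cder_cst _ s)))) _.
  by rewrite /F' /osc_factor [u ^+ m.+1]exprSr; exact: der_alg.
- by apply: intgZ => //; exact: intgZ.
- move=> s u spq /Rp_gt0 u0.
  have K0 : 0 <= K by exact: le_trans (cmod_ge0 _) (rK s spq).
  rewrite /F' !cmodM cmodV cmod_ic mul1r cmodC ger0_norm ?exprn_ge0 ?(ltW u0)//.
  rewrite (cmodn 4).
  have h : u ^+ m.+1 * cmod (osc_factor (rho s) u) <= (2 * m.+1%:R / (nu / 4)) ^+ m.+1 * expR (- (nu / 4 / 2 * u)).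
    rewrite -expR_half mulrA; apply: ler_pM; rewrite ?exprn_ge0 ?(ltW u0) ?cmod_ge0//.
      exact: powexp_le.
    by rewrite cmod_osc_factor ler_expR lerN2 ler_wpM2r ?(ltW u0)// ler_wpM2r// rnu.
  apply: ler_pM h; rewrite ?mulr_ge0 ?cmod_ge0 ?exprn_ge0 ?(ltW u0)//.
  rewrite (le_trans _ (rK s spq))// ler_piMl ?cmod_ge0// invf_le1// ler1n//.
Qed.

(* z1 and z2 run along affine curves, so rho is a quadratic polynomial of the parameter *)
Lemma cder_osc_quad m (A B D : C) (t : R) : let rho s := A + B * s%:C + D * s%:C ^+ 2 in
  0 < Im (rho t) ->
  cder (fun s => osc m (rho s)) t (ic / 4 * (B + 2 * D * t%:C) * osc m.+1 (rho t)).
Proof.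
move=> rho r0; set nu := Im (rho t) / 2; have nu0 : 0 < nu by rewrite divr_gt0.
(* [L] bounds the difference quotient of [rho] at distance at most 1 from [t]. On the window of
   radius [d] the value [rho s] differs from [rho t] by at most [nu], so that [Im (rho s) >= nu]. *)
pose L := cmod B + cmod D * (2 * `|t| + 1) + 1.
have L0 : 0 < L by rewrite ltr_wpDl// addr_ge0 ?cmod_ge0// mulr_ge0 ?cmod_ge0// addr_ge0// mulr_ge0.
pose d := Num.min 1 (nu / L).
have d0 : 0 < d by rewrite lt_min ltr01 divr_gt0.
have st s : t - d < s < t + d -> `|s - t| <= 1 /\ `|s - t| <= nu / L.
  rewrite ltrBlDr -ltrBlDl => /andP[h1 h2].
  have : `|s - t| <= d by rewrite ler_norml; apply/andP; split; lra.
  by rewrite le_min => /andP[].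
apply: (@cder_osc m rho (fun s => B + 2 * D * s%:C) t (t - d) (t + d) nu (cmod B + 2 * cmod D * (`|t| + 1))) => //.
- by rewrite ltrDl d0 andbT ltrBlDr ltrDl.
- move=> s _.
  apply: cder_eq (cderD (cderD (cder_cst A s) (cderZ B (cder_id s))) (cderZ D (cderX 2 (cder_id s)))) _.
  by rewrite /=; ring.
- move=> s /st [s1 s2].
  have E : rho s - rho t = (s - t)%:C * (B + D * (s + t)%:C).
    by rewrite /rho rmorphB rmorphD/=; ring.
  have : cmod (rho s - rho t) <= nu.
    rewrite E cmodM cmodC.
    have : cmod (B + D * (s + t)%:C) <= L.
      rewrite (le_trans (ler_cmodD _ _))// cmodM cmodC /L -addrA lerD2l.
      rewrite -[leLHS]addr0 lerD//.
      rewrite ler_wpM2l ?cmod_ge0//.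
      have -> : s + t = (s - t) + 2 * t by ring.
      by rewrite (le_trans (ler_normD _ _))// normrM ger0_norm// addrC lerD2l.
    move=> h; apply: (le_trans (ler_pM (normr_ge0 _) (cmod_ge0 _) s2 h)).
    by rewrite divfK ?gt_eqF.
  have := Im_le_cmod (rho s - rho t); rewrite ImD ImN ler_norml => /andP[h _] h2.
  by rewrite /nu in h2 *; lra.
- move=> s /st [s1 _].
  rewrite (le_trans (ler_cmodD _ _))// !cmodM cmodC lerD2l.
  rewrite (cmodn 2).
  rewrite ler_wpM2l ?mulr_ge0 ?cmod_ge0//.
  have -> : s = (s - t) + t by ring.
  by rewrite (le_trans (ler_normD _ _))// addrC lerD2l.
Qed.

Lemma ccontM (F G : R -> C) x : ccont F x -> ccont G x -> ccont (fun s => F s * G s) x.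
Proof.
move=> [a b] [c d]; split.
  rewrite (_ : _ \o _ = (fun s => (Re \o F) s * (Re \o G) s - (Im \o F) s * (Im \o G) s)).
    by apply: cvgB; apply: cvgM.
  by apply/funext => s /=; rewrite ReM.
rewrite (_ : _ \o _ = (fun s => (Re \o F) s * (Im \o G) s + (Im \o F) s * (Re \o G) s)).
  by apply: cvgD; apply: cvgM.
by apply/funext => s /=; rewrite ImM.
Qed.

Lemma ccontD (F G : R -> C) x : ccont F x -> ccont G x -> ccont (fun s => F s + G s) x.
Proof.
move=> [a b] [c d]; split.
  rewrite (_ : _ \o _ = (fun s => (Re \o F) s + (Re \o G) s)); first exact: cvgD.
  by apply/funext => s /=; rewrite ReD.
rewrite (_ : _ \o _ = (fun s => (Im \o F) s + (Im \o G) s)); first exact: cvgD.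
by apply/funext => s /=; rewrite ImD.
Qed.

Lemma ccont_real (f : R -> R) (x : R) : {for x, continuous f} -> ccont (fun s => (f s)%:C) x.
Proof. by move=> cf; split => //=; exact: cst_continuous. Qed.

Lemma ccont_cst (c : C) x : ccont (fun=> c) x.
Proof. exact: cder_ccont (cder_cst c x). Qed.

(** The derivative of [w u * osc_factor rho u], integrated. The factor [u ^+ 2] in the bound of [w]
    removes the boundary term at 0 and compensates [k ^+ 2 / u ^+ 2] from the exponent; [Im rho > 0]
    removes the term at infinity. *)
Lemma wosc_ibp (w w' : R -> R) (K : R) m rho : 0 < Im rho ->
  (forall u : R, 0 < u -> is_derive u 1 w (w' u)) ->
  (forall u : R, 0 < u -> {for u, continuous w'}) ->
  (forall u, 0 < u -> `|w u| <= K * u ^+ 2 * (1 + u) ^+ m) ->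
  (forall u, 0 < u -> `|w' u| <= K * (1 + u) ^+ m) ->
  wosc w' rho + ic * rho / 4 * wosc w rho - ic * (k ^+ 2)%:C * wosc (fun u => w u / u ^+ 2) rho = 0.
Proof.
move=> r0 dw cw wK w'K; set v := Im rho / 4; have v0 : 0 < v by rewrite divr_gt0.
have K0 : 0 <= K.
  have := w'K 1 ltr01; have h : 0 < (1 + 1 : R) ^+ m by rewrite exprn_gt0// addr_gt0.
  by move=> /(le_trans (normr_ge0 _)); rewrite pmulr_lge0.
have cw0 (u : R) : 0 < u -> {for u, continuous w} by move=> /dw; exact: cont_derive.
have i1 : cintg Rp (fun u => (w' u)%:C * osc_factor rho u).
  by apply: (@wosc_cintg _ _ K m) => //; exact: meas_ray.
have wK2 u : 0 < u -> `|w u| <= K * (1 + u) ^+ (m + 2).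
  move=> u0; apply: (le_trans (wK u u0)); rewrite -mulrA ler_wpM2l//.
  rewrite exprD [leRHS]mulrC; apply: ler_wpM2r.
    by rewrite exprn_ge0 ?addr_ge0 ?(ltW u0).
  by rewrite lerXn2r ?nnegrE ?addr_ge0 ?(ltW u0)// lerDr.
have i2 : cintg Rp (fun u => (w u)%:C * osc_factor rho u).
  by apply: (@wosc_cintg _ _ K (m + 2)) => //; exact: meas_ray.
have cw2 (u : R) : 0 < u -> {for u, continuous (fun u => w u / u ^+ 2)}.
  move=> u0; apply: cvgM; first exact: cw0.
  by apply: cvgV; [rewrite expf_neq0 ?gt_eqF|exact: exprn_continuous].
have i3 : cintg Rp (fun u => (w u / u ^+ 2)%:C * osc_factor rho u).
  apply: (@wosc_cintg _ _ K m) => //; first exact: meas_ray.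
  move=> u u0; rewrite normrM [`|_ ^-1|]ger0_norm ?invr_ge0 ?sqr_ge0//.
  by rewrite ler_pdivrMr ?exprn_gt0// mulrAC wK.
have [h1 h2 h3] := exh_ray (0 : R).
pose F u := (w u)%:C * osc_factor rho u.
pose F' u := (w' u)%:C * osc_factor rho u + (ic * rho / 4 * ((w u)%:C * osc_factor rho u)
  + - (ic * (k ^+ 2)%:C) * ((w u / u ^+ 2)%:C * osc_factor rho u)).
have iF' : cintg Rp F'.
  by apply: cintgD => //; apply: cintgD => //; exact: cintgZ.
have -> : wosc w' rho + ic * rho / 4 * wosc w rho - ic * (k ^+ 2)%:C * wosc (fun u => w u / u ^+ 2) rho = cint Rp F'.
  rewrite /F' cintD// ?cintD// ?cintZ//; [by rewrite mulNr addrA|exact: cintgZ..|].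
  by apply: cintgD => //; exact: cintgZ.
have ce (u : R) : 0 < u -> ccont (osc_factor rho) u by move=> u0; exact: cder_ccont (der_osc_factor rho u0).
apply: etrans (@cint_FTC R Rp F F' (lo 0) (hi 0) 0 0 mRp h1 h2 h3 _ _ iF' _ _) (subrr 0).
- move=> u /Rp_gt0 u0; apply: cder_eq (cderM (cder_real (dw u u0)) (der_osc_factor rho u0)) _.
  by rewrite /F'; field; rewrite fmorph_eq0 gt_eqF.
- move=> u /Rp_gt0 u0; apply: ccontD; first by apply: ccontM; [exact/ccont_real/cw|exact: ce].
  apply: ccontD; apply: ccontM; try exact: ccont_cst.
    by apply: ccontM; [exact/ccont_real/cw0|exact: ce].
  by apply: ccontM; [exact/ccont_real/cw2|exact: ce].
- apply: (@ccvg_le _ _ _ (fun n => K * 2 ^+ m * lo 0 n)); last exact: loV_cvg.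
  move=> n; have l0 := @lo_gt0 R n; rewrite subr0 /= cmodM cmodC.
  have l1 : lo 0 n <= 1 :> R by rewrite /lo add0r invf_le1// ler1n.
  apply: (le_trans (ler_wpM2l (normr_ge0 _) (osc_factor_le1 (ltW r0) l0))); rewrite mulr1.
  apply: (le_trans (wK _ l0)); rewrite -[leLHS]mulrA -[leRHS]mulrA; apply: ler_wpM2l => //.
  rewrite [leLHS]mulrC; apply: ler_pM; rewrite ?exprn_ge0 ?addr_ge0 ?(ltW l0)//.
    by rewrite lerXn2r ?nnegrE ?addr_ge0 ?(ltW l0)// -[leRHS]/(1 + 1) lerD2l.
  by rewrite expr2 ler_piMl// ltW.
- pose c := K * (1 + 2 * (m + 2)%:R / v) ^+ (m + 2).
  apply: (@ccvg_le _ _ _ (fun n => c * (v / 2)^-1 / hi 0 n)); last exact: hiV_cvg.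
  move=> n; have l0 := @hi_gt0 R n; rewrite subr0 /= cmodM cmodC cmod_osc_factor -/v.
  apply: (le_trans (ler_wpM2r (expR_ge0 _) (wK2 _ l0))).
  apply: (@le_trans _ _ (c * expR (- (v / 2 * hi 0 n)))).
    rewrite -expR_half mulrA ler_wpM2r ?expR_ge0// /c -mulrA ler_wpM2l//.
    exact: pow1exp_le.
  rewrite -[leRHS]mulrA; apply: ler_wpM2l; last by rewrite -invfM expRN_le// !mulr_gt0.
  by rewrite mulr_ge0// exprn_ge0// addr_ge0// divr_ge0 ?(ltW v0)// mulr_ge0.
Qed.

Lemma eq_wosc (w1 w2 : R -> R) rho : (forall u, 0 < u -> w1 u = w2 u) -> wosc w1 rho = wosc w2 rho.
Proof. by move=> e; apply: eq_cint => u /Rp_gt0 u0; rewrite e. Qed.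

Lemma woscZ (c : R) (w : R -> R) rho : cintg Rp (fun u => (w u)%:C * osc_factor rho u) ->
  wosc (fun u => c * w u) rho = c%:C * wosc w rho.
Proof.
move=> i; rewrite /wosc -cintZ//; apply: eq_cint => u _.
by rewrite rmorphM/= mulrA.
Qed.

Lemma woscD (w1 w2 : R -> R) rho : cintg Rp (fun u => (w1 u)%:C * osc_factor rho u) ->
  cintg Rp (fun u => (w2 u)%:C * osc_factor rho u) -> wosc (fun u => w1 u + w2 u) rho = wosc w1 rho + wosc w2 rho.
Proof.
move=> i1 i2; rewrite /wosc -cintD//; apply: eq_cint => u _.
by rewrite rmorphD/= mulrDl.
Qed.

(** [wosc_ibp] for the weight [u ^+ m.+2]. For [m = 0] this becomes the Helmholtz equation of the
    kernel in [h_pde]; solved for [osc m] it yields the decay in [osc0_decay]. *)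
Lemma osc_rec m rho : 0 < Im rho ->
  m.+2%:R * osc m.+1 rho + ic * rho / 4 * osc m.+2 rho - ic * (k ^+ 2)%:C * osc m rho = 0.
Proof.
move=> r0.
have := @wosc_ibp (fun u => u ^+ m.+2) (fun u => m.+2%:R * u ^+ m.+1) m.+2%:R m.+1 rho r0.
rewrite woscZ; last exact: pow_cintg.
rewrite rmorph_nat (@eq_wosc (fun u => u ^+ m.+2 / u ^+ 2) (fun u => u ^+ m)); last first.
  by move=> u u0; rewrite -addn2 exprD mulfK// expf_neq0// gt_eqF.
apply.
- by move=> u u0; apply: rder_eq (rderX m.+2 (rderI u)) _; rewrite mulr1.
- move=> u u0; apply: cvgM; [exact: cvg_cst|exact: exprn_continuous].
- move=> u u0; rewrite ger0_norm ?exprn_ge0 ?(ltW u0)//.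
  have h1 : u ^+ m.+2 <= u ^+ 2 * (1 + u) ^+ m.+1.
    rewrite -addn2 exprD mulrC; apply: ler_wpM2l; first exact: sqr_ge0.
    apply: (@le_trans _ _ ((1 + u) ^+ m)).
      by rewrite lerXn2r ?nnegrE ?addr_ge0 ?(ltW u0)// lerDr.
    by rewrite exprS ler_peMl ?exprn_ge0 ?addr_ge0 ?(ltW u0)// lerDl ltW.
  apply: (le_trans h1); rewrite -mulrA; apply: ler_peMl; last by rewrite ler1n.
  by rewrite mulr_ge0 ?sqr_ge0 ?exprn_ge0 ?addr_ge0 ?(ltW u0).
- move=> u u0; rewrite ger0_norm ?mulr_ge0 ?exprn_ge0 ?(ltW u0)//.
  by rewrite ler_wpM2l// lerXn2r ?nnegrE ?addr_ge0 ?(ltW u0)// lerDr.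
Qed.

(* Bounds that stay uniform as rho approaches the real axis: splitting u ^ m into a
   part that can be integrated by parts and an integrable remainder. *)
Definition cauchy_wt (u : R) := (1 + u ^+ 2)^-1.

Lemma cauchy_wt_gt0 u : 0 < cauchy_wt u. Proof. by rewrite invr_gt0 opr2_gt0. Qed.

Lemma intg_cauchy_wt : intg Rp cauchy_wt /\ \int[mu]_(u in Rp) cauchy_wt u <= pi.
Proof.
have [i e] := @poisson_integral R 1 0 ltr01.
have E s : 1 / (1 ^+ 2 + (s - 0) ^+ 2) = cauchy_wt s by rewrite expr1n subr0 div1r.
have i' : intg setT cauchy_wt by move: i; congr (intg _ _); apply/funext => s; exact: E.
have e' : \int[mu]_s cauchy_wt s = pi by rewrite -e; apply: eq_Rintegral => s _; rewrite E.
split; first exact: (@intg_subset _ setT).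
rewrite -e' [X in X <= _]Rintegral_mkcond; apply: le_Rintegral => //.
- rewrite /intg -restrict_EFin; apply/integrable_restrict => //=; rewrite setTI.
  exact: (@intg_subset _ setT).
- by move=> u _; rewrite patchE; case: ifPn => // _; rewrite ltW ?cauchy_wt_gt0.
Qed.

Lemma wosc_cauchy_wt (w : R -> R) (K : R) rho : 0 < Im rho -> measurable_fun Rp w ->
  (forall u, 0 < u -> `|w u| <= K * cauchy_wt u) ->
  cintg Rp (fun u => (w u)%:C * osc_factor rho u) /\ cmod (wosc w rho) <= K * pi.
Proof.
move=> r0 mw wK; have [iw ew] := intg_cauchy_wt.
have iK : intg Rp (fun u => K * cauchy_wt u) by exact: intgZ.
have K0 : 0 <= K.
  have := le_trans (normr_ge0 _) (wK 1 ltr01).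
  by rewrite pmulr_lge0// cauchy_wt_gt0.
have le u : Rp u -> cmod ((w u)%:C * osc_factor rho u) <= K * cauchy_wt u.
  move=> /Rp_gt0 u0; rewrite cmodM cmodC.
  by rewrite (le_trans (ler_wpM2l _ (osc_factor_le1 (ltW r0) u0)))// mulr1 wK.
have i : cintg Rp (fun u => (w u)%:C * osc_factor rho u).
  apply: (cintg_le mRp _ iK) => //.
  by apply: cmeasM; [exact: cmeas_real|exact: osc_factor_cmeas].
split => //; apply: (le_trans (cint_le mRp i iK le)).
by rewrite RintegralZl// ler_wpM2l.
Qed.

(** The identity of [wosc_ibp] solved for its middle term: a weight that is not integrable is traded
    for [w'] and [w u / u ^+ 2], at the price of [(cmod rho)^-1] and without a power of [Im rho]. *)
Lemma ibp_bound (w w' : R -> R) (A B : R) rho : 0 < Im rho ->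
  cmod (wosc w' rho) <= A -> cmod (wosc (fun u => w u / u ^+ 2) rho) <= B ->
  wosc w' rho + ic * rho / 4 * wosc w rho - ic * (k ^+ 2)%:C * wosc (fun u => w u / u ^+ 2) rho = 0 ->
  cmod (wosc w rho) <= 4 * (A + k ^+ 2 * B) / cmod rho.
Proof.
move=> r0 hA hB; set a := wosc w' rho; set b := wosc w rho; set c := wosc _ rho => E.
have rho0 : rho != 0 by apply/eqP => h; move: r0; rewrite h ltxx.
have cr : 0 < cmod rho.
  by rewrite lt_neqAle cmod_ge0 andbT eq_sym; apply/eqP => /cmod_eq0/eqP; exact/negP.
rewrite ler_pdivlMr// -[X in _ * X <= _]mul1r.
have E2 : b * rho = 4 * ic * (a - ic * (k ^+ 2)%:C * c).
  have -> : b * rho = - (4 * ic * (ic * rho / 4 * b)).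
    rewrite (_ : 4 * ic * (ic * rho / 4 * b) = ic ^+ 2 * (b * rho)); last by field.
    by rewrite sqr_ic mulN1r opprK.
  have -> : ic * rho / 4 * b = - (a - ic * (k ^+ 2)%:C * c) by rewrite -[RHS]addr0 -E; ring.
  by ring.
rewrite mul1r -cmodM E2 !cmodM (cmodn 4) cmod_ic mulr1 ler_wpM2l//.
rewrite (le_trans (ler_cmodB _ _))// lerD// !cmodM cmod_ic mul1r cmodC ger0_norm ?sqr_ge0//.
by rewrite ler_wpM2l ?sqr_ge0.
Qed.

Lemma meas_cauchy_wt : measurable_fun Rp cauchy_wt.
Proof. by apply: intg_meas; case: intg_cauchy_wt. Qed.

Lemma meas_powww (n m : nat) : measurable_fun Rp (fun u : R => u ^+ n * cauchy_wt u ^+ m).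
Proof.
apply: measurable_funM; first exact: exprn_measurable.
by apply: measurable_funX; exact: meas_cauchy_wt.
Qed.

Lemma cont_cauchy_wt (u : R) : {for u, continuous cauchy_wt}.
Proof. exact: cont_derive (rderV (der_opr2 u) (opr2_neq0 u)). Qed.

Lemma cont_powww (n m : nat) (u : R) : {for u, continuous (fun u : R => u ^+ n * cauchy_wt u ^+ m)}.
Proof.
apply: cvgM; first exact: exprn_continuous.
by apply: (@continuous_comp _ _ _ cauchy_wt (fun s => s ^+ m)); [exact: cont_cauchy_wt|exact: exprn_continuous].
Qed.

Lemma der_powww (n m : nat) (u : R) : is_derive u (1 : R) (fun u : R => u ^+ n * cauchy_wt u ^+ m)
  (n%:R * u ^+ n.-1 * cauchy_wt u ^+ m - 2 * m%:R * u ^+ n.+1 * cauchy_wt u ^+ m.+1).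
Proof.
have h := opr2_neq0 u.
have d := rderM (rderX n (rderI u)) (rderX m (rderV (der_opr2 u) h)).
apply: rder_eq d _; rewrite -/(cauchy_wt u).
have -> : - (2 * u) / (1 + u ^+ 2) ^+ 2 = - 2 * u * cauchy_wt u ^+ 2 by rewrite /cauchy_wt; field.
case: m => [|m] /=; first by ring.
by rewrite !exprS; ring.
Qed.

Lemma cauchy_wt_le1 u : cauchy_wt u <= 1.
Proof. by rewrite invf_le1 ?opr2_gt0// lerDl sqr_ge0. Qed.

Lemma u2ww_le1 u : u ^+ 2 * cauchy_wt u <= 1.
Proof. by rewrite ler_pdivrMr ?opr2_gt0// mul1r lerDr. Qed.

Lemma uww_le1 u : 0 < u -> u * cauchy_wt u <= 1.
Proof. move=> u0; rewrite ler_pdivrMr ?opr2_gt0// mul1r; nra. Qed.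

(** Split [1 = u ^+ 2 / (1 + u ^+ 2) + (1 + u ^+ 2)^-1]. The second part is integrable; the
    derivative of the first and its quotient by [u ^+ 2] are bounded by multiples of [cauchy_wt], so
    [ibp_bound] applies. *)
Lemma osc0_le_aux rho : 0 < Im rho -> cmod (osc 0 rho) <= (pi * (4 * (2 + k ^+ 2)) + pi) * (1 + (cmod rho)^-1).
Proof.
move=> r0; have rr : 0 <= (cmod rho)^-1 by rewrite invr_ge0 cmod_ge0.
pose w u := u ^+ 2 * cauchy_wt u ^+ 1.
have ww0 u := ltW (cauchy_wt_gt0 u).
have [i1 b1] : cintg Rp (fun u => (cauchy_wt u)%:C * osc_factor rho u) /\ cmod (wosc cauchy_wt rho) <= 1 * pi.
  by apply: wosc_cauchy_wt => //; [exact: meas_cauchy_wt|move=> u u0; rewrite mul1r ger0_norm].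
have E u : 2%:R * u ^+ 1 * cauchy_wt u ^+ 1 - 2 * 1%:R * u ^+ 3 * cauchy_wt u ^+ 2 = 2 * u * cauchy_wt u ^+ 2.
  by have h := opr2_neq0 u; rewrite /cauchy_wt; field.
have [i2 b2] : cintg Rp (fun u => (2 * u * cauchy_wt u ^+ 2)%:C * osc_factor rho u) /\
    cmod (wosc (fun u => 2 * u * cauchy_wt u ^+ 2) rho) <= 2 * pi.
  apply: wosc_cauchy_wt => //.
    rewrite (_ : (fun u => _) = fun u => 2 * (u ^+ 1 * cauchy_wt u ^+ 2)); last by apply/funext => u; rewrite mulrA.
    by apply: measurable_funM => //; exact: meas_powww.
  move=> u u0; rewrite ger0_norm ?mulr_ge0 ?exprn_ge0 ?(ltW u0)//.
  have -> : 2 * u * cauchy_wt u ^+ 2 = 2 * ((u * cauchy_wt u) * cauchy_wt u) by ring.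
  by rewrite ler_wpM2l// ler_piMl// uww_le1.
have b3 : cmod (wosc (fun u => w u / u ^+ 2) rho) <= 1 * pi.
  by rewrite (@eq_wosc _ cauchy_wt)// => u u0; rewrite /w expr1 mulrAC mulfV ?mul1r// expf_neq0 ?gt_eqF.
have b4 : cmod (wosc w rho) <= 4 * (2 * pi + k ^+ 2 * (1 * pi)) / cmod rho.
  apply: ibp_bound b2 b3 _ => //; apply: (@wosc_ibp _ _ 2 0) => //.
  - by move=> u u0; apply: rder_eq (der_powww 2 1 u) _; rewrite -E.
  - move=> u u0; rewrite (_ : (fun u => _) = fun u => 2 * (u ^+ 1 * cauchy_wt u ^+ 2)); last first.
      by apply/funext => v; rewrite mulrA.
    by apply: cvgM; [exact: cvg_cst|exact: cont_powww].
  - move=> u u0; rewrite mulr1 /w expr1 ger0_norm; last by rewrite mulr_ge0 ?sqr_ge0.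
    rewrite mulrC; apply: ler_wpM2r; first exact: sqr_ge0.
    by rewrite (le_trans (cauchy_wt_le1 u))// ler1n.
  - move=> u u0; rewrite mulr1 ger0_norm ?mulr_ge0 ?exprn_ge0 ?(ltW u0)//.
    rewrite -mulrA ler_piMr// expr2 mulrA mulr_ile1 ?mulr_ge0 ?(ltW u0)// ?cauchy_wt_le1//.
    exact: uww_le1.
have iw : cintg Rp (fun u => (w u)%:C * osc_factor rho u).
  apply: (@wosc_cintg _ _ 1 0) => //; first exact: meas_powww.
  move=> u u0; rewrite mulr1 /w expr1 ger0_norm; first exact: u2ww_le1.
  by rewrite mulr_ge0 ?sqr_ge0.
have -> : osc 0 rho = wosc w rho + wosc cauchy_wt rho.
  rewrite -woscD//; apply: eq_wosc => u u0; rewrite /w /cauchy_wt expr1.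
  by have h := opr2_neq0 u; rewrite expr0; field.
rewrite (le_trans (ler_cmodD _ _))//.
rewrite mulrDl lerD//.
  rewrite (le_trans b4)// [leRHS]mulrDr mulr1.
  have -> : 4 * (2 * pi + k ^+ 2 * (1 * pi)) / cmod rho = pi * (4 * (2 + k ^+ 2)) / cmod rho by ring.
  by rewrite lerDr !mulr_ge0 ?pi_ge0// addr_ge0 ?sqr_ge0.
by rewrite (le_trans b1)// mul1r ler_peMr ?pi_ge0// lerDl.
Qed.

(** The weight [u / (1 + u ^+ 2)] just fails to be integrable; it is split as [u ^+ 3 / (1 + u ^+ 2)
    ^+ 2 + u / (1 + u ^+ 2) ^+ 2], the first part being integrated by parts. *)
Lemma tail_le rho : 0 < Im rho ->
  cintg Rp (fun u => (u ^+ 1 * cauchy_wt u ^+ 1)%:C * osc_factor rho u) /\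
  cmod (wosc (fun u => u ^+ 1 * cauchy_wt u ^+ 1) rho) <= (pi * (4 * (4 + k ^+ 2)) + pi) * (1 + (cmod rho)^-1).
Proof.
move=> r0; have rr : 0 <= (cmod rho)^-1 by rewrite invr_ge0 cmod_ge0.
have ww0 u := ltW (cauchy_wt_gt0 u).
pose w u := u ^+ 3 * cauchy_wt u ^+ 2.
have it : cintg Rp (fun u => (u ^+ 1 * cauchy_wt u ^+ 1)%:C * osc_factor rho u).
  apply: (@wosc_cintg _ _ 1 0) => //; first exact: meas_powww.
  by move=> u u0; rewrite !expr1 mulr1 ger0_norm ?mulr_ge0 ?(ltW u0)// uww_le1.
split => //.
have [i1 b1] : cintg Rp (fun u => (u ^+ 1 * cauchy_wt u ^+ 2)%:C * osc_factor rho u) /\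
    cmod (wosc (fun u => u ^+ 1 * cauchy_wt u ^+ 2) rho) <= 1 * pi.
  apply: wosc_cauchy_wt => //; first exact: meas_powww.
  move=> u u0; rewrite ger0_norm ?mulr_ge0 ?exprn_ge0 ?(ltW u0)//.
  by rewrite expr2 mulrA ler_wpM2r// expr1 uww_le1.
pose w' u := 3%:R * u ^+ 2 * cauchy_wt u ^+ 2 - 2 * 2%:R * u ^+ 4 * cauchy_wt u ^+ 3.
have w'le u : 0 < u -> `|w' u| <= 4 * cauchy_wt u.
  move=> u0; have -> : w' u = (3 * (u ^+ 2 * cauchy_wt u) - 4 * (u ^+ 2 * cauchy_wt u) ^+ 2) * cauchy_wt u.
    by rewrite /w'; ring.
  rewrite normrM (ger0_norm (ww0 u)) ler_wpM2r//.
  have := u2ww_le1 u; have : 0 <= u ^+ 2 * cauchy_wt u by rewrite mulr_ge0 ?sqr_ge0.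
  move: (_ * _) => y y0 y1; rewrite ler_norml; apply/andP; split; nra.
have cw' (u : R) : {for u, continuous w'}.
  rewrite (_ : w' = fun u => 3%:R * (u ^+ 2 * cauchy_wt u ^+ 2) - (2 * 2%:R) * (u ^+ 4 * cauchy_wt u ^+ 3)).
    by apply: cvgB; (apply: cvgM; [exact: cvg_cst|exact: cont_powww]).
  by apply/funext => v; rewrite /w' !mulrA.
have [i2 b2] : cintg Rp (fun u => (w' u)%:C * osc_factor rho u) /\ cmod (wosc w' rho) <= 4 * pi.
  by apply: wosc_cauchy_wt => //; exact: meas_ray.
have b3 : cmod (wosc (fun u => w u / u ^+ 2) rho) <= 1 * pi.
  rewrite (@eq_wosc _ (fun u => u ^+ 1 * cauchy_wt u ^+ 2))// => u u0; rewrite /w.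
  by field; rewrite gt_eqF.
have b4 : cmod (wosc w rho) <= 4 * (4 * pi + k ^+ 2 * (1 * pi)) / cmod rho.
  apply: ibp_bound b2 b3 _ => //; apply: (@wosc_ibp _ _ 4 0) => //.
  - by move=> u u0; apply: rder_eq (der_powww 3 2 u) _.
  - move=> u u0; rewrite mulr1 /w ger0_norm ?mulr_ge0 ?exprn_ge0 ?(ltW u0)//.
    rewrite exprS expr2 [cauchy_wt u ^+ 2]expr2.
    have -> : u * (u * u) * (cauchy_wt u * cauchy_wt u) = (u * cauchy_wt u) * cauchy_wt u * (u * u) by ring.
    rewrite ler_wpM2r ?mulr_ge0 ?(ltW u0)//.
    have := uww_le1 u0; have := cauchy_wt_le1 u; have := ww0 u.
    have : 0 <= u * cauchy_wt u by rewrite mulr_ge0// ltW.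
    by move: (u * cauchy_wt u) (cauchy_wt u) => y z *; nra.
  - move=> u u0; rewrite mulr1 (le_trans (w'le u u0))// ler_piMr//; exact: cauchy_wt_le1.
have iw : cintg Rp (fun u => (w u)%:C * osc_factor rho u).
  apply: (@wosc_cintg _ _ 1 0) => //; first exact: meas_powww.
  move=> u u0; rewrite mulr1 /w ger0_norm ?mulr_ge0 ?exprn_ge0 ?(ltW u0)//.
  have -> : u ^+ 3 * cauchy_wt u ^+ 2 = (u * cauchy_wt u) * (u ^+ 2 * cauchy_wt u) by ring.
  by rewrite mulr_ile1 ?mulr_ge0 ?sqr_ge0 ?(ltW u0)// ?u2ww_le1// uww_le1.
have -> : wosc (fun u => u ^+ 1 * cauchy_wt u ^+ 1) rho = wosc w rho + wosc (fun u => u ^+ 1 * cauchy_wt u ^+ 2) rho.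
  rewrite -woscD//; apply: eq_wosc => u u0; rewrite /w /cauchy_wt.
  by have h := opr2_neq0 u; field.
rewrite (le_trans (ler_cmodD _ _))//.
rewrite mulrDl lerD//.
  rewrite (le_trans b4)// [leRHS]mulrDr mulr1.
  have -> : 4 * (4 * pi + k ^+ 2 * (1 * pi)) / cmod rho = pi * (4 * (4 + k ^+ 2)) / cmod rho by ring.
  by rewrite lerDr !mulr_ge0 ?pi_ge0// addr_ge0 ?sqr_ge0.
by rewrite (le_trans b1)// mul1r ler_peMr ?pi_ge0// lerDl.
Qed.

Definition osc_bound : R := pi * (4 * (4 + k ^+ 2)) + pi.

Lemma osc_bound_gt0 : 0 < osc_bound.
Proof. by rewrite /osc_bound addr_gt0 ?pi_gt0// !mulr_gt0 ?pi_gt0// ltr_wpDr ?sqr_ge0. Qed.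

Lemma pi_le_osc_bound : pi <= osc_bound.
Proof. by rewrite /osc_bound lerDr !mulr_ge0 ?pi_ge0// addr_ge0 ?sqr_ge0. Qed.

Lemma osc0_le rho : 0 < Im rho -> cmod (osc 0 rho) <= osc_bound * (1 + (cmod rho)^-1).
Proof.
move=> r0; rewrite (le_trans (osc0_le_aux r0))// ler_wpM2r ?addr_ge0 ?invr_ge0 ?cmod_ge0//.
by rewrite /osc_bound lerD2r ler_wpM2l ?pi_ge0// ler_wpM2l// lerD2r ler_nat.
Qed.

(** Split [u = u ^+ 3 / (1 + u ^+ 2) + u / (1 + u ^+ 2)]. Integration of the first part by parts
    leads back to [osc 0] and to the weight of [tail_le], with one more factor [(cmod rho)^-1]. *)
Lemma osc1_le rho : 0 < Im rho -> cmod (osc 1 rho) <= osc_bound * (9 + 8 * k ^+ 2) * (1 + (cmod rho)^-1) ^+ 2.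
Proof.
move=> r0; set q := 1 + (cmod rho)^-1.
have q1 : 1 <= q by rewrite lerDl invr_ge0 cmod_ge0.
have rr : 0 <= (cmod rho)^-1 by rewrite invr_ge0 cmod_ge0.
have ww0 u := ltW (cauchy_wt_gt0 u).
have [it bt] := tail_le r0; rewrite -/osc_bound -/q in bt.
have b0 := osc0_le r0; rewrite -/q in b0.
have c0 := ltW osc_bound_gt0.
pose w u := u ^+ 3 * cauchy_wt u ^+ 1.
pose w1 u := (u ^+ 2 - 1) * cauchy_wt u ^+ 2.
have [i1 b1] : cintg Rp (fun u => (w1 u)%:C * osc_factor rho u) /\ cmod (wosc w1 rho) <= 1 * pi.
  have w1le u : 0 < u -> `|w1 u| <= 1 * cauchy_wt u.
    move=> u0; rewrite mul1r; have -> : w1 u = (u ^+ 2 * cauchy_wt u - cauchy_wt u) * cauchy_wt u by rewrite /w1; ring.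
    rewrite normrM (ger0_norm (ww0 u)) -[leRHS]mul1r ler_wpM2r//.
    have := u2ww_le1 u; have : 0 <= u ^+ 2 * cauchy_wt u by rewrite mulr_ge0 ?sqr_ge0.
    have := cauchy_wt_le1 u; have := ww0 u.
    by move: (u ^+ 2 * cauchy_wt u) (cauchy_wt u) => y z *; rewrite ler_norml; apply/andP; split; lra.
  apply: wosc_cauchy_wt => //; apply: meas_ray => u _.
  rewrite (_ : w1 = fun u => u ^+ 2 * cauchy_wt u ^+ 2 - u ^+ 0 * cauchy_wt u ^+ 2); last first.
    by apply/funext => v; rewrite /w1; ring.
  by apply: cvgB; exact: cont_powww.
have i0 := pow_cintg 0 r0.
pose w' u := 3%:R * u ^+ 2 * cauchy_wt u ^+ 1 - 2 * 1%:R * u ^+ 4 * cauchy_wt u ^+ 2.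
have w'E u : w' u = u ^+ 0 + w1 u.
  by have h := opr2_neq0 u; rewrite /w' /w1 /cauchy_wt; field.
have b2 : cmod (wosc w' rho) <= 2 * osc_bound * q.
  rewrite (@eq_wosc _ (fun u => u ^+ 0 + w1 u))// woscD//.
  rewrite (le_trans (ler_cmodD _ _))// (le_trans (lerD b0 b1))//.
  have := pi_le_osc_bound; rewrite mul1r; have := osc_bound_gt0; move: osc_bound pi => A B *; nra.
have b3 : cmod (wosc (fun u => w u / u ^+ 2) rho) <= osc_bound * q.
  rewrite (@eq_wosc _ (fun u => u ^+ 1 * cauchy_wt u ^+ 1))// => u u0; rewrite /w.
  by field; rewrite gt_eqF.
have w'c (u : R) : {for u, continuous w'}.
  rewrite (_ : w' = fun u => 3%:R * (u ^+ 2 * cauchy_wt u ^+ 1) - (2 * 1%:R) * (u ^+ 4 * cauchy_wt u ^+ 2)).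
    by apply: cvgB; (apply: cvgM; [exact: cvg_cst|exact: cont_powww]).
  by apply/funext => v; rewrite /w' !mulrA.
have b4 : cmod (wosc w rho) <= 4 * (2 * osc_bound * q + k ^+ 2 * (osc_bound * q)) / cmod rho.
  apply: ibp_bound b2 b3 _ => //; apply: (@wosc_ibp _ _ 3 0) => //.
  - by move=> u u0; apply: rder_eq (der_powww 3 1 u) _.
  - move=> u u0; rewrite mulr1 /w ger0_norm ?mulr_ge0 ?exprn_ge0 ?(ltW u0)//.
    have -> : u ^+ 3 * cauchy_wt u ^+ 1 = (u * cauchy_wt u) * u ^+ 2 by ring.
    rewrite ler_wpM2r ?sqr_ge0// (le_trans (uww_le1 u0))// ler1n//.
  - move=> u u0; rewrite mulr1.
    have -> : w' u = 3 * (u ^+ 2 * cauchy_wt u) - 2 * (u ^+ 2 * cauchy_wt u) ^+ 2 by rewrite /w'; ring.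
    have := u2ww_le1 u; have : 0 <= u ^+ 2 * cauchy_wt u by rewrite mulr_ge0 ?sqr_ge0.
    move: (_ * _) => y y0 y1; rewrite ler_norml; apply/andP; split; nra.
have iw : cintg Rp (fun u => (w u)%:C * osc_factor rho u).
  apply: (@wosc_cintg _ _ 1 1) => //; first exact: meas_powww.
  move=> u u0; rewrite mul1r /w ger0_norm ?mulr_ge0 ?exprn_ge0 ?(ltW u0)//.
  have -> : u ^+ 3 * cauchy_wt u ^+ 1 = u * (u ^+ 2 * cauchy_wt u) by ring.
  rewrite (@le_trans _ _ u)// ?ler_piMr ?(ltW u0) ?u2ww_le1//.
  by rewrite expr1 lerDr.
have -> : osc 1 rho = wosc w rho + wosc (fun u => u ^+ 1 * cauchy_wt u ^+ 1) rho.
  rewrite -woscD//; apply: eq_wosc => u u0; rewrite /w /cauchy_wt.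
  by have h := opr2_neq0 u; field.
rewrite (le_trans (ler_cmodD _ _))// (le_trans (lerD b4 bt))//.
have r1 : (cmod rho)^-1 <= q by rewrite lerDr.
have -> : 4 * (2 * osc_bound * q + k ^+ 2 * (osc_bound * q)) / cmod rho =
  (osc_bound * (8 + 4 * k ^+ 2) * q) * (cmod rho)^-1 by ring.
have h1 : (osc_bound * (8 + 4 * k ^+ 2) * q) * (cmod rho)^-1 <= (osc_bound * (8 + 4 * k ^+ 2) * q) * q.
  have q0 : 0 <= q by exact: le_trans ler01 q1.
  by apply: ler_wpM2l => //; nonneg.
have h2 : osc_bound * q <= osc_bound * (1 + 4 * k ^+ 2) * q * q.
  rewrite -!mulrA ler_wpM2l// mulrA ler_peMl// ?(le_trans ler01)//.
  by rewrite mulr_ege1// lerDl mulr_ge0 ?sqr_ge0.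
by rewrite (le_trans (lerD h1 h2))// le_eqVlt; apply/orP; left; apply/eqP; ring.
Qed.

Lemma osc2_le rho : 0 < Im rho -> cmod (osc 2 rho) <= 4 * osc_bound * (18 + 17 * k ^+ 2) * (1 + (cmod rho)^-1) ^+ 3.
Proof.
move=> r0; set q := 1 + (cmod rho)^-1.
have rr : 0 <= (cmod rho)^-1 by rewrite invr_ge0 cmod_ge0.
have q1 : 1 <= q by rewrite lerDl.
have b0 := osc0_le r0; have b1 := osc1_le r0; rewrite -/q in b0 b1.
have := @ibp_bound (fun u => u ^+ 2) (fun u => 2 * u ^+ 1) _ _ rho r0.
rewrite woscZ; last exact: pow_cintg.
rewrite (@eq_wosc (fun u => u ^+ 2 / u ^+ 2) (fun u => u ^+ 0)); last first.
  by move=> u u0; rewrite mulfV// expf_neq0 ?gt_eqF.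
rewrite -/(osc 0 rho) -/(osc 1 rho) -/(osc 2 rho).
move=> /(_ (2 * (osc_bound * (9 + 8 * k ^+ 2) * q ^+ 2)) (osc_bound * q)).
move=> /(_ _ b0 _)/le_trans -> //.
- by rewrite cmodM cmodC ger0_norm// ler_wpM2l.
- rewrite (rmorph_nat (real_complex R)); exact: (osc_rec 0 r0).
have c0 := ltW osc_bound_gt0.
have r1 : (cmod rho)^-1 <= q by rewrite lerDr.
apply: (@le_trans _ _ (4 * (2 * (osc_bound * (9 + 8 * k ^+ 2) * q ^+ 2) + k ^+ 2 * (osc_bound * q)) * q)).
  have q0 : 0 <= q by exact: le_trans ler01 q1.
  by apply: ler_wpM2l => //; nonneg.
have h : k ^+ 2 * (osc_bound * q) <= k ^+ 2 * (osc_bound * q ^+ 2).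
  by rewrite !ler_wpM2l ?sqr_ge0// expr2 ler_peMl// (le_trans ler01).
apply: (@le_trans _ _ (4 * (2 * (osc_bound * (9 + 8 * k ^+ 2) * q ^+ 2) + k ^+ 2 * (osc_bound * q ^+ 2)) * q)).
  by rewrite ler_wpM2r ?(le_trans ler01)// ler_wpM2l// lerD2l.
by rewrite le_eqVlt; apply/orP; left; apply/eqP; ring.
Qed.

(* one extra power of decay, read off the recursion *)
Lemma osc0_decay rho : 0 < Im rho ->
  cmod (osc 0 rho) <= k ^- 2 * (2 * cmod (osc 1 rho) + cmod rho / 4 * cmod (osc 2 rho)).
Proof.
move=> r0; have := osc_rec 0 r0 => /eqP; rewrite subr_eq0 => /eqP E.
have k2 : 0 < k ^+ 2 by rewrite exprn_gt0.
rewrite -(ler_pM2l k2) mulrA divff ?gt_eqF// mul1r.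
have -> : k ^+ 2 * cmod (osc 0 rho) = cmod (ic * (k ^+ 2)%:C * osc 0 rho).
  by rewrite !cmodM cmod_ic mul1r cmodC ger0_norm// ltW.
rewrite -E (le_trans (ler_cmodD _ _))// !cmodM cmodV (cmodn 2) (cmodn 4) cmod_ic mul1r.
by rewrite lexx.
Qed.
End oscint.

(** * The scaled kernel and its derivatives *)

Section kernel.
Context {R : realType}.
Local Notation C := R[i].
Local Notation Re := (@complex.Re R).
Local Notation Im := (@complex.Im R).
Local Notation mu := (@lebesgue_measure R).
Local Notation Rp := (`]0, +oo[%classic : set R).
Variables a k th : R.
Hypotheses (a0 : 0 < a) (k0 : 0 < k) (th0 : 0 < th) (th1 : th < pi / 2).
Local Notation e := (eith th).
Local Notation I0 := (osc k 0).
Local Notation I1 := (osc k 1).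
Local Notation I2 := (osc k 2).

Lemma cth_gt0 : 0 < cos th.
Proof.
apply: cos_gt0_pihalf; rewrite th1 andbT (lt_trans _ th0)// oppr_lt0.
by rewrite divr_gt0 ?pi_gt0.
Qed.

Lemma sth_gt0 : 0 < sin th.
Proof.
apply: sin_gt0_pi; rewrite th0 (lt_trans th1)//.
by rewrite ltr_pdivrMr// ltr_pMr ?pi_gt0// ltr1n.
Qed.

Lemma Re_e : Re e = cos th. Proof. by []. Qed.
Lemma Im_e : Im e = sin th. Proof. by []. Qed.
Lemma cmod_e : cmod e = 1.
Proof. by rewrite /cmod Re_e Im_e cos2Dsin2 sqrtr1. Qed.
Lemma eJe : e^* * e = 1.
Proof. by rewrite mulcJ_cmod cmod_e expr1n. Qed.
Lemma e_neq0 : e != 0.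
Proof. by apply/eqP => E; have := eJe; rewrite E mulr0 => /eqP; rewrite eq_sym oner_eq0. Qed.

Definition krho (x : R) (Z : C) : C := (x%:C * e) ^+ 2 + Z ^+ 2.

(* displacements between points of the scaled path *)
Definition admissible (Z : C) := exists b y, [/\ 0 <= b, b <= 2 * a, 0 <= y &
  Z = b%:C + y%:C * e \/ Z = - (b%:C + y%:C * e)].

Lemma krho_adm (x b y : R) Z : Z = b%:C + y%:C * e \/ Z = - (b%:C + y%:C * e) ->
  krho x Z = (x ^+ 2 + y ^+ 2)%:C * e ^+ 2 + (2 * b * y)%:C * e + (b ^+ 2)%:C.
Proof.
by rewrite /krho; case=> ->; ring.
Qed.

Lemma Im_krho (x b y : R) : Im ((x ^+ 2 + y ^+ 2)%:C * e ^+ 2 + (2 * b * y)%:C * e + (b ^+ 2)%:C)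
  = 2 * sin th * cos th * (x ^+ 2 + y ^+ 2) + 2 * b * y * sin th.
Proof. by rewrite expr2 !(ReImE, Re_e, Im_e); ring. Qed.

(** After rotation by the conjugate of [e] the three terms of [rho] have the arguments [th], 0 and
    [- th]; the cosine of each is at least [cos th], so nothing cancels in the real part. *)
Lemma cmod_krho (x b y : R) : 0 <= b -> 0 <= y ->
  cos th * (x ^+ 2 + b ^+ 2 + y ^+ 2) <=
  cmod ((x ^+ 2 + y ^+ 2)%:C * e ^+ 2 + (2 * b * y)%:C * e + (b ^+ 2)%:C).
Proof.
move=> b_0 y_0; set r := (X in cmod X).
have -> : cmod r = cmod (e^* * r) by rewrite cmodM cmodJ cmod_e mul1r.
apply: le_trans (Re_le_cmod _); apply: le_trans (ler_norm _).
have -> : e^* * r = (x ^+ 2 + y ^+ 2)%:C * e * (e^* * e) + (2 * b * y)%:C * (e^* * e) + (b ^+ 2)%:C * e^*.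
  by rewrite /r; ring.
rewrite eJe !(ReImE, Re_e, Im_e).
have : 0 <= b * y by rewrite mulr_ge0.
rewrite -[2 * b * y]mulrA; move: (b * y) => z *; lra.
Qed.

Lemma cmod_adm (b y : R) Z : 0 <= b -> 0 <= y ->
  Z = b%:C + y%:C * e \/ Z = - (b%:C + y%:C * e) ->
  b ^+ 2 + y ^+ 2 <= cmod Z ^+ 2 <= 2 * (b ^+ 2 + y ^+ 2).
Proof.
move=> b_0 y_0 h; have -> : cmod Z = cmod (b%:C + y%:C * e) by case: h => ->; rewrite ?cmodN.
rewrite cmod_sqr !(ReImE, Re_e, Im_e).
have -> : (b + (y * cos th - 0 * sin th)) ^+ 2 + (0 + (y * sin th + 0 * cos th)) ^+ 2 =
  b ^+ 2 + y ^+ 2 * (cos th ^+ 2 + sin th ^+ 2) + 2 * b * y * cos th by ring.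
rewrite cos2Dsin2 mulr1.
have by0 : 0 <= b * y by rewrite mulr_ge0.
have := cth_gt0; have := cos_le1 th; move: (cos th) => c c1 c0.
apply/andP; split; first by rewrite lerDl -mulrA mulr_ge0 ?mulr_ge0 ?(ltW c0)//; nra.
have : 0 <= (b - y) ^+ 2 by exact: sqr_ge0.
nra.
Qed.

Lemma q_gt0 (x : R) (Z : C) : 0 < Im (krho x Z) -> 0 < x ^+ 2 + cmod Z ^+ 2.
Proof.
move=> Ip; rewrite lt_neqAle addr_ge0 ?sqr_ge0// andbT eq_sym.
apply/negP; rewrite paddr_eq0 ?sqr_ge0// !sqrf_eq0 => /andP[/eqP x0 /eqP/cmod_eq0 z0].
by move: Ip; rewrite /krho x0 z0 mul0r expr0n addr0 ltxx.
Qed.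

(** Two regimes. For [x ^+ 2 + y ^+ 2 >= 1] the restriction [b <= 2 * a] makes [Im rho] comparable
    to [q], and [osc_le] applies. Closer in, [Im rho] may tend to 0 while [b] stays positive, but
    [cmod rho] is still at least a multiple of [q], and the bounds that are uniform up to the real
    axis apply. *)
Lemma osc_bounds : exists2 K, 0 < K & forall (x : R) (Z : C), admissible Z -> 0 < Im (krho x Z) ->
  let q := x ^+ 2 + cmod Z ^+ 2 in
  [/\ cmod (I0 (krho x Z)) <= K / (q * (1 + q)),
      cmod (I1 (krho x Z)) <= K / q ^+ 2 & cmod (I2 (krho x Z)) <= K / q ^+ 3].
Proof.
have c0 := cth_gt0; have s0 := sth_gt0.
pose M := 1 + 4 * a ^+ 2.
have M0 : 0 < M by pos.
pose L1 := 2 * M / (2 * sin th * cos th); pose L2 := 2 * (M + (cos th)^-1).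
have L10 : 0 < L1 by pos.
have L20 : 0 < L2 by pos.
pose L := L1 + L2.
have L0 : 0 < L by pos.
pose B := osc_const 0 + osc_const 1 + osc_const 2 + osc_bound k + osc_bound k * (9 + 8 * k ^+ 2) + 4 * osc_bound k * (18 + 17 * k ^+ 2).
have cII0 m : 0 <= @osc_const R m by exact: osc_const_ge0.
have cN0 := osc_bound_gt0 k.
have p0 := cII0 0%N; have p1 := cII0 1%N; have p2 := cII0 2%N; have p3 := ltW cN0.
have p4 : 0 <= osc_bound k * (9 + 8 * k ^+ 2) by nonneg.
have p5 : 0 <= 4 * osc_bound k * (18 + 17 * k ^+ 2) by nonneg.
have [B1 B2 B3] : [/\ osc_const 0 <= B, osc_const 1 <= B & osc_const 2 <= B] by move: p0 p1 p2 p3 p4 p5; rewrite /B; clear; split; lra.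
have [B4 B5 B6] : [/\ osc_bound k <= B, osc_bound k * (9 + 8 * k ^+ 2) <= B & 4 * osc_bound k * (18 + 17 * k ^+ 2) <= B].
  by move: p0 p1 p2 p3 p4 p5; rewrite /B; clear; split; lra.
have main (x : R) Z m : admissible Z -> 0 < Im (krho x Z) -> (m <= 2)%N ->
    cmod (osc k m (krho x Z)) <= B * (L / (x ^+ 2 + cmod Z ^+ 2)) ^+ m.+1.
  move=> [b [y [b_0 ba y_0 hZ]]] Ip m2.
  have [q1 q2] := andP (cmod_adm b_0 y_0 hZ).
  have b4 : b ^+ 2 <= 4 * a ^+ 2 by rewrite (_ : 4 * a ^+ 2 = (2 * a) ^+ 2); [rewrite lerXn2r ?nnegrE// (le_trans b_0)|ring].
  set q := x ^+ 2 + _; set D := x ^+ 2 + b ^+ 2 + y ^+ 2.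
  have qD : q <= 2 * D by rewrite /q /D; have := sqr_ge0 x; clear -a0 k0 th0 th1 q2; lra.
  have E := krho_adm x hZ.
  have hr : cos th * D <= cmod (krho x Z) by rewrite E; exact: cmod_krho.
  have ImE : Im (krho x Z) = 2 * sin th * cos th * (x ^+ 2 + y ^+ 2) + 2 * b * y * sin th.
    by rewrite E Im_krho.
  have by0 : 0 <= 2 * b * y * sin th by nonneg.
  have q0 : 0 < q by exact: q_gt0.
  have D0 : 0 < D by clear -a0 k0 th0 th1 qD q0; lra.
  have LqD : L1 / q <= L / q.
    by rewrite ler_pM2r ?invr_gt0// lerDl ltW.
  have LqD2 : L2 / q <= L / q.
    by rewrite ler_pM2r ?invr_gt0// lerDr ltW.
  have [xy|xy] := leP 1 (x ^+ 2 + y ^+ 2).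
    have h : (Im (krho x Z))^-1 <= L / q.
      apply: le_trans LqD.
      rewrite -[L1 / q]invrK lef_pV2 ?posrE ?invr_gt0 ?(divr_gt0 L10 q0)//.
      rewrite invf_div ImE.
      have bM : b ^+ 2 <= 4 * a ^+ 2 * (x ^+ 2 + y ^+ 2).
        apply: (@le_trans _ _ (4 * a ^+ 2)); first exact: b4.
        by rewrite ler_peMr//; nonneg.
      have -> : q / L1 = (2 * sin th * cos th) * (q / (2 * M)).
        by rewrite /L1; field; rewrite ?gt_eqF.
      have : q / (2 * M) <= x ^+ 2 + y ^+ 2.
        rewrite ler_pdivrMr; last by pos.
        apply: (le_trans qD); rewrite /D /M.
        have -> : (x ^+ 2 + y ^+ 2) * (2 * (1 + 4 * a ^+ 2)) = 2 * (x ^+ 2 + y ^+ 2) + 2 * (4 * a ^+ 2 * (x ^+ 2 + y ^+ 2)) by ring.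
        by clear -a0 k0 th0 th1 bM; lra.
      move=> h; apply: (@le_trans _ _ (2 * sin th * cos th * (x ^+ 2 + y ^+ 2))); last by rewrite lerDl.
      by rewrite ler_wpM2l//; nonneg.
    apply: (le_trans (osc_le k m Ip)).
    apply: ler_pM; rewrite ?osc_const_ge0 ?invr_ge0 ?exprn_ge0 ?(ltW Ip)//.
      by case: m m2 => [|[|[|//]]] _.
    by rewrite -exprVn lerXn2r ?nnegrE ?invr_ge0 ?divr_ge0 ?(ltW Ip) ?(ltW q0) ?(ltW L0).
  have h : 1 + (cmod (krho x Z))^-1 <= L / q.
    apply: le_trans LqD2.
    have h1 : 1 <= 2 * M / q.
      rewrite ler_pdivlMr// mul1r (le_trans qD)// ler_wpM2l// /D /M.
      by clear -a0 k0 th0 th1 b4 xy; lra.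
    have h2 : (cmod (krho x Z))^-1 <= 2 / cos th / q.
      rewrite -[2 / cos th / q]invrK lef_pV2 ?posrE ?invr_gt0 ?divr_gt0//; last first.
        by apply: lt_le_trans hr; rewrite mulr_gt0.
      apply: le_trans hr.
      have -> : (2 / cos th / q)^-1 = cos th * (q / 2) by field; rewrite ?gt_eqF.
      by rewrite ler_wpM2l ?(ltW c0)//; clear -a0 k0 th0 th1 qD; lra.
    by rewrite /L2 mulrDr mulrDl lerD.
  have hh j : (1 + (cmod (krho x Z))^-1) ^+ j <= (L / q) ^+ j.
    by rewrite lerXn2r ?nnegrE ?divr_ge0 ?(ltW L0) ?(ltW q0)//; nonneg.
  case: m m2 => [|[|[|//]]] _.
  - apply: (le_trans (osc0_le k Ip)).
    by rewrite -[X in _ * X <= _]expr1; apply: ler_pM (hh _) => //; nonneg.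
  - apply: (le_trans (osc1_le k Ip)).
    by apply: ler_pM (hh _) => //; nonneg.
  apply: (le_trans (osc2_le k Ip)).
  by apply: ler_pM (hh _) => //; nonneg.
have B0 : 0 < B by exact: lt_le_trans B4.
(* By [osc0_decay] there is also the bound [K0 / q ^+ 2] for [osc 0]; together with [B * L / q] it
   gives the factor [(q * (1 + q))^-1]. *)
pose K0 := k ^- 2 * (2 * (B * L ^+ 2) + (B * L ^+ 3)).
have K00 : 0 < K0 by rewrite mulr_gt0 ?invr_gt0 ?exprn_gt0// addr_gt0 ?mulr_gt0 ?exprn_gt0.
pose K := 2 * (B * L + K0) + B * L ^+ 2 + B * L ^+ 3.
have K_gt0 : 0 < K.
  have k3 : 0 < B * L ^+ 2 by rewrite mulr_gt0 ?exprn_gt0.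
  have k5 : 0 < B * L ^+ 3 by rewrite mulr_gt0 ?exprn_gt0.
  have k4 : 0 < B * L by rewrite mulr_gt0.
  by rewrite /K; move: k3 k4 k5 K00; clear; lra.
exists K => // x Z aZ Ip q.
have h0 := main x Z 0%N aZ Ip isT; have h1 := main x Z 1%N aZ Ip isT; have h2 := main x Z 2%N aZ Ip isT.
rewrite -/q in h0 h1 h2.
have q0 : 0 < q by exact: q_gt0.
have rq : cmod (krho x Z) <= q.
  by rewrite (le_trans (ler_cmodD _ _))// !cmodX cmodM cmod_e mulr1 cmodC real_normK ?num_real.
split.
- have g0 : cmod (I0 (krho x Z)) <= (B * L) / q by rewrite (le_trans h0)// expr1 mulrA.
  have g1 : cmod (I0 (krho x Z)) <= K0 / q ^+ 2.
    apply: (le_trans (osc0_decay k0 Ip)).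
    rewrite /K0 -[leRHS]mulrA ler_wpM2l ?invr_ge0 ?sqr_ge0//.
    rewrite [leRHS]mulrDl; apply: lerD.
      rewrite -[leRHS]mulrA; apply: ler_wpM2l => //.
      by apply: (le_trans h1); rewrite expr_div_n mulrA.
    apply: (@le_trans _ _ (q * (B * (L / q) ^+ 3))).
      apply: ler_pM => //; [nonneg|nonneg|].
      by apply: le_trans rq; rewrite ler_pdivrMr// ler_peMr ?cmod_ge0// ler1n.
    by rewrite le_eqVlt; apply/orP; left; apply/eqP; field; rewrite gt_eqF.
  rewrite ler_pdivlMr; last by pos.
  rewrite mulrDr mulr1 mulrDr.
  have : cmod (I0 (krho x Z)) * q <= B * L by rewrite -ler_pdivlMr.
  have : cmod (I0 (krho x Z)) * (q * q) <= K0 by rewrite -expr2 -ler_pdivlMr ?exprn_gt0.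
  rewrite /K; have k2 : 0 <= B * L ^+ 2 by nonneg.
  have k3 : 0 <= B * L ^+ 3 by nonneg.
  have k4 : 0 <= B * L by nonneg.
  by move: k2 k3 k4 K00; clear; lra.
- apply: (le_trans h1); rewrite expr_div_n mulrA ler_pM2r ?invr_gt0 ?exprn_gt0//.
  rewrite /K.
  have k3 : 0 <= B * L ^+ 3 by nonneg.
  have k4 : 0 <= B * L by nonneg.
  by move: k3 k4 K00; clear; lra.
- apply: (le_trans h2); rewrite expr_div_n mulrA ler_pM2r ?invr_gt0 ?exprn_gt0//.
  rewrite /K.
  have k3 : 0 <= B * L ^+ 2 by nonneg.
  have k4 : 0 <= B * L by nonneg.
  by move: k3 k4 K00; clear; lra.
Qed.

(** The constant for which [e * h0] has the Poisson kernel [x / (pi * q)] as its leading part when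
    the displacement lies on the same ray. *)
Definition C0 : C := (- (ic / (4 * (pi : R)%:C))).
(* [h0 x Z] is [hker k (x e) Z]; subscripts 1 and 2 are derivatives in the two complex
   arguments of [hker]. *)
Definition h0 x Z := C0 * (x%:C * e) * I0 (krho x Z).
Definition h1 x Z := C0 * (I0 (krho x Z) + ic / 2 * (x%:C * e) ^+ 2 * I1 (krho x Z)).
Definition h2 x Z := C0 * (ic / 2) * (x%:C * e) * Z * I1 (krho x Z).
Definition h11 x Z := C0 * (x%:C * e) * (3 * (ic / 2) * I1 (krho x Z) - (x%:C * e) ^+ 2 / 4 * I2 (krho x Z)).
Definition h22 x Z := C0 * (x%:C * e) * (ic / 2 * I1 (krho x Z) - Z ^+ 2 / 4 * I2 (krho x Z)).
Definition h12 x Z := C0 * (ic / 2) * Z * (I1 (krho x Z) + ic / 2 * (x%:C * e) ^+ 2 * I2 (krho x Z)).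

(** The sum of the second derivatives contains only [2 * ic * I1 - rho / 4 * I2], which [osc_rec]
    for [m = 0] turns into a multiple of [I0]. *)
Lemma h_pde x Z : 0 < Im (krho x Z) -> h11 x Z + h22 x Z = - (k ^+ 2)%:C * h0 x Z.
Proof.
move=> /(@osc_rec _ k 0) E.
have -> : h11 x Z + h22 x Z = C0 * (x%:C * e) * (2 * ic * I1 (krho x Z) - krho x Z / 4 * I2 (krho x Z)).
  by rewrite /h11 /h22 /krho; field.
have -> : 2 * ic * I1 (krho x Z) - krho x Z / 4 * I2 (krho x Z) =
  ic * (2%:R * I1 (krho x Z) + ic * krho x Z / 4 * I2 (krho x Z) - ic * (k ^+ 2)%:C * I0 (krho x Z))
   - (ic ^+ 2 + 1) * krho x Z / 4 * I2 (krho x Z) + ic ^+ 2 * (k ^+ 2)%:C * I0 (krho x Z).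
  by field.
by rewrite E mulr0 sqr_ic addNr /h0; ring.
Qed.

Lemma dIx m x Z : 0 < Im (krho x Z) ->
  cder (fun s => osc k m (krho s Z)) x (e * (ic / 2 * (x%:C * e) * osc k m.+1 (krho x Z))).
Proof.
move=> r0.
have E s : krho s Z = Z ^+ 2 + 0 * s%:C + e ^+ 2 * s%:C ^+ 2 by rewrite /krho; ring.
rewrite (_ : (fun s => _) = fun s => osc k m (Z ^+ 2 + 0 * s%:C + e ^+ 2 * s%:C ^+ 2)); last first.
  by apply/funext => s; rewrite E.
rewrite E in r0 *; apply: cder_eq (@cder_osc_quad R k m (Z ^+ 2) 0 (e ^+ 2) x r0) _.
by field.
Qed.

Lemma dIZ m x (Z d : C) (t : R) : 0 < Im (krho x (Z + d * t%:C)) ->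
  cder (fun s => osc k m (krho x (Z + d * s%:C))) t
   (d * (ic / 2 * (Z + d * t%:C) * osc k m.+1 (krho x (Z + d * t%:C)))).
Proof.
move=> r0.
have E s : krho x (Z + d * s%:C) = ((x%:C * e) ^+ 2 + Z ^+ 2) + (2 * Z * d) * s%:C + d ^+ 2 * s%:C ^+ 2.
  by rewrite /krho; ring.
rewrite (_ : (fun s => _) = fun s => osc k m (((x%:C * e) ^+ 2 + Z ^+ 2) + (2 * Z * d) * s%:C + d ^+ 2 * s%:C ^+ 2)); last first.
  by apply/funext => s; rewrite E.
rewrite E in r0 *; apply: cder_eq (@cder_osc_quad R k m _ _ _ t r0) _.
by field.
Qed.

Lemma dz1 x : cder (fun s => s%:C * e) x e.
Proof. by apply: cder_eq (cderM (cder_id x) (cder_cst e x)) _; ring. Qed.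
Lemma dzZ (Z d : C) t : cder (fun s => Z + d * s%:C) t d.
Proof. by apply: cder_eq (cderD (cder_cst Z t) (cderZ d (cder_id t))) _; ring. Qed.

Lemma d_h0x x Z : 0 < Im (krho x Z) -> cder (h0^~ Z) x (e * h1 x Z).
Proof.
move=> r0; apply: cder_eq (cderM (cderZ C0 (dz1 x)) (dIx 0 r0)) _.
by rewrite /h1; ring.
Qed.
Lemma d_h1x x Z : 0 < Im (krho x Z) -> cder (h1^~ Z) x (e * h11 x Z).
Proof.
move=> r0; apply: cder_eq (cderZ C0 (cderD (dIx 0 r0)
  (cderM (cderZ (ic / 2) (cderX 2 (dz1 x))) (dIx 1 r0)))) _.
rewrite /h11 /=.
have -> (z : C) : z / 4 = - (ic / 2) * (ic / 2) * z.
  have -> : - (ic / 2) * (ic / 2) * z = - (ic ^+ 2) * z / 4 by field.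
  by rewrite sqr_ic opprK mul1r.
by field.
Qed.
Lemma d_h2x x Z : 0 < Im (krho x Z) -> cder (h2^~ Z) x (e * h12 x Z).
Proof.
move=> r0; apply: cder_eq (cderM (cderM (cderZ (C0 * (ic / 2)) (dz1 x)) (cder_cst Z x)) (dIx 1 r0)) _.
by rewrite /h12; field.
Qed.
Lemma d_h0Z x (Z d : C) (t : R) : 0 < Im (krho x (Z + d * t%:C)) ->
  cder (fun s => h0 x (Z + d * s%:C)) t (d * h2 x (Z + d * t%:C)).
Proof.
move=> r0; apply: cder_eq (cderZ (C0 * (x%:C * e)) (dIZ 0 r0)) _.
by rewrite /h2; ring.
Qed.
Lemma d_h2Z x (Z d : C) (t : R) : 0 < Im (krho x (Z + d * t%:C)) ->
  cder (fun s => h2 x (Z + d * s%:C)) t (d * h22 x (Z + d * t%:C)).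
Proof.
move=> r0; apply: cder_eq (cderM (cderZ (C0 * (ic / 2) * (x%:C * e)) (dzZ Z d t)) (dIZ 1 r0)) _.
rewrite /h22.
have -> (z : C) : z / 4 = - (ic / 2) * (ic / 2) * z.
  have -> : - (ic / 2) * (ic / 2) * z = - (ic ^+ 2) * z / 4 by field.
  by rewrite sqr_ic opprK mul1r.
by field.
Qed.

Lemma h0Z x Z : h0 x (- Z) = h0 x Z.
Proof. by rewrite /h0 /krho sqrrN. Qed.
Lemma cmod_C0 : cmod C0 <= 1.
Proof.
rewrite /C0 cmodN cmodM cmod_ic mul1r cmodV cmodM (cmodn 4) cmodC ger0_norm ?pi_ge0//.
by rewrite invf_le1 ?mulr_gt0 ?pi_gt0//; have := @pi_ge2 R; lra.
Qed.

(** The bounds have the homogeneity of the Poisson kernel and its derivatives. The extra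
    [(1 + q)^-1] for [h0] makes fields of order [(1 + x ^+ 2)^-1], and thereby their products with
    derivatives integrable at infinity. *)
Lemma kernel_bounds_exist : exists2 K, 0 < K & forall (x : R) (Z : C), admissible Z -> 0 < Im (krho x Z) ->
  let q := x ^+ 2 + cmod Z ^+ 2 in
  0 < q /\
  [/\ cmod (h0 x Z) <= K * `|x| / (q * (1 + q)), cmod (h1 x Z) <= K / q,
      cmod (h2 x Z) <= K * `|x| * cmod Z / q ^+ 2 &
      [/\ cmod (h11 x Z) <= K * `|x| / q ^+ 2, cmod (h22 x Z) <= K * `|x| / q ^+ 2 &
      cmod (h12 x Z) <= K * cmod Z / q ^+ 2]].
Proof.
have [K K0 hK] := osc_bounds; exists (3 * K); first by pos.
move=> x Z aZ Ip q; have [b0 b1 b2] := hK x Z aZ Ip; rewrite -/q in b0 b1 b2.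
have q0 : 0 < q by exact: q_gt0.
have xe : cmod (x%:C * e) = `|x| by rewrite cmodM cmod_e mulr1 cmodC.
have xq : `|x| ^+ 2 <= q by rewrite real_normK ?num_real// lerDl sqr_ge0.
have zq : cmod Z ^+ 2 <= q by rewrite lerDr sqr_ge0.
have i2 : cmod (ic / 2 : C) = 2^-1 by rewrite cmodM cmod_ic mul1r cmodV (cmodn 2).
have C1 := cmod_C0; have C00 := cmod_ge0 C0.
have cM (A B : R) : 0 <= A -> A <= B -> cmod C0 * A <= B.
  by move=> A0 AB; rewrite (le_trans _ AB)// ler_piMl.
have b0' : cmod (I0 (krho x Z)) <= K / q.
  apply: (le_trans b0); rewrite ler_wpM2l ?(ltW K0)// lef_pV2 ?posrE//; last by pos.
  by rewrite ler_peMr ?(ltW q0)// lerDl ltW.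
have g1 : q * cmod (I1 (krho x Z)) <= K / q.
  have -> : K / q = q * (K / q ^+ 2) by field; rewrite gt_eqF.
  by rewrite ler_wpM2l// ltW.
have g2 : q * cmod (I2 (krho x Z)) <= K / q ^+ 2.
  have -> : K / q ^+ 2 = q * (K / q ^+ 3) by field; rewrite gt_eqF.
  by rewrite ler_wpM2l// ltW.
have n0 := cmod_ge0 (I0 (krho x Z)); have n1 := cmod_ge0 (I1 (krho x Z)); have n2 := cmod_ge0 (I2 (krho x Z)).
have x0 := normr_ge0 x; have z0 := cmod_ge0 Z.
have Kq : 0 <= K / q by rewrite divr_ge0 ?ltW.
have Kq2 : 0 <= K / q ^+ 2 by rewrite divr_ge0 ?exprn_ge0 ?ltW.
have cm := (@cmodM R, @cmodX R, @cmodV R, @cmodC R, cmod_e, @cmod_ic R, @cmodn R, @mulr1 R, @mul1r R).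
split => //; split.
- rewrite /h0 !cm -mulrA; apply: cM; first by rewrite mulr_ge0.
  have -> : 3 * K * `|x| / (q * (1 + q)) = `|x| * (3 * (K / (q * (1 + q)))) by ring.
  rewrite ler_wpM2l// (le_trans b0)// ler_peMl ?ler1n// divr_ge0 ?(ltW K0)//.
  by nonneg.
- rewrite /h1 cmodM; apply: cM; first exact: cmod_ge0.
  rewrite (le_trans (ler_cmodD _ _))// !cm.
  have : `|x| ^+ 2 * cmod (I1 (krho x Z)) <= K / q.
    by apply: le_trans g1; rewrite ler_wpM2r.
  by rewrite -[3 * K / q]mulrA -[2^-1 * _ * _]mulrA; move: b0' Kq; clear; lra.
- rewrite /h2 !cm -!mulrA; apply: cM; first by nonneg.
  have -> : 3 * (K * (`|x| * (cmod Z / q ^+ 2))) = (`|x| * cmod Z) * (3 * (K / q ^+ 2)) by ring.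
  have -> : 2^-1 * (`|x| * (cmod Z * cmod (I1 (krho x Z)))) = (`|x| * cmod Z) * (2^-1 * cmod (I1 (krho x Z))) by ring.
  by apply: ler_wpM2l; [rewrite mulr_ge0|move: n1 b1 Kq2; clear; lra].
split.
- rewrite /h11 !cm -mulrA; apply: cM; first by rewrite mulr_ge0 ?cmod_ge0.
  have -> : 3 * K * `|x| / q ^+ 2 = `|x| * (3 * (K / q ^+ 2)) by ring.
  rewrite ler_wpM2l// (le_trans (ler_cmodB _ _))// !cm.
  have : `|x| ^+ 2 * cmod (I2 (krho x Z)) <= K / q ^+ 2.
    by apply: le_trans g2; rewrite ler_wpM2r.
  by rewrite [X in _ + X]mulrAC; move: b1 Kq2; clear; lra.
- rewrite /h22 !cm -mulrA; apply: cM; first by rewrite mulr_ge0 ?cmod_ge0.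
  have -> : 3 * K * `|x| / q ^+ 2 = `|x| * (3 * (K / q ^+ 2)) by ring.
  rewrite ler_wpM2l// (le_trans (ler_cmodB _ _))// !cm.
  have : cmod Z ^+ 2 * cmod (I2 (krho x Z)) <= K / q ^+ 2.
    by apply: le_trans g2; rewrite ler_wpM2r.
  by rewrite [X in _ + X]mulrAC; move: b1 Kq2; clear; lra.
- rewrite /h12 !cm -!mulrA; apply: cM; first by nonneg.
  have -> : 3 * (K * (cmod Z / q ^+ 2)) = cmod Z * (3 * (K / q ^+ 2)) by ring.
  rewrite [leLHS]mulrCA ler_wpM2l//.
  have -> : ic * (2^-1 * (x%:C * (e * (x%:C * (e * I2 (krho x Z)))))) =
    ic * (2^-1 * ((x%:C * e) ^+ 2 * I2 (krho x Z))) by ring.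
  have : cmod (I1 (krho x Z) + ic * (2^-1 * ((x%:C * e) ^+ 2 * I2 (krho x Z)))) <=
     cmod (I1 (krho x Z)) + 2^-1 * (`|x| ^+ 2 * cmod (I2 (krho x Z))).
    by rewrite (le_trans (ler_cmodD _ _))// !cm.
  have : `|x| ^+ 2 * cmod (I2 (krho x Z)) <= K / q ^+ 2.
    by apply: le_trans g2; rewrite ler_wpM2r.
  by move: b1 Kq2; clear; lra.
Qed.

End kernel.

(** * Parametric integrals, limits and primitives *)

Section cgen.
Context {R : realType}.
Local Notation C := R[i].
Local Notation Re := (@complex.Re R).
Local Notation Im := (@complex.Im R).
Local Notation mu := (@lebesgue_measure R).
Local Notation Rp := (`]0, +oo[%classic : set R).

(** Dominated convergence along sequences; dropping the first [N] terms keeps a sequence inside the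
    window of radius [d]. *)
Lemma cint_ccont (A : set R) (F : R -> R -> C) (t d : R) g : measurable A -> 0 < d ->
  (forall s, `|s - t| < d -> cmeas A (F s)) ->
  (forall y, A y -> ccont (F^~ y) t) -> intg A g ->
  (forall s y, `|s - t| < d -> A y -> cmod (F s y) <= g y) ->
  ccont (fun s => cint A (F s)) t.
Proof.
move=> mA d0 mF cF ig Fg.
have key (w : nat -> R) : w n @[n --> \oo] --> t ->
    ccvg (fun n => cint A (F (w n))) (cint A (F t)).
  move=> wt; have [N _ wN] : \forall n \near \oo, `|w n - t| < d.
    by move/cvgrPdist_lt: (wt) => /(_ _ d0); apply: filterS => n; rewrite distrC.
  have wN' n : `|w (n + N)%N - t| < d by apply: wN => /=; exact: leq_addl.
  have wt' : w (n + N)%N @[n --> \oo] --> t by rewrite (@cvg_shiftn N).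
  have [//|y Ay|//|n y Ay|_ [h1 h2]] := @cint_dcvg R A (fun n => F (w (n + N)%N)) (F t) g mA.
  - by move=> n; exact: mF.
  - have [c1 c2] := cF y Ay; split.
      by apply: (continuous_cvg _ c1).
    by apply: (continuous_cvg _ c2).
  - exact: Fg.
  split.
    by rewrite -(@cvg_shiftn N R^o).
  by rewrite -(@cvg_shiftn N R^o).
split; apply/(@cvg_nbhsP R R^o) => w /key [] //.
Qed.

Lemma ccvgM (v w : nat -> C) l m : ccvg v l -> ccvg w m -> ccvg (fun n => v n * w n) (l * m).
Proof.
move=> [v1 v2] [w1 w2]; split.
  by rewrite ReM; under eq_fun do rewrite ReM; apply: cvgB; apply: cvgM.
by rewrite ImM; under eq_fun do rewrite ImM; apply: cvgD; apply: cvgM.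
Qed.

Lemma ccvgD (v w : nat -> C) l m : ccvg v l -> ccvg w m -> ccvg (fun n => v n + w n) (l + m).
Proof.
move=> [v1 v2] [w1 w2]; split.
  by rewrite ReD; under eq_fun do rewrite ReD; exact: cvgD.
by rewrite ImD; under eq_fun do rewrite ImD; exact: cvgD.
Qed.

Lemma ccvgB (v w : nat -> C) l m : ccvg v l -> ccvg w m -> ccvg (fun n => v n - w n) (l - m).
Proof.
move=> [v1 v2] [w1 w2]; split.
  by rewrite ReD ReN; under eq_fun do rewrite ReD ReN; exact: cvgB.
by rewrite ImD ImN; under eq_fun do rewrite ImD ImN; exact: cvgB.
Qed.

Lemma ccvg_cst (c : C) : ccvg (fun=> c) c.
Proof. by split; exact: cvg_cst. Qed.

Lemma ccvgJ (v : nat -> C) l : ccvg v l -> ccvg (fun n => (v n)^* ) l^*.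
Proof.
move=> [v1 v2]; split.
  by rewrite ReJ; under eq_fun do rewrite ReJ.
by rewrite ImJ; under eq_fun do rewrite ImJ; exact: cvgN.
Qed.

Lemma ccont_ccvg (F : R -> C) t (w : nat -> R) : ccont F t -> w n @[n --> \oo] --> t ->
  ccvg (fun n => F (w n)) (F t).
Proof.
move=> [c1 c2] wt; split.
  by apply: (continuous_cvg _ c1).
by apply: (continuous_cvg _ c2).
Qed.

Lemma ccont_cmeas (F : R -> C) : (forall x, 0 < x -> ccont F x) -> cmeas Rp F.
Proof.
by move=> cF; split; apply: meas_ray => x /cF [].
Qed.

Lemma conjM (z w : C) : (z * w)^* = z^* * w^*. Proof. exact: rmorphM. Qed.

Lemma ccontJ (F : R -> C) x : ccont F x -> ccont (fun s => (F s)^* ) x.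
Proof.
move=> [h1 h2]; split; first by rewrite (_ : _ \o _ = Re \o F)//; apply/funext => s /=; rewrite ReJ.
by rewrite (_ : _ \o _ = fun s => - (Im \o F) s); [exact: cvgN|apply/funext => s /=; rewrite ImJ].
Qed.

Lemma cint_normsq (F : R -> C) : cint Rp (fun x => (F x)^* * F x) = (\int[mu]_(x in Rp) (cmod (F x) ^+ 2))%:C.
Proof.
rewrite /cint; apply: eq_ReIm; rewrite ?ReC ?ImC /=.
  by apply: eq_Rintegral => x _; rewrite mulcJ_cmod ReC.
under eq_Rintegral do rewrite mulcJ_cmod ImC.
by rewrite /Rintegral integral0.
Qed.

Lemma normsq_ge0 (F : R -> C) : 0 <= \int[mu]_(x in Rp) (cmod (F x) ^+ 2).
Proof. by apply: Rintegral_ge0 => x _; rewrite sqr_ge0. Qed.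

Lemma cmeasN (A : set R) F : cmeas A F -> cmeas A (fun x => - F x).
Proof.
move=> mF; rewrite (_ : (fun x => _) = fun x => -1 * F x); first exact: cmeasM (cmeas_cst _ _) mF.
by apply/funext => x; rewrite mulN1r.
Qed.

Lemma cder_unique (F : R -> C) t D E : cder F t D -> cder F t E -> D = E.
Proof.
move=> [a1 a2] [b1 b2]; apply: eq_ReIm.
  by rewrite -(@derive_val _ _ _ _ _ _ _ a1) -(@derive_val _ _ _ _ _ _ _ b1).
by rewrite -(@derive_val _ _ _ _ _ _ _ a2) -(@derive_val _ _ _ _ _ _ _ b2).
Qed.

Lemma ccvg_shift (N : nat) (v : nat -> C) l : ccvg (fun n => v (n + N)%N) l -> ccvg v l.
Proof.
move=> [v1 v2]; split.
  by rewrite -(@cvg_shiftn N R^o).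
by rewrite -(@cvg_shiftn N R^o).
Qed.

Definition prim (f : R -> R) (r : R) := \int[mu]_(t in `]0, r]) f t.

Lemma primE (f : R -> R) r : prim f r = \int[mu]_(t in Rp) (f t * \1_`]0, r] t).
Proof.
rewrite /prim Rintegral_mkcond [RHS]Rintegral_mkcond; apply: eq_Rintegral => x _.
rewrite !patchE indicE; case: ifPn => [xA|xA].
  have -> : x \in Rp by move: xA; rewrite !inE /= !in_itv /= => /andP[-> _].
  by rewrite mulr1.
by rewrite mulr0; case: ifP.
Qed.

Lemma prim_der (f : R -> R) r : intg Rp f -> 0 < r -> {for r, continuous f} -> is_derive r 1 (prim f) (f r).
Proof.
move=> If r0 cf; have r1 : r < r + 1 by rewrite ltrDl.
have Ir : intg `]0, r + 1]%classic f.
  by apply: intg_subset If => // x; rewrite /= !in_itv /= => /andP[-> _].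
have [d E] := @continuous_FTC1 R f (BRight 0) r (r + 1) r1 Ir r0 cf.
by apply: DeriveDef; [exact: d|rewrite -derive1E E].
Qed.

Lemma prim_seq (f : R -> R) (r : nat -> R) (g : R -> R) : intg Rp f ->
  (forall x, 0 < x -> \1_`]0, r i] x @[i --> \oo] --> g x) ->
  prim f (r i) @[i --> \oo] --> \int[mu]_(t in Rp) (f t * g t).
Proof.
move=> If rg; under eq_fun do rewrite primE.
have mF i : measurable_fun Rp (fun t => f t * \1_`]0, r i] t).
  by apply: measurable_funM; [exact: intg_meas|exact: measurable_indic].
have lF x : Rp x -> f x * \1_`]0, r i] x @[i --> \oo] --> f x * g x.
  by move=> /Rp_gt0 x0; apply: cvgM; [exact: cvg_cst|exact: rg].
have bF i x : Rp x -> `|f x * \1_`]0, r i] x| <= `|f x|.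
  move=> _; rewrite normrM indicE.
  by case: (_ \in _); rewrite ?normr1 ?mulr1// normr0 mulr0.
by have [_ h] := Rint_dcvg mRp mF lF (intg_norm mRp If) bF; exact: h.
Qed.

Lemma prim_lo (f : R -> R) : intg Rp f -> prim f (lo 0 i) @[i --> \oo] --> 0.
Proof.
move=> If; have := @prim_seq f (lo 0) (fun=> 0) If.
have -> : \int[mu]_(t in Rp) (f t * 0) = 0 by under eq_Rintegral do rewrite mulr0; rewrite /Rintegral integral0.
apply => x x0; apply: cvg_near_cst.
have := @lo_cvg R 0 => /cvgrPdist_lt /(_ x x0); apply: filterS => i.
rewrite sub0r normrN gtr0_norm ?lo_gt0// => h; rewrite indicE memNset//= in_itv /= => /andP[_].
by rewrite leNgt h.
Qed.

Lemma prim_hi (f : R -> R) : intg Rp f -> prim f (hi 0 i) @[i --> \oo] --> \int[mu]_(t in Rp) f t.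
Proof.
move=> If; have := @prim_seq f (hi 0) (fun=> 1) If.
have -> : \int[mu]_(t in Rp) (f t * 1) = \int[mu]_(t in Rp) f t by apply: eq_Rintegral => t _; rewrite mulr1.
have [_ _ h3] := exh_ray (0 : R).
apply => x x0; apply: cvg_near_cst.
have := h3 x; rewrite /= in_itv /= andbT => /(_ x0); apply: filterS => i /andP[_ h].
by rewrite indicE mem_set//= in_itv /= x0.
Qed.

(** The primitive from 0 lies between 0 and the total integral, so it vanishes identically, and with
    it its derivative [f]. *)
Lemma int0_zero (f : R -> R) : intg Rp f -> (forall x, 0 < x -> 0 <= f x) ->
  (forall x, 0 < x -> {for x, continuous f}) -> \int[mu]_(t in Rp) f t = 0 ->
  forall x, 0 < x -> f x = 0.
Proof.
move=> If f0 cf E.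
have P0 r : prim f r = 0.
  apply/eqP; rewrite eq_le primE; apply/andP; split.
    rewrite -[leRHS]E; apply: le_Rintegral => //.
      apply: (@intg_le R Rp _ (fun x => `|f x|)) => //.
      + by apply: measurable_funM; [exact: intg_meas|exact: measurable_indic].
      + exact: intg_norm.
      + move=> x _; rewrite normrM indicE.
        by case: (_ \in _); rewrite ?normr1 ?mulr1// normr0 mulr0.
    move=> x /Rp_gt0 x0; rewrite indicE; case: (_ \in _); rewrite ?mulr1// mulr0 f0//.
  by apply: Rintegral_ge0 => x /Rp_gt0 x0; rewrite mulr_ge0 ?f0// indicE.
move=> x x0; have d := prim_der If x0 (cf x x0).
have Pc : prim f = cst 0 by apply/funext => r; rewrite P0.
by rewrite -(@derive_val _ _ _ _ _ _ _ d) Pc derive_cst.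
Qed.
End cgen.

(** * Auxiliary linear inequalities *)

Section lin.
Context {R : realFieldType}.
Implicit Types x y z w s t : R.
Lemma lin1 x y z w s : 0 <= x -> 0 <= y -> 0 <= z -> 0 <= w -> s <= z -> s <= 2 * x + 4 * y + 2 * z + w.
Proof. lra. Qed.
Lemma lin2 x y z w s : 0 <= x -> 0 <= y -> 0 <= z -> 0 <= w -> s <= y -> s <= 2 * x + 4 * y + 2 * z + w.
Proof. lra. Qed.
Lemma lin3 x y z w s t : 0 <= x -> 0 <= y -> 0 <= z -> s <= w -> t <= y -> s + t <= 2 * x + 4 * y + 2 * z + w.
Proof. lra. Qed.
End lin.

(** * Monotonicity, Lipschitz bounds and comparison with the case k = 0 *)

Section approx.
Context {R : realType}.
Local Notation C := R[i].
Local Notation Re := (@complex.Re R).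
Local Notation Im := (@complex.Im R).
Local Notation mu := (@lebesgue_measure R).
Local Notation Rp := (`]0, +oo[%classic : set R).

Lemma cauchy_int (B c : R) : 0 < B -> intg Rp (fun y => (B ^+ 2 + (y + c) ^+ 2)^-1) /\
  \int[mu]_(y in Rp) (B ^+ 2 + (y + c) ^+ 2)^-1 <= pi / B.
Proof.
move=> B0; have [i E] := poisson_integral (- c) B0.
have i' : intg setT (fun y => (B ^+ 2 + (y + c) ^+ 2)^-1).
  have := intgZ B^-1 measurableT i; congr intg; apply/funext => y.
  by rewrite opprK mulrA mulVf ?gt_eqF// mul1r.
have E' : \int[mu]_y (B ^+ 2 + (y + c) ^+ 2)^-1 = pi / B.
  have : \int[mu]_y (B^-1 * (B / (B ^+ 2 + (y - - c) ^+ 2))) = pi / B.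
    by rewrite RintegralZl// E mulrC.
  move=> <-; apply: eq_Rintegral => y _.
  by rewrite opprK mulrA mulVf ?gt_eqF// mul1r.
split; first exact: intg_subset i'.
rewrite -E'; apply: fine_le.
- by apply: integrable_fin_num => //; exact: intg_subset i'.
- exact: integrable_fin_num.
- apply: ge0_subset_integral => //.
    by apply/measurable_EFinP; exact: (intg_meas i').
  by move=> y _; rewrite lee_fin invr_ge0 addr_ge0 ?sqr_ge0.
Qed.

Lemma nincr_der (f f' : R -> R) (u v s t : R) : (forall x : R, u < x < v -> is_derive x 1 f (f' x)) ->
  (forall x, u < x < v -> f' x <= 0) -> u < s -> s <= t -> t < v -> f t <= f s.
Proof.
move=> df f'0 us st tv.
have I x : s <= x <= t -> u < x < v by move=> /andP[h1 h2]; apply/andP; split; lra.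
apply: (@ler0_derive1_nincr R f s t) => //.
- by move=> x; rewrite in_itv /= => /andP[h1 h2]; case: (df x (I x _)) => //; rewrite !ltW.
- move=> x; rewrite in_itv /= => /andP[h1 h2]; have xI : u < x < v by apply: I; rewrite !ltW.
  by rewrite derive1E (@derive_val _ _ _ _ _ _ _ (df x xI)) f'0.
- apply: continuous_in_subspaceT => x; rewrite inE /= in_itv /= => /I xI.
  by apply: cont_derive; exact: (df x xI).
Qed.

Lemma cder0_eq (F : R -> C) (u v s t : R) : (forall x : R, u < x < v -> cder F x 0) ->
  u < s -> s <= t -> t < v -> F t = F s.
Proof.
move=> dF us st tv.
have gen (f : R -> R) : (forall x : R, u < x < v -> is_derive x 1 f 0) -> f t = f s.
  move=> df; apply/eqP; rewrite eq_le; apply/andP; split.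
    by apply: (nincr_der (f' := fun=> 0) df).
  have df' (x : R) : u < x < v -> is_derive x 1 (fun y => - f y) 0.
    by move=> /df h; apply: rder_eq (rderN h) _; rewrite oppr0.
  by have := nincr_der (f' := fun=> 0) df' (fun _ _ => lexx 0) us st tv; rewrite lerN2.
by apply: eq_ReIm; [apply: (gen (Re \o F))|apply: (gen (Im \o F))] => x /dF [].
Qed.

(* Lipschitz bound for complex-valued functions, with the constant 2 lost by treating
   real and imaginary parts separately *)
Lemma cder_lip (F F' : R -> C) (L u v s t : R) : (forall x : R, u < x < v -> cder F x (F' x)) ->
  (forall x, u < x < v -> cmod (F' x) <= L) -> u < s < v -> u < t < v ->
  cmod (F t - F s) <= 2 * L * `|t - s|.
Proof.
move=> dF FL.
wlog st : s t / s <= t.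
  move=> H us ut; have [st|ts] := leP s t; first exact: H.
  by rewrite -cmodN opprB distrC; apply: H => //; exact: ltW.
move=> /andP[us _] /andP[_ tv]; rewrite (ger0_norm (_ : 0 <= t - s)) ?subr_ge0//.
have gen (f f' : R -> R) : (forall x : R, u < x < v -> is_derive x 1 f (f' x)) ->
    (forall x, u < x < v -> f' x <= L) -> f t - f s <= L * (t - s).
  move=> df fL.
  have dg (x : R) : u < x < v -> is_derive x 1 (fun y => f y - L * y) (f' x - L).
    by move=> /df h; apply: rder_eq (rderB h (rderZ L (rderI x))) _; rewrite mulr1.
  have := nincr_der dg _ us st tv => /(_ _)/wrap[|].
    by move=> x /fL; rewrite subr_le0.
  by lra.
have b (P : C -> R) : (forall z, `|P z| <= cmod z) -> (forall x, u < x < v -> is_derive x 1 (P \o F) (P (F' x))) ->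
    `|P (F t) - P (F s)| <= L * (t - s).
  move=> Pz dP; rewrite ler_norml; apply/andP; split.
    have h := gen (fun x => - P (F x)) (fun x => - P (F' x)) (fun x xI => rderN (dP x xI)).
    rewrite lerNl opprB; have : - P (F t) - - P (F s) <= L * (t - s).
      apply: h => x xI; apply: le_trans (FL x xI); apply: le_trans (Pz _).
      by rewrite -normrN ler_norm.
    by rewrite opprK addrC.
  apply: (gen _ _ dP) => x xI; apply: le_trans (FL x xI); apply: le_trans (Pz _).
  exact: ler_norm.
have hR := b Re (@Re_le_cmod R) (fun x xI => (dF x xI).1).
have hI := b Im (@Im_le_cmod R) (fun x xI => (dF x xI).2).
rewrite (le_trans (cmod_leD _))// !(ReImE).
have -> : 2 * L * (t - s) = L * (t - s) + L * (t - s) by ring.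
by apply: lerD.
Qed.

Lemma cexp_i_le (y : R) : 0 <= y -> cmod (cexp (ic * y%:C) - 1) <= 2 /\ cmod (cexp (ic * y%:C) - 1) <= 2 * y.
Proof.
move=> y0.
have n1 (x : R) : cmod (cexp (ic * x%:C)) = 1 by rewrite cmod_cexp !(icE, ReImE) mul0r mul1r subr0 expR0.
split; first by rewrite (le_trans (ler_cmodB _ _))// n1 cmod1.
have d (x : R) : - 1 < x < y + 1 -> cder (fun x => cexp (ic * x%:C)) x (ic * cexp (ic * x%:C)).
  by move=> _; apply: cder_eq (cder_cexp (cderZ ic (cder_id x))) _; rewrite mulr1.
have := cder_lip d (L := 1) _ (s := 0) (t := y) _ _.
rewrite mulr0 cexp0 subr0 mulr1 (ger0_norm y0); apply.
- by move=> x _; rewrite cmodM cmod_ic mul1r n1.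
- by apply/andP; split; lra.
- by apply/andP; split; lra.
Qed.

(** [osc 0] without the term [k ^+ 2 / u] in the exponent, that is, the leading part near the
    singularity of the kernel. *)
Lemma free_int (rho : C) : 0 < Im rho -> cintg Rp (fun u => cexp (ic * rho * (u / 4)%:C)) /\
  cint Rp (fun u => cexp (ic * rho * (u / 4)%:C)) = 4 * ic / rho.
Proof.
move=> r0; have v0 : 0 < Im rho / 4 by rewrite divr_gt0.
have rn0 : rho != 0 by apply/eqP => E; move: r0; rewrite E ltxx.
have in0 : ic != 0 :> C by apply/eqP => E; have := cmod_ic R; rewrite E cmod0 => /eqP; rewrite eq_sym oner_eq0.
have [iv _] := intg_expR v0.
have nE (u : R) : cmod (cexp (ic * rho * (u / 4)%:C)) = expR (- (Im rho / 4 * u)).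
  by rewrite cmod_cexp; congr expR; rewrite !(icE, ReImE); ring.
have d (u : R) : cder (fun u => cexp (ic * rho * (u / 4)%:C)) u ((ic * rho / 4) * cexp (ic * rho * (u / 4)%:C)).
  have d1 : cder (fun u => (u / 4)%:C) u (4^-1)%:C.
    by apply: cder_real; apply: rder_eq (rderM (rderI u) (rderC _ u)) _; ring.
  by apply: cder_eq (cder_cexp (cderZ (ic * rho) d1)) _; field.
have ci : cintg Rp (fun u => cexp (ic * rho * (u / 4)%:C)).
  apply: cintg_le iv _ => //.
    by apply: (cder_cmeas (@Rp_open R)) => u _; exact: d.
  by move=> u _; rewrite nE.
split => //.
have [h1 h2 h3] := exh_ray (0 : R).
have -> : 4 * ic / rho = 0 - 4 / (ic * rho).
  have -> : 4 * ic / rho = 4 * ic ^+ 2 / (ic * rho) by field; rewrite in0 rn0.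
  by rewrite sqr_ic mulrN1 mulNr sub0r.
pose F (u : R) := (4 / (ic * rho)) * cexp (ic * rho * (u / 4)%:C).
apply: (@cint_FTC R Rp F _ (lo 0) (hi 0) (4 / (ic * rho)) 0 mRp h1 h2 h3 _ _ ci).
- by move=> u _; apply: cder_eq (cderZ _ (d u)) _; field; rewrite in0 rn0.
- by move=> u _; exact: (cder_ccont (d u)).
- have := ccont_ccvg (cder_ccont (cderZ (4 / (ic * rho)) (d 0))) (@lo_cvg R 0).
  by rewrite mul0r mulr0 cexp0 mulr1.
- apply: (@ccvg_le R _ _ (fun n => (cmod (4 / (ic * rho)) * (Im rho / 4)^-1) / hi 0 n)); last exact: hiV_cvg.
  move=> i; rewrite subr0 /F cmodM nE -[leRHS]mulrA; apply: ler_wpM2l; first exact: cmod_ge0.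
  by rewrite -invfM expRN_le// mulr_gt0// hi_gt0.
Qed.

(** The factor with exponent [i k ^+ 2 / u] is compared with 1. For [u <= d] the difference is at
    most 2, majorized by [4 * d ^+ 2 / (d ^+ 2 + u ^+ 2)]; for [u > d] it is at most
    [2 * k ^+ 2 / d]. The cut [d] is left free, to be fitted to the distance from the
    singularity. *)
Lemma osc0_approx (k d : R) (rho : C) : 0 < d -> 0 < Im rho ->
  cmod (osc k 0 rho - 4 * ic / rho) <= 4 * d * pi + 8 * k ^+ 2 / (d * Im rho).
Proof.
move=> d0 r0; have v0 : 0 < Im rho / 4 by rewrite divr_gt0.
have [iE E] := free_int r0; have [iv Ev] := intg_expR v0.
have [ic1 le1] := cauchy_int 0 d0.
have iI := pow_cintg k 0 r0.
rewrite -E /osc /wosc -cintB//.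
have ig : intg Rp (fun u => 4 * d ^+ 2 * (d ^+ 2 + (u + 0) ^+ 2)^-1 + 2 * k ^+ 2 / d * expR (- (Im rho / 4 * u))).
  by apply: intgD => //; exact: intgZ.
apply: (le_trans (cint_le mRp (cintgB mRp iI iE) ig _)).
  move=> u /Rp_gt0 u0.
  have k2 : 0 <= k ^+ 2 / u by rewrite divr_ge0 ?sqr_ge0// ltW.
  have [e1 e2] := cexp_i_le k2.
  rewrite expr0 mul1r /osc_factor cexpD -[X in _ - X]mulr1 -mulrBr cmodM.
  have -> : cmod (cexp (ic * rho * (u / 4)%:C)) = expR (- (Im rho / 4 * u)).
    by rewrite cmod_cexp; congr expR; rewrite !(icE, ReImE); ring.
  have x0 := expR_ge0 (- (Im rho / 4 * u)).
  have x1 : expR (- (Im rho / 4 * u)) <= 1 by rewrite -[leRHS]expR0 ler_expR oppr_le0; exact: (mulr_ge0 (ltW v0) (ltW u0)).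
  have [ud|du] := leP u d.
    apply: ler_wpDr; first by nonneg.
    apply: (@le_trans _ _ 2); first by rewrite -[leRHS]mul1r ler_pM ?cmod_ge0.
    rewrite ler_pdivlMr; last by rewrite ltr_pwDl ?sqr_ge0// exprn_gt0.
    rewrite addr0; have h : u ^+ 2 <= d ^+ 2 by rewrite !expr2; exact: (ler_pM (ltW u0) (ltW u0) ud ud).
    rewrite (_ : 4 * d ^+ 2 = 2 * (d ^+ 2 + d ^+ 2)); last by ring.
    by rewrite ler_wpM2l// lerD2l.
  apply: ler_wpDl; first by nonneg.
  rewrite mulrC; apply: ler_wpM2r => //; apply: (le_trans e2).
  have uV : u^-1 <= d^-1 by rewrite lef_pV2 ?posrE//; exact: ltW.
  by rewrite -[leRHS]mulrA; apply: ler_wpM2l => //; apply: ler_wpM2l => //; exact: sqr_ge0.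
rewrite RintegralD//; [|exact: intgZ..].
rewrite !RintegralZl// Ev; apply: lerD.
  have -> : 4 * d * pi = 4 * d ^+ 2 * (pi / d) by field; rewrite gt_eqF.
  by apply: ler_wpM2l => //; rewrite mulr_ge0 ?sqr_ge0.
by rewrite le_eqVlt; apply/orP; left; apply/eqP; field; rewrite !gt_eqF.
Qed.
End approx.

(** * Measurability and continuity of the kernel *)

Section kernel_meas.
Context {R : realType}.
Local Notation C := R[i].
Local Notation Rp := (`]0, +oo[%classic : set R).
Variables k th : R.

Lemma meas_kernel x (Z : R -> C) : cmeas Rp Z ->
 (forall m, cmeas Rp (fun y => osc k m (krho th x (Z y)))) ->
 [/\ cmeas Rp (fun y => h0 k th x (Z y)), cmeas Rp (fun y => h1 k th x (Z y)),
  cmeas Rp (fun y => h2 k th x (Z y)) &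
  [/\ cmeas Rp (fun y => h11 k th x (Z y)), cmeas Rp (fun y => h22 k th x (Z y)) &
  cmeas Rp (fun y => h12 k th x (Z y))]].
Proof.
move=> mZ mI; have z2 : cmeas Rp (fun y => (Z y) ^+ 2 / 4).
  rewrite (_ : (fun y => _) = fun y => Z y * Z y * 4^-1); last by apply/funext => y; rewrite expr2.
  by apply: cmeasM; [exact: cmeasM|exact: cmeas_cst].
have cs c := @cmeas_cst R Rp c.
split; last split.
- exact: cmeasM (cs _) (mI 0%N).
- exact: cmeasM (cs _) (cmeasD (mI 0%N) (cmeasM (cs _) (mI 1%N))).
- exact: cmeasM (cmeasM (cs _) mZ) (mI 1%N).
- exact: cmeasM (cs _) (cmeasD (cmeasM (cs _) (mI 1%N)) (cmeasN (cmeasM (cs _) (mI 2%N)))).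
- exact: cmeasM (cs _) (cmeasD (cmeasM (cs _) (mI 1%N)) (cmeasN (cmeasM z2 (mI 2%N)))).
- exact: cmeasM (cmeasM (cs _) mZ) (cmeasD (mI 1%N) (cmeasM (cs _) (mI 2%N))).
Qed.

Lemma ccont_h11 x Z : 0 < complex.Im (krho th x Z) -> ccont ((h11 k th)^~ Z) x.
Proof.
move=> r0.
have cz : ccont (fun s => s%:C * eith th) x by exact: cder_ccont (dz1 th x).
have cI m : ccont (fun s => osc k m (krho th s Z)) x by exact: cder_ccont (dIx k m r0).
have cc c : ccont (fun=> c) x by exact: ccont_cst.
rewrite /h11; apply: ccontM; first exact: ccontM.
apply: ccontD; first exact: ccontM.
rewrite (_ : (fun s => _) = fun s => (- (4^-1)) * ((s%:C * eith th) * (s%:C * eith th)) * osc k 2 (krho th s Z)).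
  by apply: ccontM; last exact: cI; apply: ccontM; [exact: cc|exact: ccontM].
by apply/funext => s; rewrite expr2; ring.
Qed.

Lemma ccont_h22 x Z : 0 < complex.Im (krho th x Z) -> ccont ((h22 k th)^~ Z) x.
Proof.
move=> r0.
have cz : ccont (fun s => s%:C * eith th) x by exact: cder_ccont (dz1 th x).
have cI m : ccont (fun s => osc k m (krho th s Z)) x by exact: cder_ccont (dIx k m r0).
have cc c : ccont (fun=> c) x by exact: ccont_cst.
rewrite /h22; apply: ccontM; first exact: ccontM.
apply: ccontD; first exact: ccontM.
rewrite (_ : (fun s => _) = fun s => (- (Z ^+ 2 / 4)) * osc k 2 (krho th s Z)).
  by apply: ccontM; [exact: cc|exact: cI].
by apply/funext => s; rewrite mulNr.
Qed.

Lemma ccont_h22Z x (Z d : C) (t : R) : 0 < complex.Im (krho th x (Z + d * t%:C)) ->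
  ccont (fun s => h22 k th x (Z + d * s%:C)) t.
Proof.
move=> r0.
have cz : ccont (fun s => Z + d * s%:C) t by exact: (cder_ccont (dzZ Z d t)).
have cI m : ccont (fun s => osc k m (krho th x (Z + d * s%:C))) t by exact: (cder_ccont (dIZ k m r0)).
have cc c : ccont (fun=> c) t by exact: ccont_cst.
rewrite /h22; apply: ccontM; first exact: cc.
apply: ccontD; first by apply: ccontM; [exact: cc|exact: cI].
rewrite (_ : (fun s => _) = fun s => (- 4^-1 * ((Z + d * s%:C) * (Z + d * s%:C))) * osc k 2 (krho th x (Z + d * s%:C))).
  by apply: ccontM; [apply: ccontM; [exact: cc|exact: ccontM]|exact: cI].
by apply/funext => s; rewrite expr2; ring.
Qed.

Lemma mul_le_sqr (X Y : R) : X * Y <= X ^+ 2 + Y ^+ 2.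
Proof.
have : 0 <= (X - Y) ^+ 2 by exact: sqr_ge0.
by have := sqr_ge0 (X + Y); nra.
Qed.

End kernel_meas.

(** * Layer potentials of half-line data *)

Section halfline.
Context {R : realType}.
Local Notation C := R[i].
Local Notation Re := (@complex.Re R).
Local Notation Im := (@complex.Im R).
Local Notation mu := (@lebesgue_measure R).
Local Notation Rp := (`]0, +oo[%classic : set R).

Variables a k th K : R.
Hypotheses (a0 : 0 < a) (k0 : 0 < k) (th0 : 0 < th) (th1 : th < pi / 2) (K0 : 0 < K).
Local Notation e := (eith th).
Local Notation h0 := (h0 k th).
Local Notation h1 := (h1 k th).
Local Notation h2 := (h2 k th).
Local Notation h11 := (h11 k th).
Local Notation h22 := (h22 k th).
Local Notation h12 := (h12 k th).
Local Notation krho := (krho th).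
Definition kernel_bounds := forall (x : R) (Z : C), admissible a th Z -> 0 < Im (krho x Z) ->
  let q := x ^+ 2 + cmod Z ^+ 2 in
  0 < q /\
  [/\ cmod (h0 x Z) <= K * `|x| / (q * (1 + q)), cmod (h1 x Z) <= K / q,
      cmod (h2 x Z) <= K * `|x| * cmod Z / q ^+ 2 &
      [/\ cmod (h11 x Z) <= K * `|x| / q ^+ 2, cmod (h22 x Z) <= K * `|x| / q ^+ 2 &
      cmod (h12 x Z) <= K * cmod Z / q ^+ 2]].
Hypothesis hK : kernel_bounds.

(* Displacement from the source point [y] on a half-line to a target; the sources lie on
   the same ray as the target when [b = 0], on the opposite one, beyond a gap [b], otherwise. *)
Definition displ (b r y : R) : C := (b%:C + r%:C * e) + e * y%:C.
(** For [b = 0] the shift [r] may have either sign, since [displ] then stays on the line of the ray;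
    this is the position of the data in the corner. Across a gap only [r >= 0] keeps the
    displacement admissible. *)
Definition offset_ok (b r : R) := b = 0 \/ [/\ 0 <= b, b <= 2 * a & 0 <= r].
(* The form [B ^ 2 + (y + c) ^ 2] of the bound makes Cauchy's integral applicable. *)
Definition dist_low (x b r B c : R) :=
  forall y, 0 < y -> B ^+ 2 + (y + c) ^+ 2 <= 2 * (x ^+ 2 + b ^+ 2 + (y + r) ^+ 2).

Lemma displE b r y : displ b r y = b%:C + (y + r)%:C * e.
Proof. by rewrite /displ rmorphD/=; ring. Qed.

Lemma displ_admissible (b r y : R) : offset_ok b r -> 0 < y ->
  [/\ admissible a th (displ b r y), b ^+ 2 + (y + r) ^+ 2 <= cmod (displ b r y) ^+ 2 &
   forall x : R, 0 < x ^+ 2 + (y + r) ^+ 2 -> 0 < Im (krho x (displ b r y))].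
Proof.
move=> ok y0; have c0 := cth_gt0 th0 th1; have s0 := sth_gt0 th0 th1.
have [b' [y' [b_0 ba y_0 hZ [bb yy]]]] : exists b' y', [/\ 0 <= b', b' <= 2 * a, 0 <= y',
    displ b r y = b'%:C + y'%:C * e \/ displ b r y = - (b'%:C + y'%:C * e) & b' = b /\ y' ^+ 2 = (y + r) ^+ 2].
  case: ok => [b_0|[b_0 ba r0]].
    exists 0, `|y + r|; rewrite normr_ge0 displE b_0 real_normK ?num_real//.
    split=> //; first by rewrite mulr_ge0// ltW.
    have [h|h] := leP 0 (y + r); [left|right]; first by rewrite ger0_norm.
    by rewrite ler0_norm ?(ltW h)// rmorphN/=; ring.
  by exists b, (y + r); split => //; [rewrite addr_ge0// ltW|left; exact: displE].
split.
- by exists b', y'.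
- by have /andP[+ _] := cmod_adm th0 th1 b_0 y_0 hZ; rewrite bb yy.
move=> x; rewrite (krho_adm _ hZ) Im_krho yy => h.
by rewrite ltr_pwDl//; [rewrite mulr_gt0// mulr_gt0// mulr_gt0|nonneg].
Qed.

Lemma dist_low_gt0 x b r B c y : offset_ok b r -> 0 < B -> dist_low x b r B c -> 0 < y ->
  0 < x ^+ 2 + (y + r) ^+ 2.
Proof.
move=> ok B0 w y0; rewrite lt_neqAle addr_ge0 ?sqr_ge0// andbT eq_sym.
apply/negP; rewrite paddr_eq0 ?sqr_ge0// !sqrf_eq0 => /andP[/eqP x0 /eqP yr].
case: ok => [b_0|[_ _ r0]]; last by move: (ltr_wpDr r0 y0); rewrite yr ltxx.
have := w y y0; rewrite x0 b_0 yr expr0n /= !addr0 mulr0.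
by rewrite leNgt ltr_wpDr ?sqr_ge0// exprn_gt0.
Qed.

(** The denominator [q] depends on the position only through [B] and [c], so one majorant serves a
    whole window of [x], [b] or [r], as differentiation under the integral demands. *)
Lemma kernel_bounds_displ x b r B c y : offset_ok b r -> 0 < B -> dist_low x b r B c -> 0 < y ->
  let Z := displ b r y in let q := B ^+ 2 + (y + c) ^+ 2 in
  [/\ 0 < Im (krho x Z), cmod (h0 x Z) <= 2 * K * (`|x| / (1 + x ^+ 2)) / q,
   cmod (h1 x Z) <= 2 * K / q, cmod (h2 x Z) <= 2 * K / q &
   [/\ cmod (h11 x Z) <= 4 * K / B / q, cmod (h22 x Z) <= 4 * K / B / q & cmod (h12 x Z) <= 4 * K / B / q]].
Proof.
move=> ok B0 w y0 Z q.
have [aZ Zq Ip] := displ_admissible ok y0; rewrite -/Z in aZ Zq Ip.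
have I0 := Ip x (dist_low_gt0 ok B0 w y0).
have [Q0 [b0 b1 b2 [b11 b22 b12]]] := hK aZ I0.
set Q := x ^+ 2 + cmod Z ^+ 2 in Q0 b0 b1 b2 b11 b22 b12.
have qQ : q <= 2 * Q.
  by apply: (le_trans (w y y0)); rewrite ler_wpM2l// -addrA lerD2l.
have q0 : 0 < q by rewrite ltr_pwDl ?sqr_ge0// exprn_gt0.
have iQ : Q^-1 <= 2 / q.
  by rewrite -[2 / q]invrK lef_pV2 ?posrE ?invr_gt0 ?divr_gt0// invf_div ler_pdivrMr// mulrC.
have KQ : K / Q <= 2 * K / q by rewrite [2 * K]mulrC -mulrA ler_wpM2l// ltW.
have xx : `|x| ^+ 2 = x ^+ 2 by rewrite real_normK ?num_real.
have xQ : `|x| ^+ 2 <= Q by rewrite xx lerDl sqr_ge0.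
have zQ : cmod Z ^+ 2 <= Q by rewrite lerDr sqr_ge0.
have BQ : B ^+ 2 <= 2 * Q by apply: le_trans qQ; rewrite lerDl sqr_ge0.
(* For second derivatives half a power of the squared distance is given up for a factor [B^-1], so
   that the same integrable [q^-1] remains. *)
have sec (X : R) : 0 <= X -> X ^+ 2 <= Q -> K * X / Q ^+ 2 <= 4 * K / B / q.
  move=> X0 XQ; have XB : X * B <= 2 * Q.
    have : 0 <= (X - B) ^+ 2 by exact: sqr_ge0.
    by move: XQ BQ Q0; clear; nra.
  have : X / Q <= 2 / B by rewrite ler_pdivrMr// mulrAC ler_pdivlMr.
  move=> h; have -> : K * X / Q ^+ 2 = K * (X / Q * Q^-1) by field; rewrite gt_eqF.
  have -> : 4 * K / B / q = K * (2 / B * (2 / q)) by field; rewrite !gt_eqF.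
  rewrite ler_wpM2l ?(ltW K0)//; apply: ler_pM => //; first by rewrite divr_ge0// ltW.
  by rewrite invr_ge0 ltW.
split => //.
- apply: (le_trans b0).
  have -> : K * `|x| / (Q * (1 + Q)) = K * (`|x| * ((1 + Q)^-1 * Q^-1)) by rewrite invfM; ring.
  have -> : 2 * K * (`|x| / (1 + x ^+ 2)) / q = K * (`|x| * ((1 + x ^+ 2)^-1 * (2 / q))) by ring.
  rewrite ler_wpM2l ?(ltW K0)// ler_wpM2l//; apply: ler_pM => //; try nonneg.
  by rewrite lef_pV2 ?posrE ?ltr_wpDr ?sqr_ge0 ?(ltW Q0)// lerD2l -xx.
- exact: le_trans KQ.
- apply: (le_trans b2); apply: le_trans KQ.
  have -> : K * `|x| * cmod Z / Q ^+ 2 = (K / Q) * (`|x| * cmod Z / Q) by field; rewrite gt_eqF.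
  rewrite ler_piMr ?divr_ge0 ?(ltW K0) ?(ltW Q0)// ler_pdivrMr// mul1r.
  by rewrite /Q -xx mul_le_sqr.
split; [apply: (le_trans b11)|apply: (le_trans b22)|apply: (le_trans b12)]; apply: sec => //; exact: cmod_ge0.
Qed.

Definition good (M : R) (p : R -> C) := cmeas Rp p /\
  forall y, 0 < y -> cmod (p y) <= M /\ cmod (p y) <= M * Num.sqrt y.

(* Opaque on purpose, as are the fields below: unification would otherwise unfold the
   nested integrals. *)
Fact layer_key : {f : (R -> C -> C) -> (R -> C) -> R -> R -> R -> C |
  f = fun H p x b r => cint Rp (fun y => H x (displ b r y) * p y)}.
Proof. by eexists. Qed.
Definition layer := sval layer_key.
Lemma layerE : layer = fun H p x b r => cint Rp (fun y => H x (displ b r y) * p y).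
Proof. exact: (svalP layer_key). Qed.

Lemma good_ge0 M p : good M p -> 0 <= M.
Proof. by move=> [_ /(_ 1 ltr01) [+ _]]; apply: le_trans; exact: cmod_ge0. Qed.

Lemma W_bound H p x b r B c A M : 0 < B -> good M p ->
  cmeas Rp (fun y => H x (displ b r y)) ->
  (forall y, 0 < y -> cmod (H x (displ b r y)) <= A / (B ^+ 2 + (y + c) ^+ 2)) ->
  cintg Rp (fun y => H x (displ b r y) * p y) /\ cmod (layer H p x b r) <= A * M * (pi / B).
Proof.
move=> B0 gp mH bH; have M0 := good_ge0 gp; case: gp => mp bp.
have [i le] := cauchy_int c B0.
have q0 y : 0 < B ^+ 2 + (y + c) ^+ 2 by rewrite ltr_pwDl ?sqr_ge0// exprn_gt0.
have A0 : 0 <= A.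
  have := bH 1 ltr01; move=> /(le_trans (cmod_ge0 _)); rewrite pmulr_lge0// invr_gt0//.
have bd y : Rp y -> cmod (H x (displ b r y) * p y) <= A * M * (B ^+ 2 + (y + c) ^+ 2)^-1.
  move=> /Rp_gt0 y0; rewrite cmodM mulrAC; apply: ler_pM; rewrite ?cmod_ge0//; first exact: bH.
  by case: (bp y y0).
have ig : intg Rp (fun y => A * M * (B ^+ 2 + (y + c) ^+ 2)^-1) by exact: intgZ.
have ci : cintg Rp (fun y => H x (displ b r y) * p y).
  by apply: cintg_le ig bd => //; exact: cmeasM.
split => //; rewrite layerE; apply: (le_trans (cint_le mRp ci ig bd)).
by rewrite RintegralZl// ler_wpM2l// mulr_ge0.
Qed.

Lemma meas_II m x b r : (forall y, 0 < y -> 0 < Im (krho x (displ b r y))) ->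
  cmeas Rp (fun y => osc k m (krho x (displ b r y))).
Proof.
move=> h; apply: (cder_cmeas (@Rp_open R)) => y /Rp_gt0 y0.
exact: (dIZ k m (h y y0)).
Qed.

Lemma meas_Zb b r : cmeas Rp (displ b r).
Proof.
apply: cmeasD; first exact: cmeas_cst.
by apply: cmeasM; [exact: cmeas_cst|apply: cmeas_real].
Qed.

Lemma meas_H x b r : (forall y, 0 < y -> 0 < Im (krho x (displ b r y))) ->
 [/\ cmeas Rp (fun y => h0 x (displ b r y)), cmeas Rp (fun y => h1 x (displ b r y)),
  cmeas Rp (fun y => h2 x (displ b r y)) &
  [/\ cmeas Rp (fun y => h11 x (displ b r y)), cmeas Rp (fun y => h22 x (displ b r y)) &
  cmeas Rp (fun y => h12 x (displ b r y))]].
Proof. by move=> h; exact: (meas_kernel (meas_Zb b r) (fun m => meas_II m h)). Qed.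

Lemma layer_bounds p x b r B c M : offset_ok b r -> 0 < B -> dist_low x b r B c -> good M p ->
  let bd A H := cintg Rp (fun y => H x (displ b r y) * p y) /\ cmod (layer H p x b r) <= A * M * (pi / B) in
  [/\ bd (2 * K * (`|x| / (1 + x ^+ 2))) h0, bd (2 * K) h1, bd (2 * K) h2 &
   [/\ bd (4 * K / B) h11, bd (4 * K / B) h22 & bd (4 * K / B) h12]].
Proof.
move=> ok B0 w gp bd; have hz y y0 := kernel_bounds_displ ok B0 w (y := y) y0.
have [m0 m1 m2 [m3 m4 m5]] : _ := @meas_H x b r (fun y y0 => let: And5 i _ _ _ _ := hz y y0 in i).
split; last split; apply: (W_bound B0 gp (c := c)) => // y /hz [i0 b0 b1 b2 [b3 b4 b5]] //.
Qed.

Lemma layer_der (H H' : R -> R -> C) p t u v B c A M : u < t < v -> good M p -> 0 < B ->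
  (forall s, u < s < v -> cmeas Rp (H s)) ->
  (forall s, u < s < v -> cintg Rp (fun y => H s y * p y)) ->
  (forall s y, u < s < v -> 0 < y -> cder (H^~ y) s (H' s y)) ->
  (forall s y, u < s < v -> 0 < y -> cmod (H' s y) <= A / (B ^+ 2 + (y + c) ^+ 2)) ->
  cder (fun s => cint Rp (fun y => H s y * p y)) t (cint Rp (fun y => H' t y * p y)).
Proof.
move=> utv gp B0 mH iH dH bH'; have M0 := good_ge0 gp; case: gp => mp bp.
have [i le] := cauchy_int c B0.
have ig : intg Rp (fun y => A * M * (B ^+ 2 + (y + c) ^+ 2)^-1) by exact: intgZ.
apply: (@cint_cder R Rp (fun s y => H s y * p y) (fun s y => H' s y * p y) t u v _ mRp utv iH _ ig).
- move=> s y us /Rp_gt0 y0; apply: cder_eq (cderM (dH s y us y0) (cder_cst (p y) s)) _.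
  by rewrite mulr0 addr0.
move=> s y us /Rp_gt0 y0; rewrite cmodM mulrAC; apply: ler_pM; rewrite ?cmod_ge0//; first exact: bH'.
by case: (bp y y0).
Qed.

Lemma xx_le1 (x : R) : `|x| / (1 + x ^+ 2) <= 1.
Proof.
rewrite ler_pdivrMr ?ltr_wpDr ?sqr_ge0// mul1r -[x ^+ 2]real_normK ?num_real//.
have := normr_ge0 x; have : 0 <= (`|x| - 1) ^+ 2 by exact: sqr_ge0.
by move: `|x| => X; nra.
Qed.

Lemma cint_eZ (F p : R -> C) (c : C) : cintg Rp (fun y => F y * p y) ->
  cint Rp (fun y => (c * F y) * p y) = c * cint Rp (fun y => F y * p y).
Proof. by move=> i; rewrite -cintZ//; apply: eq_cint => y _; rewrite mulrA. Qed.

Lemma layer_dx p x b r B c M u v : u < x < v -> offset_ok b r -> 0 < B ->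
  (forall s, u < s < v -> dist_low s b r B c) -> good M p ->
  [/\ cder (fun s => layer h0 p s b r) x (e * layer h1 p x b r),
      cder (fun s => layer h1 p s b r) x (e * layer h11 p x b r) &
      cder (fun s => layer h2 p s b r) x (e * layer h12 p x b r)].
Proof.
move=> uxv ok B0 w gp.
have hz s y (us : u < s < v) y0 := kernel_bounds_displ ok B0 (w s us) (y := y) y0.
have wp s (us : u < s < v) := layer_bounds ok B0 (w s us) gp.
have mh s (us : u < s < v) := @meas_H s b r (fun y y0 => let: And5 i _ _ _ _ := hz s y us y0 in i).
have [[_ _] [i1 _] _ [[i11 _] _ [i12 _]]] := wp x uxv.
have em z : cmod (e * z) = cmod z by rewrite cmodM cmod_e mul1r.
rewrite layerE; split.
- rewrite -(cint_eZ e i1); have := @layer_der (fun s y => h0 s (displ b r y)) (fun s y => e * h1 s (displ b r y)) p x u v B c (2 * K) M uxv gp B0.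
  apply.
  + by move=> s /mh [].
  + by move=> s /wp [[]].
  + by move=> s y us y0; apply: d_h0x; case: (hz s y us y0).
  + by move=> s y us y0; rewrite em; case: (hz s y us y0).
- rewrite -(cint_eZ e i11); have := @layer_der (fun s y => h1 s (displ b r y)) (fun s y => e * h11 s (displ b r y)) p x u v B c (4 * K / B) M uxv gp B0.
  apply.
  + by move=> s /mh [].
  + by move=> s /wp [_ []].
  + by move=> s y us y0; apply: d_h1x; case: (hz s y us y0).
  + by move=> s y us y0; rewrite em; case: (hz s y us y0) => _ _ _ _ [].
- rewrite -(cint_eZ e i12); have := @layer_der (fun s y => h2 s (displ b r y)) (fun s y => e * h12 s (displ b r y)) p x u v B c (4 * K / B) M uxv gp B0.
  apply.
  + by move=> s /mh [].
  + by move=> s /wp [_ _ []].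
  + by move=> s y us y0; apply: d_h2x; case: (hz s y us y0).
  + by move=> s y us y0; rewrite em; case: (hz s y us y0) => _ _ _ _ [].
Qed.

Lemma layer_dr p x b r B c M u v : u < r < v -> (forall s, u < s < v -> offset_ok b s) -> 0 < B ->
  (forall s, u < s < v -> dist_low x b s B c) -> good M p ->
  cder (fun s => layer h0 p x b s) r (e * layer h2 p x b r) /\
  cder (fun s => layer h2 p x b s) r (e * layer h22 p x b r).
Proof.
move=> uxv ok B0 w gp.
have hz s y (us : u < s < v) y0 := kernel_bounds_displ (ok s us) B0 (w s us) (y := y) y0.
have wp s (us : u < s < v) := layer_bounds (ok s us) B0 (w s us) gp.
have mh s (us : u < s < v) := @meas_H x b s (fun y y0 => let: And5 i _ _ _ _ := hz s y us y0 in i).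
have [_ _ [i2 _] [_ [i22 _] _]] := wp r uxv.
have em z : cmod (e * z) = cmod z by rewrite cmodM cmod_e mul1r.
have ZE s y : displ b s y = (b%:C + e * y%:C) + e * s%:C by rewrite /displ; ring.
rewrite layerE; split.
- rewrite -(cint_eZ e i2); have := @layer_der (fun s y => h0 x (displ b s y)) (fun s y => e * h2 x (displ b s y)) p r u v B c (2 * K) M uxv gp B0.
  apply.
  + by move=> s /mh [].
  + by move=> s /wp [[]].
  + move=> s y us y0; rewrite (_ : (fun s => _) = fun s => h0 x ((b%:C + e * y%:C) + e * s%:C)).
      by rewrite ZE; apply: d_h0Z; rewrite -ZE; case: (hz s y us y0).
    by apply/funext => s'; rewrite ZE.
  + by move=> s y us y0; rewrite em; case: (hz s y us y0).
- rewrite -(cint_eZ e i22); have := @layer_der (fun s y => h2 x (displ b s y)) (fun s y => e * h22 x (displ b s y)) p r u v B c (4 * K / B) M uxv gp B0.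
  apply.
  + by move=> s /mh [].
  + by move=> s /wp [_ _ []].
  + move=> s y us y0; rewrite (_ : (fun s => _) = fun s => h2 x ((b%:C + e * y%:C) + e * s%:C)).
      by rewrite ZE; apply: d_h2Z; rewrite -ZE; case: (hz s y us y0).
    by apply/funext => s'; rewrite ZE.
  + by move=> s y us y0; rewrite em; case: (hz s y us y0) => _ _ _ _ [].
Qed.

(** [b] is measured across the gap, in the unscaled direction, [r] along the scaled ray; this is why
    [layer_dr] has a factor [e] and this lemma has none. *)
Lemma layer_db p x b r B c M u v : u < b < v -> (forall s, u < s < v -> offset_ok s r) -> 0 < B ->
  (forall s, u < s < v -> dist_low x s r B c) -> good M p ->
  cder (fun s => layer h0 p x s r) b (layer h2 p x b r) /\
  cder (fun s => layer h2 p x s r) b (layer h22 p x b r).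
Proof.
move=> uxv ok B0 w gp.
have hz s y (us : u < s < v) y0 := kernel_bounds_displ (ok s us) B0 (w s us) (y := y) y0.
have wp s (us : u < s < v) := layer_bounds (ok s us) B0 (w s us) gp.
have mh s (us : u < s < v) := @meas_H x s r (fun y y0 => let: And5 i _ _ _ _ := hz s y us y0 in i).
have ZE s y : displ s r y = (r%:C * e + e * y%:C) + 1 * s%:C by rewrite /displ; ring.
rewrite layerE; split.
- have := @layer_der (fun s y => h0 x (displ s r y)) (fun s y => h2 x (displ s r y)) p b u v B c (2 * K) M uxv gp B0.
  apply.
  + by move=> s /mh [].
  + by move=> s /wp [[]].
  + move=> s y us y0; rewrite (_ : (fun s => _) = fun s => h0 x ((r%:C * e + e * y%:C) + 1 * s%:C)).
      rewrite ZE -[h2 x _]mul1r; apply: d_h0Z; rewrite -ZE; by case: (hz s y us y0).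
    by apply/funext => s'; rewrite ZE.
  + by move=> s y us y0; case: (hz s y us y0).
- have := @layer_der (fun s y => h2 x (displ s r y)) (fun s y => h22 x (displ s r y)) p b u v B c (4 * K / B) M uxv gp B0.
  apply.
  + by move=> s /mh [].
  + by move=> s /wp [_ _ []].
  + move=> s y us y0; rewrite (_ : (fun s => _) = fun s => h2 x ((r%:C * e + e * y%:C) + 1 * s%:C)).
      rewrite ZE -[h22 x _]mul1r; apply: d_h2Z; rewrite -ZE; by case: (hz s y us y0).
    by apply/funext => s'; rewrite ZE.
  + by move=> s y us y0; case: (hz s y us y0) => _ _ _ _ [].
Qed.

(* near the edge the data vanish like sqrt y, which makes the gradient integrable there *)
Lemma layer_edge H p x b r A M : 0 < x -> - x <= r -> good M p ->
  cmeas Rp (fun y => H x (displ b r y)) -> 0 <= A ->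
  (forall y, 0 < y -> cmod (H x (displ b r y)) <= A / (x ^+ 2 + (y + r) ^+ 2)) ->
  cmod (layer H p x b r) <= A * M * (20 * pi) / Num.sqrt x.
Proof.
move=> x0 xr gp mH A0 bH; have M0 := good_ge0 gp; case: (gp) => mp bp.
have [i le] := cauchy_int r x0; have [j lj _ _] := poisson_sqrt_int 0 x0.
have q0 y : 0 < x ^+ 2 + (y + r) ^+ 2 by rewrite ltr_pwDl ?sqr_ge0// exprn_gt0.
have [ci _] := W_bound x0 gp mH bH.
(* The majorant is split at [y = 2 * x]: below, [sqrt y <= 2 * sqrt x]; above, [y + r >= y / 2] by
   [- x <= r], and the Poisson integral of [sqrt y] applies. *)
pose g y := A * M * (2 * Num.sqrt x * (x ^+ 2 + (y + r) ^+ 2)^-1 +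
   4 / x * (x * Num.sqrt (y - 0) / (x ^+ 2 + (y - 0) ^+ 2))).
have ig : intg Rp g.
  by apply: intgZ => //; apply: intgD => //; exact: intgZ.
have sx0 : 0 < Num.sqrt x by rewrite sqrtr_gt0.
have sxx : Num.sqrt x * Num.sqrt x = x by rewrite -expr2 sqr_sqrtr// ltW.
have bd y : Rp y -> cmod (H x (displ b r y) * p y) <= g y.
  move=> /Rp_gt0 y0; have sy0 := sqrtr_ge0 y.
  rewrite cmodM /g !subr0.
  apply: (@le_trans _ _ (A / (x ^+ 2 + (y + r) ^+ 2) * (M * Num.sqrt y))).
    by apply: ler_pM; rewrite ?cmod_ge0 ?bH//; case: (bp y y0).
  have -> : A / (x ^+ 2 + (y + r) ^+ 2) * (M * Num.sqrt y) = A * M * (Num.sqrt y * (x ^+ 2 + (y + r) ^+ 2)^-1) by ring.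
  rewrite ler_wpM2l ?mulr_ge0//.
  have [yx|xy] := leP y (2 * x).
    apply: ler_wpDr; first by nonneg.
    rewrite ler_wpM2r ?invr_ge0 ?(ltW (q0 y))//.
    rewrite -ler_sqr ?nnegrE ?mulr_ge0 ?(ltW sx0)// exprMn !sqr_sqrtr ?(ltW x0) ?(ltW y0)//; lra.
  apply: ler_wpDl; first by nonneg.
  have -> : 4 / x * (x * Num.sqrt y / (x ^+ 2 + y ^+ 2)) = Num.sqrt y * (4 / (x ^+ 2 + y ^+ 2)).
    by field; rewrite !gt_eqF//; pos.
  rewrite ler_wpM2l// -[4 / _]invrK lef_pV2 ?posrE//; last by pos.
  rewrite invf_div ler_pdivrMr//.
  have h : y / 2 <= y + r by lra.
  have : (y / 2) ^+ 2 <= (y + r) ^+ 2 by rewrite lerXn2r ?nnegrE//; lra.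
  by have := sqr_ge0 x; rewrite expr_div_n; lra.
rewrite layerE; apply: (le_trans (cint_le mRp ci ig bd)).
rewrite RintegralZl//; last by apply: intgD => //; exact: intgZ.
rewrite RintegralD//; [|exact: intgZ..].
rewrite !RintegralZl//.
rewrite -[leRHS]mulrA; apply: ler_wpM2l; first by rewrite mulr_ge0.
apply: (@le_trans _ _ (2 * Num.sqrt x * (pi / x) + 4 / x * (3 / 4 * pi * Num.sqrt x))).
  by apply: lerD; apply: ler_wpM2l => //; nonneg.
have -> : 2 * Num.sqrt x * (pi / x) + 4 / x * (3 / 4 * pi * Num.sqrt x) = 5 * pi / Num.sqrt x.
  by move: sx0 sxx; move: (Num.sqrt x) => S S0 <-; field; rewrite gt_eqF.
rewrite ler_wpM2r ?invr_ge0 ?(ltW sx0)//; have := @pi_gt0 R; lra.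
Qed.

Lemma layer_edge_h1_h2 p x b r M : 0 < x -> - x <= r -> offset_ok b r -> good M p ->
  cmod (layer h1 p x b r) <= 2 * K * M * (20 * pi) / Num.sqrt x /\
  cmod (layer h2 p x b r) <= 2 * K * M * (20 * pi) / Num.sqrt x.
Proof.
move=> x0 xr ok gp.
have w : dist_low x b r x r.
  move=> y y0; have := sqr_ge0 x; have := sqr_ge0 b; have := sqr_ge0 (y + r); lra.
have hz y y0 := kernel_bounds_displ ok x0 w (y := y) y0.
have [m0 m1 m2 _] := @meas_H x b r (fun y y0 => let: And5 i _ _ _ _ := hz y y0 in i).
have K2 : 0 <= 2 * K by rewrite mulr_ge0// ltW.
by split; apply: layer_edge => // y y0; case: (hz y y0).
Qed.

(** The derivative of [2 * atan (sqrt x)]: an integrable majorant that admits a singularity of order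
    [sqrt x] inverse at the edge. *)
Definition edgew (x : R) := (Num.sqrt x * (1 + x))^-1.

Lemma intg_edgew : intg Rp edgew.
Proof.
have [h1 h2 h3] := exh_ray (0 : R).
have sq (x : R) : 0 < x -> 0 < Num.sqrt x by move=> x0; rewrite sqrtr_gt0.
have s2 (x : R) : 0 < x -> Num.sqrt x ^+ 2 = x by move=> x0; rewrite sqr_sqrtr ?ltW.
have d (x : R) : 0 < x -> is_derive x 1 (fun x => 2 * atan (Num.sqrt x)) (edgew x).
  move=> x0; apply: rder_eq (rderZ 2 (rder_comp (is_derive1_sqrt x0) (is_derive1_atan _))) _.
  by rewrite s2// /edgew; have := sq x x0; move: (Num.sqrt x) => S S0; field; rewrite !gt_eqF// ltr_wpDr// ltW.
have c (x : R) : 0 < x -> {for x, continuous edgew}.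
  move=> x0; have dd := rderV (rderM (is_derive1_sqrt x0) (rderD (rderC 1 x) (rderI x))) _.
  apply: cont_derive; apply: dd; rewrite gt_eqF// mulr_gt0 ?sq//; lra.
apply: (@ge0_FTC_exhaust R Rp edgew (fun x => 2 * atan (Num.sqrt x)) (lo 0) (hi 0) 4 mRp h1 h2 h3).
- by move=> x /Rp_gt0; exact: d.
- by move=> x /Rp_gt0; exact: c.
- by apply: meas_ray => x x0; exact: c.
- by move=> x /Rp_gt0 x0; rewrite invr_ge0 mulr_ge0 ?sqrtr_ge0//; lra.
- move=> x _; rewrite normrM ger0_norm//; have := atan_bound (Num.sqrt x); lra.
Qed.

Lemma displ_move b r be ga s y : displ (b + be * s) (r + ga * s) y =
  displ b r y + (be%:C + ga%:C * e) * s%:C.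
Proof. by rewrite /displ !rmorphD !rmorphM/=; ring. Qed.

(** A shift of [r] by at most [x / 2] changes the squared distance by a bounded factor only, so the
    bound at [r] holds on a whole neighbourhood. *)
Lemma dist_low_near x b r d : `|d| <= x / 2 -> dist_low x b (r + d) x r.
Proof.
move=> dx y y0; move: dx; rewrite ler_norml => /andP[d1 d2].
have d3 : d ^+ 2 <= x ^+ 2 / 4 by nra.
have h1 : 0 <= (y + r + 2 * d) ^+ 2 by exact: sqr_ge0.
have h2 := sqr_ge0 b; have h3 := sqr_ge0 x.
have E : 2 * (y + (r + d)) ^+ 2 = (y + r) ^+ 2 + (y + r + 2 * d) ^+ 2 - 2 * d ^+ 2 by ring.
by rewrite mulrDr E; lra.
Qed.

Lemma layer_seq p M x b r be ga (s : nat -> R) : 0 < x -> good M p -> offset_ok b r ->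
  (forall i, offset_ok (b + be * s i) (r + ga * s i)) -> (forall i, `|ga * s i| <= x / 2) ->
  s i @[i --> \oo] --> 0 ->
  ccvg (fun i => layer h0 p x (b + be * s i) (r + ga * s i)) (layer h0 p x b r) /\
  ccvg (fun i => layer h2 p x (b + be * s i) (r + ga * s i)) (layer h2 p x b r).
Proof.
move=> x0 gp ok oks sx s0; have M0 := good_ge0 gp.
have w i : dist_low x (b + be * s i) (r + ga * s i) x r by exact: dist_low_near.
have w0 : dist_low x b r x r.
  move=> y y0; have := sqr_ge0 x; have := sqr_ge0 b; have := sqr_ge0 (y + r); lra.
have hz i y (y0 : 0 < y) := kernel_bounds_displ (oks i) x0 (w i) y0.
have hz0 y (y0 : 0 < y) := kernel_bounds_displ ok x0 w0 y0.
have wp i := layer_bounds (oks i) x0 (w i) gp.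
have [mp bp] := gp.
have [ic1 _] := cauchy_int r x0.
have ig : intg Rp (fun y => 2 * K * M * (x ^+ 2 + (y + r) ^+ 2)^-1) by exact: intgZ.
have xx1 : `|x| / (1 + x ^+ 2) <= 1 by exact: xx_le1.
have gen (H : R -> C -> C) : (forall i, cmeas Rp (fun y => H x (displ (b + be * s i) (r + ga * s i) y))) ->
   (forall y, 0 < y -> ccont (fun t => H x (displ b r y + (be%:C + ga%:C * e) * t%:C)) 0) ->
   (forall i y, 0 < y -> cmod (H x (displ (b + be * s i) (r + ga * s i) y)) <= 2 * K / (x ^+ 2 + (y + r) ^+ 2)) ->
   ccvg (fun i => layer H p x (b + be * s i) (r + ga * s i)) (layer H p x b r).
  move=> mH cH bH.
  have mF i : cmeas Rp (fun y => H x (displ (b + be * s i) (r + ga * s i) y) * p y) by exact: cmeasM.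
  have lF y : Rp y -> ccvg (fun i => H x (displ (b + be * s i) (r + ga * s i) y) * p y) (H x (displ b r y) * p y).
    move=> /Rp_gt0 y0; apply: ccvgM; last exact: ccvg_cst.
    have := ccont_ccvg (cH y y0) s0.
    rewrite mulr0 addr0 => h; rewrite (_ : (fun _ => _) = fun i => H x (displ b r y + (be%:C + ga%:C * e) * (s i)%:C))//.
    by apply/funext => i; rewrite displ_move.
  have bF i y : Rp y -> cmod (H x (displ (b + be * s i) (r + ga * s i) y) * p y) <= 2 * K * M * (x ^+ 2 + (y + r) ^+ 2)^-1.
    move=> /Rp_gt0 y0; rewrite cmodM mulrAC; apply: ler_pM; rewrite ?cmod_ge0 ?bH//.
    by case: (bp y y0).
  by have [_ h] := cint_dcvg mRp mF lF ig bF; rewrite layerE; exact: h.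
have q0 y : 0 < x ^+ 2 + (y + r) ^+ 2 by rewrite ltr_pwDl ?sqr_ge0// exprn_gt0.
have mh i := @meas_H x (b + be * s i) (r + ga * s i) (fun y y0 => let: And5 j _ _ _ _ := hz i y y0 in j).
split; apply: gen.
- by move=> i; case: (mh i).
- move=> y y0; apply: cder_ccont; apply: d_h0Z; rewrite mulr0 addr0.
  by case: (hz0 y y0).
- move=> i y y0; have [_ h _ _ _] := hz i y y0; apply: (le_trans h).
  rewrite ler_wpM2r ?invr_ge0 ?(ltW (q0 y))// ler_piMr// mulr_ge0// ltW//.
- by move=> i; case: (mh i).
- move=> y y0; apply: cder_ccont; apply: d_h2Z; rewrite mulr0 addr0.
  by case: (hz0 y y0).
- by move=> i y y0; case: (hz i y y0).
Qed.

(** * Fields of a pair of half-line data *)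

Section pair.
Variables (p n : R -> C) (M : R).
Hypotheses (gp : good M p) (gn : good M n).

(** The factor [e] is the derivative of the path. The offsets [(a - t, 0, a + t, 0)] describe the
    strip, [(0, - r, 2 * a, r)] the corner, and [(0, 0, 2 * a, 0)] the ray that carries [p]. *)
Fact u0_key : {f : R -> R -> R -> R -> R -> C | f = fun x b r b' r' => e * (layer h0 p x b r + layer h0 n x b' r')}.
Proof. by eexists. Qed.
Definition u0 := sval u0_key.
Lemma u0E x b r b' r' : u0 x b r b' r' = e * (layer h0 p x b r + layer h0 n x b' r').
Proof. by rewrite /u0 (svalP u0_key). Qed.
Fact u1_key : {f : R -> R -> R -> R -> R -> C | f = fun x b r b' r' => e * (layer h1 p x b r + layer h1 n x b' r')}.
Proof. by eexists. Qed.
Definition u1 := sval u1_key.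
Lemma u1E x b r b' r' : u1 x b r b' r' = e * (layer h1 p x b r + layer h1 n x b' r').
Proof. by rewrite /u1 (svalP u1_key). Qed.
Fact u11_key : {f : R -> R -> R -> R -> R -> C | f = fun x b r b' r' => e * (layer h11 p x b r + layer h11 n x b' r')}.
Proof. by eexists. Qed.
Definition u11 := sval u11_key.
Lemma u11E x b r b' r' : u11 x b r b' r' = e * (layer h11 p x b r + layer h11 n x b' r').
Proof. by rewrite /u11 (svalP u11_key). Qed.
Fact u22_key : {f : R -> R -> R -> R -> R -> C | f = fun x b r b' r' => e * (layer h22 p x b r + layer h22 n x b' r')}.
Proof. by eexists. Qed.
Definition u22 := sval u22_key.
Lemma u22E x b r b' r' : u22 x b r b' r' = e * (layer h22 p x b r + layer h22 n x b' r').
Proof. by rewrite /u22 (svalP u22_key). Qed.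
(** The offsets of [p] and [n] move in opposite directions in the strip and in the corner, hence the
    minus sign. The variant [g2] belongs to offsets that move together. *)
Fact u2_key : {f : R -> R -> R -> R -> R -> C | f = fun x b r b' r' => e * (layer h2 n x b' r' - layer h2 p x b r)}.
Proof. by eexists. Qed.
Definition u2 := sval u2_key.
Lemma u2E x b r b' r' : u2 x b r b' r' = e * (layer h2 n x b' r' - layer h2 p x b r).
Proof. by rewrite /u2 (svalP u2_key). Qed.
(** The number 100 covers every constant in the bounds below; the largest is 80, twice the 40 of the
    edge bound [layer_edge_h1_h2]. *)
Definition field_const := 100 * K * M * pi.

Lemma field_const_ge0 : 0 <= field_const.
Proof. have M0 := good_ge0 gp; rewrite /field_const; nonneg. Qed.

Lemma Qle (c D : R) : 0 <= K * M * pi -> 0 < D -> c <= 50 ->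
  2 * (c * (K * M * pi) / D) <= field_const / D.
Proof.
move=> KM D0 c5; rewrite /field_const.
have -> : 2 * (c * (K * M * pi) / D) = (2 * c) * (K * M * pi / D) by ring.
have -> : 100 * K * M * pi / D = 100 * (K * M * pi / D) by ring.
apply: ler_wpM2r; first by rewrite divr_ge0 ?(ltW D0).
by lra.
Qed.

Lemma dist_low_x x b r : dist_low x b r `|x| r.
Proof.
move=> y y0; rewrite real_normK ?num_real//.
have := sqr_ge0 x; have := sqr_ge0 b; have := sqr_ge0 (y + r); lra.
Qed.

Lemma cmod_eM z : cmod (e * z) = cmod z.
Proof. by rewrite cmodM cmod_e mul1r. Qed.

Lemma pair_le (z w : C) X : cmod z <= X -> cmod w <= X -> cmod (e * (z + w)) <= 2 * X.
Proof.
move=> h1 h2; rewrite cmod_eM (le_trans (ler_cmodD _ _))//.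
by rewrite mulr2n mulrDl mul1r lerD.
Qed.

Lemma pair_leB (z w : C) X : cmod z <= X -> cmod w <= X -> cmod (e * (z - w)) <= 2 * X.
Proof. by move=> h1 h2; apply: pair_le; rewrite ?cmodN. Qed.

Lemma field_bounds x b r b' r' : 0 < x -> offset_ok b r -> offset_ok b' r' ->
  [/\ cmod (u0 x b r b' r') <= field_const / (1 + x ^+ 2), cmod (u1 x b r b' r') <= field_const / x,
      cmod (u2 x b r b' r') <= field_const / x &
   [/\ cmod (u11 x b r b' r') <= field_const / x ^+ 2, cmod (u22 x b r b' r') <= field_const / x ^+ 2 &
   [/\ -x <= r -> -x <= r' -> cmod (u1 x b r b' r') <= field_const / Num.sqrt x &
       -x <= r -> -x <= r' -> cmod (u2 x b r b' r') <= field_const / Num.sqrt x]]].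
Proof.
move=> x0 ok ok'; have M0 := good_ge0 gp.
have x0' : 0 < `|x| by rewrite normr_gt0 gt_eqF.
have [[_ a1] [_ a2] [_ a3] [[_ a4] [_ a5] _]] := layer_bounds ok x0' (dist_low_x x b r) gp.
have [[_ b1] [_ b2] [_ b3] [[_ b4] [_ b5] _]] := layer_bounds ok' x0' (dist_low_x x b' r') gn.
rewrite (gtr0_norm x0) in a1 a2 a3 a4 a5 b1 b2 b3 b4 b5.
have X1 : 0 < 1 + x ^+ 2 by rewrite ltr_pwDl ?sqr_ge0.
have KM : 0 <= K * M * pi by nonneg.
have le (c c' D : R) : 0 < D -> c <= 50 -> c' = c * (K * M * pi) / D -> 2 * c' <= field_const / D.
  by move=> D0 c5 ->; exact: Qle.
rewrite u0E u1E u2E u11E u22E.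
split; last split; last split.
- apply: (le_trans (pair_le a1 b1)); apply: (le 2) => //; first by rewrite ler_nat.
  by field; rewrite !gt_eqF.
- apply: (le_trans (pair_le a2 b2)); apply: (le 2) => //; first by rewrite ler_nat.
  by ring.
- apply: (le_trans (pair_leB b3 a3)); apply: (le 2) => //; first by rewrite ler_nat.
  by ring.
- apply: (le_trans (pair_le a4 b4)); apply: (le 4) => //; first by rewrite exprn_gt0.
    by rewrite ler_nat.
  by field; rewrite gt_eqF.
- apply: (le_trans (pair_le a5 b5)); apply: (le 4) => //; first by rewrite exprn_gt0.
    by rewrite ler_nat.
  by field; rewrite gt_eqF.
- move=> r1 r2; have [A1 _] := layer_edge_h1_h2 x0 r1 ok gp; have [B1 _] := layer_edge_h1_h2 x0 r2 ok' gn.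
  apply: (le_trans (pair_le A1 B1)); apply: (le 40) => //; rewrite ?sqrtr_gt0 ?ler_nat//.
  by ring.
- move=> r1 r2; have [_ A1] := layer_edge_h1_h2 x0 r1 ok gp; have [_ B1] := layer_edge_h1_h2 x0 r2 ok' gn.
  apply: (le_trans (pair_leB B1 A1)); apply: (le 40) => //; rewrite ?sqrtr_gt0 ?ler_nat//.
  by ring.
Qed.

Fact g2_key : {f : R -> R -> R -> R -> R -> C | f = fun x b r b' r' => e * (layer h2 p x b r + layer h2 n x b' r')}.
Proof. by eexists. Qed.
Definition g2 := sval g2_key.
Lemma g2E x b r b' r' : g2 x b r b' r' = e * (layer h2 p x b r + layer h2 n x b' r').
Proof. by rewrite /g2 (svalP g2_key). Qed.

(* away from the source segments everything is bounded up to x = 0 *)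
Lemma field_bounds_away x d b r b' r' c1 c2 : 0 < x -> 0 < d -> dist_low x b r d c1 -> dist_low x b' r' d c2 -> offset_ok b r -> offset_ok b' r' ->
  [/\ cmod (u0 x b r b' r') <= field_const / d * x, cmod (u1 x b r b' r') <= field_const / d,
      cmod (u2 x b r b' r') <= field_const / d &
      [/\ cmod (u22 x b r b' r') <= field_const / d ^+ 2, cmod (u11 x b r b' r') <= field_const / d ^+ 2 &
      cmod (g2 x b r b' r') <= field_const / d]].
Proof.
move=> x0 d0 w w' ok ok'; have M0 := good_ge0 gp.
have [[_ a1] [_ a2] [_ a3] [[_ a4] [_ a5] _]] := layer_bounds ok d0 w gp.
have [[_ b1] [_ b2] [_ b3] [[_ b4] [_ b5] _]] := layer_bounds ok' d0 w' gn.
have KM : 0 <= K * M * pi by nonneg.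
have le (c c' D : R) : 0 < D -> c <= 50 -> c' = c * (K * M * pi) / D -> 2 * c' <= field_const / D.
  by move=> D0 c5 ->; exact: Qle.
rewrite u0E u1E u2E u22E u11E g2E; split; last split.
- have X1 : `|x| / (1 + x ^+ 2) <= x.
    rewrite gtr0_norm// ler_pdivrMr ?ltr_pwDl ?sqr_ge0//.
    by rewrite ler_peMr ?(ltW x0)// lerDl sqr_ge0.
  apply: (le_trans (pair_le a1 b1)).
  apply: (@le_trans _ _ (2 * (2 * K * M * (pi / d)) * x)).
    have -> : 2 * (2 * K * (`|x| / (1 + x ^+ 2)) * M * (pi / d)) = 2 * (2 * K * M * (pi / d)) * (`|x| / (1 + x ^+ 2)) by ring.
    by rewrite ler_wpM2l// !mulr_ge0 ?invr_ge0 ?pi_ge0// ltW.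
  rewrite ler_wpM2r ?(ltW x0)//; apply: (le 2) => //; first by rewrite ler_nat.
  by ring.
- apply: (le_trans (pair_le a2 b2)); apply: (le 2) => //; first by rewrite ler_nat.
  by ring.
- apply: (le_trans (pair_leB b3 a3)); apply: (le 2) => //; first by rewrite ler_nat.
  by ring.
- apply: (le_trans (pair_le a5 b5)); apply: (le 4) => //; first by rewrite exprn_gt0.
    by rewrite ler_nat.
  by field; rewrite gt_eqF.
- apply: (le_trans (pair_le a4 b4)); apply: (le 4) => //; first by rewrite exprn_gt0.
    by rewrite ler_nat.
  by field; rewrite gt_eqF.
- apply: (le_trans (pair_le a3 b3)); apply: (le 2) => //; first by rewrite ler_nat.
  by ring.
Qed.

Lemma field_bounds_gap x d b r b' r' : 0 < x -> 0 < d -> d <= b -> d <= b' -> offset_ok b r -> offset_ok b' r' ->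
  [/\ cmod (u0 x b r b' r') <= field_const / d * x, cmod (u1 x b r b' r') <= field_const / d,
      cmod (u2 x b r b' r') <= field_const / d &
      cmod (u22 x b r b' r') <= field_const / d ^+ 2].
Proof.
move=> x0 d0 db db' ok ok'.
have w (c s : R) : d <= c -> dist_low x c s d s.
  move=> dc y y0; have : d ^+ 2 <= c ^+ 2 by rewrite lerXn2r ?nnegrE ?(ltW d0)// (le_trans _ dc)// ltW.
  by have := sqr_ge0 x; have := sqr_ge0 d; have := sqr_ge0 (y + s); lra.
by have [? ? ? []] := field_bounds_away x0 d0 (w b r db) (w b' r' db') ok ok'.
Qed.

Lemma dist_low_half x s b r : 0 < x -> x / 2 < s < 2 * x -> dist_low s b r (x / 2) r.
Proof.
move=> x0 /andP[xs _] y y0.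
have : (x / 2) ^+ 2 <= s ^+ 2 by rewrite lerXn2r ?nnegrE//; lra.
have := sqr_ge0 s; have := sqr_ge0 b; have := sqr_ge0 (y + r); lra.
Qed.

Lemma layer_ccont q x b r : 0 < x -> offset_ok b r -> good M q ->
  ccont (fun s => layer h11 q s b r) x /\ ccont (fun s => layer h22 q s b r) x.
Proof.
move=> x0 okc gq; have xh : 0 < x / 2 by rewrite divr_gt0.
have hs s : `|s - x| < x / 2 -> x / 2 < s < 2 * x by rewrite ltr_norml => /andP[]; lra.
have hz s y (sx : `|s - x| < x / 2) y0 := kernel_bounds_displ okc xh (dist_low_half b r x0 (hs s sx)) (y := y) y0.
have mh s (us : `|s - x| < x / 2) := @meas_H s b r (fun y y0 => let: And5 i _ _ _ _ := hz s y us y0 in i).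
have [mq bq] := gq; have M0 := good_ge0 gq.
have xx : `|x - x| < x / 2 by rewrite subrr normr0.
have [ic _] := cauchy_int r xh.
have ig : intg Rp (fun y => (4 * K / (x / 2)) * M * ((x / 2) ^+ 2 + (y + r) ^+ 2)^-1) by exact: intgZ.
have q0 y : 0 < (x / 2) ^+ 2 + (y + r) ^+ 2 by rewrite ltr_pwDl ?sqr_ge0// exprn_gt0.
have bd s y z : 0 < y -> cmod z <= 4 * K / (x / 2) / ((x / 2) ^+ 2 + (y + r) ^+ 2) ->
    cmod (z * q y) <= (4 * K / (x / 2)) * M * ((x / 2) ^+ 2 + (y + r) ^+ 2)^-1.
  move=> y0 hz'; rewrite cmodM mulrAC; apply: ler_pM; rewrite ?cmod_ge0//.
  by case: (bq y y0).
rewrite layerE; split.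
- apply: (cint_ccont mRp xh _ _ ig) => [s sx|y /Rp_gt0 y0|s y sx /Rp_gt0 y0].
  + by apply: cmeasM => //; case: (mh s sx) => _ _ _ [].
  + by apply: ccontM; [apply: ccont_h11; case: (hz x y xx y0)|exact: ccont_cst].
  + by apply: bd => //; case: (hz s y sx y0) => _ _ _ _ [].
- apply: (cint_ccont mRp xh _ _ ig) => [s sx|y /Rp_gt0 y0|s y sx /Rp_gt0 y0].
  + by apply: cmeasM => //; case: (mh s sx) => _ _ _ [].
  + by apply: ccontM; [apply: ccont_h22; case: (hz x y xx y0)|exact: ccont_cst].
  + by apply: bd => //; case: (hz s y sx y0) => _ _ _ _ [].
Qed.

Lemma u_ccont x b r b' r' : 0 < x -> offset_ok b r -> offset_ok b' r' ->
  ccont (fun s => u11 s b r b' r') x /\ ccont (fun s => u22 s b r b' r') x.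
Proof.
move=> x0 ok ok'; have [a1 a2] := layer_ccont x0 ok gp; have [b1 b2] := layer_ccont x0 ok' gn.
split.
  rewrite (_ : (fun s => _) = fun s => e * (layer h11 p s b r + layer h11 n s b' r')); last by apply/funext => s; rewrite u11E.
  by apply: ccontM; [exact: ccont_cst|exact: ccontD].
rewrite (_ : (fun s => _) = fun s => e * (layer h22 p s b r + layer h22 n s b' r')); last by apply/funext => s; rewrite u22E.
by apply: ccontM; [exact: ccont_cst|exact: ccontD].
Qed.

Lemma u_dx x b r b' r' : 0 < x -> offset_ok b r -> offset_ok b' r' ->
  [/\ cder (fun s => u0 s b r b' r') x (e * u1 x b r b' r'),
      cder (fun s => u1 s b r b' r') x (e * u11 x b r b' r') &
      exists D, cder (fun s => u2 s b r b' r') x D].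
Proof.
move=> x0 ok ok'; have x2 : x / 2 < x < 2 * x by apply/andP; split; lra.
have xh : 0 < x / 2 by rewrite divr_gt0.
have [a1 a2 a3] := layer_dx x2 ok xh (fun s => dist_low_half b r x0) gp.
have [b1 b2 b3] := layer_dx x2 ok' xh (fun s => dist_low_half b' r' x0) gn.
have uE (F G : R -> C) : (forall s, F s = G s) -> forall D, cder G x D -> cder F x D.
  by move=> /funext -> .
split.
- apply: (uE _ _ (fun s => u0E s b r b' r')).
  by apply: cder_eq (cderZ e (cderD a1 b1)) _; rewrite u1E; ring.
- apply: (uE _ _ (fun s => u1E s b r b' r')).
  by apply: cder_eq (cderZ e (cderD a2 b2)) _; rewrite u11E; ring.
- apply: ex_intro; apply: (uE _ _ (fun s => u2E s b r b' r')); exact: (cderZ e (cderB b3 a3)).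
Qed.

Lemma u_pde x b r b' r' : 0 < x -> offset_ok b r -> offset_ok b' r' ->
  u11 x b r b' r' + u22 x b r b' r' = - (k ^+ 2)%:C * u0 x b r b' r'.
Proof.
move=> x0 ok ok'.
have x0' : 0 < `|x| by rewrite normr_gt0 gt_eqF.
have W_pde q c s : offset_ok c s -> good M q -> layer h11 q x c s + layer h22 q x c s = - (k ^+ 2)%:C * layer h0 q x c s.
  move=> okc gq.
  have [[i0 _] _ _ [[i11 _] [i22 _] _]] := layer_bounds okc x0' (dist_low_x x c s) gq.
  rewrite layerE -cintD// -cintZ//; apply: eq_cint => y /Rp_gt0 y0.
  by rewrite -mulrDl h_pde ?mulrA//; case: (kernel_bounds_displ okc x0' (dist_low_x x c s) y0).
have := W_pde p b r ok gp; have := W_pde n b' r' ok' gn => E1 E2.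
rewrite u11E u22E u0E -mulrDr addrACA E1 E2; ring.
Qed.
Lemma u_seq x b r b' r' be ga be' ga' (s : nat -> R) : 0 < x -> offset_ok b r -> offset_ok b' r' ->
  (forall i, offset_ok (b + be * s i) (r + ga * s i)) -> (forall i, offset_ok (b' + be' * s i) (r' + ga' * s i)) ->
  (forall i, `|ga * s i| <= x / 2) -> (forall i, `|ga' * s i| <= x / 2) -> s i @[i --> \oo] --> 0 ->
  ccvg (fun i => u0 x (b + be * s i) (r + ga * s i) (b' + be' * s i) (r' + ga' * s i)) (u0 x b r b' r') /\
  ccvg (fun i => u2 x (b + be * s i) (r + ga * s i) (b' + be' * s i) (r' + ga' * s i)) (u2 x b r b' r').
Proof.
move=> x0 ok ok' oks oks' sx sx' s0.
have [P0 P2] := layer_seq x0 gp ok oks sx s0; have [N0 N2] := layer_seq x0 gn ok' oks' sx' s0.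
split.
  rewrite u0E (_ : (fun i => _) = fun i => e * (layer h0 p x (b + be * s i) (r + ga * s i) +
     layer h0 n x (b' + be' * s i) (r' + ga' * s i))); last by apply/funext => i; rewrite u0E.
  exact: (ccvgM (ccvg_cst e) (ccvgD P0 N0)).
rewrite u2E (_ : (fun i => _) = fun i => e * (layer h2 n x (b' + be' * s i) (r' + ga' * s i)
  - layer h2 p x (b + be * s i) (r + ga * s i))); last by apply/funext => i; rewrite u2E.
exact: (ccvgM (ccvg_cst e) (ccvgB N2 P2)).
Qed.
End pair.

(** * Green's identity on one slice *)

Section slice.
Variables (p n : R -> C) (M : R).
Hypotheses (gp : good M p) (gn : good M n).
Variables (b r b' r' A : R).
Hypotheses (ok : offset_ok b r) (ok' : offset_ok b' r').
Local Notation v0 x := (u0 p n x b r b' r').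
Local Notation v1 x := (u1 p n x b r b' r').
Local Notation v11 x := (u11 p n x b r b' r').
Local Notation v22 x := (u22 p n x b r b' r').
Local Notation v2 x := (u2 p n x b r b' r').
Hypothesis vA : forall x, 0 < x -> [/\ cmod (v1 x) <= A, cmod (v2 x) <= A & cmod (v22 x) <= A].

Lemma cauchy_wtE (x : R) : cauchy_wt x = (1 + x ^+ 2)^-1. Proof. by []. Qed.

Lemma sqr_le_cauchy_wt (x X Y : R) : 0 < x -> 0 <= Y -> X ^+ 2 <= Y ^+ 2 -> (X * x) ^+ 2 <= Y ^+ 2 -> X ^+ 2 <= 2 * Y ^+ 2 * cauchy_wt x.
Proof.
move=> x0 Y0 h1 h2; rewrite ler_pdivlMr ?opr2_gt0//.
by rewrite exprMn in h2; lra.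
Qed.

Lemma A_ge0 : 0 <= A.
Proof. by have [h _ _] := vA ltr01; exact: le_trans (cmod_ge0 _) h. Qed.

Definition Cs := 2 * (A + field_const M) ^+ 2 + k ^+ 2 * field_const M ^+ 2.

Lemma sq_bd (z : C) x : 0 < x -> cmod z <= A -> cmod z <= field_const M / x ->
  cmod z ^+ 2 <= Cs * cauchy_wt x.
Proof.
move=> x0 zA zQ; have A0 := A_ge0; have Q0 := field_const_ge0 gp; have w0 := cauchy_wt_gt0 x.
have h : cmod z ^+ 2 <= 2 * (A + field_const M) ^+ 2 * cauchy_wt x.
  apply: sqr_le_cauchy_wt => //; first by nonneg.
    by rewrite lerXn2r ?nnegrE ?cmod_ge0//; [nonneg|rewrite (le_trans zA)// lerDl].
  rewrite lerXn2r ?nnegrE ?mulr_ge0 ?cmod_ge0 ?(ltW x0)//; first by nonneg.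
  by rewrite -ler_pdivlMr// (le_trans zQ)// ler_wpM2r ?invr_ge0 ?(ltW x0)// lerDr.
apply: (le_trans h); rewrite ler_wpM2r ?(ltW w0)// /Cs lerDl; nonneg.
Qed.

Lemma v_cont x : 0 < x -> [/\ ccont (fun x => v0 x) x, ccont (fun x => v1 x) x,
  ccont (fun x => v2 x) x, ccont (fun x => v11 x) x & ccont (fun x => v22 x) x].
Proof.
move=> x0; have [d0 d1 [D d2]] := u_dx gp gn x0 ok ok'; have [c1 c2] := u_ccont gp gn x0 ok ok'.
by split; [exact: (cder_ccont d0)|exact: (cder_ccont d1)|exact: (cder_ccont d2)|exact: c1|exact: c2].
Qed.

Lemma v_prod (F G : R -> C) : (forall x, 0 < x -> ccont F x) -> (forall x, 0 < x -> ccont G x) ->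
  (forall x, 0 < x -> cmod (F x) * cmod (G x) <= Cs * cauchy_wt x) ->
  cintg Rp (fun x => (F x)^* * G x).
Proof.
move=> cF cG h; have [iw _] := @intg_cauchy_wt R.
apply: (@cintg_le R Rp _ (fun x => Cs * cauchy_wt x)) => //; last 2 first.
- exact: intgZ.
- by move=> x /Rp_gt0 x0; rewrite cmodM cmodJ h.
by apply: ccont_cmeas => x x0; apply: ccontM; [exact/ccontJ/cF|exact: cG].
Qed.

Lemma v_bounds x : 0 < x -> [/\ cmod (v0 x) * cmod (v0 x) <= Cs * cauchy_wt x,
  cmod (v1 x) * cmod (v1 x) <= Cs * cauchy_wt x, cmod (v2 x) * cmod (v2 x) <= Cs * cauchy_wt x &
  cmod (v0 x) * cmod (v22 x) <= Cs * cauchy_wt x /\ cmod (v0 x) * cmod (v11 x) <= Cs * cauchy_wt x].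
Proof.
move=> x0; have [A1 A2 A3] := vA x0; have [B0 B1 B2 _] := field_bounds gp gn x0 ok ok'.
have A0 := A_ge0; have Q0 := field_const_ge0 gp; have w0 := cauchy_wt_gt0 x; have w1 := cauchy_wt_le1 x.
have v0Q : cmod (v0 x) <= field_const M by apply: (le_trans B0); rewrite -cauchy_wtE ler_piMr.
have c0 := cmod_ge0 (v0 x).
have T1 : cmod (v0 x) * cmod (v0 x) <= field_const M * (field_const M * cauchy_wt x) by apply: ler_pM.
have T2 : cmod (v0 x) * cmod (v22 x) <= field_const M * cauchy_wt x * A by apply: ler_pM => //; exact: cmod_ge0.
(* [v11] is controlled by [v0] and [v22] through the equation. *)
have T3 : cmod (v11 x) <= k ^+ 2 * cmod (v0 x) + cmod (v22 x).
  have -> : v11 x = - (k ^+ 2)%:C * v0 x - v22 x by rewrite -(u_pde gp gn x0 ok ok') addrK.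
  rewrite (le_trans (ler_cmodB _ _))// cmodM cmodN cmodC ger0_norm ?sqr_ge0//.
have e1 : 0 <= A * field_const M * cauchy_wt x by nonneg.
have e2 : 0 <= A * A * cauchy_wt x by nonneg.
have e3 : 0 <= field_const M * field_const M * cauchy_wt x by nonneg.
have e4 : 0 <= k ^+ 2 * (field_const M * field_const M * cauchy_wt x) by nonneg.
have CE : Cs * cauchy_wt x = 2 * (A * A * cauchy_wt x) + 4 * (A * field_const M * cauchy_wt x) + 2 * (field_const M * field_const M * cauchy_wt x)
   + k ^+ 2 * (field_const M * field_const M * cauchy_wt x) by rewrite /Cs; ring.
have T1' : cmod (v0 x) * cmod (v0 x) <= field_const M * field_const M * cauchy_wt x by rewrite -mulrA.
have T2' : cmod (v0 x) * cmod (v22 x) <= A * field_const M * cauchy_wt x by rewrite (le_trans T2)// mulrC mulrA.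
split.
- by rewrite CE; exact: lin1.
- by rewrite -expr2; exact: sq_bd.
- by rewrite -expr2; exact: sq_bd.
split.
  by rewrite CE; exact: lin2.
apply: (le_trans (ler_wpM2l c0 T3)).
have -> : cmod (v0 x) * (k ^+ 2 * cmod (v0 x) + cmod (v22 x)) =
  k ^+ 2 * (cmod (v0 x) * cmod (v0 x)) + cmod (v0 x) * cmod (v22 x) by ring.
have T4 := ler_wpM2l (sqr_ge0 k) T1'.
by rewrite CE; exact: lin3.
Qed.

Lemma v_bound02 x : 0 < x -> cmod (v0 x) * cmod (v2 x) <= Cs * cauchy_wt x.
Proof.
move=> x0; have [b0 _ b2 _] := v_bounds x0.
have : 0 <= (cmod (v0 x) - cmod (v2 x)) ^+ 2 by exact: sqr_ge0.
rewrite sqrrB; rewrite -expr2 in b0; rewrite -expr2 in b2; move: b0 b2.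
move: (cmod (v0 x) ^+ 2) (cmod (v2 x) ^+ 2) (cmod (v0 x) * cmod (v2 x)) => X Y Z; lra.
Qed.

Lemma v_cintg02 : cintg Rp (fun x => (v0 x)^* * v2 x).
Proof. by apply: v_prod => x x0; [case: (v_cont x0)|case: (v_cont x0)|exact: v_bound02]. Qed.

Lemma v_cintg : [/\ cintg Rp (fun x => (v0 x)^* * v0 x), cintg Rp (fun x => (v1 x)^* * v1 x),
  cintg Rp (fun x => (v2 x)^* * v2 x), cintg Rp (fun x => (v0 x)^* * v22 x) &
  cintg Rp (fun x => (v0 x)^* * v11 x)].
Proof.
by split; apply: v_prod => x x0; case: (v_cont x0) => //; case: (v_bounds x0) => // _ _ _ [].
Qed.

(** The derivative of [v0^* * v1] along the slice is [e^* |v1|^2 + e v0^* v11], and the equation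
    replaces [v11] by [v22]. The limit [l] at the edge [x = 0] is kept: it vanishes in the strip and
    carries the flux density of the other pair in the corner. *)
Lemma slice_green l : ccvg (fun i => (v0 (lo 0 i))^* * v1 (lo 0 i)) l ->
  e * cint Rp (fun x => (v0 x)^* * v22 x) =
  - (k ^+ 2)%:C * e * cint Rp (fun x => (v0 x)^* * v0 x) + l + e^* * cint Rp (fun x => (v1 x)^* * v1 x).
Proof.
move=> vl; have [i0 i1 i2 i22 i11] := v_cintg; have [h1 h2 h3] := exh_ray (0 : R).
have Q0 := field_const_ge0 gp.
have FTC : cint Rp (fun x => e^* * ((v1 x)^* * v1 x) + e * ((v0 x)^* * v11 x)) = 0 - l.
  apply: (@cint_FTC R Rp (fun x => (v0 x)^* * v1 x) (fun x => e^* * ((v1 x)^* * v1 x) + e * ((v0 x)^* * v11 x))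
    (lo 0) (hi 0) l 0 mRp h1 h2 h3).
  - move=> x /Rp_gt0 x0; have [d0 d1 _] := u_dx gp gn x0 ok ok'.
    by apply: cder_eq (cderM (cderJ d0) d1) _; rewrite conjM; ring.
  - move=> x /Rp_gt0 x0; have [c0 c1 c2 c11 c22] := v_cont x0; have cJ0 := ccontJ c0; have cJ1 := ccontJ c1.
    by apply: ccontD; (apply: ccontM; [exact: ccont_cst|exact: ccontM]).
  - by apply: cintgD => //; exact: cintgZ.
  - exact: vl.
  - apply: (@ccvg_le R _ _ (fun n => field_const M * field_const M / hi 0 n)); last exact: hiV_cvg.
    move=> i; rewrite subr0 /= cmodM cmodJ -mulrA.
    have x0 := @hi_gt0 R i; have [B0 B1 _ _] := field_bounds gp gn x0 ok ok'.
    apply: ler_pM B1; rewrite ?cmod_ge0// (le_trans B0)// -cauchy_wtE ler_piMr//; exact: cauchy_wt_le1.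
rewrite cintD// in FTC; [|exact: cintgZ..].
rewrite !cintZ// sub0r in FTC.
have -> : cint Rp (fun x => (v0 x)^* * v22 x) = - (k ^+ 2)%:C * cint Rp (fun x => (v0 x)^* * v0 x) - cint Rp (fun x => (v0 x)^* * v11 x).
  rewrite -cintZ// -cintB//; last exact: cintgZ.
  apply: eq_cint => x /Rp_gt0 x0.
  have -> : v22 x = - (k ^+ 2)%:C * v0 x - v11 x by rewrite -(u_pde gp gn x0 ok ok') addrAC subrr add0r.
  by ring.
move: (cint Rp (fun x => (v1 x)^* * v1 x)) (cint Rp (fun x => (v0 x)^* * v11 x)) (cint Rp (fun x => (v0 x)^* * v0 x)) FTC => J1 J11 J0.
by move=> FTC; rewrite -[l]opprK -FTC; ring.
Qed.

End slice.

Fact flux_key : {f : (R -> C) -> (R -> C) -> R | f = fun p n =>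
  Im (cint Rp (fun x => (u0 p n x 0 0 (2 * a) 0)^* * u2 p n x 0 0 (2 * a) 0))}.
Proof. by eexists. Qed.
Definition flux := sval flux_key.
Lemma fluxE p n : flux p n = Im (cint Rp (fun x => (u0 p n x 0 0 (2 * a) 0)^* * u2 p n x 0 0 (2 * a) 0)).
Proof. by rewrite /flux (svalP flux_key). Qed.

(** * The flux across the strip *)

Section strip.
Variables (p n : R -> C) (M : R).
Hypotheses (gp : good M p) (gn : good M n).

(** [t = a] is the ray of [p] and [t = - a] that of [n]. *)
Definition strip_flux t := cint Rp (fun x => (u0 p n x (a - t) 0 (a + t) 0)^* * u2 p n x (a - t) 0 (a + t) 0).

Lemma offset_ok_strip t : - a <= t <= a -> offset_ok (a - t) 0 /\ offset_ok (a + t) 0.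
Proof. by move=> /andP[h1 h2]; split; right; split; lra. Qed.

Lemma u_dt x t : 0 < x -> - a < t < a ->
  cder (fun t => u0 p n x (a - t) 0 (a + t) 0) t (u2 p n x (a - t) 0 (a + t) 0) /\
  cder (fun t => u2 p n x (a - t) 0 (a + t) 0) t (u22 p n x (a - t) 0 (a + t) 0).
Proof.
move=> x0 /andP[t1 t2].
have x0' : 0 < `|x| by rewrite normr_gt0 gt_eqF.
have ok s : 0 < s < 2 * a -> offset_ok s 0 by move=> /andP[h1 h2]; right; split; lra.
have b1 : 0 < a - t < 2 * a by apply/andP; split; lra.
have b2 : 0 < a + t < 2 * a by apply/andP; split; lra.
have [P0 P2] := layer_db b1 ok x0' (fun s _ => dist_low_x x s 0) gp.
have [N0 N2] := layer_db b2 ok x0' (fun s _ => dist_low_x x s 0) gn.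
have dm : is_derive t 1 (fun t => a - t) (-1) by apply: rder_eq (rderB (rderC a t) (rderI t)) _; rewrite sub0r.
have dp : is_derive t 1 (fun t => a + t) 1 by apply: rder_eq (rderD (rderC a t) (rderI t)) _; rewrite add0r.
split.
  rewrite (_ : (fun t => _) = fun t => e * (layer h0 p x (a - t) 0 + layer h0 n x (a + t) 0)); last by apply/funext => s; rewrite u0E.
  apply: cder_eq (cderZ e (cderD (cder_comp dm P0) (cder_comp dp N0))) _.
  by rewrite u2E rmorphN; ring.
rewrite (_ : (fun t => _) = fun t => e * (layer h2 n x (a + t) 0 - layer h2 p x (a - t) 0)); last by apply/funext => s; rewrite u2E.
apply: cder_eq (cderZ e (cderB (cder_comp dp N2) (cder_comp dm P2))) _.
by rewrite u22E rmorphN; ring.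
Qed.

Lemma strip_gap t d : 0 < d -> d <= a - t -> d <= a + t -> forall x, 0 < x ->
  let A := field_const M / d + field_const M / d ^+ 2 in
  [/\ cmod (u1 p n x (a - t) 0 (a + t) 0) <= A, cmod (u2 p n x (a - t) 0 (a + t) 0) <= A &
  cmod (u22 p n x (a - t) 0 (a + t) 0) <= A].
Proof.
move=> d0 d1 d2; have [ok1 ok2] : offset_ok (a - t) 0 /\ offset_ok (a + t) 0 by apply: offset_ok_strip; apply/andP; split; lra.
move=> x x0 A; have Q0 := field_const_ge0 gp.
have [_ b1 b2 b3] := field_bounds_gap gp gn x0 d0 d1 d2 ok1 ok2.
have q1 : 0 <= field_const M / d by rewrite divr_ge0// ltW.
have q2 : 0 <= field_const M / d ^+ 2 by rewrite divr_ge0// exprn_ge0// ltW.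
split; first by rewrite (le_trans b1)// lerDl.
  by rewrite (le_trans b2)// lerDl.
by rewrite (le_trans b3)// lerDr.
Qed.

(** The direction of [t] is unscaled, so the derivative is a real norm of [u2] plus the integral of
    [u0^* u22]. In [slice_green] the edge term vanishes because [u0] is O(x) away from the data.
    Multiplying that identity by the conjugate of [e] makes the term with [k] real and leaves the
    norm of [u1] with the factor [e ^- 2]. *)
Lemma strip_flux_der t : - a < t < a -> exists2 D, cder strip_flux t D & Im D <= 0.
Proof.
move=> /andP[t1 t2]; pose d := Num.min (a - t) (a + t) / 2.
have d0 : 0 < d by rewrite divr_gt0// lt_min; apply/andP; split; lra.
have [dm dp] : 2 * d <= a - t /\ 2 * d <= a + t.
  by rewrite /d [2 * _]mulrC divfK//; split; rewrite ge_min lexx ?orbT.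
pose A := field_const M / d + field_const M / d ^+ 2.
have gap s : t - d < s < t + d -> d <= a - s /\ d <= a + s.
  by move=> /andP[h1 h2]; split; lra.
have vA s (h : t - d < s < t + d) x (x0 : 0 < x) := strip_gap d0 (gap s h).1 (gap s h).2 x0.
have oks s : t - d < s < t + d -> offset_ok (a - s) 0 /\ offset_ok (a + s) 0.
  by move=> /gap[h1 h2]; apply: offset_ok_strip; apply/andP; split; lra.
have tt : t - d < t < t + d by apply/andP; split; lra.
have [iw _] := @intg_cauchy_wt R.
have [q1 q2] := oks t tt.
have [i0 i1 i2 i22 _] := v_cintg gp gn q1 q2 (vA t tt).
have dY : cder strip_flux t (cint Rp (fun x => (u2 p n x (a - t) 0 (a + t) 0)^* * u2 p n x (a - t) 0 (a + t) 0
   + (u0 p n x (a - t) 0 (a + t) 0)^* * u22 p n x (a - t) 0 (a + t) 0)).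
  apply: (@cint_cder R Rp (fun t x => (u0 p n x (a - t) 0 (a + t) 0)^* * u2 p n x (a - t) 0 (a + t) 0)
    (fun t x => (u2 p n x (a - t) 0 (a + t) 0)^* * u2 p n x (a - t) 0 (a + t) 0
   + (u0 p n x (a - t) 0 (a + t) 0)^* * u22 p n x (a - t) 0 (a + t) 0) t (t - d) (t + d) (fun x => 2 * Cs M A * cauchy_wt x) mRp tt).
  - by move=> s h; have [q1' q2'] := oks s h; exact: (v_cintg02 gp gn q1' q2' (vA s h)).
  - move=> s x h /Rp_gt0 x0.
    have [h1 h2] := gap s h.
    have [e1 e2] : cder (fun t => u0 p n x (a - t) 0 (a + t) 0) s (u2 p n x (a - s) 0 (a + s) 0) /\
       cder (fun t => u2 p n x (a - t) 0 (a + t) 0) s (u22 p n x (a - s) 0 (a + s) 0).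
      by apply: u_dt => //; apply/andP; split; lra.
    exact: (cderM (cderJ e1) e2).
  - exact: intgZ.
  - move=> s x h /Rp_gt0 x0; have [q1' q2'] := oks s h.
    have [_ _ b2 [b22 _]] := v_bounds gp gn q1' q2' (vA s h) x0.
    rewrite (le_trans (ler_cmodD _ _))// !cmodM !cmodJ -mulrA mulr2n mulrDl mul1r.
    by apply: lerD; [exact: b2|exact: b22].
eexists; first exact: dY.
rewrite cintD//.
have vl : ccvg (fun i => (u0 p n (lo 0 i) (a - t) 0 (a + t) 0)^* * u1 p n (lo 0 i) (a - t) 0 (a + t) 0) 0.
  apply: (@ccvg_le R _ _ (fun i => (field_const M / d * (field_const M / d)) * lo 0 i)); last exact: loV_cvg.
  move=> i; rewrite subr0 cmodM cmodJ; have l0 := @lo_gt0 R i.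
  have [h1 h2] := gap t tt.
  have [b0 b1 _ _] := field_bounds_gap gp gn l0 d0 h1 h2 q1 q2.
  by rewrite mulrAC; apply: ler_pM; rewrite ?cmod_ge0.
have G := slice_green gp gn q1 q2 (vA t tt) vl; rewrite addr0 in G.
rewrite cint_normsq; rewrite !cint_normsq in G.
have := normsq_ge0 (fun x => u1 p n x (a - t) 0 (a + t) 0); move: G.
move: (cint Rp (fun x => (u0 p n x (a - t) 0 (a + t) 0)^* * u22 p n x (a - t) 0 (a + t) 0))
  (\int[mu]_(x in Rp) (cmod (u0 p n x (a - t) 0 (a + t) 0) ^+ 2))
  (\int[mu]_(x in Rp) (cmod (u1 p n x (a - t) 0 (a + t) 0) ^+ 2))
  (\int[mu]_(x in Rp) (cmod (u2 p n x (a - t) 0 (a + t) 0) ^+ 2)) => J22 J0 J1 J2 G J10.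
have -> : J22 = - (k ^+ 2 * J0)%:C + e^* * e^* * J1%:C.
  transitivity (e^* * (e * J22)); first by rewrite mulrA eJe mul1r.
  rewrite G mulrDr.
  have -> : e^* * (- (k ^+ 2)%:C * e * J0%:C) = - ((e^* * e) * ((k ^+ 2)%:C * J0%:C)) by ring.
  by rewrite eJe mul1r (rmorphM (real_complex R) (k ^+ 2) J0) mulrA.
rewrite !(ReImE, Re_e, Im_e).
have c0 := cth_gt0 th0 th1; have s0 := sth_gt0 th0 th1.
have sc : 0 <= sin th * cos th * J1 by rewrite !mulr_ge0// ltW.
move: (sin th) (cos th) sc => s c sc.
rewrite (_ : _ + _ = - (2 * (s * c * J1))); first by rewrite oppr_le0 mulr_ge0.
by ring.
Qed.

Lemma strip_flux_nincr s t : - a < s -> s <= t -> t < a -> Im (strip_flux t) <= Im (strip_flux s).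
Proof.
move=> h1 h2 h3.
(* The derivative is at hand inside []- a, a[] only; outside, the value 0 makes the choice a total
   function [f']. *)
have dd x : exists D, - a < x < a -> cder strip_flux x D /\ Im D <= 0.
  have [h|h] := boolP (- a < x < a); last by exists 0.
  by have [D d1 d2] := strip_flux_der h; exists D.
pose f' x := Im (sval (cid (dd x))).
apply: (@nincr_der R (fun x => Im (strip_flux x)) f' (- a) a) => // x xa; rewrite /f'; case: (cid _) => D /= /(_ xa) [d1 d2] //.
by case: d1.
Qed.

Lemma edge_prod x (z w : C) : 0 < x -> cmod z <= field_const M / (1 + x ^+ 2) -> cmod w <= field_const M / Num.sqrt x ->
  cmod (z^* * w) <= 2 * field_const M ^+ 2 * edgew x.
Proof.
move=> x0 b0 b2; have Q0 := field_const_ge0 gp; rewrite cmodM cmodJ.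
have -> : 2 * field_const M ^+ 2 * edgew x = (field_const M * (2 / (1 + x))) * (field_const M / Num.sqrt x).
  by rewrite /edgew invfM; ring.
apply: ler_pM => //; rewrite ?cmod_ge0//; apply: (le_trans b0).
rewrite ler_wpM2l// -[2 / _]invrK lef_pV2 ?posrE ?invr_gt0 ?divr_gt0 ?opr2_gt0//; try lra.
rewrite invf_div ler_pdivrMr//; have : 0 <= (x - 1) ^+ 2 by exact: sqr_ge0.
by rewrite sqrrB expr1n mulr1; have := sqr_ge0 x; lra.
Qed.

Lemma edge_bd x b r b' r' : 0 < x -> offset_ok b r -> offset_ok b' r' -> - x <= r -> - x <= r' ->
  cmod ((u0 p n x b r b' r')^* * u2 p n x b r b' r') <= 2 * field_const M ^+ 2 * edgew x.
Proof.
move=> x0 ok ok' r0 r0'; have Q0 := field_const_ge0 gp.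
have [b0 _ _ [_ _ [_ /(_ r0 r0') b2]]] := field_bounds gp gn x0 ok ok'.
exact: edge_prod.
Qed.

Lemma meas02 b r b' r' : offset_ok b r -> offset_ok b' r' ->
  cmeas Rp (fun x => (u0 p n x b r b' r')^* * u2 p n x b r b' r').
Proof.
move=> q1 q2; apply: ccont_cmeas => x x0; have [d1 _ [D d2]] := u_dx gp gn x0 q1 q2.
exact: (cder_ccont (cderM (cderJ d1) d2)).
Qed.

Lemma cintg02 b r b' r' : offset_ok b r -> offset_ok b' r' -> 0 <= r -> 0 <= r' ->
  cintg Rp (fun x => (u0 p n x b r b' r')^* * u2 p n x b r b' r').
Proof.
move=> q1 q2 r0 r0'; apply: (@cintg_le R Rp _ (fun x => 2 * field_const M ^+ 2 * edgew x)) => //.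
- exact: meas02.
- by apply: intgZ => //; exact: intg_edgew.
- by move=> x /Rp_gt0 x0; apply: edge_bd => //; [apply: le_trans r0|apply: le_trans r0']; rewrite oppr_le0 ltW.
Qed.

(** The bounds by the width of the gap degenerate as [t] tends to [a]. The edge bound, which rests
    on the behaviour [sqrt y] of the data, gives the majorant [edgew] uniformly in [t]. *)
Lemma strip_flux_cvg : ccvg (fun i => strip_flux (a - a / i.+2%:R))
  (cint Rp (fun x => (u0 p n x 0 0 (2 * a) 0)^* * u2 p n x 0 0 (2 * a) 0)).
Proof.
pose s i : R := a / i.+2%:R.
have s0 i : 0 < s i by rewrite divr_gt0.
have sa i : s i <= a by rewrite ler_pdivrMr// ler_peMr ?(ltW a0)// ler1n.
have scvg : s i @[i --> \oo] --> 0 by have := @hiV_cvg R a; under eq_fun do rewrite /hi add0r.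
have ok1 : offset_ok 0 0 by left.
have ok2 : offset_ok (2 * a) 0 by right; split => //; rewrite mulr_ge0// ltW.
have oks1 i : offset_ok (0 + 1 * s i) (0 + 0 * s i).
  by right; rewrite add0r mul1r mul0r addr0; split => //; have := s0 i; have := sa i; move: (s i) => z *; lra.
have oks2 i : offset_ok (2 * a + - 1 * s i) (0 + 0 * s i).
  by right; rewrite mulN1r mul0r addr0; split => //; have := s0 i; have := sa i; move: (s i) => z *; lra.
have bE i : a - (a - s i) = 0 + 1 * s i by ring.
have b'E i : a + (a - s i) = 2 * a + -1 * s i by ring.
have r0E i : 0 = 0 + 0 * s i by rewrite mul0r addr0.
have ptw x : 0 < x -> ccvg (fun i => (u0 p n x (a - (a - s i)) 0 (a + (a - s i)) 0)^* * u2 p n x (a - (a - s i)) 0 (a + (a - s i)) 0)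
    ((u0 p n x 0 0 (2 * a) 0)^* * u2 p n x 0 0 (2 * a) 0).
  move=> x0; have z i : `|0 * s i| <= x / 2 by rewrite mul0r normr0 divr_ge0// ltW.
  have [L0 L2] := u_seq gp gn x0 ok1 ok2 oks1 oks2 z z scvg.
  rewrite (_ : (fun i => _) = fun i => (u0 p n x (0 + 1 * s i) (0 + 0 * s i) (2 * a + -1 * s i) (0 + 0 * s i))^* *
     u2 p n x (0 + 1 * s i) (0 + 0 * s i) (2 * a + -1 * s i) (0 + 0 * s i)); first exact: (ccvgM (ccvgJ L0) L2).
  by apply/funext => i; rewrite bE b'E -r0E.
have ig : intg Rp (fun x => 2 * field_const M ^+ 2 * edgew x) by apply: intgZ => //; exact: intg_edgew.
have okt i : offset_ok (a - (a - s i)) 0 /\ offset_ok (a + (a - s i)) 0.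
  by apply: offset_ok_strip; have := s0 i; have := sa i; move: (s i) => z *; apply/andP; split; lra.
have mF i : cmeas Rp (fun x => (u0 p n x (a - (a - s i)) 0 (a + (a - s i)) 0)^* * u2 p n x (a - (a - s i)) 0 (a + (a - s i)) 0).
  by have [q1 q2] := okt i; exact: meas02.
have bF i x : Rp x -> cmod ((u0 p n x (a - (a - s i)) 0 (a + (a - s i)) 0)^* * u2 p n x (a - (a - s i)) 0 (a + (a - s i)) 0) <= 2 * field_const M ^+ 2 * edgew x.
  move=> /Rp_gt0 x0; have [q1 q2] := okt i; apply: edge_bd => //; by rewrite oppr_le0 ltW.
by have [_ h] := cint_dcvg mRp mF (fun x Rx => ptw x (Rp_gt0 Rx)) ig bF; exact: h.
Qed.
End strip.

(** The reflection [t -> - t] exchanges the two rays and reverses the transverse direction. *)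
Lemma strip_flux_swap p n M t : good M p -> good M n -> - a <= t <= a -> strip_flux p n (- t) = - strip_flux n p t.
Proof.
move=> gp gn ta; have [q1 q2] := offset_ok_strip ta.
have S0 x : u0 p n x (a - - t) 0 (a + - t) 0 = u0 n p x (a - t) 0 (a + t) 0.
  by rewrite !u0E opprK addrC.
have S2 x : u2 p n x (a - - t) 0 (a + - t) 0 = - u2 n p x (a - t) 0 (a + t) 0.
  by rewrite !u2E opprK -mulrN opprB.
rewrite /strip_flux (eq_cint (G := fun x => -1 * ((u0 n p x (a - t) 0 (a + t) 0)^* * u2 n p x (a - t) 0 (a + t) 0))); last first.
  by move=> x _; rewrite S0 S2 mulrN mulN1r.
by rewrite cintZ ?mulN1r//; exact: (cintg02 gn gp q1 q2).
Qed.

Lemma flux_strip_le0 p n M : good M p -> good M n -> flux p n + flux n p <= 0.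
Proof.
move=> gp gn; have [_ c1] := strip_flux_cvg gp gn; have [_ c2] := strip_flux_cvg gn gp; rewrite -fluxE in c1; rewrite -fluxE in c2.
have s0 i : 0 < a / i.+2%:R by rewrite divr_gt0.
(* With [i.+2] the point [t = a - a / i.+2] is positive, so [- t <= t] and monotonicity compares the
   two ends of the strip. *)
have s1 i : a / i.+2%:R <= a / 2 by rewrite ler_wpM2l ?(ltW a0)// lef_pV2 ?posrE// ler_nat.
suff : flux p n <= - flux n p by rewrite -lerBrDr sub0r.
apply: (ler_cvg_to c1 (cvgN c2)); apply: nearW => i.
rewrite -[leRHS]/(- Im (strip_flux n p (a - a / i.+2%:R))) -ImN -(strip_flux_swap gp gn); last by have := s0 i; have := s1 i; move: (a / _.+2%:R) => z *; apply/andP; split; lra.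
by apply: (strip_flux_nincr gp gn); have := s0 i; have := s1 i; move: (a / _.+2%:R) => z *; lra.
Qed.

(** * The flux around a corner *)

Section corner1.
Variables (p n : R -> C) (M : R).
Hypotheses (gp : good M p) (gn : good M n).

Lemma offset_ok0 r : offset_ok 0 r. Proof. by left. Qed.
Lemma offset_ok2a r : 0 <= r -> offset_ok (2 * a) r.
Proof. by move=> r0; right; split => //; rewrite mulr_ge0// ltW. Qed.

Lemma u_dr x r : 0 < x -> 0 < r ->
  cder (fun r => u0 p n x 0 (- r) (2 * a) r) r (e * u2 p n x 0 (- r) (2 * a) r) /\
  cder (fun r => u2 p n x 0 (- r) (2 * a) r) r (e * u22 p n x 0 (- r) (2 * a) r).
Proof.
move=> x0 r0; pose d := Num.min r (x / 2).
have d0 : 0 < d by rewrite lt_min r0 divr_gt0.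
have [dr dx] : d <= r /\ d <= x / 2 by split; rewrite ge_min lexx ?orbT.
have i1 : - r - d < - r < - r + d by apply/andP; split; lra.
have i2 : r - d < r < r + d by apply/andP; split; lra.
have w b c s : c - d < s < c + d -> dist_low x b s x c.
  move=> /andP[h1 h2]; rewrite (_ : s = c + (s - c)); last by ring.
  by apply: dist_low_near; rewrite ler_norml; apply/andP; split; lra.
have [P0 P2] := layer_dr i1 (fun s _ => offset_ok0 s) x0 (w 0 (- r)) gp.
have ok2 s : r - d < s < r + d -> offset_ok (2 * a) s by move=> /andP[h1 h2]; apply: offset_ok2a; lra.
have [N0 N2] := layer_dr i2 ok2 x0 (w (2 * a) r) gn.
have dm : is_derive r 1 (fun r => - r) (-1) by exact: rderN (rderI r).
split.
  rewrite (_ : (fun t => _) = fun r => e * (layer h0 p x 0 (- r) + layer h0 n x (2 * a) r)); last by apply/funext => s; rewrite u0E.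
  apply: cder_eq (cderZ e (cderD (cder_comp dm P0) N0)) _.
  by rewrite u2E rmorphN; ring.
rewrite (_ : (fun t => _) = fun r => e * (layer h2 n x (2 * a) r - layer h2 p x 0 (- r))); last by apply/funext => s; rewrite u2E.
apply: cder_eq (cderZ e (cderB N2 (cder_comp dm P2))) _.
by rewrite u22E rmorphN; ring.
Qed.

Lemma corner_seq x (s : nat -> R) : 0 < x -> (forall i, 0 < s i) -> s i @[i --> \oo] --> 0 ->
  ccvg (fun i => u0 p n x 0 (- s i) (2 * a) (s i)) (u0 p n x 0 0 (2 * a) 0) /\
  ccvg (fun i => u2 p n x 0 (- s i) (2 * a) (s i)) (u2 p n x 0 0 (2 * a) 0).
Proof.
move=> x0 s0 scvg; have x2 : 0 < x / 2 by rewrite divr_gt0.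
have [N _ sN] : \forall i \near \oo, `|0 - s i| < x / 2 by move/cvgrPdist_lt: scvg => /(_ _ x2).
have sN' i : `|s (i + N)%N| <= x / 2.
  by have := sN (i + N)%N (leq_addl _ _); rewrite sub0r normrN => /ltW.
have sc' : s (i + N)%N @[i --> \oo] --> 0 by rewrite (@cvg_shiftn N R^o).
have o1 : offset_ok 0 0 by exact: offset_ok0.
have o2 : offset_ok (2 * a) 0 by exact: offset_ok2a.
have b1 i : offset_ok (0 + 0 * s (i + N)%N) (0 + -1 * s (i + N)%N) by rewrite mul0r addr0; exact: offset_ok0.
have b2 i : offset_ok (2 * a + 0 * s (i + N)%N) (0 + 1 * s (i + N)%N).
  by rewrite mul0r addr0 add0r mul1r; apply: offset_ok2a; rewrite ltW.
have c1 i : `|-1 * s (i + N)%N| <= x / 2 by rewrite mulN1r normrN.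
have c2 i : `|1 * s (i + N)%N| <= x / 2 by rewrite mul1r.
have [L0 L2] := u_seq gp gn x0 o1 o2 b1 b2 c1 c2 sc'.
have E1 i : 0 + 0 * s (i + N)%N = 0 by rewrite mul0r addr0.
have E2 i : 0 + -1 * s (i + N)%N = - s (i + N)%N by rewrite add0r mulN1r.
have E3 i : 2 * a + 0 * s (i + N)%N = 2 * a by rewrite mul0r addr0.
have E4 i : 0 + 1 * s (i + N)%N = s (i + N)%N by rewrite add0r mul1r.
split; apply: (ccvg_shift (N := N)).
  rewrite (_ : (fun i => _) = (fun i => u0 p n x (0 + 0 * s (i + N)%N) (0 + -1 * s (i + N)%N) (2 * a + 0 * s (i + N)%N) (0 + 1 * s (i + N)%N))) //.
  by apply/funext => i; rewrite E1 E2 E3 E4.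
rewrite (_ : (fun i => _) = (fun i => u2 p n x (0 + 0 * s (i + N)%N) (0 + -1 * s (i + N)%N) (2 * a + 0 * s (i + N)%N) (0 + 1 * s (i + N)%N))) //.
by apply/funext => i; rewrite E1 E2 E3 E4.
Qed.
End corner1.

Section corner.
Variables (p n p' n' : R -> C) (M : R).
Hypotheses (gp : good M p) (gn : good M n) (gp' : good M p') (gn' : good M n').
Hypothesis sym : forall x r, 0 < x -> 0 < r ->
  u0 p n x 0 (- r) (2 * a) r = u0 p' n' r 0 (- x) (2 * a) x.

Lemma near_pos (F G : R -> C) t D : 0 < t -> (forall s, 0 < s -> F s = G s) -> cder F t D -> cder G t D.
Proof.
move=> t0 FG; apply: near_eq_cder.
by have := lt_nbhsr t0; apply: filterS => s; exact: FG.
Qed.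

Lemma eIr (z w : C) : e * z = e * w -> z = w.
Proof. by move=> h; rewrite -[z]mul1r -[w]mul1r -(eJe th) -!mulrA h. Qed.

(** Differentiating the symmetry in one variable exchanges the derivative along the ray with the
    transverse one, since both are scaled by the same [e]. *)
Lemma sym12 x r : 0 < x -> 0 < r ->
  [/\ u2 p n x 0 (- r) (2 * a) r = u1 p' n' r 0 (- x) (2 * a) x,
      u1 p n x 0 (- r) (2 * a) r = u2 p' n' r 0 (- x) (2 * a) x &
      u22 p n x 0 (- r) (2 * a) r = u11 p' n' r 0 (- x) (2 * a) x].
Proof.
have A y s : 0 < y -> 0 < s -> u2 p n y 0 (- s) (2 * a) s = u1 p' n' s 0 (- y) (2 * a) y.
  move=> y0 s0; have [h _] := u_dr gp gn y0 s0.
  have [h' _ _] := u_dx gp' gn' s0 (offset_ok0 (- y)) (offset_ok2a (ltW y0)).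
  apply: eIr; apply: (cder_unique _ h').
  by apply: near_pos h => // s' s'0; exact: sym.
move=> x0 r0; split; first exact: A.
  have [h _] := u_dr gp' gn' r0 x0.
  have [h' _ _] := u_dx gp gn x0 (offset_ok0 (- r)) (offset_ok2a (ltW r0)).
  apply: eIr; apply: (cder_unique _ h).
  by apply: near_pos h' => // s s0; exact: sym.
have [_ h] := u_dr gp gn x0 r0.
have [_ h' _] := u_dx gp' gn' r0 (offset_ok0 (- x)) (offset_ok2a (ltW x0)).
apply: eIr; apply: (cder_unique _ h').
by apply: near_pos h => // s s0; exact: A.
Qed.

Definition corner_flux r := cint Rp (fun x => (u0 p n x 0 (- r) (2 * a) r)^* * u2 p n x 0 (- r) (2 * a) r).
Definition corner_energy r := \int[mu]_(x in Rp) (cmod (u2 p n x 0 (- r) (2 * a) r) ^+ 2) +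
  k ^+ 2 * \int[mu]_(x in Rp) (cmod (u0 p n x 0 (- r) (2 * a) r) ^+ 2) +
  \int[mu]_(x in Rp) (cmod (u1 p n x 0 (- r) (2 * a) r) ^+ 2).
(** The edge term at [x = 0] of Green's identity on the slice at height [r]: by the symmetry it is
    the flux density of the other pair at the point [r] of its ray. *)
Definition corner_source r := (u0 p' n' r 0 0 (2 * a) 0)^* * u2 p' n' r 0 0 (2 * a) 0.

(** The data of [p] lie below the slice, so no gap gives bounds as [x] tends to 0. For the other
    pair, however, [r] is the distance from the data and [x] a shift, and its bounds at distance [r]
    are uniform in [x]. *)
Lemma corner_gap d r : 0 < d -> d <= r -> forall x, 0 < x ->
  let A := field_const M / d + field_const M / d ^+ 2 in
  [/\ cmod (u1 p n x 0 (- r) (2 * a) r) <= A, cmod (u2 p n x 0 (- r) (2 * a) r) <= A &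
  cmod (u22 p n x 0 (- r) (2 * a) r) <= A].
Proof.
move=> d0 dr x x0 A; have Q0 := field_const_ge0 gp; have r0 := lt_le_trans d0 dr.
have [-> -> ->] := sym12 x0 r0.
have [_ b1 b2 [b3 _ _]] := field_bounds gp' gn' r0 (offset_ok0 (- x)) (offset_ok2a (ltW x0)).
have q1 : 0 <= field_const M / d by rewrite divr_ge0// ltW.
have q2 : 0 <= field_const M / d ^+ 2 by rewrite divr_ge0// exprn_ge0// ltW.
have e1 : field_const M / r <= field_const M / d by rewrite ler_wpM2l// lef_pV2 ?posrE.
have e2 : field_const M / r ^+ 2 <= field_const M / d ^+ 2.
  by rewrite ler_wpM2l// lef_pV2 ?posrE ?exprn_gt0// lerXn2r ?nnegrE ?(ltW d0) ?(ltW r0).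
split.
- by rewrite (le_trans b2)// (le_trans e1)// lerDl.
- by rewrite (le_trans b1)// (le_trans e1)// lerDl.
- by rewrite (le_trans b3)// (le_trans e2)// lerDr.
Qed.

(** Here [r] is scaled as well: the derivative is [e^*] times the norm of [u2] plus [e] times the
    integral of [u0^* u22], and [slice_green] turns the latter into
    [- k^2 e |u0|^2 + l + e^* |u1|^2]. All three norms come with the imaginary part [- sin th]. *)
Lemma corner_flux_der r : 0 < r -> exists2 D, cder corner_flux r D & Im D = - (sin th * corner_energy r) + Im (corner_source r).
Proof.
move=> r0; pose d := r / 2; have d0 : 0 < d by rewrite divr_gt0.
pose A := field_const M / d + field_const M / d ^+ 2.
have gap s : d < s < 2 * r -> d <= s /\ 0 < s.
  by move=> /andP[h1 h2]; rewrite ltW//; split=> //; exact: lt_trans h1.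
have vA s (h : d < s < 2 * r) x (x0 : 0 < x) := corner_gap d0 (gap s h).1 x0.
have ok1 s := offset_ok0 (- s).
have ok2 s (h : d < s < 2 * r) := offset_ok2a (ltW (gap s h).2).
have rr : d < r < 2 * r by rewrite /d; apply/andP; split; lra.
have [iw _] := @intg_cauchy_wt R.
have [i0 i1 i2 i22 _] := v_cintg gp gn (ok1 r) (ok2 r rr) (vA r rr).
pose F (r x : R) : C := (u0 p n x 0 (- r) (2 * a) r)^* * u2 p n x 0 (- r) (2 * a) r.
pose F' (r x : R) : C := e^* * ((u2 p n x 0 (- r) (2 * a) r)^* * u2 p n x 0 (- r) (2 * a) r)
   + e * ((u0 p n x 0 (- r) (2 * a) r)^* * u22 p n x 0 (- r) (2 * a) r).
have dZ : cder corner_flux r (cint Rp (F' r)).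
  apply: (@cint_cder R Rp F F' r d (2 * r) (fun x => 2 * Cs M A * cauchy_wt x) mRp rr).
  - by move=> s h; exact: (v_cintg02 gp gn (ok1 s) (ok2 s h) (vA s h)).
  - move=> s x h /Rp_gt0 x0; have [_ s0] := gap s h.
    have [e1 e2] := u_dr gp gn x0 s0.
    by apply: cder_eq (cderM (cderJ e1) e2) _; rewrite /F' conjM; ring.
  - exact: intgZ.
  - move=> s x h /Rp_gt0 x0.
    have [_ _ b2 [b22 _]] := v_bounds gp gn (ok1 s) (ok2 s h) (vA s h) x0.
    rewrite (le_trans (ler_cmodD _ _))// !cmodM !cmodJ cmod_e !mul1r.
    have -> : 2 * Cs M A * cauchy_wt x = Cs M A * cauchy_wt x + Cs M A * cauchy_wt x by ring.
    by apply: lerD; [exact: b2|exact: b22].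
eexists; first exact: dZ.
have vl : ccvg (fun i => (u0 p n (lo 0 i) 0 (- r) (2 * a) r)^* * u1 p n (lo 0 i) 0 (- r) (2 * a) r) (corner_source r).
  have [L0 L2] := corner_seq gp' gn' r0 (@lo_gt0 R) (@lo_cvg R 0).
  rewrite (_ : (fun i => _) = fun i => (u0 p' n' r 0 (- lo 0 i) (2 * a) (lo 0 i))^* * u2 p' n' r 0 (- lo 0 i) (2 * a) (lo 0 i)).
    exact: (ccvgM (ccvgJ L0) L2).
  apply/funext => i; rewrite sym ?lo_gt0//.
  by have [_ -> _] := sym12 (@lo_gt0 R i) r0.
have G := slice_green gp gn (ok1 r) (ok2 r rr) (vA r rr) vl.
rewrite /F' cintD//; [|exact: cintgZ..].
rewrite cintZ// cintZ// G.
rewrite !cint_normsq /corner_energy.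
move: (\int[mu]_(x in Rp) (cmod (u0 p n x 0 (- r) (2 * a) r) ^+ 2))
  (\int[mu]_(x in Rp) (cmod (u1 p n x 0 (- r) (2 * a) r) ^+ 2))
  (\int[mu]_(x in Rp) (cmod (u2 p n x 0 (- r) (2 * a) r) ^+ 2)) (corner_source r) => J0 J1 J2 l.
rewrite !(ReImE, Re_e, Im_e).
by move: (k ^+ 2) (sin th) (cos th) (Im l) => k2 s c L; ring.
Qed.

(** Majorants for [r -> 0] and [r -> +oo]. The edge bound of the field itself holds for [r <= x];
    for [x < r] the symmetry gives the edge bound of the other field in [r], which is smaller. *)
Lemma corner_bd r x : 0 < r -> 0 < x ->
  cmod ((u0 p n x 0 (- r) (2 * a) r)^* * u2 p n x 0 (- r) (2 * a) r) <= 2 * field_const M ^+ 2 * edgew x /\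
  cmod ((u0 p n x 0 (- r) (2 * a) r)^* * u2 p n x 0 (- r) (2 * a) r) <= (field_const M / (1 + r ^+ 2)) * (field_const M / Num.sqrt x).
Proof.
move=> r0 x0; have Q0 := field_const_ge0 gp.
have [b0 _ _ [_ _ [_ b2]]] := field_bounds gp gn x0 (offset_ok0 (- r)) (offset_ok2a (ltW r0)).
have [B0 _ _ [_ _ [B1 _]]] := field_bounds gp' gn' r0 (offset_ok0 (- x)) (offset_ok2a (ltW x0)).
have E : cmod (u2 p n x 0 (- r) (2 * a) r) <= field_const M / Num.sqrt x.
  have [rx|xr] := leP r x.
    by apply: b2; [rewrite lerN2|apply: (le_trans _ (ltW r0)); rewrite oppr_le0 ltW].
  have [-> _ _] := sym12 x0 r0.
  apply: (le_trans (B1 _ _)); first by rewrite lerN2 ltW.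
    by apply: (le_trans _ (ltW x0)); rewrite oppr_le0 ltW.
  by rewrite ler_wpM2l// lef_pV2 ?posrE ?sqrtr_gt0// ler_sqrt// ltW.
split; first exact: (edge_prod gp).
by rewrite cmodM cmodJ; apply: ler_pM; rewrite ?cmod_ge0// sym.
Qed.

Lemma corner_cvg (s : nat -> R) (L : R -> C) : (forall i, 0 < s i) ->
  (forall x, 0 < x -> ccvg (fun i => (u0 p n x 0 (- s i) (2 * a) (s i))^* * u2 p n x 0 (- s i) (2 * a) (s i)) (L x)) ->
  ccvg (fun i => corner_flux (s i)) (cint Rp L).
Proof.
move=> s0 h; have ig : intg Rp (fun x => 2 * field_const M ^+ 2 * edgew x) by apply: intgZ => //; exact: intg_edgew.
have mF i : cmeas Rp (fun x => (u0 p n x 0 (- s i) (2 * a) (s i))^* * u2 p n x 0 (- s i) (2 * a) (s i)).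
  by apply: (meas02 gp gn); [exact: offset_ok0|exact: offset_ok2a (ltW (s0 i))].
have bF i x : Rp x -> cmod ((u0 p n x 0 (- s i) (2 * a) (s i))^* * u2 p n x 0 (- s i) (2 * a) (s i)) <= 2 * field_const M ^+ 2 * edgew x.
  by move=> /Rp_gt0 x0; case: (corner_bd (s0 i) x0).
by have [_ h'] := cint_dcvg mRp mF (fun x Rx => h x (Rp_gt0 Rx)) ig bF; exact: h'.
Qed.

Lemma corner_flux_lo : Im (corner_flux (lo 0 i)) @[i --> \oo] --> flux p n.
Proof.
have [] := @corner_cvg (lo 0) (fun x => (u0 p n x 0 0 (2 * a) 0)^* * u2 p n x 0 0 (2 * a) 0) (@lo_gt0 R).
  move=> x x0; have [L0 L2] := corner_seq gp gn x0 (@lo_gt0 R) (@lo_cvg R 0).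
  exact: (ccvgM (ccvgJ L0) L2).
by move=> _ h; rewrite fluxE.
Qed.

Lemma corner_flux_hi : Im (corner_flux (hi 0 i)) @[i --> \oo] --> 0.
Proof.
have Q0 := field_const_ge0 gp.
have [] := @corner_cvg (hi 0) (fun x => 0) (@hi_gt0 R).
  move=> x x0; apply: (@ccvg_le R _ _ (fun n => field_const M * (field_const M / Num.sqrt x) / hi 0 n)); last exact: hiV_cvg.
  move=> i; rewrite subr0; have r0 := @hi_gt0 R i.
  have [_ h] := corner_bd r0 x0; apply: (le_trans h).
  rewrite [leRHS]mulrAC; apply: ler_wpM2r; first by rewrite divr_ge0 ?sqrtr_ge0.
  rewrite ler_wpM2l// lef_pV2 ?posrE ?opr2_gt0//.
  have : 0 <= (hi 0 i - 1) ^+ 2 :> R by exact: sqr_ge0.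
  by rewrite sqrrB expr1n mulr1; have := sqr_ge0 (hi 0 i); lra.
move=> _; rewrite /cint /=; rewrite (_ : \int[mu]_(_ in _) _ = 0)//.
by rewrite /Rintegral integral0.
Qed.

(** [corner_flux] minus the primitive of its source is nonincreasing in [r], equals [flux p n] in
    the limit 0 and [- flux p' n'] at infinity. If these agree it is constant, so the energy
    vanishes on every slice, and with it [u0]. *)
Lemma flux_corner_ge0 : 0 <= flux p n + flux p' n' /\
  (flux p n + flux p' n' = 0 -> forall x r, 0 < x -> 0 < r -> u0 p n x 0 (- r) (2 * a) r = 0).
Proof.
have s0 := sth_gt0 th0 th1.
have fi : cintg Rp corner_source by apply: (cintg02 gp' gn'); rewrite ?lexx//; [exact: offset_ok0|exact: offset_ok2a].
have fcont (r : R) : 0 < r -> ccont corner_source r.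
  move=> r0; have [d0 _ [D d2]] := u_dx gp' gn' r0 (offset_ok0 0) (offset_ok2a (lexx 0)).
  exact: (cder_ccont (cderM (cderJ d0) d2)).
pose F := prim (Im \o corner_source).
pose Ph r := Im (corner_flux r) - F r.
have dPh (r : R) : 0 < r -> is_derive r 1 Ph (- (sin th * corner_energy r)).
  move=> r0; have [D [_ d2] ImD] := corner_flux_der r0; have [_ c2] := fcont r r0.
  apply: rder_eq (rderB d2 (prim_der fi.2 r0 c2)) _.
  by rewrite ImD /= addrK.
have E0 r : 0 <= corner_energy r.
  have h2 := normsq_ge0 (fun x => u2 p n x 0 (- r) (2 * a) r).
  have h0 := normsq_ge0 (fun x => u0 p n x 0 (- r) (2 * a) r).
  have h1 := normsq_ge0 (fun x => u1 p n x 0 (- r) (2 * a) r).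
  by rewrite /corner_energy; apply: addr_ge0 => //; apply: addr_ge0 => //; rewrite mulr_ge0 ?sqr_ge0.
have mono (s t : R) : 0 < s -> s <= t -> Ph t <= Ph s.
  move=> sp st; apply: (@nincr_der R Ph (fun r => - (sin th * corner_energy r)) 0 (t + 1)) => //.
  - by move=> x /andP[x0 _]; exact: dPh.
  - by move=> x /andP[x0 _]; rewrite oppr_le0 mulr_ge0// ltW.
  - by rewrite ltrDl.
have Llo : Ph (lo 0 i) @[i --> \oo] --> flux p n.
  by rewrite -[flux p n]subr0; apply: cvgB; [exact: corner_flux_lo|exact: (prim_lo fi.2)].
have Lhi : Ph (hi 0 i) @[i --> \oo] --> - flux p' n'.
  rewrite -[- flux p' n']add0r fluxE; apply: cvgB; first exact: corner_flux_hi.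
  exact: (prim_hi fi.2).
have lo1 i : lo 0 i <= 1 :> R by rewrite /lo add0r invf_le1// ler1n.
have hi1 i : 1 <= hi 0 i :> R by rewrite /hi add0r ler1n.
have le1 : - flux p' n' <= flux p n.
  by apply: (ler_cvg_to Lhi Llo); apply: nearW => i; apply: mono; [exact: lo_gt0|exact: le_trans (hi1 i)].
split; first by rewrite -lerBlDr sub0r.
move=> fl0 x r x0 r0.
have flE : - flux p' n' = flux p n by apply/eqP; rewrite eq_sym -subr_eq0 opprK fl0.
have Phc t : 0 < t -> Ph t = flux p n.
  move=> t0; apply/eqP; rewrite eq_le; apply/andP; split.
    apply: (@ler_cvg_to _ _ _ _ (fun=> Ph t) _ _ _ (cvg_cst _) Llo).
    have := @lo_cvg R 0 => /cvgrPdist_lt /(_ t t0); apply: filterS => i.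
    rewrite sub0r normrN gtr0_norm ?lo_gt0// => h; apply: mono; [exact: lo_gt0|exact: ltW].
  rewrite -flE; apply: (@ler_cvg_to _ _ _ _ _ (fun=> Ph t) _ _ Lhi (cvg_cst _)).
  have [_ _ h3] := exh_ray (0 : R); have := h3 t; rewrite /= in_itv /= andbT => /(_ t0).
  by apply: filterS => i /andP[_ h]; exact: mono.
have dc : is_derive r 1 (cst (flux p n)) (- (sin th * corner_energy r)).
  have d := dPh r r0; have nr : \forall s \near r, Ph s = cst (flux p n) s.
    by have := lt_nbhsr r0; apply: filterS => s; exact: Phc.
  by apply: (near_eq_is_derive _ d); exact: nr.
have Er : corner_energy r = 0.
  have := @derive_val _ _ _ _ _ _ _ dc; rewrite derive_cst => /esym/eqP.
  by rewrite oppr_eq0 mulf_eq0 gt_eqF//= => /eqP.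
have h2 := normsq_ge0 (fun x => u2 p n x 0 (- r) (2 * a) r).
have h0 := normsq_ge0 (fun x => u0 p n x 0 (- r) (2 * a) r).
have h1 := normsq_ge0 (fun x => u1 p n x 0 (- r) (2 * a) r).
have k2 : 0 < k ^+ 2 by rewrite exprn_gt0.
have J0 : \int[mu]_(x in Rp) (cmod (u0 p n x 0 (- r) (2 * a) r) ^+ 2) = 0.
  have kh0 := mulr_ge0 (ltW k2) h0.
  move: Er; rewrite /corner_energy => /eqP; rewrite paddr_eq0 ?addr_ge0// => /andP[+ _].
  by rewrite paddr_eq0// mulf_eq0 (gt_eqF k2) /= => /andP[_ /eqP].
have [ok1 ok2] := (offset_ok0 (- r), offset_ok2a (ltW r0)).
have vA := corner_gap r0 (lexx r).
have [i0 _ _ _ _] := v_cintg gp gn ok1 ok2 vA.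
have := @int0_zero R (fun x => cmod (u0 p n x 0 (- r) (2 * a) r) ^+ 2) _ _ _ J0 x x0.
have sE : (fun x => cmod (u0 p n x 0 (- r) (2 * a) r) ^+ 2) = Re \o (fun x => (u0 p n x 0 (- r) (2 * a) r)^* * u0 p n x 0 (- r) (2 * a) r).
  by apply/funext => y; rewrite /= mulcJ_cmod.
move=> h; apply: cmod_eq0; apply/eqP; rewrite -sqrf_eq0; apply/eqP; apply: h.
- by rewrite sE; exact: i0.1.
- by move=> y _; rewrite sqr_ge0.
- move=> y y0; rewrite sE; have [d0 _ _] := u_dx gp gn y0 ok1 ok2.
  by have [] := cder_ccont (cderM (cderJ d0) d0).
Qed.
End corner.

(** * Symmetry at the corner *)

Section semigroup.
Variables (p n : R -> C) (M : R).
Hypotheses (gp : good M p) (gn : good M n).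
Variable x : R.
Hypothesis x0 : 0 < x.

(** The method of images: the kernel with source at [x] minus the one with source at [- x], at
    distance [T] from the ray. For [h0] it vanishes at [y = 0]. *)
Definition dif (H : R -> C -> C) (T y : R) : C := e * (H T (displ 0 (- x) y) - H T (displ 0 x y)).
Fact P0_key : {f | f = dif h0}. Proof. by eexists. Qed.
Fact P1_key : {f | f = dif h1}. Proof. by eexists. Qed.
Fact P2_key : {f | f = dif h2}. Proof. by eexists. Qed.
Fact P11_key : {f | f = dif h11}. Proof. by eexists. Qed.
Fact P22_key : {f | f = dif h22}. Proof. by eexists. Qed.
Definition P0 := sval P0_key.
Definition P1 := sval P1_key.
Definition P2 := sval P2_key.
Definition P11 := sval P11_key.
Definition P22 := sval P22_key.
Lemma P0E : P0 = dif h0. Proof. exact: svalP P0_key. Qed.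
Lemma P1E : P1 = dif h1. Proof. exact: svalP P1_key. Qed.
Lemma P2E : P2 = dif h2. Proof. exact: svalP P2_key. Qed.
Lemma P11E : P11 = dif h11. Proof. exact: svalP P11_key. Qed.
Lemma P22E : P22 = dif h22. Proof. exact: svalP P22_key. Qed.

Local Notation v0 y s := (u0 p n y 0 s (2 * a) s).
Local Notation v1 y s := (u1 p n y 0 s (2 * a) s).
Local Notation v11 y s := (u11 p n y 0 s (2 * a) s).
Local Notation v22 y s := (u22 p n y 0 s (2 * a) s).
Local Notation v2 y s := (g2 p n y 0 s (2 * a) s).

Lemma Im_krho_displ0 T r y : 0 < T -> 0 < Im (krho T (displ 0 r y)).
Proof.
move=> T0; have c0 := cth_gt0 th0 th1; have s0 := sth_gt0 th0 th1.
have -> : krho T (displ 0 r y) = (T ^+ 2 + (y + r) ^+ 2)%:C * e ^+ 2 by rewrite /krho displE; ring.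
have q0 : 0 < T ^+ 2 + (y + r) ^+ 2 by rewrite ltr_pwDl ?sqr_ge0// exprn_gt0.
rewrite [e ^+ 2]expr2; move: (T ^+ 2 + _) q0 => q q0.
rewrite !(ReImE, Re_e, Im_e) mul0r addr0 mulr_gt0//.
by rewrite addr_gt0// mulr_gt0.
Qed.

(** The image is farther away than the source, so it obeys the same bound. Taking [B <= T] gives
    majorants uniform on a window of heights. *)
Lemma dirichlet_bounds B T y : 0 < B -> B <= T -> 0 < y -> let q := B ^+ 2 + (y + - x) ^+ 2 in
  [/\ cmod (P0 T y) <= 4 * K / q, cmod (P1 T y) <= 4 * K / q, cmod (P2 T y) <= 4 * K / q,
    cmod (P11 T y) <= 8 * K / B / q & cmod (P22 T y) <= 8 * K / B / q].
Proof.
move=> B0 BT y0 q.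
have BT2 : B ^+ 2 <= T ^+ 2 by rewrite lerXn2r ?nnegrE ?(ltW B0)// (le_trans _ BT)// ltW.
have w1 : dist_low T 0 (- x) B (- x).
  move=> z z0; have := sqr_ge0 T; have := sqr_ge0 (z + - x); have := sqr_ge0 (0 : R); lra.
have w2 : dist_low T 0 x B (- x).
  move=> z z0; have zx : 0 <= 4 * (z * x) by rewrite mulr_ge0// mulr_ge0// ltW.
  have E : (z + x) ^+ 2 = (z + - x) ^+ 2 + 4 * (z * x) by ring.
  have := sqr_ge0 T; have := sqr_ge0 (z + - x); have := sqr_ge0 (0 : R); lra.
have [_ a0' a1 a2 [a11 a22 _]] := kernel_bounds_displ (offset_ok0 (- x)) B0 w1 y0.
have [_ b0' b1 b2 [b11 b22 _]] := kernel_bounds_displ (offset_ok0 x) B0 w2 y0.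
rewrite -/q in a0' a1 a2 a11 a22 b0' b1 b2 b11 b22.
have q0 : 0 < q by rewrite ltr_pwDl ?sqr_ge0// exprn_gt0.
have le0 : 2 * K * (`|T| / (1 + T ^+ 2)) / q <= 2 * K / q.
  rewrite ler_wpM2r ?invr_ge0 ?(ltW q0)// ler_piMr ?mulr_ge0 ?(ltW K0)//; exact: xx_le1.
have dl (H : R -> C -> C) c : cmod (H T (displ 0 (- x) y)) <= c -> cmod (H T (displ 0 x y)) <= c -> cmod (dif H T y) <= c + c.
  by move=> h1' h2'; rewrite /dif cmod_eM (le_trans (ler_cmodB _ _))// lerD.
have e4 : 4 * K / q = 2 * K / q + 2 * K / q by ring.
have e8 : 8 * K / B / q = 4 * K / B / q + 4 * K / B / q by ring.
rewrite P0E P1E P2E P11E P22E e4 e8; split.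
- exact: (dl _ _ (le_trans a0' le0) (le_trans b0' le0)).
- exact: (dl _ _ a1 b1).
- exact: (dl _ _ a2 b2).
- exact: (dl _ _ a11 b11).
- exact: (dl _ _ a22 b22).
Qed.

Lemma dirichlet_meas T : 0 < T -> [/\ cmeas Rp (P0 T), cmeas Rp (P1 T), cmeas Rp (P2 T),
   cmeas Rp (P11 T) & cmeas Rp (P22 T)].
Proof.
move=> T0.
have [m0 m1 m2 [m11 m22 _]] := @meas_H T 0 (- x) (fun y _ => Im_krho_displ0 (- x) y T0).
have [l0 l1 l2 [l11 l22 _]] := @meas_H T 0 x (fun y _ => Im_krho_displ0 x y T0).
have dm (H : R -> C -> C) : cmeas Rp (fun y => H T (displ 0 (- x) y)) -> cmeas Rp (fun y => H T (displ 0 x y)) -> cmeas Rp (dif H T).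
  by move=> h1' h2'; exact: (cmeasM (cmeas_cst _ e) (cmeasD h1' (cmeasN h2'))).
by rewrite P0E P1E P2E P11E P22E; split; apply: dm.
Qed.

Lemma dirichlet_dT T y : 0 < T -> cder (P0^~ y) T (e * P1 T y) /\ cder (P1^~ y) T (e * P11 T y).
Proof.
move=> T0; rewrite P0E P1E P11E; split.
  apply: cder_eq (cderZ e (cderB (d_h0x k (Im_krho_displ0 (- x) y T0)) (d_h0x k (Im_krho_displ0 x y T0)))) _.
  by rewrite /dif -mulrBr.
apply: cder_eq (cderZ e (cderB (d_h1x k (Im_krho_displ0 (- x) y T0)) (d_h1x k (Im_krho_displ0 x y T0)))) _.
by rewrite /dif -mulrBr.
Qed.

Lemma dirichlet_dy T y : 0 < T -> [/\ cder (P0 T) y (e * P2 T y), cder (P2 T) y (e * P22 T y) & ccont (P22 T) y].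
Proof.
move=> T0; rewrite P0E P2E P22E; split.
- apply: cder_eq (cderZ e (cderB (d_h0Z k (Im_krho_displ0 (- x) y T0)) (d_h0Z k (Im_krho_displ0 x y T0)))) _.
  by rewrite /dif /displ -mulrBr.
- apply: cder_eq (cderZ e (cderB (d_h2Z k (Im_krho_displ0 (- x) y T0)) (d_h2Z k (Im_krho_displ0 x y T0)))) _.
  by rewrite /dif /displ -mulrBr.
have c1 := ccont_h22Z k (Im_krho_displ0 (- x) y T0); have c2 := ccont_h22Z k (Im_krho_displ0 x y T0).
have c3 := ccontM (ccont_cst (-1) y) c2.
rewrite (_ : dif h22 T = fun y => e * (h22 T (displ 0 (- x) y) + -1 * h22 T (displ 0 x y))).
  exact: (ccontM (ccont_cst e y) (ccontD c1 c3)).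
by apply/funext => z; rewrite /dif mulN1r.
Qed.

Lemma dirichlet_pde T y : 0 < T -> P11 T y + P22 T y = - (k ^+ 2)%:C * P0 T y.
Proof.
move=> T0; have E1 := h_pde k (Im_krho_displ0 (- x) y T0); have E2 := h_pde k (Im_krho_displ0 x y T0).
have alg (c A B A' B' H H' : C) : A + B = c * H -> A' + B' = c * H' ->
    e * (A - A') + e * (B - B') = c * (e * (H - H')).
  by move=> E E'; rewrite -mulrDr addrACA -opprD E E' -mulrBr mulrCA.
by rewrite P0E P11E P22E; exact: alg E1 E2.
Qed.

Lemma P0_0 T : P0 T 0 = 0.
Proof.
rewrite P0E /dif !displE !add0r rmorphN/= mulNr h0Z subrr mulr0 //.
Qed.

Lemma ok2s s : 0 < s -> offset_ok (2 * a) s. Proof. by move=> s0; apply: offset_ok2a; exact: ltW. Qed.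

Lemma vB S s y : 0 < S -> S <= s -> 0 < y ->
  [/\ cmod (v0 y s) <= field_const M, cmod (v0 y s) <= field_const M / (1 + y ^+ 2), cmod (v0 y s) <= field_const M / S * y, cmod (v1 y s) <= field_const M / S &
   [/\ cmod (v1 y s) <= field_const M / y, cmod (v2 y s) <= field_const M / S, cmod (v22 y s) <= field_const M / S ^+ 2 & cmod (v11 y s) <= field_const M / S ^+ 2]].
Proof.
move=> S0 Ss y0; have s0 := lt_le_trans S0 Ss; have Q0 := field_const_ge0 gp.
have w b : dist_low y b s S 0.
  move=> z z0; have S2 : S ^+ 2 <= s ^+ 2 by rewrite lerXn2r ?nnegrE ?(ltW S0) ?(ltW s0).
  have zs : 0 <= 2 * (z * s) by rewrite mulr_ge0// mulr_ge0// ltW.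
  have E : (z + s) ^+ 2 = z ^+ 2 + 2 * (z * s) + s ^+ 2 by ring.
  rewrite addr0; have := sqr_ge0 y; have := sqr_ge0 b; have := sqr_ge0 z; have := sqr_ge0 s; lra.
have [b0 b1 _ [b22 b11 b2]] := field_bounds_away gp gn y0 S0 (w 0) (w (2 * a)) (offset_ok0 s) (ok2s s0).
have [c0 c1 _ _] := field_bounds gp gn y0 (offset_ok0 s) (ok2s s0).
split => //; apply: (le_trans c0); rewrite -cauchy_wtE ler_piMr//; exact: cauchy_wt_le1.
Qed.

Lemma g2_dx y s : 0 < y -> 0 < s -> exists D, cder (fun y => v2 y s) y D.
Proof.
move=> y0 s0; have x2 : y / 2 < y < 2 * y by apply/andP; split; lra.
have xh : 0 < y / 2 by rewrite divr_gt0.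
have [_ _ a3] := layer_dx x2 (offset_ok0 s) xh (fun t => dist_low_half 0 s y0) gp.
have [_ _ b3] := layer_dx x2 (ok2s s0) xh (fun t => dist_low_half (2 * a) s y0) gn.
exists (e * (e * layer h12 p y 0 s + e * layer h12 n y (2 * a) s)).
rewrite (_ : (fun y => _) = fun y => e * (layer h2 p y 0 s + layer h2 n y (2 * a) s)); last by apply/funext => z; rewrite g2E.
exact: (cderZ e (cderD a3 b3)).
Qed.

Lemma v_meas2 s : 0 < s -> [/\ cmeas Rp (fun y => v0 y s), cmeas Rp (fun y => v1 y s), cmeas Rp (fun y => v2 y s),
   cmeas Rp (fun y => v22 y s) & cmeas Rp (fun y => v11 y s)].
Proof.
move=> s0; split; apply: ccont_cmeas => y y0.
- by have [h _ _] := u_dx gp gn y0 (offset_ok0 s) (ok2s s0); exact: cder_ccont h.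
- by have [_ h _] := u_dx gp gn y0 (offset_ok0 s) (ok2s s0); exact: cder_ccont h.
- by have [D h] := g2_dx y0 s0; exact: cder_ccont h.
- by have [_ h] := u_ccont gp gn y0 (offset_ok0 s) (ok2s s0); exact: h.
- by have [h _] := u_ccont gp gn y0 (offset_ok0 s) (ok2s s0); exact: h.
Qed.

Lemma v_ds y s : 0 < y -> 0 < s -> cder (fun s => v0 y s) s (e * v2 y s) /\ cder (fun s => v2 y s) s (e * v22 y s).
Proof.
move=> y0 s0; pose d := Num.min s (y / 2).
have d0 : 0 < d by rewrite lt_min s0 divr_gt0.
have [ds dy] : d <= s /\ d <= y / 2 by split; rewrite ge_min lexx ?orbT.
have i2 : s - d < s < s + d by apply/andP; split; lra.
have w b r : s - d < r < s + d -> dist_low y b r y s.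
  move=> /andP[h1 h2]; rewrite (_ : r = s + (r - s)); last by ring.
  by apply: dist_low_near; rewrite ler_norml; apply/andP; split; lra.
have [A0 A2] := layer_dr i2 (fun r _ => offset_ok0 r) y0 (w 0) gp.
have ok2 r : s - d < r < s + d -> offset_ok (2 * a) r by move=> /andP[h1 h2]; apply: ok2s; lra.
have [N0 N2] := layer_dr i2 ok2 y0 (w (2 * a)) gn.
split.
  rewrite (_ : (fun t => _) = fun r => e * (layer h0 p y 0 r + layer h0 n y (2 * a) r)); last by apply/funext => r; rewrite u0E.
  by apply: cder_eq (cderZ e (cderD A0 N0)) _; rewrite g2E; ring.
rewrite (_ : (fun t => _) = fun r => e * (layer h2 p y 0 r + layer h2 n y (2 * a) r)); last by apply/funext => r; rewrite g2E.
by apply: cder_eq (cderZ e (cderD A2 N2)) _; rewrite u22E; ring.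
Qed.

Lemma pairing_bound (P f : R -> C) B A N : 0 < B -> cmeas Rp P -> cmeas Rp f ->
  (forall y, 0 < y -> cmod (P y) <= A / (B ^+ 2 + (y + - x) ^+ 2)) ->
  (forall y, 0 < y -> cmod (f y) <= N) ->
  cintg Rp (fun y => P y * f y) /\ cmod (cint Rp (fun y => P y * f y)) <= A * N * (pi / B).
Proof.
move=> B0 mP mf bP bf; have [i le] := cauchy_int (- x) B0.
have q0 y : 0 < B ^+ 2 + (y + - x) ^+ 2 by rewrite ltr_pwDl ?sqr_ge0// exprn_gt0.
have N0 : 0 <= N by exact: le_trans (cmod_ge0 _) (bf 1 ltr01).
have A0 : 0 <= A.
  have := bP 1 ltr01; move=> /(le_trans (cmod_ge0 _)); rewrite pmulr_lge0// invr_gt0//.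
have bd y : Rp y -> cmod (P y * f y) <= A * N * (B ^+ 2 + (y + - x) ^+ 2)^-1.
  move=> /Rp_gt0 y0; rewrite cmodM mulrAC; apply: ler_pM; rewrite ?cmod_ge0//; [exact: bP|exact: bf].
have ig : intg Rp (fun y => A * N * (B ^+ 2 + (y + - x) ^+ 2)^-1) by exact: intgZ.
have ci : cintg Rp (fun y => P y * f y) by apply: (cintg_le mRp (cmeasM mP mf) ig bd).
split; first exact: ci.
apply: (le_trans (cint_le mRp ci ig bd)).
by rewrite RintegralZl// ler_wpM2l// mulr_ge0.
Qed.

(** The Wronskian of [P0] and the field with respect to height, integrated along the ray. *)
Definition green_pairing T s := cint Rp (fun y => P1 T y * v0 y s - P0 T y * v2 y s).

Lemma ccvg0_bd (f g : nat -> C) A : ccvg f 0 -> (forall i, cmod (g i) <= A) -> ccvg (fun i => f i * g i) 0.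
Proof.
move=> [f1 f2] gA; apply: (@ccvg_le R _ _ (fun i => A * (`|Re (f i)| + `|Im (f i)|))).
  move=> i; rewrite subr0 cmodM mulrC; apply: ler_pM; rewrite ?cmod_ge0//; exact: cmod_leD.
rewrite (_ : 0 = A * (`|Re (0 : C)| + `|Im (0 : C)|)); last by rewrite /= normr0 addr0 mulr0.
apply: cvgM; first exact: cvg_cst.
by apply: cvgD; apply: cvg_norm.
Qed.

(** The terms with [k] cancel, and up to the factor [e] the integrand is the derivative in [y] of
    [P0 * v1 - P2 * v0]. At [y = 0] both [P0] and [v0] vanish; at infinity [v0] and [v1] decay like
    [1 / y]. *)
Lemma green0 T s : 0 < T -> 0 < s -> cint Rp (fun y => P11 T y * v0 y s - P0 T y * v22 y s) = 0.
Proof.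
move=> T0 s0; have Q0 := field_const_ge0 gp.
have [m0 m1 m2 m11 m22] := dirichlet_meas T0; have [n0 n1 n2 n22 n11] := v_meas2 s0.
have [h1 h2 h3] := exh_ray (0 : R).
have bP y := dirichlet_bounds T0 (lexx T) (y := y); have bv y := vB s0 (lexx s) (y := y).
pose F y := P0 T y * v1 y s - P2 T y * v0 y s.
have [j1 _] : cintg Rp (fun y => P11 T y * v0 y s) /\ _ := pairing_bound T0 m11 n0 (fun y y0 => let: And5 _ _ _ h _ := bP y y0 in h) (fun y y0 => let: And5 h _ _ _ _ := bv y y0 in h).
have [j2 _] : cintg Rp (fun y => P0 T y * v22 y s) /\ _ := pairing_bound T0 m0 n22 (fun y y0 => let: And5 h _ _ _ _ := bP y y0 in h) (fun y y0 => let: And5 _ _ _ _ (And4 _ _ h _) := bv y y0 in h).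
have E : cint Rp (fun y => e * (P11 T y * v0 y s - P0 T y * v22 y s)) = 0 - 0.
  apply: (@cint_FTC R Rp F _ (lo 0) (hi 0) 0 0 mRp h1 h2 h3).
  - move=> y /Rp_gt0 y0; have [d0 d2 _] := dirichlet_dy y T0; have [e0 e1 _] := u_dx gp gn y0 (offset_ok0 s) (ok2s s0).
    apply: cder_eq (cderB (cderM d0 e1) (cderM d2 e0)) _.
    have -> : P11 T y = - (k ^+ 2)%:C * P0 T y - P22 T y by rewrite -(dirichlet_pde y T0) addrK.
    have -> : v22 y s = - (k ^+ 2)%:C * v0 y s - v11 y s by rewrite -(u_pde gp gn y0 (offset_ok0 s) (ok2s s0)) addrAC subrr add0r.
    by ring.
  - move=> y /Rp_gt0 y0; have [d0 d2 c22] := dirichlet_dy y T0; have [e0 e1 _] := u_dx gp gn y0 (offset_ok0 s) (ok2s s0).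
    have [_ k22] := u_ccont gp gn y0 (offset_ok0 s) (ok2s s0).
    have cc c : ccont (fun=> c) y by exact: ccont_cst.
    have c0 := cder_ccont d0; have q0 := cder_ccont e0.
    have c11 : ccont (fun y => P11 T y) y.
      rewrite (_ : (fun y => P11 T y) = fun y => - (k ^+ 2)%:C * P0 T y + -1 * P22 T y).
        exact: (ccontD (ccontM (cc _) c0) (ccontM (cc _) c22)).
      by apply/funext => z; rewrite mulN1r -(dirichlet_pde z T0) addrK.
    rewrite (_ : (fun y => _) = fun y => e * (P11 T y * v0 y s + -1 * (P0 T y * v22 y s))); last by apply/funext => z; rewrite mulN1r.
    exact: (ccontM (cc _) (ccontD (ccontM c11 q0) (ccontM (cc _) (ccontM c0 k22)))).
  - exact: (cintgZ e mRp (cintgB mRp j1 j2)).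
  - have [d0 _ _] := dirichlet_dy 0 T0.
    have f0 : ccvg (fun i => P0 T (lo 0 i)) 0.
      by have := ccont_ccvg (cder_ccont d0) (@lo_cvg R 0); rewrite P0_0.
    have bA i : cmod (v1 (lo 0 i) s) <= field_const M / s by have [_ _ _ h _] := bv _ (@lo_gt0 R i).
    have g0 := ccvg0_bd f0 bA.
    have g1 : ccvg (fun i => P2 T (lo 0 i) * v0 (lo 0 i) s) 0.
      apply: (@ccvg_le R _ _ (fun i => (4 * K / T ^+ 2 * (field_const M / s)) * lo 0 i)); last exact: loV_cvg.
      move=> i; rewrite subr0 cmodM -mulrA; have l0 := @lo_gt0 R i.
      have [_ _ b2 _ _] := bP _ l0; have [_ _ b0 _ _] := bv _ l0.
      apply: ler_pM; rewrite ?cmod_ge0//; apply: (le_trans b2).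
      rewrite ler_wpM2l ?mulr_ge0 ?(ltW K0)// lef_pV2 ?posrE ?exprn_gt0//; last by rewrite ltr_pwDl ?sqr_ge0// exprn_gt0.
      by rewrite lerDl sqr_ge0.
    by have := ccvgB g0 g1; rewrite subrr.
  - apply: (@ccvg_le R _ _ (fun i => (4 * K / T ^+ 2 * (field_const M + field_const M)) / hi 0 i)); last exact: hiV_cvg.
    move=> i; rewrite subr0; have l0 := @hi_gt0 R i.
    have hi1 : 1 <= hi 0 i :> R by rewrite /hi add0r ler1n.
    have [b0 _ b2 _ _] := bP _ l0; have [_ c0 _ _ [c1 _ _ _]] := bv _ l0.
    have qT : 4 * K / (T ^+ 2 + (hi 0 i + - x) ^+ 2) <= 4 * K / T ^+ 2.
      rewrite ler_wpM2l ?mulr_ge0 ?(ltW K0)// lef_pV2 ?posrE ?exprn_gt0//; last by rewrite ltr_pwDl ?sqr_ge0// exprn_gt0.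
      by rewrite lerDl sqr_ge0.
    have c0' : cmod (v0 (hi 0 i) s) <= field_const M / hi 0 i.
      apply: (le_trans c0); rewrite ler_wpM2l// lef_pV2 ?posrE ?opr2_gt0//.
      have : 0 <= (hi 0 i - 1) ^+ 2 :> R by exact: sqr_ge0.
      by rewrite sqrrB expr1n mulr1; have := sqr_ge0 (hi 0 i); lra.
    rewrite /F /= (le_trans (ler_cmodB _ _))// !cmodM.
    rewrite -mulrA [X in _ <= _ * X]mulrDl mulrDr; apply: lerD; apply: ler_pM; rewrite ?cmod_ge0//.
      exact: le_trans b0 qT.
    exact: le_trans b2 qT.
by apply: eIr; rewrite mulr0 -(cintZ e mRp (cintgB mRp j1 j2)) E subrr.
Qed.

Lemma green_pairing_der T s r : 0 < T + r -> 0 < s + r -> cder (fun r => green_pairing (T + r) (s + r)) r 0.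
Proof.
move=> T0 s0; pose d := Num.min (T + r) (s + r) / 2.
have d0 : 0 < d by rewrite divr_gt0// lt_min T0.
have [dT ds] : 2 * d <= T + r /\ 2 * d <= s + r.
  by rewrite /d [2 * _]mulrC divfK//; split; rewrite ge_min lexx ?orbT.
have gap t : r - d < t < r + d -> d <= T + t /\ d <= s + t by move=> /andP[h1 h2]; split; lra.
have rr : r - d < r < r + d by apply/andP; split; lra.
have bP t y (h : r - d < t < r + d) := dirichlet_bounds d0 (gap t h).1 (y := y).
have bv t y (h : r - d < t < r + d) := vB d0 (gap t h).2 (y := y).
have Tp t (h : r - d < t < r + d) : 0 < T + t := lt_le_trans d0 (gap t h).1.
have sp t (h : r - d < t < r + d) : 0 < s + t := lt_le_trans d0 (gap t h).2.
have Q0 := field_const_ge0 gp.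
pose F t y := P1 (T + t) y * v0 y (s + t) - P0 (T + t) y * v2 y (s + t).
pose F' t y := e * (P11 (T + t) y * v0 y (s + t) - P0 (T + t) y * v22 y (s + t)).
have i1 t (h : r - d < t < r + d) : cintg Rp (fun y => P11 (T + t) y * v0 y (s + t) - P0 (T + t) y * v22 y (s + t)).
  have [m0 m1 m2 m11 m22] := dirichlet_meas (Tp t h); have [n0 n1 n2 n22 n11] := v_meas2 (sp t h).
  have [j1 _] := pairing_bound d0 m11 n0 (fun y y0 => let: And5 _ _ _ z _ := bP t y h y0 in z) (fun y y0 => let: And5 z _ _ _ _ := bv t y h y0 in z).
  have [j2 _] := pairing_bound d0 m0 n22 (fun y y0 => let: And5 z _ _ _ _ := bP t y h y0 in z) (fun y y0 => let: And5 _ _ _ _ (And4 _ _ z _) := bv t y h y0 in z).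
  exact: (cintgB mRp j1 j2).
have [ic1 _] := cauchy_int (- x) d0.
pose g y := (8 * K / d * field_const M + 4 * K * (field_const M / d ^+ 2)) * (d ^+ 2 + (y + - x) ^+ 2)^-1.
have ig : intg Rp g by exact: intgZ.
have -> : 0 = cint Rp (F' r).
  by rewrite /F' (cintZ e mRp (i1 r rr)) green0 ?mulr0 ?(Tp r rr) ?(sp r rr).
apply: (@cint_cder R Rp F F' r (r - d) (r + d) g mRp rr _ _ ig).
- move=> t h.
  have [m0 m1 m2 m11 m22] := dirichlet_meas (Tp t h); have [n0 n1 n2 n22 n11] := v_meas2 (sp t h).
  have [j1 _] := pairing_bound d0 m1 n0 (fun y y0 => let: And5 _ z _ _ _ := bP t y h y0 in z) (fun y y0 => let: And5 z _ _ _ _ := bv t y h y0 in z).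
  have [j2 _] := pairing_bound d0 m0 n2 (fun y y0 => let: And5 z _ _ _ _ := bP t y h y0 in z) (fun y y0 => let: And5 _ _ _ _ (And4 _ z _ _) := bv t y h y0 in z).
  exact: (cintgB mRp j1 j2).
- move=> t y h /Rp_gt0 y0.
  have sh c : is_derive t 1 (fun r => c + r) 1 by apply: rder_eq (rderD (rderC c t) (rderI t)) _; rewrite add0r.
  have [A0 A1] := dirichlet_dT y (Tp t h); have [V0 V2] := v_ds y0 (sp t h).
  apply: cder_eq (cderB (cderM (cder_comp (sh T) A1) (cder_comp (sh s) V0)) (cderM (cder_comp (sh T) A0) (cder_comp (sh s) V2))) _.
  by rewrite /F' !mul1r; ring.
- move=> t y h /Rp_gt0 y0; have [b0 _ _ b11 _] := bP t y h y0; have [c0 _ _ _ [_ _ c22 _]] := bv t y h y0.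
  rewrite /F' cmod_eM (le_trans (ler_cmodB _ _))// !cmodM /g [leRHS]mulrDl; apply: lerD.
    by rewrite [leRHS]mulrAC; apply: ler_pM; rewrite ?cmod_ge0.
  by rewrite [leRHS]mulrAC; apply: ler_pM; rewrite ?cmod_ge0.
Qed.

(** Raising both heights by the same amount leaves the Wronskian unchanged, and it tends to 0 when
    that amount tends to infinity. *)
Lemma green_pairing_zero T s : 0 < T -> 0 < s -> green_pairing T s = 0.
Proof.
move=> T0 s0; have Q0 := field_const_ge0 gp.
have cst i : green_pairing (T + hi 0 i) (s + hi 0 i) = green_pairing T s.
  rewrite -[in RHS](addr0 T) -[in RHS](addr0 s).
  have hp := @hi_gt0 R i.
  apply: (@cder0_eq R (fun r => green_pairing (T + r) (s + r)) (- Num.min T s) (hi 0 i + 1)).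
  - move=> r /andP[h _]; have [mT ms] : Num.min T s <= T /\ Num.min T s <= s by split; rewrite ge_min lexx ?orbT.
    by apply: green_pairing_der; lra.
  - by rewrite oppr_lt0 lt_min T0.
  - exact: ltW.
  - by rewrite ltrDl.
have bd i : cmod (green_pairing T s - 0) <= ((4 * K * field_const M + 4 * K * (field_const M / s)) * pi) / hi 0 i.
  have hp := @hi_gt0 R i.
  rewrite subr0 -(cst i); set T' := T + _; set s' := s + _.
  have T'0 : 0 < T' by rewrite addr_gt0.
  have ss' : s <= s' by rewrite lerDl ltW.
  have s'0 := lt_le_trans s0 ss'.
  have bP y := dirichlet_bounds T'0 (lexx T') (y := y); have bv y := vB s0 ss' (y := y).
  have [m0 m1 m2 m11 m22] := dirichlet_meas T'0; have [n0 n1 n2 n22 n11] := v_meas2 s'0.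
  have [j1 l1] := pairing_bound T'0 m1 n0 (fun y y0 => let: And5 _ z _ _ _ := bP y y0 in z) (fun y y0 => let: And5 z _ _ _ _ := bv y y0 in z).
  have [j2 l2] := pairing_bound T'0 m0 n2 (fun y y0 => let: And5 z _ _ _ _ := bP y y0 in z) (fun y y0 => let: And5 _ _ _ _ (And4 _ z _ _) := bv y y0 in z).
  rewrite /green_pairing (cintB mRp j1 j2) (le_trans (ler_cmodB _ _))// (le_trans (lerD l1 l2))//.
  have pT : pi / T' <= pi / hi 0 i by rewrite ler_wpM2l ?pi_ge0// lef_pV2 ?posrE// lerDr ltW.
  have nn : 0 <= 4 * K * field_const M + 4 * K * (field_const M / s) by have Kp := K0; nonneg.
  by rewrite -mulrDl -[leRHS]mulrA ler_wpM2l.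
exact: (ccvg_unique (ccvg_cst (green_pairing T s)) (ccvg_le bd (@hiV_cvg R _))).
Qed.

Definition dirichlet_pairing T s := cint Rp (fun y => P0 T y * v0 y s).

(** Moving the intermediate height [t] at fixed total height [sg] produces the Wronskian, which is
    zero; so the pairing may be evaluated in the limit where [t] or [sg - t] tends to 0. *)
Lemma dirichlet_pairing_der sg t : 0 < t < sg -> cder (fun t => dirichlet_pairing t (sg - t)) t 0.
Proof.
move=> /andP[t0 tsg]; have s0 : 0 < sg - t by rewrite subr_gt0.
pose d := Num.min t (sg - t) / 2.
have d0 : 0 < d by rewrite divr_gt0// lt_min t0.
have [dT ds] : 2 * d <= t /\ 2 * d <= sg - t.
  by rewrite /d [2 * _]mulrC divfK//; split; rewrite ge_min lexx ?orbT.
have gap r : t - d < r < t + d -> d <= r /\ d <= sg - r by move=> /andP[h1 h2]; split; lra.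
have tt : t - d < t < t + d by apply/andP; split; lra.
have bP r y (h : t - d < r < t + d) := dirichlet_bounds d0 (gap r h).1 (y := y).
have bv r y (h : t - d < r < t + d) := vB d0 (gap r h).2 (y := y).
have Tp r (h : t - d < r < t + d) : 0 < r := lt_le_trans d0 (gap r h).1.
have sp r (h : t - d < r < t + d) : 0 < sg - r := lt_le_trans d0 (gap r h).2.
have Q0 := field_const_ge0 gp.
pose F r y := P0 r y * v0 y (sg - r).
pose F' r y := e * (P1 r y * v0 y (sg - r) - P0 r y * v2 y (sg - r)).
have i1 r (h : t - d < r < t + d) : cintg Rp (fun y => P1 r y * v0 y (sg - r) - P0 r y * v2 y (sg - r)).
  have [m0 m1 m2 m11 m22] := dirichlet_meas (Tp r h); have [n0 n1 n2 n22 n11] := v_meas2 (sp r h).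
  have [j1 _] := pairing_bound d0 m1 n0 (fun y y0 => let: And5 _ z _ _ _ := bP r y h y0 in z) (fun y y0 => let: And5 z _ _ _ _ := bv r y h y0 in z).
  have [j2 _] := pairing_bound d0 m0 n2 (fun y y0 => let: And5 z _ _ _ _ := bP r y h y0 in z) (fun y y0 => let: And5 _ _ _ _ (And4 _ z _ _) := bv r y h y0 in z).
  exact: (cintgB mRp j1 j2).
have [ic1 _] := cauchy_int (- x) d0.
pose g y := (4 * K * field_const M + 4 * K * (field_const M / d)) * (d ^+ 2 + (y + - x) ^+ 2)^-1.
have ig : intg Rp g by exact: intgZ.
have -> : 0 = cint Rp (F' t).
  by rewrite /F' (cintZ e mRp (i1 t tt)) -/(green_pairing t (sg - t)) green_pairing_zero ?mulr0.
apply: (@cint_cder R Rp F F' t (t - d) (t + d) g mRp tt _ _ ig).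
- move=> r h.
  have [m0 m1 m2 m11 m22] := dirichlet_meas (Tp r h); have [n0 n1 n2 n22 n11] := v_meas2 (sp r h).
  by have [] := pairing_bound d0 m0 n0 (fun y y0 => let: And5 z _ _ _ _ := bP r y h y0 in z) (fun y y0 => let: And5 z _ _ _ _ := bv r y h y0 in z).
- move=> r y h /Rp_gt0 y0.
  have sh : is_derive r 1 (fun r => sg - r) (-1) by apply: rder_eq (rderB (rderC sg r) (rderI r)) _; rewrite sub0r.
  have [A0 A1] := dirichlet_dT y (Tp r h); have [V0 V2] := v_ds y0 (sp r h).
  apply: cder_eq (cderM A0 (cder_comp sh V0)) _.
  by rewrite /F' rmorphN; ring.
- move=> r y h /Rp_gt0 y0; have [b0 b1 _ _ _] := bP r y h y0; have [c0 _ _ _ [_ c2 _ _]] := bv r y h y0.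
  rewrite /F' cmod_eM (le_trans (ler_cmodB _ _))// !cmodM /g [leRHS]mulrDl; apply: lerD.
    by rewrite [leRHS]mulrAC; apply: ler_pM; rewrite ?cmod_ge0.
  by rewrite [leRHS]mulrAC; apply: ler_pM; rewrite ?cmod_ge0.
Qed.

Lemma dirichlet_pairing_const sg t1 t2 : 0 < t1 -> t1 <= t2 -> t2 < sg -> dirichlet_pairing t2 (sg - t2) = dirichlet_pairing t1 (sg - t1).
Proof.
move=> h1 h2 h3; exact: (@cder0_eq R (fun t => dirichlet_pairing t (sg - t)) 0 sg t1 t2 (@dirichlet_pairing_der sg) h1 h2 h3).
Qed.

Definition bint (f : R -> R) (A : R) := intg Rp f /\ \int[mu]_(y in Rp) f y <= A.

Lemma bintD f g A B : bint f A -> bint g B -> bint (fun y => f y + g y) (A + B).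
Proof. by move=> [i1 l1] [i2 l2]; split; [exact: intgD|rewrite RintegralD//; exact: lerD]. Qed.

Lemma bintZ c f A : 0 <= c -> bint f A -> bint (fun y => c * f y) (c * A).
Proof. by move=> c0 [i1 l1]; split; [exact: intgZ|rewrite RintegralZl// ler_wpM2l]. Qed.

Lemma poisson_half T : 0 < T -> intg Rp (fun y => T / (T ^+ 2 + (y - x) ^+ 2)) /\
  \int[mu]_(y in Rp) (T / (T ^+ 2 + (y - x) ^+ 2)) = pi / 2 + atan (x / T).
Proof.
move=> T0; have [i _] := poisson_integral x T0.
have iR : intg Rp (fun y => T / (T ^+ 2 + (y - x) ^+ 2)) by exact: intg_subset i.
split => //; have Tn : T != 0 by rewrite gt_eqF.
have qn (y : R) : T ^+ 2 + (y - x) ^+ 2 != 0 by rewrite gt_eqF// ltr_pwDl ?sqr_ge0// exprn_gt0.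
pose F y := atan (T^-1 * y + - (T^-1 * x)).
have dF (y : R) : is_derive y 1 F (T / (T ^+ 2 + (y - x) ^+ 2)).
  apply: rder_eq (rder_comp (rderD (rderZ _ (rderI y)) (rderC _ y)) (is_derive1_atan _)) _.
  have -> : 1 + (T^-1 * y - T^-1 * x) ^+ 2 = (T ^+ 2 + (y - x) ^+ 2) / T ^+ 2 by field.
  by field; rewrite qn Tn.
have cf (y : R) : {for y, continuous (fun s => T / (T ^+ 2 + (s - x) ^+ 2))}.
  have d1 : is_derive y 1 (fun s => T ^+ 2 + (s - x) ^+ 2) (2 * (y - x)).
    apply: rder_eq (rderD (rderC _ y) (rderX 2 (rderB (rderI y) (rderC x y)))) _.
    by rewrite /=; ring.
  exact: (cont_derive (rderZ T (rderV d1 (qn y)))).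
have [h1 h2 h3] := exh_ray (0 : R).
have -> : pi / 2 + atan (x / T) = pi / 2 - F 0.
  by rewrite /F mulr0 add0r atanN opprK [_^-1 * _]mulrC.
apply: (@FTC_exhaust R Rp _ F (lo 0) (hi 0) _ _ mRp h1 h2 h3) => //.
  exact: (cvg_comp _ _ (@lo_cvg R 0) (cont_derive (dF 0))).
have tv : 0 < T^-1 by rewrite invr_gt0.
have hy : (T^-1 * hi 0 i + - (T^-1 * x)) @[i --> \oo] --> +oo.
  apply/cvgryPge => A; near=> n0.
  rewrite -lerBlDr opprK -ler_pdivrMl// invrK /hi add0r.
  rewrite (@le_trans _ _ n0%:R)// ?ler_nat//; last by rewrite ltnW// ltnW.
  by near: n0; exact: nbhs_infty_ger.
exact: (cvg_comp _ _ hy (@cvgy_atan R)).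
Unshelve. all: by end_near. Qed.

(** The constant of [osc0_approx] for the cut at the inverse distance, using that [Im rho] is
    [2 * sin th * cos th] times the squared distance. *)
Definition poisson_const : R := 4 * pi + 4 * k ^+ 2 / (sin th * cos th).

Lemma poisson_const_ge0 : 0 <= poisson_const.
Proof. by have s0 := ltW (sth_gt0 th0 th1); have c0 := ltW (cth_gt0 th0 th1); rewrite /poisson_const; nonneg. Qed.

(* Near the singularity the kernel is the Poisson kernel of the half-plane. *)
Lemma h0_poisson T r y lam : 0 < T -> 0 < lam ->
  cmod (e * h0 T (displ 0 r y) - (T / (pi * (T ^+ 2 + (y + r) ^+ 2)))%:C) <=
  poisson_const * (lam + T ^+ 2 / lam * (T ^+ 2 + (y + r) ^+ 2)^-1).
Proof.
move=> T0 l0; set q := T ^+ 2 + (y + r) ^+ 2.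
have q0 : 0 < q by rewrite ltr_pwDl ?sqr_ge0// exprn_gt0.
pose d := Num.sqrt q; have d0 : 0 < d by rewrite sqrtr_gt0.
have dq : d ^+ 2 = q by rewrite sqr_sqrtr// ltW.
have s0 := sth_gt0 th0 th1; have c0 := cth_gt0 th0 th1.
have rho0 := Im_krho_displ0 r y T0.
have rhoE : krho T (displ 0 r y) = q%:C * e ^+ 2 by rewrite /krho displE /q; ring.
have IE : Im (krho T (displ 0 r y)) = 2 * (sin th * cos th) * q.
  by rewrite rhoE expr2 !(ReImE, Re_e, Im_e); ring.
have dVp : 0 < d^-1 by rewrite invr_gt0.
have := osc0_approx k dVp rho0; rewrite IE rhoE => A.
have en := e_neq0 th; have qn : q%:C != 0 :> C by rewrite fmorph_eq0 gt_eqF.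
have pn : (pi : R)%:C != 0 :> C by rewrite fmorph_eq0 gt_eqF// pi_gt0.
have -> : e * h0 T (displ 0 r y) - (T / (pi * q))%:C =
   C0 * T%:C * e ^+ 2 * (osc k 0 (q%:C * e ^+ 2) - 4 * ic / (q%:C * e ^+ 2)).
  rewrite /h0 rhoE; set J := osc _ _ _.
  have -> : (T / (pi * q))%:C = T%:C / ((pi : R)%:C * q%:C) :> C by rewrite rmorphM fmorphV rmorphM.
  rewrite /C0; have i2 := sqr_ic R.
  have -> : - (ic / (4 * (pi : R)%:C)) * T%:C * e ^+ 2 * (J - 4 * ic / (q%:C * e ^+ 2)) =
     e * (- (ic / (4 * (pi : R)%:C)) * (T%:C * e) * J) + ic ^+ 2 * T%:C / ((pi : R)%:C * q%:C).
    by move: en qn pn; move: (q%:C) ((pi : R)%:C) (T%:C) e J => Q P T1 e1 J1 en qn pn; field; rewrite en qn pn.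
  by congr (_ + _); rewrite i2 mulN1r mulNr.
have Ck0 := poisson_const_ge0.
apply: (@le_trans _ _ (poisson_const * (T / d))).
  rewrite !cmodM !cmod_e !mulr1 cmodC (gtr0_norm T0) -mulrA.
  apply: (@le_trans _ _ (1 * (T * (poisson_const / d)))); last by rewrite mul1r mulrCA mulrA.
  apply: ler_pM; [nonneg|apply: mulr_ge0; nonneg|exact: cmod_C0|].
  rewrite ler_wpM2l ?(ltW T0)//; apply: (le_trans A).
  rewrite le_eqVlt; apply/orP; left; apply/eqP; rewrite /poisson_const -dq.
  by field; rewrite !gt_eqF.
(* The error [T / d] is split by the inequality of the means with a free parameter [lam], into a
   small constant and a multiple of an integrable function. *)
rewrite ler_wpM2l//.
have : 0 <= (lam - T / d) ^+ 2 / lam by rewrite divr_ge0 ?sqr_ge0// ltW.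
have -> : (lam - T / d) ^+ 2 / lam = (lam + T ^+ 2 / lam * q^-1) - 2 * (T / d).
  by rewrite -dq; field; rewrite !gt_eqF.
rewrite subr_ge0; apply: le_trans.
by rewrite -[leLHS]mul1r; apply: ler_wpM2r; [apply: divr_ge0; exact: ltW|rewrite ler1n].
Qed.

(** The mass that the Poisson kernel at height [T] above [x] gives to the half-line; it tends to 1
    with [T -> 0]. *)
Definition mass T : R := (pi / 2 + atan (x / T)) / pi.

Lemma cint_real (f : R -> R) : cint Rp (fun y => (f y)%:C) = (\int[mu]_(y in Rp) f y)%:C.
Proof. by apply: eq_ReIm => //=; rewrite /Rintegral integral0. Qed.

Lemma cintg_real (f : R -> R) : intg Rp f -> cintg Rp (fun y => (f y)%:C).
Proof. by move=> i; split => //; exact: integrable0. Qed.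

(** Oscillation of a function against the Poisson kernel: within distance [lam] it is Lipschitz,
    beyond it only bounded, and there [w ^+ 2 >= lam ^+ 2] makes the Cauchy weight of width [lam]
    large enough. *)
Lemma lip_split (de Q L lam w tau q : R) : 0 <= Q -> 0 <= L -> 0 < lam -> 0 < tau -> 0 < q -> w ^+ 2 <= q ->
  de <= 2 * Q -> de <= 2 * L * `|w| ->
  tau / q * de <= 2 * L * lam * tau * q^-1 + 4 * Q * tau * (lam ^+ 2 + w ^+ 2)^-1.
Proof.
move=> Q0 L0 l0 t0 q0 wq d1 d2.
have p0 : 0 < lam ^+ 2 + w ^+ 2 by rewrite ltr_pwDl ?sqr_ge0// exprn_gt0.
have tq : 0 <= tau / q by rewrite divr_ge0// ltW.
have [wl|lw] := leP `|w| lam.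
  apply: ler_wpDr; first by nonneg.
  have -> : 2 * L * lam * tau * q^-1 = tau / q * (2 * L * lam) by ring.
  rewrite ler_wpM2l// (le_trans d2)// ler_wpM2l//; nonneg.
apply: ler_wpDl; first by nonneg.
have lw2 : lam ^+ 2 <= w ^+ 2.
  by rewrite -(real_normK (num_real w)) !expr2; apply: ler_pM; exact: ltW.
have h : 2 * Q <= 4 * Q * (w ^+ 2 / (lam ^+ 2 + w ^+ 2)).
  have -> : 4 * Q * (w ^+ 2 / (lam ^+ 2 + w ^+ 2)) = 2 * Q * (2 * w ^+ 2 / (lam ^+ 2 + w ^+ 2)) by ring.
  rewrite ler_peMr ?mulr_ge0// ler_pdivlMr// mul1r; lra.
apply: (@le_trans _ _ (tau / q * (4 * Q * (w ^+ 2 / (lam ^+ 2 + w ^+ 2))))).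
  by rewrite ler_wpM2l// (le_trans d1).
have -> : tau / q * (4 * Q * (w ^+ 2 / (lam ^+ 2 + w ^+ 2))) = 4 * Q * tau * (lam ^+ 2 + w ^+ 2)^-1 * (w ^+ 2 / q) by ring.
rewrite ler_piMr//; first by nonneg.
by rewrite ler_pdivrMr// mul1r.
Qed.

Lemma v_lip S s y : 0 < S -> S <= s -> 0 < y -> cmod (v0 y s - v0 x s) <= 2 * (field_const M / S) * `|y + - x|.
Proof.
move=> S0 Ss y0; have s0 := lt_le_trans S0 Ss.
have m0 : 0 < Num.min x y by rewrite lt_min x0.
apply: (@cder_lip R (fun y => v0 y s) (fun y => e * v1 y s) (field_const M / S) 0 (x + y)).
- by move=> z /andP[z0 _]; have [h _ _] := u_dx gp gn z0 (offset_ok0 s) (ok2s s0).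
- by move=> z /andP[z0 _]; rewrite cmod_eM; have [_ _ _ h _] := vB S0 Ss z0.
- by rewrite x0 ltrDl.
- by rewrite y0 ltrDr.
Qed.

Definition Ac (S : R) : R := 4 * poisson_const * field_const M * pi + 2 * field_const M * (pi / x) + 2 * (field_const M / S) * pi + 4 * field_const M * pi.

(** An approximate identity with a rate. The height is [lam ^+ 2] because the errors are of the
    orders [lam], [tau / lam] and [tau], all O(lam) for [tau = lam ^+ 2]. *)
Lemma dirichlet_pairing_approx S s lam : 0 < S -> S <= s -> 0 < lam -> lam <= 1 ->
  cmod (dirichlet_pairing (lam ^+ 2) s - (mass (lam ^+ 2))%:C * v0 x s) <= Ac S * lam.
Proof.
move=> S0 Ss l0 l1; have Q0 := field_const_ge0 gp; have C0' := poisson_const_ge0.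
set tau := lam ^+ 2; have t0 : 0 < tau by rewrite exprn_gt0.
have s0 := lt_le_trans S0 Ss.
have [m0 _ _ _ _] := dirichlet_meas t0; have [n0 _ _ _ _] := v_meas2 s0.
have bP y := dirichlet_bounds t0 (lexx tau) (y := y).
have bv y (y0 : 0 < y) := vB S0 Ss y0.
have bf y (y0 : 0 < y) : cmod (v0 y s) <= field_const M by have [] := bv y y0.
have [j1 _] := pairing_bound t0 m0 n0 (fun y y0 => let: And5 z _ _ _ _ := bP y y0 in z) bf.
have pi0 := @pi_gt0 R; have pi1 : 1 <= pi :> R by rewrite (le_trans _ (@pi_ge2 R))// ler1n.
pose poi (r y : R) : R := tau / (pi * (tau ^+ 2 + (y + r) ^+ 2)).
have [ip ep] := poisson_half t0.
have pE y : poi (- x) y = pi^-1 * (tau / (tau ^+ 2 + (y - x) ^+ 2)) by rewrite /poi invfM mulrCA.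
have ip' : intg Rp (poi (- x)).
  by rewrite (_ : poi (- x) = fun y => pi^-1 * (tau / (tau ^+ 2 + (y - x) ^+ 2))); [exact: intgZ|apply/funext].
have mE : (mass tau)%:C * v0 x s = cint Rp (fun y => v0 x s * (poi (- x) y)%:C).
  rewrite (cintZ _ mRp (cintg_real ip')) cint_real mulrC; congr (_ * _%:C).
  under eq_Rintegral do rewrite pE.
  by rewrite RintegralZl// ep /mass mulrC.
have j2 : cintg Rp (fun y => v0 x s * (poi (- x) y)%:C) by exact: (cintgZ _ mRp (cintg_real ip')).
rewrite mE /dirichlet_pairing -(cintB mRp j1 j2).
have [iw ew] := @intg_cauchy_wt R.
have B1 : bint (@cauchy_wt R) pi by split.
have B2 := cauchy_int (- x) t0; have B3 := cauchy_int x x0; have B4 := cauchy_int (- x) l0.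
have c1 : 0 <= 2 * poisson_const * field_const M * lam by have := ltW l0 => ?; nonneg.
have c2 : 0 <= 2 * poisson_const * field_const M * (tau ^+ 2 / lam) by have := ltW l0 => ?; nonneg.
have c3 : 0 <= 2 * field_const M * tau by have := ltW t0 => ?; nonneg.
have c4 : 0 <= 2 * (field_const M / S) * lam * tau by have := ltW t0 => ?; have := ltW l0 => ?; have := ltW S0 => ?; nonneg.
have c5 : 0 <= 4 * field_const M * tau by have := ltW t0 => ?; nonneg.
have [ig eg] := bintD (bintD (bintD (bintD (bintZ c1 B1) (bintZ c2 B2)) (bintZ c3 B3)) (bintZ c4 B2)) (bintZ c5 B4).
apply: (le_trans (cint_le mRp (cintgB mRp j1 j2) ig _)).
  move=> y /Rp_gt0 y0.
  have [f0 f1 _ _ _] := bv y y0.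
  have h1 := h0_poisson (- x) y t0 l0; have h2 := h0_poisson x y t0 l0.
  have lp := v_lip S0 Ss y0.
  have q0 : 0 < tau ^+ 2 + (y + - x) ^+ 2 by rewrite ltr_pwDl ?sqr_ge0// exprn_gt0.
  have q0' : 0 < tau ^+ 2 + (y + x) ^+ 2 by rewrite ltr_pwDl ?sqr_ge0// exprn_gt0.
  (* The errors in turn: the Poisson approximation of the kernel and of its image, the Poisson
     kernel of the image, which is O(tau), and the oscillation of [v0] about [x]. *)
  have -> : P0 tau y * v0 y s - v0 x s * (poi (- x) y)%:C =
    ((e * h0 tau (displ 0 (- x) y) - (poi (- x) y)%:C) * v0 y s - (e * h0 tau (displ 0 x y) - (poi x y)%:C) * v0 y s)
    + (- ((poi x y)%:C * v0 y s)) + (poi (- x) y)%:C * (v0 y s - v0 x s).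
    have alg (A B P Q v v' : C) : e * (A - B) * v - v' * P =
        ((e * A - P) * v - (e * B - Q) * v) + - (Q * v) + P * (v - v') by ring.
    by rewrite P0E; exact: alg.
  have pl r : 0 < tau ^+ 2 + (y + r) ^+ 2 -> `|poi r y| <= tau / (tau ^+ 2 + (y + r) ^+ 2).
    move=> h; rewrite ger0_norm; last by rewrite /poi divr_ge0 ?mulr_ge0// ltW.
    rewrite ler_wpM2l ?(ltW t0)// lef_pV2 ?posrE//; last by exact: mulr_gt0.
    by rewrite ler_peMl// ltW.
  have T1 r : 0 < tau ^+ 2 + (y + r) ^+ 2 -> (tau ^+ 2 + (y + r) ^+ 2)^-1 <= (tau ^+ 2 + (y + - x) ^+ 2)^-1 ->
    cmod ((e * h0 tau (displ 0 r y) - (poi r y)%:C) * v0 y s) <=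
      poisson_const * field_const M * lam * cauchy_wt y + poisson_const * field_const M * (tau ^+ 2 / lam) * (tau ^+ 2 + (y + - x) ^+ 2)^-1.
    move=> h hV; rewrite cmodM.
    apply: (@le_trans _ _ (poisson_const * (lam + tau ^+ 2 / lam * (tau ^+ 2 + (y + r) ^+ 2)^-1) * cmod (v0 y s))).
      by rewrite ler_wpM2r ?cmod_ge0//; exact: h0_poisson.
    rewrite mulrDr mulrDl; apply: lerD.
      have -> : poisson_const * field_const M * lam * cauchy_wt y = poisson_const * lam * (field_const M * cauchy_wt y) by ring.
      by rewrite ler_wpM2l ?mulr_ge0 ?(ltW l0).
    have -> : poisson_const * field_const M * (tau ^+ 2 / lam) * (tau ^+ 2 + (y + - x) ^+ 2)^-1 =
      poisson_const * (tau ^+ 2 / lam * (tau ^+ 2 + (y + - x) ^+ 2)^-1) * field_const M by ring.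
    have tl : 0 <= tau ^+ 2 / lam by rewrite divr_ge0 ?sqr_ge0// ltW.
    apply: ler_pM; rewrite ?cmod_ge0//.
      by apply: mulr_ge0 => //; apply: mulr_ge0 => //; rewrite invr_ge0; exact: ltW.
    by rewrite ler_wpM2l// ler_wpM2l.
  have A1 := T1 (- x) q0 (lexx _).
  have A2 : cmod ((e * h0 tau (displ 0 x y) - (poi x y)%:C) * v0 y s) <=
      poisson_const * field_const M * lam * cauchy_wt y + poisson_const * field_const M * (tau ^+ 2 / lam) * (tau ^+ 2 + (y + - x) ^+ 2)^-1.
    apply: (T1 x q0'); rewrite lef_pV2 ?posrE// lerD2l.
    rewrite -subr_ge0 (_ : _ - _ = 4 * (x * y)); last by ring.
    by rewrite mulr_ge0// mulr_ge0// ltW.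
  have A3 : cmod (- ((poi x y)%:C * v0 y s)) <= 2 * field_const M * tau * (x ^+ 2 + (y + x) ^+ 2)^-1.
    have X0 : 0 < x ^+ 2 + (y + x) ^+ 2 by rewrite ltr_pwDl ?sqr_ge0// exprn_gt0.
    rewrite cmodN cmodM cmodC.
    have -> : 2 * field_const M * tau * (x ^+ 2 + (y + x) ^+ 2)^-1 = tau * (2 / (x ^+ 2 + (y + x) ^+ 2)) * field_const M by ring.
    apply: ler_pM; rewrite ?cmod_ge0//; apply: (le_trans (pl x q0')).
    rewrite ler_wpM2l ?(ltW t0)// -[leLHS]mul1r ler_pdivrMr// mulrAC ler_pdivlMr// mul1r.
    have xy : x ^+ 2 <= (y + x) ^+ 2.
      rewrite -subr_ge0 (_ : _ - _ = y ^+ 2 + 2 * (x * y)); last by ring.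
      by rewrite addr_ge0 ?sqr_ge0// mulr_ge0// mulr_ge0// ltW.
    apply: (@le_trans _ _ (2 * (y + x) ^+ 2)); last by rewrite ler_wpM2l// lerDr sqr_ge0.
    by rewrite (_ : 2 * _ = (y + x) ^+ 2 + (y + x) ^+ 2); [rewrite lerD2r|ring].
  have A4 : cmod ((poi (- x) y)%:C * (v0 y s - v0 x s)) <=
     2 * (field_const M / S) * lam * tau * (tau ^+ 2 + (y + - x) ^+ 2)^-1 + 4 * field_const M * tau * (lam ^+ 2 + (y + - x) ^+ 2)^-1.
    rewrite cmodM cmodC; apply: (@le_trans _ _ (tau / (tau ^+ 2 + (y + - x) ^+ 2) * cmod (v0 y s - v0 x s))).
      by rewrite ler_wpM2r ?cmod_ge0//; exact: pl.
    apply: (lip_split Q0 _ l0 t0 q0 _ _ lp).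
    - by rewrite divr_ge0// ltW.
    - by rewrite lerDr sqr_ge0.
    - rewrite (le_trans (ler_cmodB _ _))// (_ : 2 * field_const M = field_const M + field_const M); last by ring.
      by apply: lerD; [exact: bf|exact: bf].
  apply: (le_trans (ler_cmodD _ _)); apply: (@le_trans _ _ (_ + _ + _ + (_ + _))); last first.
    by rewrite !addrA.
  apply: lerD; last exact: A4.
  apply: (le_trans (ler_cmodD _ _)); apply: lerD; last exact: A3.
  apply: (le_trans (ler_cmodB _ _)); apply: (le_trans (lerD A1 A2)).
  by rewrite le_eqVlt; apply/orP; left; apply/eqP; ring.
apply: (le_trans eg).
have -> : 2 * poisson_const * field_const M * lam * pi + 2 * poisson_const * field_const M * (tau ^+ 2 / lam) * (pi / tau) + 2 * field_const M * tau * (pi / x) +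
   2 * (field_const M / S) * lam * tau * (pi / tau) + 4 * field_const M * tau * (pi / lam) =
   (4 * poisson_const * field_const M * pi + lam * (2 * field_const M * (pi / x)) + 2 * (field_const M / S) * pi + 4 * field_const M * pi) * lam.
  by rewrite /tau; field; rewrite !gt_eqF.
rewrite /Ac ler_wpM2r ?(ltW l0)// !lerD2r lerD2l ler_piMl//.
by have := ltW x0 => ?; nonneg.
Qed.

(** The pairing is the same for all [t], and as [t] tends to 0 the kernel concentrates at [x]. *)
Lemma dirichlet_pairing_lim sg t : 0 < t -> t < sg -> dirichlet_pairing t (sg - t) = v0 x sg.
Proof.
move=> t0 tsg; have sg0 := lt_trans t0 tsg.
(* The bound 1 is for the approximation, [sg / 2] keeps the second height away from 0, and [t] puts
   the auxiliary heights below the given one. *)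
pose m := Num.min (Num.min 1 (sg / 2)) t.
have m0 : 0 < m by rewrite !lt_min ltr01 t0 divr_gt0.
have [m1 ms mt] : [/\ m <= 1, m <= sg / 2 & m <= t] by split; rewrite /m !ge_min lexx ?orbT.
pose lam i := m * lo 0 i.
have lo1 i : lo 0 i <= 1 :> R by rewrite /lo add0r invf_le1 ?ler1n.
have l0 i : 0 < lam i by rewrite mulr_gt0// lo_gt0.
have lm i : lam i <= m by rewrite ler_piMr// ltW.
have l1 i : lam i <= 1 := le_trans (lm i) m1.
have lam0 : lam i @[i --> \oo] --> 0 by exact: loV_cvg.
pose tau i := lam i ^+ 2.
have tl i : tau i <= lam i by rewrite /tau expr2 ler_piMl ?(ltW (l0 i)).
have t0' i : 0 < tau i by rewrite exprn_gt0.
have tau0 : tau i @[i --> \oo] --> 0.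
  rewrite (_ : tau = fun i => lam i * lam i); last by apply/funext => i; rewrite /tau expr2.
  by rewrite -[X in _ --> X](mulr0 0); exact: (cvgM lam0 lam0).
have S0 : 0 < sg / 2 by rewrite divr_gt0.
have Ss i : sg / 2 <= sg - tau i by have := le_trans (tl i) (le_trans (lm i) ms); lra.
have cst i : dirichlet_pairing (tau i) (sg - tau i) = dirichlet_pairing t (sg - t).
  by symmetry; apply: dirichlet_pairing_const => //; exact: le_trans (tl i) (le_trans (lm i) mt).
have c1 : ccvg (fun i => dirichlet_pairing (tau i) (sg - tau i) - (mass (tau i))%:C * v0 x (sg - tau i)) 0.
  apply: (@ccvg_le R _ _ (fun i => (Ac (sg / 2) * m) * lo 0 i)); last exact: loV_cvg.
  by move=> i; rewrite subr0 -mulrA; exact: dirichlet_pairing_approx.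
have c2 : ccvg (fun i => v0 x (sg - tau i)) (v0 x sg).
  apply: (@ccont_ccvg R (fun s => v0 x s) sg (fun i => sg - tau i)).
    by have [h _] := v_ds x0 sg0; exact: cder_ccont h.
  by rewrite -[X in _ --> X]subr0; apply: cvgB => //; exact: cvg_cst.
have c3 : ccvg (fun i => (mass (tau i))%:C) 1.
  split; last exact: cvg_cst.
  rewrite (_ : (fun i => _) = fun i => mass (tau i)) //=.
  have xy : x / tau i @[i --> \oo] --> +oo.
    apply/cvgryPge => A; have A1 : 0 < `|A| + 1 by rewrite ltr_pwDr.
    have e0 : 0 < x / (`|A| + 1) by rewrite divr_gt0.
    move/cvgrPdist_lt : tau0 => /(_ _ e0); apply: filterS => i.
    rewrite sub0r normrN (gtr0_norm (t0' i)) ltr_pdivlMr// mulrC -ltr_pdivlMr// => /ltW h.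
    by apply: le_trans h; rewrite (le_trans (ler_norm _))// lerDl.
  have ha : atan (x / tau i) @[i --> \oo] --> pi / 2 by exact: (cvg_comp _ _ xy (@cvgy_atan R)).
  have pn : pi != 0 :> R by rewrite gt_eqF// pi_gt0.
  suff : mass (tau i) @[i --> \oo] --> ((pi / 2 + pi / 2) / pi : R) by rewrite -splitr divff.
  by apply: cvgM; [apply: cvgD|]; [exact: cvg_cst|exact: ha|exact: cvg_cst].
have := ccvgD c1 (ccvgM c3 c2); rewrite mul1r add0r.
rewrite (_ : (fun n => _) = fun=> dirichlet_pairing t (sg - t)); last by apply/funext => i; rewrite subrK cst.
by move=> h; apply: ccvg_unique h; exact: ccvg_cst.
Qed.

Lemma v_edge y (s : nat -> R) : 0 < y -> (forall i, 0 < s i) -> s i @[i --> \oo] --> 0 ->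
  ccvg (fun i => v0 y (s i)) (u0 p n y 0 0 (2 * a) 0).
Proof.
move=> y0 s0 scvg; have y2 : 0 < y / 2 by rewrite divr_gt0.
have [N _ sN] : \forall i \near \oo, `|0 - s i| < y / 2 by move/cvgrPdist_lt: scvg => /(_ _ y2).
have c2 i : `|1 * s (i + N)%N| <= y / 2.
  by have := sN (i + N)%N (leq_addl _ _); rewrite sub0r normrN mul1r => /ltW.
have sc' : s (i + N)%N @[i --> \oo] --> 0 by rewrite (@cvg_shiftn N R^o).
have o1 : offset_ok 0 0 by exact: offset_ok0.
have o2 : offset_ok (2 * a) 0 by exact: offset_ok2a.
have b1 i : offset_ok (0 + 0 * s (i + N)%N) (0 + 1 * s (i + N)%N) by rewrite mul0r addr0; exact: offset_ok0.
have b2 i : offset_ok (2 * a + 0 * s (i + N)%N) (0 + 1 * s (i + N)%N).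
  by rewrite mul0r addr0 add0r mul1r; exact: ok2s.
have [L0 _] := u_seq gp gn y0 o1 o2 b1 b2 c2 c2 sc'.
apply: (ccvg_shift (N := N)).
rewrite (_ : (fun i => _) = (fun i => u0 p n y (0 + 0 * s (i + N)%N) (0 + 1 * s (i + N)%N) (2 * a + 0 * s (i + N)%N) (0 + 1 * s (i + N)%N))) //.
by apply/funext => i; rewrite !mul0r !mul1r !addr0 !add0r.
Qed.

(* Semigroup property: in the second variable the kernel acts as the Dirichlet Poisson kernel. *)
Lemma v_semigroup sg : 0 < sg -> v0 x sg = cint Rp (fun y => P0 sg y * u0 p n y 0 0 (2 * a) 0).
Proof.
move=> sg0; pose m := Num.min 1 (sg / 2); have Q0 := field_const_ge0 gp.
have S0 : 0 < sg / 2 by rewrite divr_gt0.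
have m0 : 0 < m by rewrite lt_min ltr01.
have ms : m <= sg / 2 by rewrite /m !ge_min lexx ?orbT.
pose s i := m * lo 0 i.
have lo1 i : lo 0 i <= 1 :> R by rewrite /lo add0r invf_le1 ?ler1n.
have l0 i : 0 < s i by rewrite mulr_gt0// lo_gt0.
have lm i : s i <= m by rewrite ler_piMr// ltW.
have s0 : s i @[i --> \oo] --> 0 by exact: loV_cvg.
have t2 i : sg / 2 <= sg - s i by have := le_trans (lm i) ms; lra.
have t0 i : 0 < sg - s i := lt_le_trans S0 (t2 i).
have tc : (sg - s i) @[i --> \oo] --> sg.
  by rewrite -[X in _ --> X]subr0; apply: cvgB => //; exact: cvg_cst.
have [ic1 _] := cauchy_int (- x) S0.
have cst i : dirichlet_pairing (sg - s i) (s i) = v0 x sg.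
  have := dirichlet_pairing_lim (t0 i) (_ : sg - s i < sg); rewrite subKr; apply.
  by rewrite ltrBlDr ltrDl.
have [_ c] : cintg Rp (fun y => P0 sg y * u0 p n y 0 0 (2 * a) 0) /\
   ccvg (fun i => cint Rp (fun y => P0 (sg - s i) y * v0 y (s i))) (cint Rp (fun y => P0 sg y * u0 p n y 0 0 (2 * a) 0)).
  apply: (@cint_dcvg R Rp (fun i y => P0 (sg - s i) y * v0 y (s i)) _ (fun y => 4 * K * field_const M * ((sg / 2) ^+ 2 + (y + - x) ^+ 2)^-1) mRp).
  - move=> i; have [q0 _ _ _ _] := dirichlet_meas (t0 i); have [n0 _ _ _ _] := v_meas2 (l0 i); exact: cmeasM.
  - move=> y /Rp_gt0 y0; apply: ccvgM; last exact: v_edge.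
    have [h _] := dirichlet_dT y sg0.
    exact: (@ccont_ccvg R (P0^~ y) sg _ (cder_ccont h) tc).
  - exact: intgZ.
  move=> i y /Rp_gt0 y0; have [b0 _ _ _ _] := dirichlet_bounds S0 (t2 i) y0.
  have [c0 _ _ _ _] := vB (l0 i) (lexx _) y0.
  by rewrite cmodM mulrAC; apply: ler_pM; rewrite ?cmod_ge0.
rewrite -/(dirichlet_pairing _ _) in c.
apply: (ccvg_unique _ c).
rewrite (_ : (fun i => _) = fun=> v0 x sg); first exact: ccvg_cst.
by apply/funext => i; exact: cst.
Qed.
End semigroup.

(** With both shifts equal to [r] the field is the Dirichlet extension of its trace [p'], by
    [v_semigroup]. Changing the shift of [p] to [- r] adds the source minus its image, which is the
    Dirichlet extension of [p] in the other variable. Exchanging [x] with [r] and [p] with [p']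
    exchanges the two integrals. *)
Lemma u_split p n p' M x r : good M p -> good M n ->
  (forall y, 0 < y -> u0 p n y 0 0 (2 * a) 0 = p' y) -> 0 < x -> 0 < r ->
  u0 p n x 0 (- r) (2 * a) r = cint Rp (fun y => P0 x r y * p' y) + cint Rp (fun y => P0 r x y * p y).
Proof.
move=> gp gn e1 x0 r0.
have -> : cint Rp (fun y => P0 x r y * p' y) = u0 p n x 0 r (2 * a) r.
  by rewrite (v_semigroup gp gn x0 r0); apply: eq_cint => y /Rp_gt0 y0; rewrite e1.
have w s : dist_low x 0 s x s by move=> z z0; have := sqr_ge0 x; have := sqr_ge0 (z + s); have := sqr_ge0 (0 : R); lra.
have [[i1 _] _ _ _] := layer_bounds (offset_ok0 (- r)) x0 (w (- r)) gp.
have [[i2 _] _ _ _] := layer_bounds (offset_ok0 r) x0 (w r) gp.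
have -> : cint Rp (fun y => P0 r x y * p y) = e * (layer h0 p x 0 (- r) - layer h0 p x 0 r).
  rewrite layerE -(cintB mRp i1 i2) -(cintZ _ mRp (cintgB mRp i1 i2)).
  have alg (A B z : C) : e * (A - B) * z = e * (A * z - B * z) by ring.
  by apply: eq_cint => y _; rewrite P0E; exact: alg.
by rewrite !u0E; ring.
Qed.

Lemma sym_pair p n p' n' M x r : good M p -> good M n -> good M p' -> good M n' ->
  (forall y, 0 < y -> u0 p n y 0 0 (2 * a) 0 = p' y) ->
  (forall y, 0 < y -> u0 p' n' y 0 0 (2 * a) 0 = p y) -> 0 < x -> 0 < r ->
  u0 p n x 0 (- r) (2 * a) r = u0 p' n' r 0 (- x) (2 * a) x.
Proof.
move=> gp gn gp' gn' e1 e2 x0 r0.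
by rewrite (u_split gp gn e1 x0 r0) (u_split gp' gn' e2 r0 x0) addrC.
Qed.

Lemma flux_corner_zero p n p' n' M : good M p -> good M n -> good M p' -> good M n' ->
  (forall y, 0 < y -> u0 p n y 0 0 (2 * a) 0 = p' y) ->
  (forall y, 0 < y -> u0 p' n' y 0 0 (2 * a) 0 = p y) ->
  0 <= flux p n + flux p' n' /\
  (flux p n + flux p' n' = 0 -> forall x, 0 < x -> p x = 0 /\ p' x = 0).
Proof.
move=> gp gn gp' gn' e1 e2.
have sy x r (x0 : 0 < x) (r0 : 0 < r) := sym_pair gp gn gp' gn' e1 e2 x0 r0.
have [f0 fz] := flux_corner_ge0 gp gn gp' gn' sy; split => // /fz z x x0.
have lim q m q' : good M q -> good M m -> (forall y, 0 < y -> u0 q m y 0 0 (2 * a) 0 = q' y) ->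
    (forall r, 0 < r -> u0 q m x 0 (- r) (2 * a) r = 0) -> q' x = 0.
  move=> gq gm eq qz; have [c _] := corner_seq gq gm x0 (@lo_gt0 R) (@lo_cvg R 0).
  rewrite eq// in c; apply: (ccvg_unique c).
  rewrite (_ : (fun i => _) = fun=> 0); first exact: ccvg_cst.
  by apply/funext => i; rewrite qz// lo_gt0.
split; last by apply: (lim p n p') => // r r0; exact: z.
by apply: (lim p' n' p) => // r r0; rewrite -sy// z.
Qed.

Lemma good_system_zero (p n : 'I_4 -> R -> C) M : (forall j, good M (p j)) -> (forall j, good M (n j)) ->
  (forall j x, 0 < x -> p j x = u0 (n (ordS j)) (p (ordS j)) x 0 0 (2 * a) 0) ->
  (forall j x, 0 < x -> n j x = u0 (p (ord_pred j)) (n (ord_pred j)) x 0 0 (2 * a) 0) ->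
  forall j x, 0 < x -> p j x = 0 /\ n j x = 0.
Proof.
move=> gp gn ep en.
(* The pairing of the fluxes at a corner; shifting the index in the first summand regroups the sum
   into the pairs of the strips. *)
pose c j := flux (p (ord_pred j)) (n (ord_pred j)) + flux (n j) (p j).
have cz j : 0 <= c j /\ (c j = 0 -> forall x, 0 < x -> p (ord_pred j) x = 0 /\ n j x = 0).
  apply: (flux_corner_zero (gp _) (gn _) (gn _) (gp _)) => y y0; first by rewrite en.
  by rewrite ep ?ord_predK.
have cs : \sum_j c j <= 0.
  rewrite big_split /= (reindex (@ordS 4)) /=; last first.
    by exists (@ord_pred 4) => i _; [exact: ordSK|exact: ord_predK].
  rewrite -big_split /= sumr_le0// => j _.
  by rewrite ordSK; exact: flux_strip_le0 (gp j) (gn j).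
have cs0 : \sum_j c j = 0.
  by apply/eqP; rewrite eq_le cs sumr_ge0// => j _; have [] := cz j.
have c0 j : c j = 0.
  by move/eqP: cs0; rewrite psumr_eq0 => [/allP/(_ j (mem_index_enum j))/eqP|i _] //; have [] := cz i.
move=> j x x0; split; last by have [_ /(_ (c0 j) x x0)[]] := cz j.
by have [_ /(_ (c0 (ordS j)) x x0)[]] := cz (ordS j); rewrite ordSK.
Qed.
End halfline.

(** * The Hankel function as an oscillatory integral *)

Section laplace.
Context {R : realType}.
Local Notation C := R[i].
Local Notation Re := (@complex.Re R).
Local Notation Im := (@complex.Im R).
Local Notation mu := (@lebesgue_measure R).
Local Notation Rp := (`]0, +oo[%classic : set R).

Lemma cmod_cexpN_le1 (z : C) : 0 <= Re z -> cmod (cexp (- z)) <= 1.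
Proof. by move=> z0; rewrite cmod_cexp ReN -[leRHS]expR0 ler_expR oppr_le0. Qed.

Lemma cexpN_le (z : C) : 0 <= Re z -> cmod (cexp (- z) - 1) <= 2 /\ cmod (cexp (- z) - 1) <= 3 * cmod z.
Proof.
move=> z0; split.
  rewrite (le_trans (ler_cmodB _ _))// cmod1 (_ : 2 = 1 + 1 :> R); last by ring.
  by rewrite lerD2r; exact: cmod_cexpN_le1.
have iy (y : R) : cmod (cexp (ic * y%:C) - 1) <= 2 * `|y|.
  have [y0|y0] := ger0P y; first by have [_ h] := cexp_i_le y0.
  have y0' : 0 <= - y by rewrite oppr_ge0 ltW.
  have [_ h] := cexp_i_le y0'; apply: le_trans h.
  rewrite le_eqVlt; apply/orP; left; apply/eqP; rewrite -cmodJ; congr cmod.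
  have Ey (r : R) : ic * r%:C = 0 +i* r by rewrite /ic; apply: eq_ReIm => /=; ring.
  by rewrite !Ey; apply: eq_ReIm; rewrite /cexp /= ?cosN ?sinN ?oppr0; ring.
have -> : cexp (- z) - 1 = cexp (ic * (- Im z)%:C) * ((expR (- Re z))%:C - 1) + (cexp (ic * (- Im z)%:C) - 1).
  rewrite mulrBr mulr1 addrA subrK; congr (_ - _).
  have -> : (expR (- Re z))%:C = cexp ((- Re z)%:C) by apply: eq_ReIm; rewrite /cexp /= ?cos0 ?sin0 ?mulr1 ?mulr0.
  by rewrite -cexpD; congr cexp; apply: eq_ReIm; rewrite !(ReImE, icE); ring.
rewrite (le_trans (ler_cmodD _ _))// (_ : 3 * cmod z = cmod z + 2 * cmod z); last by ring.
apply: lerD; last by rewrite (le_trans (iy _))// ler_wpM2l// normrN Im_le_cmod.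
rewrite cmodM cmod_cexp !(ReImE, icE) mul0r mul1r subr0 expR0 mul1r -[1]/((1 : R)%:C) -rmorphB cmodC distrC.
have e1 : expR (- Re z) <= 1 by rewrite -[leRHS]expR0 ler_expR oppr_le0.
rewrite ger0_norm ?subr_ge0//; apply: le_trans (le_trans (ler_norm _) (Re_le_cmod z)).
by have := expR_ge1Dx (- Re z); lra.
Qed.

Lemma laplace_int (p : C) : 0 < Re p -> cintg Rp (fun u => cexp (- (p * u%:C))) /\
  cint Rp (fun u => cexp (- (p * u%:C))) = p^-1.
Proof.
move=> p0; have r0 : 0 < Im (4 * ic * p).
  rewrite (_ : Im _ = 4 * Re p); first by rewrite mulr_gt0.
  by rewrite -(rmorph_nat (real_complex R)) !(ReImE, icE); ring.
have E (u : R) : ic * (4 * ic * p) * (u / 4)%:C = - (p * u%:C).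
  have -> : ic * (4 * ic * p) * (u / 4)%:C = ic ^+ 2 * (p * u%:C) by field.
  by rewrite sqr_ic mulN1r.
have [i e] := free_int r0.
have in0 : ic != 0 :> C by apply/eqP => H; have := cmod_ic R; rewrite H cmod0 => /eqP; rewrite eq_sym oner_eq0.
have pn0 : p != 0 by apply/eqP => H; move: p0; rewrite H ltxx.
have -> : (fun u : R => cexp (- (p * u%:C))) = fun u => cexp (ic * (4 * ic * p) * (u / 4)%:C).
  by apply/funext => u; rewrite E.
split => //; rewrite e; by field; rewrite in0 pn0.
Qed.

(** The substitution [u -> u^-1] on primitives. Integrability is first shown for the absolute value,
    whose primitive is bounded by the total integral. *)
Lemma inv_intg (f : R -> R) : intg Rp f -> (forall u : R, 0 < u -> {for u, continuous f}) ->
  intg Rp (fun u => f u^-1 / u ^+ 2) /\ \int[mu]_(u in Rp) (f u^-1 / u ^+ 2) = \int[mu]_(u in Rp) f u.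
Proof.
have [h1 h2 h3] := exh_ray (0 : R).
have dinv (u : R) : 0 < u -> is_derive u 1 (fun u => u^-1) (- (u ^+ 2)^-1).
  by move=> u0; apply: rder_eq (rderV (rderI u) (lt0r_neq0 u0)) _; rewrite mulN1r.
have cg (f' : R -> R) (u : R) : (forall u : R, 0 < u -> {for u, continuous f'}) -> 0 < u -> {for u, continuous (fun u : R => f' u^-1 / u ^+ 2)}.
  move=> cf u0; have u0' : 0 < u^-1 by rewrite invr_gt0.
  apply: cvgM.
    apply: (@continuous_comp _ _ _ (fun u : R => u^-1) f'); last exact: cf.
    exact: (cont_derive (dinv u u0)).
  exact: (cont_derive (rderV (rderX 2 (rderI u)) (lt0r_neq0 (exprn_gt0 2 u0)))).
have dF (f' : R -> R) (u : R) : intg Rp f' -> (forall u : R, 0 < u -> {for u, continuous f'}) -> 0 < u ->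
    is_derive u 1 (fun u : R => - prim f' u^-1) (f' u^-1 / u ^+ 2).
  move=> i cf u0; have u0' : 0 < u^-1 by rewrite invr_gt0.
  apply: rder_eq (rderN (rder_comp (dinv u u0) (prim_der i u0' (cf _ u0')))) _.
  by rewrite mulrN opprK.
move=> i cf.
have ig : intg Rp (fun u => f u^-1 / u ^+ 2).
  have iN := intg_norm mRp i.
  have cabs (u : R) : 0 < u -> {for u, continuous (fun u => `|f u|)} by move=> u0; apply: cvg_norm; exact: cf.
  have iG : intg Rp (fun u => `|f u^-1| / u ^+ 2).
    apply: (@ge0_FTC_exhaust R Rp (fun u => `|f u^-1| / u ^+ 2) (fun u => - prim (fun u => `|f u|) u^-1) (lo 0) (hi 0) (\int[mu]_(u in Rp) `|f u|) mRp h1 h2 h3).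
    - by move=> u /Rp_gt0 u0; exact: (dF _ _ iN cabs u0).
    - by move=> u /Rp_gt0 u0; exact: (cg _ _ cabs u0).
    - by apply: meas_ray => u u0; exact: (cg _ _ cabs u0).
    - by move=> u /Rp_gt0 u0; rewrite divr_ge0// sqr_ge0.
    - move=> u /Rp_gt0 u0; rewrite normrN primE ger0_norm; last first.
        by apply: Rintegral_ge0 => y _; rewrite mulr_ge0// indicE.
      apply: le_Rintegral => //.
        apply: (intg_le mRp _ iN).
          apply: measurable_funM; first exact: (intg_meas iN).
          exact: measurable_indic.
        by move=> y _; rewrite normrM normr_id ler_piMr// indicE; case: (_ \in _); rewrite ?normr1 ?normr0.
      by move=> y _; rewrite ler_piMr// indicE; case: (_ \in _).
  apply: (intg_le mRp _ iG).
    by apply: meas_ray => u u0; exact: (cg _ _ cf u0).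
  by move=> u /Rp_gt0 u0; rewrite normrM (ger0_norm (_ : 0 <= (u ^+ 2)^-1))// invr_ge0 sqr_ge0.
split => //.
have -> : \int[mu]_(u in Rp) f u = 0 - (- \int[mu]_(u in Rp) f u) by rewrite sub0r opprK.
apply: (@FTC_exhaust R Rp (fun u => f u^-1 / u ^+ 2) (fun u => - prim f u^-1) (lo 0) (hi 0)
  (- \int[mu]_(u in Rp) f u) 0 mRp h1 h2 h3).
- by move=> u /Rp_gt0 u0; exact: (dF _ _ i cf u0).
- by move=> u /Rp_gt0 u0; exact: (cg _ _ cf u0).
- exact: ig.
- apply: cvgN; rewrite (_ : (fun n => _) = fun n => prim f n.+1%:R); last first.
    by apply/funext => n; rewrite /lo add0r invrK.
  have := prim_hi i; rewrite (_ : (fun n => prim f (hi 0 n)) = fun n => prim f (n.+1).+1%:R).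
    by rewrite (@cvg_shiftS R^o (fun n => prim f n.+1%:R)).
  by apply/funext => n; rewrite /hi add0r.
- rewrite -[X in _ --> X]oppr0; apply: cvgN.
  have := prim_lo i; rewrite -(@cvg_shiftS R^o (fun n => prim f (lo 0 n))).
  rewrite (_ : (fun n => _) = fun n => prim f (hi 0 n)^-1)//.
  by apply/funext => n; rewrite /hi /lo !add0r.
Qed.

Lemma ccontN (F : R -> C) x : ccont F x -> ccont (fun s => - F s) x.
Proof.
move=> h; rewrite (_ : (fun s => _) = fun s => -1 * F s); first exact: (ccontM (ccont_cst _ _) h).
by apply/funext => s; rewrite mulN1r.
Qed.

Lemma ccont_inv (u : R) : 0 < u -> ccont (fun u => (u^-1)%:C) u.
Proof. by move=> u0; apply: ccont_real; exact: (cont_derive (rderV (rderI u) (lt0r_neq0 u0))). Qed.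

Lemma ccont_expN (p : C) (u : R) : ccont (fun u => cexp (- (p * u%:C))) u.
Proof. exact: (cder_ccont (cder_cexp (cderN (cderZ p (cder_id u))))). Qed.

Lemma cder_clog (P : R -> C) (t : R) P' : 0 < Re (P t) -> cder P t P' ->
  cder (fun s => clog (P s)) t (P' / P t).
Proof.
move=> x0 dP; have [dx dy] := dP.
have xn : (Re \o P) t != 0 by rewrite /= gt_eqF.
have q0 : 0 < Re (P t) ^+ 2 + Im (P t) ^+ 2 by rewrite ltr_pwDl ?sqr_ge0// exprn_gt0.
have s0 : 0 < Num.sqrt (Re (P t) ^+ 2 + Im (P t) ^+ 2) by rewrite sqrtr_gt0.
have dq := rderD (rderX 2 dx) (rderX 2 dy).
have dl := rder_comp (rder_comp dq (is_derive1_sqrt q0)) (is_derive1_ln s0).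
have da := rder_comp (rderM dy (rderV dx xn)) (is_derive1_atan _).
have Pn : P t != 0 by apply/eqP => H; move: x0; rewrite H ltxx.
have PV : (P t)^-1 = (P t)^* * ((Re (P t) ^+ 2 + Im (P t) ^+ 2)^-1)%:C.
  apply: (mulIf Pn); rewrite mulVf// mulrAC mulcJ_cmod cmod_sqr -(rmorphM (real_complex R)) mulfV//.
  by rewrite gt_eqF.
have ss : Num.sqrt (Re (P t) ^+ 2 + Im (P t) ^+ 2) ^+ 2 = Re (P t) ^+ 2 + Im (P t) ^+ 2 by rewrite sqr_sqrtr// ltW.
have nr : \forall s \near t, 0 < Re (P s) by have [c _] := cder_cvg dP; exact: (cvgr_gt _ c).
split.
  apply: rder_eq dl _; rewrite PV mulrA !ReImE /=; move: ss s0.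
  by move: (Num.sqrt (Re (P t) ^+ 2 + Im (P t) ^+ 2)) => S ss s0; rewrite -ss; field; rewrite gt_eqF.
have d : is_derive t 1 (fun s => atan ((Im \o P) s / (Re \o P) s)) (Im (P' / P t)).
  apply: rder_eq da _; rewrite PV mulrA !ReImE /=.
  have h : 1 + (Im (P t) / Re (P t)) ^+ 2 != 0 by rewrite gt_eqF// ltr_pwDl// sqr_ge0.
  field.
  by apply/andP; split; rewrite gt_eqF.
by apply: (near_eq_is_derive _ d); near=> s => /=; rewrite /carg ifT//; near: s.
Unshelve. all: by end_near. Qed.

Lemma clog1 : clog 1 = 0 :> C.
Proof. by rewrite /clog cmod1 ln1 /carg /= ltr01 mul0r atan0. Qed.

(** Along the segment from 1 to [p] the integral and [- clog] have the same derivative, by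
    [laplace_int], and both vanish at 1. *)
Lemma frullani (p : C) : 0 < Re p ->
  cintg Rp (fun u => (u^-1)%:C * (cexp (- (p * u%:C)) - cexp (- u%:C))) /\ 
  cint Rp (fun u => (u^-1)%:C * (cexp (- (p * u%:C)) - cexp (- u%:C))) = - clog p.
Proof.
move=> p0; pose m := Num.min 1 (Re p); have m0 : 0 < m by rewrite lt_min ltr01.
have [m1 mp] : m <= 1 /\ m <= Re p by split; rewrite /m ge_min lexx ?orbT.
pose P t : C := 1 + t%:C * (p - 1).
(* Half of the lower bound of the real part on the segment is spent on going [d] beyond its ends,
   which makes 0 and 1 interior points. *)
pose d := m / (2 * (1 + `|Re p - 1|)).
have n0 : 0 < 1 + `|Re p - 1| by rewrite ltr_pwDl.
have d0 : 0 < d by rewrite divr_gt0// mulr_gt0.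
have dm : d * `|Re p - 1| <= m / 2.
  rewrite /d invfM mulrA mulrAC -[leRHS]mulr1 -mulrA ler_wpM2l ?divr_ge0 ?(ltW m0)//.
  by rewrite ler_pdivrMr// mul1r lerDr.
have ReP t : - d < t < 1 + d -> m / 2 <= Re (P t).
  move=> /andP[t1 t2]; rewrite /P !ReImE mul0r subr0.
  have [/andP[b1 b2] md] : - `|Re p - 1| <= Re p - 1 <= `|Re p - 1| /\ m / 2 <= m - d * `|Re p - 1|.
    by rewrite -ler_norml; split => //; lra.
  apply: (le_trans md).
  have [tn|tp] := leP t 0.
    have : t * (Re p - 1) >= - (d * `|Re p - 1|).
      by rewrite -mulNr; have := normr_ge0 (Re p - 1); nra.
    by lra.
  have [tl|tg] := leP t 1.
    have : m <= 1 + t * (Re p - 1) by nra.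
    by have := mulr_ge0 (ltW d0) (normr_ge0 (Re p - 1)); lra.
  have : (t - 1) * (Re p - 1) >= - (d * `|Re p - 1|).
    by rewrite -mulNr; have := normr_ge0 (Re p - 1); nra.
  by lra.
have mh : 0 < m / 2 by rewrite divr_gt0.
have P0 t (h : - d < t < 1 + d) : 0 < Re (P t) := lt_le_trans mh (ReP t h).
have dP (t : R) : cder P t (p - 1).
  by apply: cder_eq (cderD (cder_cst 1 t) (cderM (cder_id t) (cder_cst (p - 1) t))) _; ring.
have dE (u t : R) : cder (fun t => cexp (- (P t * u%:C))) t (- (p - 1) * u%:C * cexp (- (P t * u%:C))).
  by apply: cder_eq (cder_cexp (cderN (cderM (dP t) (cder_cst u%:C t)))) _; ring.
have nE (u t : R) : 0 < u -> - d < t < 1 + d -> cmod (cexp (- (P t * u%:C))) <= expR (- (m / 2 * u)).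
  move=> u0 h; rewrite cmod_cexp ler_expR ReN ReM ImC mulr0 subr0 lerN2 ler_wpM2r ?(ltW u0)//.
  exact: ReP.
have [ie _] := intg_expR mh.
have z0 : - d < 0 < 1 + d by rewrite oppr_lt0 d0 ltr_pwDl// ltW.
have z1 : - d < 1 < 1 + d by rewrite ltrDl d0 (lt_trans _ ltr01)// oppr_lt0.
have PE0 : P 0 = 1 by rewrite /P mul0r addr0.
have PE1 : P 1 = p by rewrite /P mul1r addrC subrK.
pose F t u := (u^-1)%:C * (cexp (- (P t * u%:C)) - cexp (- (1 * u%:C))).
have cF t : cmeas Rp (F t).
  apply: ccont_cmeas => u u0; apply: ccontM; first exact: ccont_inv.
  by apply: ccontD; [exact: ccont_expN|apply: ccontN; exact: ccont_expN].
have iF t : - d < t < 1 + d -> cintg Rp (F t).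
  move=> h; apply: (cintg_le mRp (cF t) (g := fun u => 2 * cmod (p - 1) * `|t - 0| * expR (- (m / 2 * u)))).
    exact: intgZ.
  move=> u /Rp_gt0 u0; rewrite /F cmodM cmodC (ger0_norm (_ : 0 <= u^-1)) ?invr_ge0 ?(ltW u0)//.
  rewrite ler_pdivrMl// (_ : cexp (- (1 * u%:C)) = cexp (- (P 0 * u%:C))); last by rewrite PE0.
  apply: (le_trans (cder_lip (fun s _ => dE u s) (L := cmod (p - 1) * u * expR (- (m / 2 * u))) _ z0 h)).
    move=> s hs; rewrite !cmodM cmodN cmodC (gtr0_norm u0) ler_wpM2l ?mulr_ge0 ?cmod_ge0 ?(ltW u0)//.
    exact: nE.
  by rewrite le_eqVlt; apply/orP; left; apply/eqP; ring.
have dH t (h : - d < t < 1 + d) : cder (fun t => cint Rp (F t)) t (- ((p - 1) / P t)).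
  have [j1 j2] := laplace_int (P0 t h).
  have -> : - ((p - 1) / P t) = cint Rp (fun u => - (p - 1) * cexp (- (P t * u%:C))) by rewrite cintZ// j2 mulNr.
  apply: (@cint_cder R Rp F (fun t u => - (p - 1) * cexp (- (P t * u%:C))) t (- d) (1 + d)
     (fun u => cmod (p - 1) * expR (- (m / 2 * u))) mRp h iF).
  - move=> s u hs /Rp_gt0 u0.
    apply: cder_eq (cderZ _ (cderB (dE u s) (cder_cst _ s))) _.
    have un : u%:C != 0 :> C by rewrite fmorph_eq0 gt_eqF.
    by rewrite fmorphV subr0; field.
  - exact: intgZ.
  - move=> s u hs /Rp_gt0 u0; rewrite cmodM cmodN ler_wpM2l ?cmod_ge0//; exact: nE.
have i1 := iF 1 z1; rewrite /F PE1 in i1.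
have E1 : (fun u : R => (u^-1)%:C * (cexp (- (p * u%:C)) - cexp (- (1 * u%:C)))) =
   (fun u => (u^-1)%:C * (cexp (- (p * u%:C)) - cexp (- u%:C))) by apply/funext => u; rewrite mul1r.
rewrite E1 in i1; split; first exact: i1.
have dc t (h : - d < t < 1 + d) : cder (fun t => cint Rp (F t) + clog (P t)) t 0.
  by apply: cder_eq (cderD (dH t h) (cder_clog (P0 t h) (dP t))) _; rewrite addNr.
have /andP[q1 q2] := z0; have /andP[q3 q4] := z1.
have := cder0_eq dc q1 ler01 q4; rewrite PE0 PE1 clog1.
have -> : cint Rp (F 0) = 0.
  rewrite (@eq_cint R Rp _ (fun=> 0)); last by move=> u _; rewrite /F PE0 subrr mulr0.
  by rewrite -[fun=> 0](_ : (fun u : R => (0 : R)%:C) = _)// cint_real ?/Rintegral ?integral0.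
rewrite /F PE1 E1 addr0 => /eqP; rewrite addr_eq0 => /eqP //.
Qed.

(** An integrand for minus Euler's constant. *)
Definition gam_f (u : R) : R := u^-1 * (expR (- u) - (1 + u)^-1).

Lemma intg_gam_f : intg Rp gam_f.
Proof.
have [iw _] := @intg_cauchy_wt R.
apply: (intg_le mRp _ iw).
  apply: meas_ray => u u0; have u1 : 1 + u != 0 by rewrite gt_eqF// addr_gt0.
  apply: cvgM; first exact: (cont_derive (rderV (rderI u) (lt0r_neq0 u0))).
  apply: cvgB; first exact: (cont_derive (rder_comp (rderN (rderI u)) (is_derive_expR _))).
  exact: (cont_derive (rderV (rderD (rderC 1 u) (rderI u)) u1)).
move=> u /Rp_gt0 u0; have u1 : 0 < 1 + u by rewrite addr_gt0.
have e1 : expR (- u) <= (1 + u)^-1.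
  by rewrite expRN lef_pV2 ?posrE ?expR_gt0// expR_ge1Dx.
have e2 := expR_ge1Dx (- u).
have e3 := expR_ge0 (- u).
rewrite /gam_f normrM (gtr0_norm (_ : 0 < u^-1)) ?invr_gt0// distrC (ger0_norm (_ : 0 <= (1 + u)^-1 - expR (- u))) ?subr_ge0//.
rewrite ler_pdivrMl//.
have [ul|lu] := leP u 1.
  have h : (1 + u)^-1 - expR (- u) <= u ^+ 2 / (1 + u).
    rewrite (_ : u ^+ 2 / (1 + u) = (1 + u)^-1 - (1 - u)); first by rewrite lerD2l lerN2.
    by field; rewrite gt_eqF.
  apply: (le_trans h); rewrite expr2 -mulrA ler_wpM2l ?(ltW u0)//.
  rewrite ler_pdivrMr// mulrC ler_pdivlMr ?opr2_gt0//.
  have : u * u ^+ 2 <= 1 * 1 by apply: ler_pM => //; [exact: ltW|exact: sqr_ge0|rewrite expr_le1// ltW].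
  by rewrite mulrDr mulr1; lra.
apply: (@le_trans _ _ (1 + u)^-1); first by rewrite lerBlDr lerDl.
rewrite -[leLHS]mul1r ler_pdivrMr// mulrAC ler_pdivlMr ?opr2_gt0//.
by rewrite mul1r mulrDr mulr1 -expr2 lerD2r ltW.
Qed.

(** The kernel of the geometric series minus its pole at 0. Its values in [[-1, 0]] make the
    remainder in [euler_gammaE] at most the integral of one exponential. *)
Definition gam_b (u : R) : R := (expR u - 1)^-1 - u^-1.

Lemma expR1_gt0 (u : R) : 0 < u -> u <= expR u - 1 /\ 0 < expR u - 1.
Proof.
move=> u0; have h : u <= expR u - 1 by have := expR_ge1Dx u; lra.
by split => //; exact: lt_le_trans h.
Qed.

Lemma gam_b_le (u : R) : 0 < u -> - 1 <= gam_b u <= 0.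
Proof.
move=> u0; have [h1 h2] := expR1_gt0 u0; rewrite /gam_b; apply/andP; split; last first.
  by rewrite subr_le0 lef_pV2 ?posrE.
have uE : 0 < u * (expR u - 1) by rewrite mulr_gt0.
rewrite -subr_ge0 (_ : _ - _ = (u * expR u - (expR u - 1)) / (u * (expR u - 1))); last first.
  by field; rewrite !gt_eqF.
rewrite divr_ge0 ?(ltW uE)// subr_ge0.
have h3 : (1 + - u) * expR u <= expR (- u) * expR u by rewrite ler_wpM2r ?expR_ge0// expR_ge1Dx.
by rewrite -expRD addNr expR0 mulrDl mul1r mulNr in h3; lra.
Qed.

Definition gam_g (u : R) : R := (expR u - 1)^-1 - (u * (1 + u))^-1.

Lemma cont_expV (u : R) : 0 < u -> {for u, continuous (fun u : R => (expR u - 1)^-1)}.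
Proof.
move=> u0; have [_ h2] := expR1_gt0 u0.
exact: (cont_derive (rderV (rderB (is_derive_expR u) (rderC 1 u)) (lt0r_neq0 h2))).
Qed.

Lemma cont_gam_g (u : R) : 0 < u -> {for u, continuous gam_g}.
Proof.
move=> u0; have u1 : u * (1 + u) != 0 by rewrite gt_eqF// mulr_gt0// addr_gt0.
apply: cvgB; first exact: cont_expV.
exact: (cont_derive (rderV (rderM (rderI u) (rderD (rderC 1 u) (rderI u))) u1)).
Qed.

(** The primitive [ln (1 - exp (- u)) - ln u + ln (1 + u)] lies between 0 and both [u] and [u^-1],
    so it vanishes at 0 and at infinity. *)
Lemma gam_g_int : intg Rp gam_g /\ \int[mu]_(u in Rp) gam_g u = 0.
Proof.
have [iw _] := @intg_cauchy_wt R; have [h1 h2 h3] := exh_ray (0 : R).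
have ig : intg Rp gam_g.
  apply: (intg_le mRp _ (intgZ 6 mRp iw)); first by apply: meas_ray; exact: cont_gam_g.
  move=> u /Rp_gt0 u0; have [b1 b2] := expR1_gt0 u0; have u1 : 0 < 1 + u by rewrite addr_gt0.
  have wE : 6 * cauchy_wt u = 6 / (1 + u ^+ 2) by [].
  have [ul|lu] := leP u 1.
    apply: (@le_trans _ _ 2); last first.
      rewrite wE ler_pdivlMr ?opr2_gt0//.
      have h : u ^+ 2 <= 1 by rewrite expr_le1// ltW.
      by lra.
    rewrite (_ : gam_g u = gam_b u + (1 + u)^-1); last first.
      by rewrite /gam_g /gam_b; field; rewrite !gt_eqF.
    rewrite (le_trans (ler_normD _ _))// (_ : 2 = 1 + 1 :> R); last by ring.
    have /andP[g1 g2] := gam_b_le u0; apply: lerD.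
      by rewrite ler_norml g1 (le_trans g2).
    by rewrite ger0_norm ?invr_ge0 ?(ltW u1)// invf_le1// lerDl ltW.
  have u20 : 0 < u ^+ 2 by rewrite exprn_gt0.
  have e2 : u ^+ 2 / 2 <= expR u - 1.
    have := expR_ge1Dxn 1 (ltW u0); rewrite (_ : 2`!%:R = 2 :> R)//; lra.
  apply: (@le_trans _ _ (3 / u ^+ 2)); last first.
    rewrite wE ler_pdivrMr// mulrAC ler_pdivlMr ?opr2_gt0//.
    have h : 1 <= u ^+ 2 by rewrite expr_ge1// ltW.
    by lra.
  rewrite (le_trans (ler_normB _ _))// (_ : 3 / u ^+ 2 = (u ^+ 2 / 2)^-1 + (u ^+ 2)^-1); last first.
    by field; rewrite gt_eqF.
  apply: lerD.
    by rewrite ger0_norm ?invr_ge0 ?(ltW b2)// lef_pV2 ?posrE ?divr_gt0.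
  rewrite ger0_norm ?invr_ge0 ?mulr_ge0 ?(ltW u1) ?(ltW u0)// lef_pV2 ?posrE ?mulr_gt0//.
  by rewrite expr2 ler_wpM2l ?(ltW u0)// lerDr.
split => //.
pose F (u : R) := ln (1 - expR (- u)) - ln u + ln (1 + u).
have e1 (u : R) : 0 < u -> 0 < 1 - expR (- u) by move=> u0; rewrite subr_gt0 expR_lt1 oppr_lt0.
have FB (u : R) : 0 < u -> 0 <= F u /\ (F u <= u /\ F u <= u^-1).
  move=> u0; have u1 : 0 < 1 + u by rewrite addr_gt0.
  have uV : 0 < u^-1 by rewrite invr_gt0.
  have e0 := e1 u u0.
  have l1 : ln (u / (1 + u)) <= ln (1 - expR (- u)).
    rewrite ler_ln ?posrE ?divr_gt0//.
    have : expR (- u) <= (1 + u)^-1 by rewrite expRN lef_pV2 ?posrE ?expR_gt0// expR_ge1Dx.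
    have -> : u / (1 + u) = 1 - (1 + u)^-1 by field; rewrite gt_eqF.
    by lra.
  have l2 : ln (1 - expR (- u)) <= ln u.
    by rewrite ler_ln ?posrE//; have := expR_ge1Dx (- u); lra.
  have l3 : ln (1 - expR (- u)) <= 0 by apply: ln_le0; have := expR_ge0 (- u); lra.
  rewrite ln_div ?posrE// in l1.
  have l4 : ln (1 + u) <= u by apply: le_ln1Dx; lra.
  have l5 : ln (1 + u) - ln u <= u^-1.
    rewrite -ln_div ?posrE// (_ : (1 + u) / u = 1 + u^-1); last by field; rewrite gt_eqF.
    by apply: le_ln1Dx; lra.
  by rewrite /F; split; [lra|split; lra].
rewrite -[RHS](subrr 0).
apply: (@FTC_exhaust R Rp gam_g F (lo 0) (hi 0) 0 0 mRp h1 h2 h3) => //.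
- move=> u /Rp_gt0 u0; have u1 : 0 < 1 + u by rewrite addr_gt0.
  have d1 := rder_comp (rderB (rderC 1 u) (rder_comp (rderN (rderI u)) (is_derive_expR _))) (is_derive1_ln (e1 u u0)).
  have d2 := rder_comp (rderD (rderC 1 u) (rderI u)) (is_derive1_ln u1).
  apply: rder_eq (rderD (rderB d1 (is_derive1_ln u0)) d2) _.
  have [_ b2] := expR1_gt0 u0.
  rewrite /gam_g expRN; have := gt_eqF (e1 u u0); rewrite expRN => E1.
  have en := gt_eqF (expR_gt0 u); move: (gt_eqF b2) E1 en; move: (expR u) => E n1 n2 n3.
  by field; rewrite gt_eqF// gt_eqF// n1 n3.
- by move=> u /Rp_gt0; exact: cont_gam_g.
- apply: (@cvg0_le R _ (fun n => 1 * lo 0 n)); last exact: loV_cvg.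
  by move=> i; have [f0 [f1 f2]] := FB _ (@lo_gt0 R i); rewrite subr0 mul1r ger0_norm.
- apply: (@cvg0_le R _ (fun n => 1 / hi 0 n)); last exact: hiV_cvg.
  by move=> i; have [f0 [f1 f2]] := FB _ (@hi_gt0 R i); rewrite subr0 mul1r ger0_norm.
Qed.

Definition expsum (n : nat) (u : R) : R := \sum_(1 <= m < n.+1) expR (- (m%:R * u)).

Lemma expsumE n (u : R) : 0 < u -> expsum n u = (1 - expR (- (n%:R * u))) / (expR u - 1).
Proof.
move=> u0; have [_ b2] := expR1_gt0 u0; have bn := gt_eqF b2.
apply: (mulIf (negbT bn)); rewrite divfK ?bn//.
elim: n => [|n IH].
  by rewrite /expsum big_geq// mul0r mul0r oppr0 expR0 subrr.
rewrite /expsum big_nat_recr//= mulrDl -/(expsum n u) IH mulrBr mulr1 -expRD.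
rewrite (_ : - (n.+1%:R * u) + u = - (n%:R * u)); last by rewrite -natr1; ring.
by ring.
Qed.

Lemma expsum_int n : intg Rp (expsum n) /\ \int[mu]_(u in Rp) expsum n u = Defs.harmonic R n.
Proof.
elim: n => [|n [i E]].
  rewrite (_ : expsum 0 = fun=> 0); last by apply/funext => u; rewrite /expsum big_geq.
  rewrite /Defs.harmonic big_geq//; split; first exact: integrable0.
  by rewrite /Rintegral integral0.
have n0 : 0 < n.+1%:R :> R by rewrite ltr0n.
have [ie Ee] := intg_expR n0.
rewrite (_ : expsum n.+1 = fun u => expsum n u + expR (- (n.+1%:R * u))); last first.
  by apply/funext => u; rewrite /expsum big_nat_recr.
split; first exact: intgD.
by rewrite RintegralD// E Ee /Defs.harmonic [in RHS]big_nat_recr.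
Qed.

(* Splits the integrand of [H_n - ln n] into a part with vanishing integral, a part
   not depending on [n] and a part of size at most [1 / n]. *)
Lemma euler_gammaE : \int[mu]_(u in Rp) gam_f u = - euler_gamma R.
Proof.
suff h : Defs.harmonic R n - ln (n%:R) @[n --> \oo] --> - \int[mu]_(u in Rp) gam_f u.
  by rewrite /euler_gamma (cvg_lim _ h)// opprK.
rewrite -(@cvg_shiftS R^o).
apply: (@cvg0_le R _ (fun n => 1 * lo 0 n)); last exact: loV_cvg.
move=> n; rewrite mul1r /lo add0r.
have n0 : 0 < n.+1%:R :> R by rewrite ltr0n.
have nC : 0 < Re (n.+1%:R)%:C by [].
have [[f1 _] f2] := frullani nC.
have ln_n : ln (n.+1%:R) = - \int[mu]_(u in Rp) (u^-1 * (expR (- (n.+1%:R * u)) - expR (- u))).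
  have := congr1 Re f2; rewrite /clog ReImE cmodC ger0_norm//= => h.
  rewrite -[LHS]opprK -h; congr (- _); apply: eq_Rintegral => u _.
  by rewrite /cexp /= !(mulr0, mul0r, subr0, oppr0, addr0) cos0 !mulr1 ?mul0r ?subr0.
have i2 : intg Rp (fun u => u^-1 * (expR (- (n.+1%:R * u)) - expR (- u))).
  move: f1; congr (intg _ _); apply/funext => u /=.
  by rewrite /cexp /= !(mulr0, mul0r, subr0, oppr0, addr0) cos0 !mulr1 ?mul0r ?subr0.
have [i1 E1] := expsum_int n.+1.
have [ig Eg] := gam_g_int; have iff := intg_gam_f.
have [ie Ee] := intg_expR n0.
pose r u := expsum n.+1 u + u^-1 * (expR (- (n.+1%:R * u)) - expR (- u)) - gam_g u + gam_f u.
have ir : intg Rp r by apply: intgD => //; apply: intgB => //; exact: intgD.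
have Er : \int[mu]_(u in Rp) r u = Defs.harmonic R n.+1 - ln (n.+1%:R) - - \int[mu]_(u in Rp) gam_f u.
  rewrite /r RintegralD//; last by apply: intgB => //; exact: intgD.
  rewrite RintegralB//; last exact: intgD.
  by rewrite RintegralD// E1 Eg subr0 ln_n !opprK.
rewrite -Er.
have rE u : 0 < u -> r u = - expR (- (n.+1%:R * u)) * gam_b u.
  move=> u0; have [_ b2] := expR1_gt0 u0.
  rewrite /r expsumE// /gam_g /gam_f /gam_b.
  by field; rewrite !gt_eqF// addr_gt0.
rewrite -Ee; apply: (@le_trans _ _ (\int[mu]_(u in Rp) `|r u|)).
  by apply: le_normr_Rintegral.
apply: le_Rintegral => //; first exact: intg_norm.
move=> u /Rp_gt0 u0; rewrite (rE u u0) normrM normrN [X in X * _]ger0_norm ?expR_ge0//; apply: ler_piMr; first exact: expR_ge0.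
by have /andP[g1 g2] := gam_b_le u0; rewrite ler_norml g1 (le_trans g2).
Qed.

(** The comparison function [(1 + u)^-1] replaces [exp (- u)] at the price of Euler's constant.
    Under [u -> u^-1] it becomes [u / (1 + u)], its complement to 1, which is what [Lq_int] uses. *)
Lemma dlog_int (p : C) : 0 < Re p ->
  cintg Rp (fun u => (u^-1)%:C * (cexp (- (p * u%:C)) - ((1 + u)^-1)%:C)) /\
  cint Rp (fun u => (u^-1)%:C * (cexp (- (p * u%:C)) - ((1 + u)^-1)%:C)) = - clog p - (euler_gamma R)%:C.
Proof.
move=> p0; have [f1 f2] := frullani p0; have g1 := cintg_real intg_gam_f.
rewrite (_ : (fun u => _) = fun u => (u^-1)%:C * (cexp (- (p * u%:C)) - cexp (- u%:C)) + (gam_f u)%:C).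
  by split; [exact: cintgD|rewrite cintD// f2 cint_real euler_gammaE rmorphN].
apply/funext => u; have -> : cexp (- u%:C) = (expR (- u))%:C by apply: eq_ReIm; rewrite /cexp /= oppr0 ?cos0 ?sin0 ?mulr1 ?mulr0.
by rewrite /gam_f rmorphM rmorphB /=; ring.
Qed.

Lemma dlog_inv (q : C) : 0 < Re q ->
  cintg Rp (fun u => (u^-1)%:C * (cexp (- (q * (u^-1)%:C)) - (u / (1 + u))%:C)) /\
  cint Rp (fun u => (u^-1)%:C * (cexp (- (q * (u^-1)%:C)) - (u / (1 + u))%:C)) = - clog q - (euler_gamma R)%:C.
Proof.
move=> q0; have [[i1 i2] <-] := dlog_int q0.
pose f (u : R) := (u^-1)%:C * (cexp (- (q * u%:C)) - ((1 + u)^-1)%:C); rewrite -/f in i1 i2 *.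
have cf (u : R) : 0 < u -> ccont f u.
  move=> u0; apply: ccontM; first exact: ccont_inv.
  apply: ccontD; first exact: ccont_expN.
  apply: ccontN; apply: ccont_real; apply: (cont_derive (rderV (rderD (rderC 1 u) (rderI u)) _)).
  by rewrite gt_eqF// addr_gt0.
have [j1 e1] := inv_intg i1 (fun u u0 => (cf u u0).1).
have [j2 e2] := inv_intg i2 (fun u u0 => (cf u u0).2).
pose g u := (f u^-1) * ((u ^+ 2)^-1)%:C.
have ig : cintg Rp g.
  split; [move: j1|move: j2]; congr (intg _ _); apply/funext => u /=; rewrite /g.
    by ring.
  by ring.
have E : cint Rp g = cint Rp f.
  apply: eq_ReIm; [rewrite -[RHS]e1|rewrite -[RHS]e2]; apply: eq_Rintegral => u _ /=; rewrite /g.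
    by ring.
  by ring.
have gE u : Rp u -> g u = (u^-1)%:C * (cexp (- (q * (u^-1)%:C)) - (u / (1 + u))%:C).
  move=> /Rp_gt0 u0; rewrite /g /f invrK.
  have -> : (1 + u^-1)^-1 = u / (1 + u) by field; rewrite !gt_eqF// addr_gt0.
  rewrite mulrAC -(rmorphM (real_complex R)); congr (_%:C * _).
  by field; rewrite gt_eqF.
split; first exact: eq_cintg gE ig.
by rewrite -E; apply: eq_cint => u Ru; rewrite gE.
Qed.

(** Integration of a pointwise bound from 0, where [F] vanishes along the sequence [ep]. The factor
    2 comes from treating real and imaginary parts separately. *)
Lemma cder_dom (F F' : R -> C) (g g' : R -> R) (s1 : R) (ep : nat -> R) (t : R) :
  (forall t : R, 0 < t < s1 -> cder F t (F' t)) ->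
  (forall t : R, 0 < t < s1 -> is_derive t 1 g (g' t)) ->
  (forall t, 0 < t < s1 -> cmod (F' t) <= g' t) -> (forall t, 0 < t < s1 -> 0 <= g t) ->
  (forall i, 0 < ep i) -> ep i @[i --> \oo] --> 0 -> ccvg (fun i => F (ep i)) 0 ->
  0 < t < s1 -> cmod (F t) <= 2 * g t.
Proof.
move=> dF dg Fg g0 ep0 epc [F1 F2] /andP[t0 t1].
have gen (f f' : R -> R) : (forall t : R, 0 < t < s1 -> is_derive t 1 f (f' t)) ->
    (forall t, 0 < t < s1 -> f' t <= g' t) -> f (ep i) @[i --> \oo] --> 0 -> f t <= g t.
  move=> df fg fgc; rewrite -subr_le0.
  apply: (@ler_cvg_to _ _ _ _ (fun=> f t - g t) (fun i => f (ep i)) _ _ (cvg_cst _) fgc).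
  move/cvgrPdist_lt: epc => /(_ _ t0); apply: filterS => i; rewrite sub0r normrN (gtr0_norm (ep0 i)) => et.
  have fg' x (xI : 0 < x < s1) : f' x - g' x <= 0 by rewrite subr_le0 fg.
  have h := nincr_der (fun x xI => rderB (df x xI) (dg x xI)) fg' (ep0 i) (ltW et) t1.
  apply: (le_trans h).
  by rewrite gerBl g0// ep0 (lt_trans et).
have gen2 (f f' : R -> R) : (forall t : R, 0 < t < s1 -> is_derive t 1 f (f' t)) ->
    (forall t, 0 < t < s1 -> `|f' t| <= g' t) -> f (ep i) @[i --> \oo] --> 0 -> `|f t| <= g t.
  move=> df fg fgc; rewrite ler_norml; apply/andP; split.
    rewrite lerNl; apply: (gen (fun x => - f x) (fun x => - f' x)).
    - by move=> x xI; exact: rderN (df x xI).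
    - by move=> x xI; apply: le_trans (fg x xI); rewrite -normrN ler_norm.
    - by rewrite -[X in _ --> X]oppr0; exact: cvgN.
  by apply: (gen f f') => // x xI; apply: le_trans (fg x xI); exact: ler_norm.
rewrite (le_trans (cmod_leD _))// (_ : 2 * g t = g t + g t); last by ring.
apply: lerD.
  apply: (gen2 (Re \o F) (Re \o F')) => // x xI; first by have [] := dF x xI.
  by rewrite (le_trans (Re_le_cmod _))// Fg.
apply: (gen2 (Im \o F) (Im \o F')) => // x xI; first by have [] := dF x xI.
by rewrite (le_trans (Im_le_cmod _))// Fg.
Qed.

(** A Picard iteration for the chain [t D_n' = G_n], [G_(n+1)' = c D_n]. Each step integrates twice
    from 0, each integration losing the factor 2 of [cder_dom]; hence [4 * cmod c] and the squared
    factorial. *)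
Lemma ode_remainder (c : C) (D G : nat -> R -> C) (B s1 : R) (ep : nat -> R) : 0 <= B ->
  (forall n (t : R), 0 < t < s1 -> cder (D n) t ((t^-1)%:C * G n t)) ->
  (forall n (t : R), 0 < t < s1 -> cder (G n.+1) t (c * D n t)) ->
  (forall t, 0 < t < s1 -> cmod (D 0%N t) <= B) ->
  (forall i, 0 < ep i) -> ep i @[i --> \oo] --> 0 ->
  (forall n, ccvg (fun i => D n.+1 (ep i)) 0) -> (forall n, ccvg (fun i => G n.+1 (ep i)) 0) ->
  forall n t, 0 < t < s1 -> cmod (G n.+1 t) <= 2 * cmod c * B * (4 * cmod c) ^+ n * t ^+ n.+1 / (n.+1%:R * n`!%:R ^+ 2).
Proof.
move=> B0 dD dG D0 ep0 epc Dc Gc.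
have f0 n : 0 < n`!%:R :> R by rewrite ltr0n fact_gt0.
have nn n : 0 < n.+1%:R :> R by rewrite ltr0n.
have c0 := cmod_ge0 c.
pose bD n (t : R) := B * (4 * cmod c) ^+ n * t ^+ n / n`!%:R ^+ 2.
pose bG n (t : R) := 2 * cmod c * B * (4 * cmod c) ^+ n * t ^+ n.+1 / (n.+1%:R * n`!%:R ^+ 2).
have stepG n : (forall t, 0 < t < s1 -> cmod (D n t) <= bD n t) -> forall t, 0 < t < s1 -> cmod (G n.+1 t) <= bG n t.
  move=> h t ti.
  pose k := cmod c * B * (4 * cmod c) ^+ n / (n.+1%:R * n`!%:R ^+ 2).
  have k0 : 0 <= k by have := f0 n => ?; have := nn n => ?; rewrite /k; nonneg.
  have -> : bG n t = 2 * (k * t ^+ n.+1) by rewrite /bG /k; ring.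
  apply: (@cder_dom (G n.+1) (fun t => c * D n t) (fun t => k * t ^+ n.+1) (fun t => k * (n.+1%:R * t ^+ n * 1)) s1 ep t (dG n) _ _ _ ep0 epc (Gc n) ti).
  - by move=> x _; apply: rder_eq (rderZ k (rderX n.+1 (rderI x))) _.
  - move=> x xI; rewrite cmodM mulr1 (_ : k * _ = cmod c * bD n x); first by rewrite ler_wpM2l// h.
    by rewrite /k /bD; field; rewrite !gt_eqF.
  - by move=> x /andP[x0 _]; rewrite mulr_ge0// exprn_ge0// ltW.
have stepD n : (forall t, 0 < t < s1 -> cmod (D n t) <= bD n t) -> forall t, 0 < t < s1 -> cmod (D n.+1 t) <= bD n.+1 t.
  move=> h t ti; have hG := stepG n h.
  pose k := 2 * cmod c * B * (4 * cmod c) ^+ n / (n.+1%:R * n`!%:R ^+ 2) / n.+1%:R.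
  have k0 : 0 <= k by have := f0 n => ?; have := nn n => ?; rewrite /k; nonneg.
  have -> : bD n.+1 t = 2 * (k * t ^+ n.+1).
    by rewrite /bD /k factS natrM !exprS; field; rewrite !gt_eqF.
  apply: (@cder_dom (D n.+1) (fun t => (t^-1)%:C * G n.+1 t) (fun t => k * t ^+ n.+1) (fun t => k * (n.+1%:R * t ^+ n * 1)) s1 ep t (dD n.+1) _ _ _ ep0 epc (Dc n) ti).
  - by move=> x _; apply: rder_eq (rderZ k (rderX n.+1 (rderI x))) _.
  - move=> x xI; have /andP[x0 _] := xI.
    rewrite cmodM cmodC ger0_norm ?invr_ge0 ?(ltW x0)// mulr1 ler_pdivrMl//.
    apply: (le_trans (hG x xI)); rewrite le_eqVlt; apply/orP; left; apply/eqP.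
    by rewrite /bG /k exprS; field; rewrite !gt_eqF.
  - by move=> x /andP[x0 _]; rewrite mulr_ge0// exprn_ge0// ltW.
move=> n; apply: stepG; elim: n => [|n IH]; last exact: stepD.
by move=> t ti; rewrite /bD fact0 expr1n divr1 !expr0 !mulr1 D0.
Qed.

(** * A Bessel equation for the integral and its logarithmic series *)

Section bessel_integral.
Variables p q : C.
Hypotheses (p0 : 0 < Re p) (q0 : 0 < Re q).

(** With the parameter [s], [Lq] is twice the modified Bessel function [K_0] at [2 sqrt (s p q)]. It
    solves [s (s L')' = s p q L], and [s L' = - s p Iq] at [s = 1] is the quantity wanted. *)
Definition kq (s u : R) : C := cexp (- (s%:C * p * u%:C) - q * (u^-1)%:C).
Definition Lq (s : R) : C := cint Rp (fun u => (u^-1)%:C * kq s u).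
Definition Iq (s : R) : C := cint Rp (kq s).
Definition Jq (s : R) : C := cint Rp (fun u => u%:C * kq s u).

Lemma Resp s : Re (s%:C * p) = s * Re p.
Proof. by rewrite !ReImE mul0r subr0. Qed.

Lemma Resp_gt0 s : 0 < s -> 0 < Re (s%:C * p).
Proof. by move=> s0; rewrite Resp mulr_gt0. Qed.

Lemma cmod_kq s u : 0 < u -> cmod (kq s u) <= expR (- (s * Re p * u)).
Proof.
move=> u0; rewrite cmod_cexp ler_expR ReD !ReN !ReM ImM !ReC !ImC !mulr0 !mul0r !subr0 gerDl oppr_le0.
by rewrite divr_ge0// ltW.
Qed.

Lemma kqE s u : kq s u = cexp (- (s%:C * p * u%:C)) * cexp (- (q * (u^-1)%:C)).
Proof. by rewrite /kq cexpD. Qed.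

Lemma der_kq (s u : R) : 0 < u -> cder (kq s) u ((- (s%:C * p) + q * ((u ^+ 2)^-1)%:C) * kq s u).
Proof.
move=> u0; have di : cder (fun u => (u^-1)%:C) u (- (u ^+ 2)^-1)%:C.
  by apply: cder_real; apply: rder_eq (rderV (rderI u) (lt0r_neq0 u0)) _; rewrite mulN1r.
apply: cder_eq (cder_cexp (cderB (cderN (cderZ (s%:C * p) (cder_id u))) (cderZ q di))) _.
by rewrite mulr1 rmorphN mulrN opprK.
Qed.

Lemma der_kqs (s u : R) : cder (kq^~ u) s (- (p * u%:C) * kq s u).
Proof.
apply: cder_eq (cder_cexp (cderB (cderN (cderM (cderM (cder_id s) (cder_cst p s)) (cder_cst u%:C s))) (cder_cst _ s))) _.
by rewrite subr0 /kq; ring.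
Qed.

Lemma meas_kq s (w : R -> R) : (forall u : R, 0 < u -> {for u, continuous w}) -> cmeas Rp (fun u => (w u)%:C * kq s u).
Proof.
move=> cw; apply: ccont_cmeas => u u0; apply: ccontM; last exact: cder_ccont (der_kq s u0).
by apply: ccont_real; exact: cw.
Qed.

Lemma kq_intg s : 0 < s -> cintg Rp (kq s).
Proof.
move=> s0; have [ie _] := intg_expR (Resp_gt0 s0); rewrite Resp in ie.
apply: (cintg_le mRp _ ie); last by move=> u /Rp_gt0; exact: cmod_kq.
by apply: ccont_cmeas => u u0; exact: cder_ccont (der_kq s u0).
Qed.

Lemma uexp_le (v u : R) : 0 < v -> 0 < u -> u * expR (- (v * u)) <= 2 / v * expR (- (v / 2 * u)).
Proof.
move=> v0 u0; rewrite -expR_half mulrA ler_wpM2r ?expR_ge0//.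
have := expR_ge1Dx (v / 2 * u); set E := expR _ => h.
rewrite mulrAC ler_pdivlMr//; have E0 : 0 < E by exact: expR_gt0.
by have -> : u * v = 2 * (v / 2 * u); [field|lra].
Qed.

Lemma ukq_intg s : 0 < s -> cintg Rp (fun u => u%:C * kq s u).
Proof.
move=> s0; have v0 := Resp_gt0 s0; rewrite Resp in v0.
have vh : 0 < s * Re p / 2 by rewrite divr_gt0.
have [ie _] := intg_expR vh.
apply: (cintg_le mRp _ (intgZ (2 / (s * Re p)) mRp ie)).
  by apply: (meas_kq s) => u _; exact: (cont_derive (rderI u)).
move=> u /Rp_gt0 u0; rewrite cmodM cmodC (gtr0_norm u0).
by apply: le_trans (uexp_le v0 u0); rewrite ler_wpM2l ?(ltW u0)// cmod_kq.
Qed.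

(** The remainder in [x y = x + y - 1 + (x - 1) (y - 1)] for the two exponentials of [kq]; the other
    terms are integrated exactly by [dlog_int] and [dlog_inv]. *)
Definition Eq (s u : R) : C := (u^-1)%:C * ((cexp (- (s%:C * p * u%:C)) - 1) * (cexp (- (q * (u^-1)%:C)) - 1)).

(** The factors are at most [3 s |p| u] and [3 |q| / u], and each is at most 2. The cut at [u = X],
    the inverse of [sqrt s], balances the two cases and gives the order [sqrt s]. *)
Lemma Eq_int s : 0 < s -> cintg Rp (Eq s) /\ cmod (cint Rp (Eq s)) <= 12 * (cmod p + cmod q) * pi * Num.sqrt s.
Proof.
move=> s0; pose X := (Num.sqrt s)^-1; have r0 : 0 < Num.sqrt s by rewrite sqrtr_gt0.
have X0 : 0 < X by rewrite invr_gt0.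
have rs : Num.sqrt s ^+ 2 = s by rewrite sqr_sqrtr// ltW.
have XX : X ^+ 2 = s^-1 by rewrite exprVn rs.
have [ic ec] := cauchy_int 0 X0.
have pg := cmod_ge0 p; have qg := cmod_ge0 q.
have k0 : 0 <= 12 * (cmod p + cmod q) by nonneg.
have ig := intgZ (12 * (cmod p + cmod q)) mRp ic.
have mE : cmeas Rp (Eq s).
  apply: ccont_cmeas => u u0; apply: ccontM; first exact: ccont_inv.
  apply: ccontM; apply: ccontD; try exact: ccont_cst; first exact: ccont_expN.
  have di : cder (fun u => (u^-1)%:C) u (- (u ^+ 2)^-1)%:C.
    by apply: cder_real; apply: rder_eq (rderV (rderI u) (lt0r_neq0 u0)) _; rewrite mulN1r.
  exact: (cder_ccont (cder_cexp (cderN (cderZ q di)))).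
have bd u : Rp u -> cmod (Eq s u) <= 12 * (cmod p + cmod q) * (X ^+ 2 + (u + 0) ^+ 2)^-1.
  move=> /Rp_gt0 u0; rewrite addr0 XX.
  have v1 : 0 <= Re (s%:C * p * u%:C) by rewrite ReM ReC ImC mulr0 subr0 mulr_ge0 ?(ltW u0)// ltW// Resp_gt0.
  have v2 : 0 <= Re (q * (u^-1)%:C) by rewrite ReM ReC ImC mulr0 subr0 divr_ge0// ltW.
  have [a1 a2] := cexpN_le v1; have [b1 b2] := cexpN_le v2.
  rewrite !cmodM !cmodC (gtr0_norm s0) (gtr0_norm u0) in a2.
  rewrite cmodM cmodC in b2; rewrite /Eq !cmodM cmodC (_ : `|u^-1| = u^-1) in b2 *; last by rewrite gtr0_norm// invr_gt0.
  rewrite ler_pdivrMl//.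
  have sV : 0 < s^-1 by rewrite invr_gt0.
  have qq : 0 < s^-1 + u ^+ 2 by rewrite ltr_pwDl// sqr_ge0.
  have [us|su] := leP (u ^+ 2) s^-1.
    apply: (@le_trans _ _ (3 * (s * cmod p * u) * 2)); first by apply: ler_pM; rewrite ?cmod_ge0.
    have -> : 3 * (s * cmod p * u) * 2 = u * (6 * cmod p * s) by ring.
    rewrite ler_wpM2l ?(ltW u0)//.
    apply: (@le_trans _ _ (12 * cmod p * (s^-1 + u ^+ 2)^-1)); last first.
      by rewrite ler_wpM2r ?invr_ge0 ?(ltW qq)// ler_wpM2l// lerDl.
    rewrite ler_pdivlMr//.
    have -> : 12 * cmod p = 6 * cmod p * 2 by ring.
    have -> : 6 * cmod p * s * (s^-1 + u ^+ 2) = 6 * cmod p * (s * (s^-1 + u ^+ 2)) by ring.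
    apply: ler_wpM2l; first by rewrite mulr_ge0.
    rewrite mulrDr divff ?gt_eqF//.
    have : s * u ^+ 2 <= 1 by rewrite -ler_pdivlMl// mulr1.
    by lra.
  apply: (@le_trans _ _ (2 * (3 * (cmod q * u^-1)))); first by apply: ler_pM; rewrite ?cmod_ge0.
  have -> : 2 * (3 * (cmod q / u)) = u * (6 * cmod q / u ^+ 2) by field; rewrite gt_eqF.
  rewrite ler_wpM2l ?(ltW u0)//.
  apply: (@le_trans _ _ (12 * cmod q * (s^-1 + u ^+ 2)^-1)); last first.
    by rewrite ler_wpM2r ?invr_ge0 ?(ltW qq)// ler_wpM2l// lerDr.
  have -> : 12 * cmod q * (s^-1 + u ^+ 2)^-1 = 6 * cmod q * (2 / (s^-1 + u ^+ 2)) by ring.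
  apply: ler_wpM2l; first by rewrite mulr_ge0.
  rewrite ler_pdivlMr// mulrC ler_pdivrMr ?exprn_gt0//; lra.
have iE : cintg Rp (Eq s) by apply: (cintg_le mRp mE ig bd).
split; first exact: iE.
apply: (le_trans (cint_le mRp iE ig bd)); rewrite RintegralZl// -[leRHS]mulrA ler_wpM2l//.
by apply: (le_trans ec); rewrite /X invrK.
Qed.

Lemma clogZ s z : 0 < s -> 0 < Re z -> clog (s%:C * z) = (ln s)%:C + clog z.
Proof.
move=> s0 z0; have cz : 0 < cmod z.
  by apply: (lt_le_trans z0); apply: le_trans (Re_le_cmod z); exact: ler_norm.
have c1 : ln (cmod (s%:C * z)) = ln s + ln (cmod z) by rewrite cmodM cmodC (gtr0_norm s0) lnM ?posrE.
have c2 : carg (s%:C * z) = carg z.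
  by rewrite /carg !ReImE !mul0r subr0 addr0 z0 mulr_gt0// -mulf_div divff ?gt_eqF// mul1r.
by rewrite /clog c1 c2; apply: eq_ReIm; rewrite ?ReD ?ImD //= add0r.
Qed.

Lemma Lq_int s : 0 < s -> cintg Rp (fun u => (u^-1)%:C * kq s u) /\
  Lq s = - ((ln s)%:C + clog p + clog q) - (2 * euler_gamma R)%:C + cint Rp (Eq s).
Proof.
move=> s0; have [i1 e1] := dlog_int (Resp_gt0 s0); have [i2 e2] := dlog_inv q0; have [i3 _] := Eq_int s0.
have i12 := cintgD mRp i1 i2.
have E u : Rp u -> (u^-1)%:C * (cexp (- (s%:C * p * u%:C)) - ((1 + u)^-1)%:C) +
   (u^-1)%:C * (cexp (- (q * (u^-1)%:C)) - (u / (1 + u))%:C) + Eq s u = (u^-1)%:C * kq s u.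
  move=> /Rp_gt0 u0; rewrite kqE /Eq.
  have -> : (u / (1 + u))%:C = 1 - ((1 + u)^-1)%:C :> C.
    rewrite (_ : u / (1 + u) = 1 - (1 + u)^-1) ?rmorphB ?rmorph1//.
    by field; rewrite gt_eqF// addr_gt0.
  by ring.
split; first exact: (eq_cintg mRp E (cintgD mRp i12 i3)).
rewrite /Lq -(eq_cint E) (cintD mRp i12 i3) (cintD mRp i1 i2) e1 e2 (clogZ s0 p0) rmorphM /=.
by rewrite (_ : (2 : R)%:C = 2); [ring|exact: (rmorph_nat (real_complex R) 2)].
Qed.

(** The second initial value of the equation: [s L'] tends to -1. The integral is compared with the
    Laplace integral without [q], with the same cut as in [Eq_int]. *)
Lemma Iq_asym s : 0 < s -> cmod (s%:C * p * Iq s - 1) <= cmod p * (4 * pi + 3 * cmod q / Re p) * Num.sqrt s.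
Proof.
move=> s0; pose r := Num.sqrt s; have r0 : 0 < r by rewrite sqrtr_gt0.
have rs : r ^+ 2 = s by rewrite sqr_sqrtr// ltW.
pose X := r^-1; have X0 : 0 < X by rewrite invr_gt0.
have v0 := Resp_gt0 s0; have [i1 e1] := laplace_int v0.
have pn : p != 0 by apply/eqP => H; move: p0; rewrite H ltxx.
have sn : s%:C != 0 :> C by rewrite fmorph_eq0 gt_eqF.
have iI := kq_intg s0.
have -> : s%:C * p * Iq s - 1 = s%:C * p * cint Rp (fun u => kq s u - cexp (- (s%:C * p * u%:C))).
  by rewrite cintB// e1 mulrBr divff// mulf_neq0.
have [ic ec] := cauchy_int 0 X0; rewrite Resp in v0; have [ie Ee] := intg_expR v0.
have qg := cmod_ge0 q; have pg := cmod_ge0 p.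
have k1 : 0 <= 4 * X ^+ 2 by have := ltW X0 => ?; nonneg.
have k2 : 0 <= 3 * cmod q / X by have := ltW X0 => ?; nonneg.
have ig : intg Rp (fun u => 4 * X ^+ 2 * (X ^+ 2 + (u + 0) ^+ 2)^-1 + 3 * cmod q / X * expR (- (s * Re p * u))).
  by apply: intgD => //; exact: intgZ.
have bd u : Rp u -> cmod (kq s u - cexp (- (s%:C * p * u%:C))) <=
   4 * X ^+ 2 * (X ^+ 2 + (u + 0) ^+ 2)^-1 + 3 * cmod q / X * expR (- (s * Re p * u)).
  move=> /Rp_gt0 u0; rewrite addr0 kqE -[X in cmod (_ - X)]mulr1 -mulrBr cmodM.
  have v2 : 0 <= Re (q * (u^-1)%:C) by rewrite ReM ReC ImC mulr0 subr0 divr_ge0// ltW.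
  have [b1 b2] := cexpN_le v2; rewrite cmodM cmodC (_ : `|u^-1| = u^-1) in b2; last by rewrite gtr0_norm// invr_gt0.
  have E1 : cmod (cexp (- (s%:C * p * u%:C))) = expR (- (s * Re p * u)).
    by rewrite cmod_cexp ReN !ReM ImM !ReC !ImC !mulr0 !mul0r !subr0.
  have E2 : expR (- (s * Re p * u)) <= 1 by rewrite -[leRHS]expR0 ler_expR oppr_le0; apply: mulr_ge0; exact: ltW.
  have E3 := expR_ge0 (- (s * Re p * u)).
  have X2 : 0 < X ^+ 2 by rewrite exprn_gt0.
  have qq : 0 < X ^+ 2 + u ^+ 2 by rewrite ltr_pwDl// sqr_ge0.
  rewrite E1; have [uX|Xu] := leP u X.
    apply: ler_wpDr; first by rewrite mulr_ge0.
    apply: (@le_trans _ _ (1 * 2)); first by apply: ler_pM; rewrite ?cmod_ge0.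
    rewrite mul1r ler_pdivlMr//.
    have : u ^+ 2 <= X ^+ 2 by rewrite !expr2; apply: ler_pM => //; exact: ltW.
    by lra.
  apply: ler_wpDl; first by rewrite mulr_ge0// invr_ge0 ltW.
  rewrite mulrC ler_wpM2r//; apply: (le_trans b2).
  rewrite mulrA ler_wpM2l ?mulr_ge0// lef_pV2 ?posrE//; exact: ltW.
have iD := cintgB mRp iI i1.
have B := le_trans (cint_le mRp iD ig bd) (lexx _).
rewrite !cmodM cmodC (gtr0_norm s0).
have -> : cmod p * (4 * pi + 3 * cmod q / Re p) * Num.sqrt s = s * cmod p * (4 * X ^+ 2 * (pi / X) + 3 * cmod q / X * (s * Re p)^-1).
  by rewrite -/r -rs /X; field; rewrite !gt_eqF.
rewrite ler_wpM2l ?mulr_ge0 ?(ltW s0)//; apply: (le_trans B).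
rewrite RintegralD//; [|exact: intgZ..].
by rewrite !RintegralZl// Ee lerD2r ler_wpM2l.
Qed.

Lemma Lq_der (s : R) : 0 < s -> cder Lq s (- p * Iq s) /\ cder Iq s (- p * Jq s).
Proof.
move=> s0; have st : s / 2 < s < 2 * s by apply/andP; split; lra.
have tp t (h : s / 2 < t < 2 * s) : 0 < t by move/andP: h => [h _]; apply: lt_trans h; rewrite divr_gt0.
have v0 : 0 < s / 2 * Re p by rewrite mulr_gt0// divr_gt0.
have vh : 0 < s / 2 * Re p / 2 by rewrite divr_gt0.
have kb t u (h : s / 2 < t < 2 * s) : 0 < u -> cmod (kq t u) <= expR (- (s / 2 * Re p * u)).
  move=> u0; apply: (le_trans (cmod_kq t u0)); rewrite ler_expR lerN2 ler_wpM2r ?(ltW u0)// ler_wpM2r ?(ltW p0)//.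
  by have /andP[/ltW] := h.
have [i1 _] := intg_expR v0; have [i2 _] := intg_expR vh.
have un u : 0 < u -> u%:C != 0 :> C by move=> u0; rewrite fmorph_eq0 gt_eqF.
split.
  have -> : - p * Iq s = cint Rp (fun u => - p * kq s u) by rewrite /Iq cintZ//; exact: kq_intg.
  apply: (@cint_cder R Rp (fun s u => (u^-1)%:C * kq s u) (fun s u => - p * kq s u) s (s / 2) (2 * s)
    (fun u => cmod p * expR (- (s / 2 * Re p * u))) mRp st).
  - by move=> t h; have [] := Lq_int (tp t h).
  - move=> t u h /Rp_gt0 u0; apply: cder_eq (cderZ _ (der_kqs t u)) _.
    by rewrite fmorphV; field; exact: un.
  - exact: intgZ.
  - by move=> t u h /Rp_gt0 u0; rewrite cmodM cmodN ler_wpM2l ?cmod_ge0// kb.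
have -> : - p * Jq s = cint Rp (fun u => - p * (u%:C * kq s u)) by rewrite /Jq cintZ//; exact: ukq_intg.
apply: (@cint_cder R Rp kq (fun s u => - p * (u%:C * kq s u)) s (s / 2) (2 * s)
  (fun u => cmod p * (2 / (s / 2 * Re p) * expR (- (s / 2 * Re p / 2 * u)))) mRp st).
- by move=> t h; exact: kq_intg (tp t h).
- by move=> t u h /Rp_gt0 u0; apply: cder_eq (der_kqs t u) _; ring.
- by apply: intgZ => //; exact: intgZ.
- move=> t u h /Rp_gt0 u0; rewrite !cmodM cmodN cmodC (gtr0_norm u0) ler_wpM2l ?cmod_ge0//.
  by apply: le_trans (uexp_le v0 u0); rewrite ler_wpM2l ?(ltW u0)// kb.
Qed.

Lemma kq_ibp s : 0 < s -> Iq s - s%:C * p * Jq s = - (q * Lq s).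
Proof.
move=> s0; have iI := kq_intg s0; have iJ := ukq_intg s0; have [iL _] := Lq_int s0.
have [h1 h2 h3] := exh_ray (0 : R); have v0 := Resp_gt0 s0; rewrite Resp in v0.
have iJ' := cintgZ (s%:C * p) mRp iJ; have iL' := cintgZ q mRp iL.
apply/eqP; rewrite -subr_eq0 opprK; apply/eqP.
rewrite /Iq /Jq /Lq -(cintZ _ mRp iJ) -(cintZ _ mRp iL) -(cintB mRp iI iJ') -(cintD mRp (cintgB mRp iI iJ') iL').
rewrite -[RHS](subrr 0).
apply: (@cint_FTC R Rp (fun u => u%:C * kq s u) _ (lo 0) (hi 0) 0 0 mRp h1 h2 h3).
- move=> u /Rp_gt0 u0; apply: cder_eq (cderM (cder_id u) (der_kq s u0)) _.
  have -> : ((u ^+ 2)^-1)%:C = (u^-1)%:C * (u^-1)%:C :> C by rewrite -rmorphM -invfM.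
  have un : u%:C != 0 :> C by rewrite fmorph_eq0 gt_eqF.
  by rewrite fmorphV; field.
- move=> u /Rp_gt0 u0; have ck := cder_ccont (der_kq s u0); have cc c := ccont_cst c u.
  exact: (ccontD (ccontD ck (ccontN (ccontM (cc _) (ccontM (cder_ccont (cder_id u)) ck))))
    (ccontM (cc _) (ccontM (ccont_inv u0) ck))).
- exact: (cintgD mRp (cintgB mRp iI iJ') iL').
- apply: (@ccvg_le R _ _ (fun i => 1 * lo 0 i)); last exact: loV_cvg.
  move=> i; have l0 := @lo_gt0 R i; rewrite subr0 mul1r /= cmodM cmodC (gtr0_norm l0) ler_piMr ?(ltW l0)//.
  apply: (le_trans (cmod_kq s l0)); rewrite -[leRHS]expR0 ler_expR oppr_le0; apply: mulr_ge0; exact: ltW.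
- apply: (@ccvg_le R _ _ (fun i => (2 / (s * Re p) * (s * Re p / 2)^-1) / hi 0 i)); last exact: hiV_cvg.
  move=> i; have l0 := @hi_gt0 R i; rewrite subr0 /= cmodM cmodC (gtr0_norm l0).
  apply: (@le_trans _ _ (hi 0 i * expR (- (s * Re p * hi 0 i)))).
    by rewrite ler_wpM2l ?(ltW l0)// cmod_kq.
  apply: (le_trans (uexp_le v0 l0)); rewrite -[leRHS]mulrA ler_wpM2l ?divr_ge0 ?(ltW v0)//.
  by rewrite -invfM expRN_le// mulr_gt0// divr_gt0.
Qed.

Definition inv_fact_sqr (m : nat) : C := (m`!%:R * m`!%:R)^-1.
Definition psi (m : nat) : C := (digamma_succ R m)%:C.
Definition log_spq (s : R) : C := (ln s)%:C + clog p + clog q.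

Lemma psiS m : psi m.+1 = psi m + (m.+1%:R)^-1.
Proof.
rewrite /psi /digamma_succ /Defs.harmonic big_nat_recr//= addrA rmorphD; congr (_ + _).
by rewrite fmorphV (rmorph_nat (real_complex R)).
Qed.

Lemma inv_fact_sqrS m : inv_fact_sqr m.+1 * m.+1%:R ^+ 2 = inv_fact_sqr m.
Proof.
have h : m.+1%:R != 0 :> C by rewrite pnatr_eq0.
have f : m`!%:R != 0 :> C by rewrite pnatr_eq0 -lt0n fact_gt0.
by rewrite /inv_fact_sqr factS natrM; move: (m.+1%:R) (m`!%:R) h f => x y h f; field; rewrite h f.
Qed.

(** The terms of the Frobenius solution of [s (s L')' = s p q L] at the double exponent 0;
    [log_term'] is [s] times the derivative. For [m = 0] it equals -1, the limit of [s L']. *)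
Definition log_term m s : C := inv_fact_sqr m * (s%:C * (p * q)) ^+ m * (2 * psi m - log_spq s).
Definition log_term' m s : C := inv_fact_sqr m * (s%:C * (p * q)) ^+ m * (m%:R * (2 * psi m - log_spq s) - 1).
Definition remL n s : C := Lq s - \sum_(m < n.+1) log_term m s.
Definition remI n s : C := - (s%:C * p * Iq s) - \sum_(m < n.+1) log_term' m s.

Lemma der_log_spq (s : R) : 0 < s -> cder log_spq s ((s^-1)%:C).
Proof.
move=> s0; apply: cder_eq (cderD (cderD (cder_real (is_derive1_ln s0)) (cder_cst (clog p) s)) (cder_cst (clog q) s)) _.
by rewrite !addr0.
Qed.

Lemma der_pow (c : C) m (s : R) : 0 < s -> cder (fun s => (s%:C * c) ^+ m) s ((s^-1)%:C * (m%:R * (s%:C * c) ^+ m)).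
Proof.
move=> s0; apply: cder_eq (cderX m (cderM (cder_id s) (cder_cst c s))) _.
have sn : s%:C != 0 :> C by rewrite fmorph_eq0 gt_eqF.
case: m => [|m]; first by rewrite !mul0r mulr0.
by rewrite fmorphV [in RHS]exprS; field.
Qed.

Lemma der_log_term m (s : R) : 0 < s -> cder (log_term m) s ((s^-1)%:C * log_term' m s).
Proof.
move=> s0; apply: cder_eq (cderM (cderZ (inv_fact_sqr m) (der_pow (p * q) m s0)) (cderB (cder_cst (2 * psi m) s) (der_log_spq s0))) _.
by rewrite /log_term'; ring.
Qed.

Lemma der_log_term' m (s : R) : 0 < s -> cder (log_term' m) s
  ((s^-1)%:C * (inv_fact_sqr m * (s%:C * (p * q)) ^+ m * (m%:R ^+ 2 * (2 * psi m - log_spq s) - 2 * m%:R))).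
Proof.
move=> s0; apply: cder_eq (cderM (cderZ (inv_fact_sqr m) (der_pow (p * q) m s0))
  (cderB (cderZ m%:R (cderB (cder_cst (2 * psi m) s) (der_log_spq s0))) (cder_cst 1 s))) _.
by ring.
Qed.

Lemma cder_sum (n : nat) (F F' : nat -> R -> C) (s : R) : (forall m, cder (F m) s (F' m s)) ->
  cder (fun s => \sum_(m < n) F m s) s (\sum_(m < n) F' m s).
Proof.
move=> h; elim: n => [|n IH].
  rewrite big_ord0 (_ : (fun s => _) = fun=> 0); first exact: cder_cst.
  by apply/funext => t; rewrite big_ord0.
rewrite big_ord_recr /= (_ : (fun s => _) = fun s => \sum_(m < n) F m s + F n s); last first.
  by apply/funext => t; rewrite big_ord_recr.
exact: cderD.
Qed.

Lemma der_remL n (s : R) : 0 < s -> cder (remL n) s ((s^-1)%:C * remI n s).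
Proof.
move=> s0; have [d _] := Lq_der s0.
apply: cder_eq (cderB d (@cder_sum n.+1 log_term (fun m s => (s^-1)%:C * log_term' m s) s (fun m => der_log_term m s0))) _.
have sn : s%:C != 0 :> C by rewrite fmorph_eq0 gt_eqF.
rewrite /remI mulrBr mulr_sumr; congr (_ - _).
by rewrite fmorphV; field.
Qed.

(** The Frobenius recursion: by [psiS] and [inv_fact_sqrS] the derivative of the term [m.+1] of
    [log_term'] is [p q] times [log_term m], which is why the index drops from [n.+1] to [n]. *)
Lemma der_remI n (s : R) : 0 < s -> cder (remI n.+1) s ((p * q) * remL n s).
Proof.
move=> s0; have [_ d] := Lq_der s0.
apply: cder_eq (cderB (cderN (cderM (cderM (cder_id s) (cder_cst p s)) d)) (@cder_sum n.+2 log_term' (fun m s =>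
  (s^-1)%:C * (inv_fact_sqr m * (s%:C * (p * q)) ^+ m * (m%:R ^+ 2 * (2 * psi m - log_spq s) - 2 * m%:R))) s (fun m => der_log_term' m s0))) _.
rewrite /remL mulrBr; congr (_ - _).
  have := kq_ibp s0 => h.
  have -> : p * q * Lq s = - (p * - (q * Lq s)) by ring.
  by rewrite -h; ring.
have sn : s%:C != 0 :> C by rewrite fmorph_eq0 gt_eqF.
rewrite big_ord_recl /= (_ : (0%N%:R : C) = 0)// (expr0n C 2) mul0r mulr0 subrr !mulr0 add0r mulr_sumr; apply: eq_bigr => m _.
rewrite /bump /= add1n /log_term -(inv_fact_sqrS m) psiS exprS fmorphV.
have h : m.+1%:R != 0 :> C by rewrite pnatr_eq0.
by move: (m.+1%:R) (psi m) h => X P h; field; rewrite sn h.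
Qed.

Definition Brem : R := 24 * (cmod p + cmod q) * pi.

Lemma log_spq_le r : 0 < r -> r <= 1 -> cmod (log_spq (r ^+ 2)) * r <= 2 + cmod (clog p + clog q).
Proof.
move=> r0 r1; rewrite /log_spq -addrA.
apply: (@le_trans _ _ ((cmod (ln (r ^+ 2))%:C + cmod (clog p + clog q)) * r)).
  by rewrite ler_wpM2r ?(ltW r0)// ler_cmodD.
rewrite mulrDl; apply: lerD; last by rewrite ler_piMr ?cmod_ge0.
have l0 : ln r <= 0 by exact: ln_le0.
rewrite cmodC lnXn// normrMn ler0_norm// -lnV ?posrE//.
have := ln_sublinear (_ : 0 < r^-1); rewrite invr_gt0 => /(_ r0) /ltW h.
rewrite (_ : ln r^-1 *+ 2 * r = 2 * (ln r^-1 * r)); last by ring.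
rewrite ler_piMr//; apply: (@le_trans _ _ (r^-1 * r)); first by rewrite ler_wpM2r ?(ltW r0).
by rewrite mulVf ?gt_eqF.
Qed.

Lemma sqr_le1 (r : R) : 0 < r -> r <= 1 -> r ^+ 2 <= r.
Proof. by move=> r0 r1; rewrite expr2 ler_piMr// ltW. Qed.

Lemma log_term_le m : exists A, forall r, 0 < r -> r <= 1 -> cmod (log_term m.+1 (r ^+ 2)) <= A * r /\ cmod (log_term' m.+1 (r ^+ 2)) <= A * r.
Proof.
pose b := cmod (inv_fact_sqr m.+1) * cmod (p * q) ^+ m.+1.
pose A1 := cmod (2 * psi m.+1) + (2 + cmod (clog p + clog q)).
have b0 : 0 <= b by rewrite mulr_ge0 ?exprn_ge0 ?cmod_ge0.
have A10 : 0 <= A1 by rewrite !addr_ge0 ?cmod_ge0.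
exists (b * (m.+1%:R * A1 + 1)) => r r0 r1.
have h1 : cmod (2 * psi m.+1 - log_spq (r ^+ 2)) * r <= A1.
  apply: (@le_trans _ _ ((cmod (2 * psi m.+1) + cmod (log_spq (r ^+ 2))) * r)).
    by rewrite ler_wpM2r ?(ltW r0)// ler_cmodB.
  rewrite mulrDl; apply: lerD; last exact: log_spq_le.
  by rewrite ler_piMr ?cmod_ge0.
have h2 : cmod (inv_fact_sqr m.+1 * ((r ^+ 2)%:C * (p * q)) ^+ m.+1) <= b * r ^+ 2.
  rewrite cmodM cmodX cmodM cmodC ger0_norm ?sqr_ge0// exprMn [_ ^+ m.+1 * _]mulrC mulrA -/b ler_wpM2l//.
  rewrite exprS ler_piMr ?sqr_ge0// exprn_ile1 ?sqr_ge0//.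
  by rewrite (le_trans (sqr_le1 r0 r1)).
have m1 : 1 <= m.+1%:R :> R by rewrite ler1n.
have r0' := ltW r0.
have key Y : cmod Y * r <= m.+1%:R * A1 + 1 -> cmod (inv_fact_sqr m.+1 * ((r ^+ 2)%:C * (p * q)) ^+ m.+1 * Y) <= b * (m.+1%:R * A1 + 1) * r.
  move=> hY; rewrite cmodM; apply: (@le_trans _ _ (b * r ^+ 2 * cmod Y)); first by rewrite ler_wpM2r ?cmod_ge0.
  have -> : b * r ^+ 2 * cmod Y = b * r * (cmod Y * r) by ring.
  have -> : b * (m.+1%:R * A1 + 1) * r = b * r * (m.+1%:R * A1 + 1) by ring.
  by rewrite ler_wpM2l// mulr_ge0.
split; apply: key.
  by apply: (le_trans h1); rewrite ler_wpDr// ler_peMl.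
apply: (@le_trans _ _ ((m.+1%:R * cmod (2 * psi m.+1 - log_spq (r ^+ 2)) + 1) * r)).
  by rewrite ler_wpM2r// (le_trans (ler_cmodB _ _))// cmodM cmodn cmod1.
rewrite mulrDl mul1r; apply: lerD => //.
by rewrite -mulrA ler_wpM2l.
Qed.

Lemma remL0 s : 0 < s -> remL 0 s = cint Rp (Eq s).
Proof.
move=> s0; have [_ E] := Lq_int s0.
rewrite /remL E big_ord_recl big_ord0 addr0 /log_term /inv_fact_sqr /psi /digamma_succ /Defs.harmonic big_geq// fact0 mul1r invr1 expr0 !mul1r addr0.
rewrite /log_spq rmorphN rmorphM /= (_ : (2 : R)%:C = 2); [ring|exact: (rmorph_nat (real_complex R) 2)].
Qed.

(** The vanishing initial values for [ode_remainder]. Writing [s = r ^+ 2] leaves a spare factor [r]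
    that absorbs the logarithm. *)
Lemma rem_le_sqrt n : exists A, forall r, 0 < r -> r <= 1 -> cmod (remL n (r ^+ 2)) <= A * r /\ cmod (remI n (r ^+ 2)) <= A * r.
Proof.
elim: n => [|n [A hA]].
  exists (12 * (cmod p + cmod q) * pi + cmod p * (4 * pi + 3 * cmod q / Re p)) => r r0 r1.
  have s0 : 0 < r ^+ 2 by rewrite exprn_gt0.
  have rr : Num.sqrt (r ^+ 2) = r by rewrite sqrtr_sqr gtr0_norm.
  have pg := cmod_ge0 p; have qg := cmod_ge0 q; have p0' := ltW p0; have r0' := ltW r0.
  rewrite mulrDl; split.
    have [_ h] := Eq_int s0; rewrite remL0//; apply: (le_trans h); rewrite rr lerDl.
    by nonneg.
  have := Iq_asym s0; rewrite rr => h.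
  rewrite /remI big_ord_recl big_ord0 addr0 /log_term' /inv_fact_sqr fact0 mul1r invr1 expr0 !mul1r mul0r add0r opprK.
  rewrite -cmodN opprD opprK; apply: (le_trans h); rewrite lerDr.
  by nonneg.
have [A' hA'] := log_term_le n; exists (A + A') => r r0 r1.
have [a1 a2] := hA r r0 r1; have [b1 b2] := hA' r r0 r1.
rewrite mulrDl; split.
  rewrite (_ : remL n.+1 _ = remL n (r ^+ 2) - log_term n.+1 (r ^+ 2)); last first.
    by rewrite /remL [in LHS]big_ord_recr /= opprD addrA.
  by rewrite (le_trans (ler_cmodB _ _))// lerD.
rewrite (_ : remI n.+1 _ = remI n (r ^+ 2) - log_term' n.+1 (r ^+ 2)); last first.
  by rewrite /remI [in LHS]big_ord_recr /= opprD addrA.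
by rewrite (le_trans (ler_cmodB _ _))// lerD.
Qed.

Definition bterm (m : nat) : C := (m`!%:R * m.+1`!%:R)^-1 * (p * q) ^+ m.

(** [ode_remainder] at [s = 1]. The bound tends to 0 in [n], so the convergence of the series comes
    with the identity. The term [m = 0] of [log_term'] gives the summand 1, the others are shifted
    by one. *)
Lemma bessel_remainder n :
  cmod (p * Iq 1 - (1 + p * q * \sum_(m < n.+1) bterm m * (clog p + clog q - psi m - psi m.+1))) <=
  2 * cmod (p * q) * Brem * (4 * cmod (p * q)) ^+ n / n`!%:R.
Proof.
have lo1 i : lo 0 i <= 1 :> R by rewrite /lo add0r invf_le1 ?ler1n.
pose ep i : R := lo 0 i ^+ 2.
have ep0 i : 0 < ep i by rewrite exprn_gt0// lo_gt0.
have lc : lo 0 i @[i --> \oo] --> (0 : R) by have := @lo_cvg R 0.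
have epc : ep i @[i --> \oo] --> 0.
  rewrite (_ : ep = fun i => lo 0 i * lo 0 i); last by apply/funext => i; rewrite /ep expr2.
  by rewrite -[X in _ --> X](mulr0 0); exact: (cvgM lc lc).
have Dc m : ccvg (fun i => remL m.+1 (ep i)) 0.
  have [A hA] := rem_le_sqrt m.+1; apply: (@ccvg_le R _ _ (fun i => A * lo 0 i)); last exact: loV_cvg.
  by move=> i; rewrite subr0; have [] := hA _ (@lo_gt0 R i) (lo1 i).
have Gc m : ccvg (fun i => remI m.+1 (ep i)) 0.
  have [A hA] := rem_le_sqrt m.+1; apply: (@ccvg_le R _ _ (fun i => A * lo 0 i)); last exact: loV_cvg.
  by move=> i; rewrite subr0; have [] := hA _ (@lo_gt0 R i) (lo1 i).
have pg := cmod_ge0 p; have qg := cmod_ge0 q.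
have B0 : 0 <= Brem by rewrite /Brem; nonneg.
(* The interval extends to 2 to make [s = 1] an interior point; [Brem] contains the bound 2 for
   [sqrt t] there. *)
have D0 t : 0 < t < 2 -> cmod (remL 0 t) <= Brem.
  move=> /andP[t0 t2]; rewrite remL0//; have [_ h] := Eq_int t0; apply: (le_trans h).
  rewrite (_ : Brem = 12 * (cmod p + cmod q) * pi * 2); last by rewrite /Brem; ring.
  rewrite ler_wpM2l//; first by nonneg.
  apply: (@le_trans _ _ (Num.sqrt (2 ^+ 2))); last by rewrite sqrtr_sqr ger0_norm.
  by rewrite ler_sqrt ?sqr_ge0//; lra.
have i1 : 0 < (1 : R) < 2 by rewrite ltr01 ltr1n.
have := ode_remainder B0 (fun m t (h : 0 < t < 2) => der_remL m (proj1 (andP h))) (fun m t (h : 0 < t < 2) => der_remI m (proj1 (andP h))) D0 ep0 epc Dc Gc n i1.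
rewrite -cmodN expr1n mulr1.
have f1 : 1 <= n`!%:R :> R by rewrite ler1n fact_gt0.
have n1 : 1 <= n.+1%:R :> R by rewrite ler1n.
have f0 := lt_le_trans ltr01 f1.
set lhs := cmod (p * Iq 1 - _); set rhs := cmod (- remI _ _).
have -> : lhs = rhs.
  rewrite /lhs /rhs; congr cmod; rewrite /remI [RHS]opprD !opprK mul1r; congr (_ + _).
  have e1 : log_spq 1 = clog p + clog q by rewrite /log_spq ln1 add0r.
  have t0 : log_term' 0 1 = -1 by rewrite /log_term' /inv_fact_sqr fact0 mul1r invr1 expr0 !mul1r mul0r add0r.
  rewrite [RHS]big_ord_recl (_ : log_term' (ord0 : 'I_n.+2) 1 = -1); last exact: t0.
  rewrite opprD; congr (_ + _).
  rewrite mulr_sumr -sumrN; apply: eq_bigr => m _; rewrite lift0 /log_term' /inv_fact_sqr e1 /bterm psiS exprS mul1r.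
  have h : m.+1%:R != 0 :> C by rewrite pnatr_eq0.
  have f : m`!%:R != 0 :> C by rewrite pnatr_eq0 -lt0n fact_gt0.
  rewrite factS natrM; move: (m.+1%:R) (m`!%:R) h f => x y h f; field.
  by rewrite h f.
move=> h; apply: (le_trans h).
rewrite ler_wpM2l//; first by have := cmod_ge0 (p * q) => ?; nonneg.
rewrite lef_pV2 ?posrE ?mulr_gt0 ?exprn_gt0 ?(lt_le_trans ltr01 n1)//.
rewrite expr2 mulrA ler_peMl ?(ltW f0)// -[leLHS]mul1r; apply: ler_pM => //.
Qed.
End bessel_integral.

(** * The boundary case and the branch of the logarithm *)

Lemma ccvg_cmod_le (v : nat -> C) l B : ccvg v l -> (forall i, cmod (v i) <= B) -> cmod l <= 2 * B.
Proof.
move=> [v1 v2] vB; rewrite (le_trans (cmod_leD _))// (_ : 2 * B = B + B); last by ring.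
have gen (P : C -> R) : (forall z, `|P z| <= cmod z) -> P (v i) @[i --> \oo] --> P l -> `|P l| <= B.
  move=> Pz Pc; rewrite ler_norml; apply/andP; split.
    apply: (@ler_cvg_to _ _ _ _ (fun=> - B) _ _ _ (cvg_cst _) Pc); apply: nearW => i.
    by have := le_trans (Pz (v i)) (vB i); rewrite ler_norml => /andP[].
  apply: (@ler_cvg_to _ _ _ _ _ (fun=> B) _ _ Pc (cvg_cst _)); apply: nearW => i.
  by have := le_trans (Pz (v i)) (vB i); rewrite ler_norml => /andP[].
by apply: lerD; apply: gen; [exact: Re_le_cmod|exact: v1|exact: Im_le_cmod|exact: v2].
Qed.

Lemma ccvg_sum (n : nat) (f : nat -> nat -> C) (l : nat -> C) : (forall m, ccvg (f^~ m) (l m)) ->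
  ccvg (fun i => \sum_(m < n) f i m) (\sum_(m < n) l m).
Proof.
move=> h; elim: n => [|n IH].
  rewrite big_ord0 (_ : (fun i => _) = fun=> 0); first exact: ccvg_cst.
  by apply/funext => t; rewrite big_ord0.
rewrite big_ord_recr /= (_ : (fun i => _) = fun i => \sum_(m < n) f i m + f i n); first exact: ccvgD.
by apply/funext => t; rewrite big_ord_recr.
Qed.

(** [qk] lies on the boundary of the half-plane [Re q > 0] of the preceding section. [lk] is
    [clog p] plus the boundary value of [clog q], and [Bn] is the remainder bound for all [q] within
    distance 1, doubled for the passage to the limit. *)
Definition qk (k : R) : C := - (ic * (k ^+ 2)%:C).
Definition lk (k : R) (p : C) : C := clog p + ((ln (k ^+ 2))%:C - ic * (pi / 2)%:C).
Definition Bn (p q : C) (n : nat) : R := let Q := cmod q + 1 in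
  2 * (2 * (cmod p * Q) * (24 * (cmod p + Q) * pi) * (4 * (cmod p * Q)) ^+ n / n`!%:R).

Lemma clog_qk (k : R) : 0 < k ->
  ccvg (fun i => clog ((lo 0 i)%:C + qk k)) ((ln (k ^+ 2))%:C - ic * (pi / 2)%:C).
Proof.
move=> k0; have k2 : 0 < k ^+ 2 by rewrite exprn_gt0.
have RE i : Re ((lo 0 i)%:C + qk k) = lo 0 i by rewrite /qk !(ReImE, icE); ring.
have IE i : Im ((lo 0 i)%:C + qk k) = - k ^+ 2 by rewrite /qk !(ReImE, icE); ring.
split.
  rewrite (_ : Re _ = ln (Num.sqrt (0 ^+ 2 + (- k ^+ 2) ^+ 2))); last first.
    by rewrite expr0n add0r sqrtr_sqr normrN ger0_norm ?sqr_ge0// !(ReImE, icE); ring.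
  rewrite (_ : (fun i => _) = fun i => ln (Num.sqrt (lo 0 i ^+ 2 + (- k ^+ 2) ^+ 2))); last first.
    by apply/funext => i; rewrite /clog /= /cmod RE IE.
  have q0 : 0 < (0 : R) ^+ 2 + (- k ^+ 2) ^+ 2 by rewrite expr0n add0r sqrrN exprn_gt0.
  have s0 : 0 < Num.sqrt ((0 : R) ^+ 2 + (- k ^+ 2) ^+ 2) by rewrite sqrtr_gt0.
  have d := rder_comp (rder_comp (rderD (rderX 2 (rderI (0 : R))) (rderC _ _)) (is_derive1_sqrt q0)) (is_derive1_ln s0).
  exact: (cvg_comp _ _ (@lo_cvg R 0) (cont_derive d)).
rewrite (_ : Im _ = - (pi / 2)); last by rewrite !(ReImE, icE); ring.
rewrite (_ : (fun i => _) = fun i => - atan (k ^+ 2 / lo 0 i)); last first.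
  by apply/funext => i; rewrite /clog /= /carg RE IE lo_gt0 -atanN mulNr.
apply: cvgN; apply: (cvg_comp _ _ _ (@cvgy_atan R)).
apply/cvgryPge => A; near=> n; rewrite /lo add0r invrK mulrC -ler_pdivrMr//.
by rewrite (@le_trans _ _ n%:R)// ?ler_nat//; near: n; exact: nbhs_infty_ger.
Unshelve. all: by end_near. Qed.

(** The limit from [Re q > 0]. The integral converges by the majorant [exp (- Re p * u)], which is
    the same for all these [q]. *)
Lemma bessel_boundary (k : R) (p : C) n : 0 < k -> 0 < Re p ->
  cmod (p * Iq p (qk k) 1 - (1 + p * qk k * \sum_(m < n.+1) bterm p (qk k) m * (lk k p - psi m - psi m.+1))) <=
  Bn p (qk k) n.
Proof.
move=> k0 p0; set q := qk k; pose qi i : C := (lo 0 i)%:C + q.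
have q0 i : 0 < Re (qi i).
  by rewrite (_ : Re (qi i) = lo 0 i) ?lo_gt0// /qi /q /qk !(ReImE, icE); ring.
have lo1 i : lo 0 i <= 1 :> R by rewrite /lo add0r invf_le1 ?ler1n.
have qB i : cmod (qi i) <= cmod q + 1.
  by rewrite /qi (le_trans (ler_cmodD _ _))// cmodC (gtr0_norm (@lo_gt0 R i)) addrC lerD2l.
have lc : lo 0 i @[i --> \oo] --> (0 : R) by exact: (@lo_cvg R 0).
have cq (F : C -> C) : (forall t : R, ccont (fun t => F (t%:C + q)) t) -> ccvg (fun i => F (qi i)) (F q).
  by move=> h; have := ccont_ccvg (h 0) lc; rewrite (_ : (0 : R)%:C + q = q)// add0r.
have dq (t : R) : cder (fun t => t%:C + q) t 1 by apply: cder_eq (cderD (cder_id t) (cder_cst q t)) _; rewrite addr0.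
have kE (z : C) u : kq p z 1 u = cexp (- (p * u%:C) - z * (u^-1)%:C) by rewrite /kq mul1r.
have [ie _] := intg_expR p0.
have [_ cI] : cintg Rp (kq p q 1) /\ ccvg (fun i => Iq p (qi i) 1) (Iq p q 1).
  apply: (@cint_dcvg R Rp (fun i => kq p (qi i) 1) _ (fun u => expR (- (Re p * u))) mRp).
  - by move=> i; apply: cintg_meas; exact: (kq_intg p0 (q0 i) ltr01).
  - move=> u /Rp_gt0 u0; apply: (cq (fun z => kq p z 1 u)) => t.
    rewrite (_ : (fun t => _) = fun t => cexp (- (p * u%:C) - (t%:C + q) * (u^-1)%:C)); last by apply/funext => s; rewrite kE.
    exact: (cder_ccont (cder_cexp (cderB (cder_cst _ t) (cderM (dq t) (cder_cst _ t))))).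
  - exact: ie.
  - by move=> i u /Rp_gt0 u0; have := cmod_kq p (q0 i) 1 u0; rewrite mul1r.
have cb m : ccvg (fun i => bterm p (qi i) m * (clog p + clog (qi i) - psi m - psi m.+1))
   (bterm p q m * (lk k p - psi m - psi m.+1)).
  apply: ccvgM.
    apply: (cq (fun z => bterm p z m)) => t.
    exact: (cder_ccont (cderZ _ (cderX m (cderZ p (dq t))))).
  apply: ccvgB; last exact: ccvg_cst.
  apply: ccvgB; last exact: ccvg_cst.
  by apply: ccvgD; [exact: ccvg_cst|exact: clog_qk].
have cQ : ccvg qi q by apply: (cq id) => t; exact: cder_ccont (dq t).
have cX := ccvgB (ccvgM (ccvg_cst p) cI) (ccvgD (ccvg_cst 1) (ccvgM (ccvgM (ccvg_cst p) cQ) (ccvg_sum n.+1 cb))).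
apply: (ccvg_cmod_le cX) => i; apply: (le_trans (bessel_remainder p0 (q0 i) n)).
have pg := cmod_ge0 p; have qg := cmod_ge0 q; have qig := cmod_ge0 (qi i).
have Q0 : 0 <= cmod q + 1 by rewrite addr_ge0.
have pq : cmod (p * qi i) <= cmod p * (cmod q + 1) by rewrite cmodM ler_wpM2l.
rewrite ler_wpM2r ?invr_ge0 ?ler0n//; apply: ler_pM.
- by have := cmod_ge0 (p * qi i) => ?; rewrite /Brem; nonneg.
- by have := cmod_ge0 (p * qi i) => ?; nonneg.
- apply: ler_pM.
  + by have := cmod_ge0 (p * qi i) => ?; nonneg.
  + by rewrite /Brem; nonneg.
  + by rewrite ler_wpM2l.
  + by rewrite /Brem ler_wpM2r ?pi_ge0// ler_wpM2l// lerD2l.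
- by rewrite lerXn2r ?nnegrE ?mulr_ge0 ?cmod_ge0// ler_wpM2l.
Qed.

Lemma clim_ccvg (u : nat -> C) l : ccvg u l -> clim u = l.
Proof. by move=> [u1 u2]; rewrite /clim (cvg_lim _ u1)// (cvg_lim _ u2)//; case: l u1 u2. Qed.

Lemma Bn_cvg p q : Bn p q n @[n --> \oo] --> 0.
Proof.
pose x := 4 * (cmod p * (cmod q + 1)).
rewrite (_ : Bn p q = fun n => 2 * (2 * (cmod p * (cmod q + 1)) * (24 * (cmod p + (cmod q + 1)) * pi)) * exp_coeff x n).
  rewrite -[X in _ --> X](mulr0 (2 * (2 * (cmod p * (cmod q + 1)) * (24 * (cmod p + (cmod q + 1)) * pi)))).
  by apply: cvgM; [exact: cvg_cst|exact: cvg_exp_coeff].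
by apply/funext => n; rewrite /Bn /exp_coeff /= /x !mulrA.
Qed.

Lemma bterm_cvg p q : exists S, ccvg (fun n => \sum_(m < n) bterm p q m) S.
Proof.
have bd m : cmod (bterm p q m) <= exp_coeff (cmod (p * q)) m.
  rewrite (_ : exp_coeff _ m = cmod (p * q) ^+ m / m`!%:R)// /bterm [leLHS]cmodM [X in _ * X <= _]cmodX [leLHS]mulrC ler_wpM2l ?exprn_ge0 ?cmod_ge0//.
  rewrite cmodV cmodM !cmodn lef_pV2 ?posrE ?mulr_gt0 ?ltr0n ?fact_gt0//.
  by rewrite ler_peMr ?ler0n// ler1n fact_gt0.
have gen (P : C -> R) : (forall z, `|P z| <= cmod z) -> (forall x y, P (x + y) = P x + P y) -> P 0 = 0 ->
    exists l : R, P (\sum_(m < n) bterm p q m) @[n --> \oo] --> l.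
  move=> Pz PD P00.
  have c : cvgn (series (fun m => P (bterm p q m))).
    apply: (@normed_cvg R R^o); apply: (series_le_cvg _ _ _ (is_cvg_series_exp_coeff (cmod (p * q)))) => m /=.
    - exact: normr_ge0.
    - by rewrite (le_trans (cmod_ge0 _) (bd m)).
    - exact: le_trans (Pz _) (bd m).
  exists (limn (series (fun m => P (bterm p q m)))).
  rewrite (_ : (fun n => _) = series (fun m => P (bterm p q m))); first exact: c.
  apply/funext => n; rewrite /series /= big_mkord.
  elim: n => [|n IH]; first by rewrite !big_ord0.
  by rewrite !big_ord_recr /= PD IH.
have [l1 h1] := gen Re (@Re_le_cmod R) (@ReD R) erefl.
have [l2 h2] := gen Im (@Im_le_cmod R) (@ImD R) erefl.
by exists (l1 +i* l2); split.
Qed.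

Lemma cexpE (r x : R) : 0 < r -> cexp ((ln r) +i* x) = r%:C * (cos x +i* sin x).
Proof. by move=> r0; apply: eq_ReIm; rewrite /cexp /= lnK ?posrE//; ring. Qed.

Lemma tanDpi (x : R) : tan (x + pi) = tan x.
Proof. by rewrite /tan sinDpi cosDpi invrN mulrNN. Qed.

Lemma carg_polar (r x : R) : 0 < r -> 0 < x < pi -> carg (r%:C * (cos x +i* sin x)) = x.
Proof.
move=> r0 /andP[x0 xpi]; have s0 : 0 < sin x by rewrite sin_gt0_pi// x0.
have q : r * sin x / (r * cos x) = tan x by rewrite -mulf_div divff ?gt_eqF// mul1r.
rewrite /carg /= !mul0r subr0 addr0.
have [xl|xg|->] := ltgtP x (pi / 2).
- have xI : - (pi / 2) < x < pi / 2 by rewrite xl (lt_trans _ x0)// oppr_lt0 divr_gt0 ?pi_gt0.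
  by rewrite mulr_gt0 ?cos_gt0_pihalf// q tanK// in_itv.
- pose y := x - pi; have yE : x = y + pi by rewrite subrK.
  have yI : - (pi / 2) < y < pi / 2.
    by rewrite /y; have := splitr (pi : R) => h; apply/andP; split; lra.
  have cx : cos x < 0 by rewrite yE cosDpi oppr_lt0 cos_gt0_pihalf.
  have h1 : r * cos x < 0 by rewrite pmulr_rlt0.
  rewrite ltNge (ltW h1) h1 /= (mulr_ge0 (ltW r0) (ltW s0)) q yE tanDpi tanK//.
- by rewrite cos_pihalf sin_pihalf mulr0 ltxx mulr1 r0.
Qed.

Lemma polar_pos z : 0 < Re z -> [/\ 0 < cmod z, - (pi / 2) < carg z < pi / 2 & z = (cmod z)%:C * (cos (carg z) +i* sin (carg z))].
Proof.
move=> z0; have cz : 0 < cmod z.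
  by apply: (lt_le_trans z0); apply: le_trans (Re_le_cmod z); exact: ler_norm.
have cE' : carg z = atan (Im z / Re z) by rewrite /carg z0.
split => //; first by rewrite cE' atan_gtNpi2 atan_ltpi2.
have c0 : 0 < cos (carg z) by rewrite cE' cos_gt0_pihalf// atan_gtNpi2 atan_ltpi2.
have mE : cmod z = Re z * Num.sqrt (1 + (Im z / Re z) ^+ 2).
  rewrite /cmod -{2}(gtr0_norm z0) -sqrtr_sqr -sqrtrM ?sqr_ge0//; congr Num.sqrt.
  by field; rewrite gt_eqF.
have R1 : cmod z * cos (carg z) = Re z.
  by rewrite cE' cos_atan mE mulfK// gt_eqF// sqrtr_gt0 ltr_pwDl// sqr_ge0.
have I1 : cmod z * sin (carg z) = Im z.
  have : tan (carg z) = Im z / Re z by rewrite cE' atanK.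
  rewrite /tan => /(congr1 (fun t => t * cos (carg z))); rewrite divfK ?gt_eqF// => ->.
  by rewrite mulrCA R1 divfK// gt_eqF.
by apply: eq_ReIm => /=; rewrite ?R1 ?I1; ring.
Qed.

Lemma kq_osc (k : R) (p : C) : Iq p (qk k) 1 = osc k 0 (4 * ic * p).
Proof.
apply: eq_cint => u _; rewrite expr0 mul1r /kq /osc_factor mul1r; congr cexp.
have -> : ic * (4 * ic * p) * (u / 4)%:C = ic ^+ 2 * (p * u%:C) by field.
rewrite sqr_ic mulN1r; congr (_ + _).
by rewrite /qk mulNr opprK (rmorphM (real_complex R) (k ^+ 2) u^-1) mulrA.
Qed.

Lemma ccvg_bd0 (v : nat -> C) (b : nat -> R) : (forall n, cmod (v n) <= b n) -> b n @[n --> \oo] --> 0 -> ccvg v 0.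
Proof. by move=> vb b0; apply: ccvg_le b0 => n; rewrite subr0. Qed.

(** The series [S] converges absolutely by comparison with the exponential series. The remainder
    bound gives convergence of the combination with the logarithm, and the digamma series [T] is the
    difference of the two. *)
Lemma bessel_series (k : R) (p : C) : 0 < k -> 0 < Re p ->
  exists S T, [/\ ccvg (fun n => \sum_(m < n) bterm p (qk k) m) S,
   ccvg (fun n => \sum_(m < n) bterm p (qk k) m * (psi m + psi m.+1)) T &
   p * osc k 0 (4 * ic * p) = 1 + p * qk k * (S * lk k p - T)].
Proof.
move=> k0 p0; have [S cS] := bterm_cvg p (qk k); set q := qk k in cS *.
have pn : p != 0 by apply/eqP => H; move: p0; rewrite H ltxx.
have in0 : ic != 0 :> C by apply/eqP => E; have := cmod_ic R; rewrite E cmod0 => /eqP; rewrite eq_sym oner_eq0.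
have qn : q != 0 by rewrite oppr_eq0 mulf_neq0// fmorph_eq0 expf_neq0// gt_eqF.
pose X n := \sum_(m < n) bterm p q m * (lk k p - psi m - psi m.+1).
pose x := (p * Iq p q 1 - 1) / (p * q).
have cX : ccvg X x.
  apply: (ccvg_shift (N := 1)); have h0 := ccvg_bd0 (fun n => bessel_boundary n k0 p0) (@Bn_cvg p q).
  have := ccvgB (ccvg_cst x) (ccvgM (ccvg_cst (p * q)^-1) h0); rewrite mulr0 subr0.
  rewrite (_ : (fun n => _) = fun n => X (n + 1)%N)//; apply/funext => n.
  by rewrite addn1 /x /X -/q; field; rewrite pn qn.
have cT := ccvgB (ccvgM cS (ccvg_cst (lk k p))) cX.
exists S, (S * lk k p - x); split => //.
  move: cT; rewrite (_ : (fun n => _) = fun n => \sum_(m < n) bterm p q m * (psi m + psi m.+1))//.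
  apply/funext => n; rewrite /X mulr_suml -sumrB; apply: eq_bigr => m _; ring.
by rewrite subKr -kq_osc -/q /x; field; rewrite pn qn.
Qed.

(** Since [Re p > 0], the argument of [4 * ic * p] lies in []0, pi[], so halving it never meets the
    cut. The summand [i pi] is the distance between the [- pi / 2] inside [lk] and the [pi / 2] from
    the rotation by [i]. *)
Lemma hankel_log (k : R) (p : C) : 0 < k -> 0 < Re p -> let r := csqrt (4 * ic * p) in
  [/\ r != 0, r ^+ 2 = 4 * ic * p & 2 * clog (k%:C * r / 2%:R) = lk k p + ic * (pi : R)%:C].
Proof.
move=> k0 p0 r; have [cp /andP[a1 a2] pE] := polar_pos p0; set et := carg p in a1 a2 pE.
have h4 : 0 < 4 * cmod p by rewrite mulr_gt0.
pose e1 := et + pi / 2; have pih := splitr (pi : R); have pi0 := @pi_gt0 R.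
have e1I : 0 < e1 < pi by rewrite /e1; apply/andP; split; lra.
have rhoE : 4 * ic * p = (4 * cmod p)%:C * (cos e1 +i* sin e1).
  rewrite {1}pE /e1 cosDpihalf sinDpihalf rmorphM /= (_ : (4 : R)%:C = 4); last exact: (rmorph_nat (real_complex R) 4).
  have -> : (- sin et +i* cos et) = ic * (cos et +i* sin et) by rewrite /ic; apply: eq_ReIm => /=; ring.
  by ring.
have ca : carg (4 * ic * p) = e1 by rewrite rhoE carg_polar.
have cm : cmod (4 * ic * p) = 4 * cmod p by rewrite !cmodM cmodn cmod_ic mulr1.
have n0 : 4 * ic * p != 0 by apply/eqP => E; move: cm; rewrite E cmod0 => /esym/eqP; rewrite gt_eqF.
have rE : r = cexp (clog (4 * ic * p) / 2%:R) by rewrite /r /csqrt (negbTE n0).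
have half (x y : R) : (x +i* y) / 2%:R = (x / 2) +i* (y / 2) :> C.
  have -> : (2%:R : C)^-1 = (2^-1)%:C by rewrite fmorphV (rmorph_nat (real_complex R) 2).
  by apply: eq_ReIm => /=; ring.
have rE2 : r = (expR (ln (4 * cmod p) / 2))%:C * (cos (e1 / 2) +i* sin (e1 / 2)).
  rewrite rE /clog ca cm half -[X in X +i* _]expRK cexpE ?expR_gt0//.
split.
- by rewrite rE cexp_neq0.
- rewrite rE expr2 -cexpD -splitr.
  by rewrite /clog ca cm cexpE// rhoE.
have kr : k%:C * r / 2%:R = (k / 2 * expR (ln (4 * cmod p) / 2))%:C * (cos (e1 / 2) +i* sin (e1 / 2)).
  rewrite rE2 !rmorphM /= fmorphV (rmorph_nat (real_complex R) 2); ring.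
have R0 : 0 < k / 2 * expR (ln (4 * cmod p) / 2) by rewrite mulr_gt0 ?expR_gt0// divr_gt0.
have e2I : 0 < e1 / 2 < pi by have /andP[h1 h2] := e1I; apply/andP; split; lra.
have ca2 : carg (k%:C * r / 2%:R) = e1 / 2 by rewrite kr carg_polar.
have cm2 : cmod (k%:C * r / 2%:R) = k / 2 * expR (ln (4 * cmod p) / 2).
  rewrite kr cmodM cmodC (gtr0_norm R0) (_ : cmod (cos (e1 / 2) +i* sin (e1 / 2)) = 1) ?mulr1//.
  by rewrite /cmod /= cos2Dsin2 sqrtr1.
have lnE : 2 * ln (k / 2 * expR (ln (4 * cmod p) / 2)) = ln (cmod p) + ln (k ^+ 2).
  rewrite lnM ?posrE ?expR_gt0 ?divr_gt0// expRK ln_div ?posrE// lnM ?posrE// lnXn//.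
  have -> : (4 : R) = 2 ^+ 2 by ring.
  by rewrite lnXn//; field.
have E2 : (2 : C) = (2 : R)%:C by rewrite (rmorph_nat (real_complex R) 2).
rewrite [clog (k%:C * r / 2%:R)]/clog ca2 cm2 E2 /lk /clog -/et.
have Rm (x y : R) : Re (x +i* y) = x by [].
have Imm (x y : R) : Im (x +i* y) = y by [].
apply: eq_ReIm; rewrite !(ReImE, icE, Rm, Imm); first by rewrite lnE; ring.
by rewrite /e1; field.
Qed.

(** Both sides are written with the series [S] and [T] for [p = - i rho / 4]. In ['i * besselY1] the
    summand [i pi] of [hankel_log] contributes [- besselJ1], which cancels the first term of
    [hankel1]; the rest is the combination in [bessel_series]. *)
Lemma hker_integral (k : R) (w Z : C) : 0 < k -> 0 < Im (w ^+ 2 + Z ^+ 2) ->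
  hker k w Z = C0 * w * osc k 0 (w ^+ 2 + Z ^+ 2).
Proof.
move=> k0; set rho := w ^+ 2 + Z ^+ 2 => r0.
have in0 : ic != 0 :> C by apply/eqP => E; have := cmod_ic R; rewrite E cmod0 => /eqP; rewrite eq_sym oner_eq0.
have i2 := sqr_ic R.
pose p := - (ic * rho) / 4.
have rhoE : 4 * ic * p = rho.
  have -> : 4 * ic * p = - (ic ^+ 2 * rho) by rewrite /p; field.
  by rewrite i2 mulN1r opprK.
have p0 : 0 < Re p.
  have -> : p = (- ic * rho) * (4^-1)%:C by rewrite /p fmorphV (rmorph_nat (real_complex R) 4) !mulNr.
  by rewrite (_ : Re _ = Im rho / 4) ?divr_gt0// !(ReImE, icE); ring.
have [S [T [cS cT E]]] := bessel_series k0 p0; have [rn rr lE] := hankel_log k0 p0.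
rewrite rhoE in E rn rr lE; set r := csqrt rho in rn rr lE; set J := osc _ _ _ in E *.
have kn : k%:C != 0 :> C by rewrite fmorph_eq0 gt_eqF.
have pin : (pi : R)%:C != 0 :> C by rewrite fmorph_eq0 gt_eqF// pi_gt0.
pose z := k%:C * r; have zn : z != 0 by rewrite mulf_neq0.
have yE : p * qk k = - (z ^+ 2) / 4.
  rewrite /z exprMn rr /qk /p (rmorphXn (real_complex R)) /=.
  have -> : - (ic * rho) / 4 * - (ic * k%:C ^+ 2) = ic ^+ 2 * (k%:C ^+ 2 * rho) / 4 by field.
  by rewrite i2 mulN1r.
have EJ : besselJ1 z = z / 2 * S.
  apply: clim_ccvg; have := ccvgM (ccvg_cst (z / 2)) cS; congr (ccvg _ _); apply/funext => n.
  rewrite mulr_sumr; apply: eq_bigr => m _; rewrite /bterm yE.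
  have -> : - z ^+ 2 / 4 = -1 * (z / 2) ^+ 2 by field.
  rewrite exprMn -exprM exprS; ring.
have ET : cseries (fun m => ((digamma_succ R m + digamma_succ R m.+1 : R)%:C)
                        * (- (z ^+ 2) / 4%:R) ^+ m / ((m`!)%:R * ((m.+1)`!)%:R)) = T.
  apply: clim_ccvg; move: cT; congr (ccvg _ _); apply/funext => n; apply: eq_bigr => m _.
  by rewrite /bterm yE /psi rmorphD; ring.
have zE : k%:C * Rw w Z = z by [].
rewrite /hker zE /Rw -/rho -/r /hankel1 EJ /besselY1 EJ ET.
have lE' : clog (z / 2%:R) = (lk k p + ic * (pi : R)%:C) / 2.
  by rewrite -lE; field.
rewrite lE' -(complexiE R) -/ic.
have E2 : (2%:R * pi : R)%:C = 2 * (pi : R)%:C by rewrite rmorphM (rmorph_nat (real_complex R) 2).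
have E3 : (2%:R / pi : R)%:C = 2 / (pi : R)%:C by rewrite rmorphM fmorphV (rmorph_nat (real_complex R) 2).
rewrite E2 E3.
have pn : p != 0 by apply/eqP => H; move: p0; rewrite H ltxx.
have JE : J = 4 * ic / r ^+ 2 - ic * k%:C ^+ 2 * (S * lk k p - T).
  apply: (mulfI pn); rewrite E; move: (S * lk k p - T) => Y.
  rewrite /qk /p -rr (rmorphXn (real_complex R)) /=.
  transitivity (- ic ^+ 2 + ic ^+ 2 * k%:C ^+ 2 * r ^+ 2 / 4 * Y); last by field; rewrite rn.
  by rewrite i2 opprK; congr (_ + _); rewrite -i2; field.
rewrite JE /C0 -/p.
have HE : z / 2 * S + ic * (- (2 / ((pi : R)%:C * z)) + 2 / (pi : R)%:C * ((lk k p + ic * (pi : R)%:C) / 2) * (z / 2 * S) -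
    z / (2 * (pi : R)%:C) * T) = ic * (- (2 / ((pi : R)%:C * z)) + (z / (2 * (pi : R)%:C)) * (S * lk k p - T)).
  have aux X Y : X = Y + (1 + ic ^+ 2) * (z / 2 * S) -> X = Y by move=> ->; rewrite i2 subrr mul0r addr0.
  apply: aux; rewrite /z; clear -pin kn rn in0.
  by move: pin kn rn; move: ((pi : R)%:C) (k%:C) r (lk k p) => P kk r1 l pin kn rn; field; rewrite pin kn rn.
have E1 : (2%:R : R)%:C = 2 by exact: (rmorph_nat (real_complex R) 2).
rewrite E1 HE /z; move: (S * lk k p - T) => Y; clear -pin kn rn.
by move: pin kn rn; move: ((pi : R)%:C) (k%:C) r => P kk r1 pin kn rn; field; rewrite pin kn rn.
Qed.
End laplace.

(** * Regularity of square integrable data *)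

Section regularity.
Context {R : realType}.
Local Notation C := R[i].
Local Notation Re := (@complex.Re R).
Local Notation Im := (@complex.Im R).
Local Notation mu := (@lebesgue_measure R).
Local Notation Rp := (`]0, +oo[%classic : set R).

(* The Poisson kernel contracts the weight [sqrt y + d / sqrt y] by the factor 3/4,
   uniformly in [d], so letting [d] tend to 0 removes the singular part. *)
Lemma bootstrap (I : Type) (f : I -> R -> R) (sg : I -> I) (d0 A B : R) : d0 <= 1 -> 0 <= A -> 0 <= B ->
  (forall i x, 0 < x < d0 -> f i x <= B / Num.sqrt x) ->
  (forall i (w : R -> R) x, 0 < x < d0 -> (forall y, 0 < y -> 0 <= w y) ->
     intg Rp (fun y => x * w y / (x ^+ 2 + y ^+ 2)) -> (forall y, 0 < y < d0 -> f (sg i) y <= w y) ->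
     f i x <= 7 / 6 / pi * \int[mu]_(y in Rp) (x * w y / (x ^+ 2 + y ^+ 2)) + A * x) ->
  forall i x, 0 < x < d0 -> f i x <= 8 * A * Num.sqrt x.
Proof.
move=> d1 A0 B0 f0 fs.
have id3 (P X Y : R) : P != 0 -> 7 / 8 * X * Y = 7 / 6 / P * (X * (3 / 4 * P * Y)) by move=> Pn; field.
(* One step multiplies the constant by [7/6 * 3/4 = 7/8] and adds [A]; [8 * A] is the fixed point,
   and the starting error [B / d] decays geometrically. *)
have step d : 0 < d -> forall n i x, 0 < x < d0 ->
    f i x <= (8 * A + (7 / 8) ^+ n * (B / d)) * (Num.sqrt x + d / Num.sqrt x).
  move=> dp; elim=> [|n IH] i x xI; have /andP[x0 xd] := xI; have s0 : 0 < Num.sqrt x by rewrite sqrtr_gt0.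
    apply: (le_trans (f0 i x xI)); rewrite expr0 mul1r.
    apply: (@le_trans _ _ (B / d * (d / Num.sqrt x))); first by rewrite mulrA divfK// gt_eqF.
    have k1 : 0 <= B / d by rewrite divr_ge0// ltW.
    have k2 : 0 <= d / Num.sqrt x by rewrite divr_ge0// ltW.
    by apply: ler_pM => //; [rewrite lerDr mulr_ge0|rewrite lerDr sqrtr_ge0].
  set An := 8 * A + (7 / 8) ^+ n * (B / d) in IH.
  have An0 : 0 <= An.
    by have := ltW dp => ?; rewrite /An; nonneg.
  pose w y := An * (Num.sqrt y + d / Num.sqrt y).
  have [i1 e1 i2 e2] := poisson_sqrt_int 0 x0.
  have i12 : intg Rp (fun s => An * (x * Num.sqrt (s - 0) / (x ^+ 2 + (s - 0) ^+ 2) + d * (x / Num.sqrt (s - 0) / (x ^+ 2 + (s - 0) ^+ 2)))).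
    by apply: intgZ => //; apply: intgD => //; exact: intgZ.
  have wE : (fun y => x * w y / (x ^+ 2 + y ^+ 2)) =
     (fun s => An * (x * Num.sqrt (s - 0) / (x ^+ 2 + (s - 0) ^+ 2) + d * (x / Num.sqrt (s - 0) / (x ^+ 2 + (s - 0) ^+ 2)))).
    by apply/funext => y; rewrite subr0 /w; ring.
  have w0 y : 0 < y -> 0 <= w y.
    by move=> y0; rewrite mulr_ge0// addr_ge0 ?sqrtr_ge0// divr_ge0 ?sqrtr_ge0// ltW.
  have := fs i w x xI w0; rewrite wE => /(_ i12 (IH (sg i))) h; apply: (le_trans h).
  have le : \int[mu]_(s in Rp) (An * (x * Num.sqrt (s - 0) / (x ^+ 2 + (s - 0) ^+ 2) + d * (x / Num.sqrt (s - 0) / (x ^+ 2 + (s - 0) ^+ 2)))) <=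
      An * (3 / 4 * pi * (Num.sqrt x + d / Num.sqrt x)).
    rewrite RintegralZl//; last by apply: intgD => //; exact: intgZ.
    rewrite ler_wpM2l// RintegralD//; last exact: intgZ.
    rewrite RintegralZl// mulrDr; apply: lerD; first exact: e1.
    have -> : 3 / 4 * pi * (d / Num.sqrt x) = d * (3 / 4 * pi / Num.sqrt x) by ring.
    by rewrite ler_wpM2l// ltW.
  have pi0 := @pi_gt0 R.
  apply: (@le_trans _ _ (7 / 8 * An * (Num.sqrt x + d / Num.sqrt x) + A * (Num.sqrt x + d / Num.sqrt x))).
    apply: lerD.
      have -> : 7 / 8 * An * (Num.sqrt x + d / Num.sqrt x) = 7 / 6 / pi * (An * (3 / 4 * pi * (Num.sqrt x + d / Num.sqrt x))).
        clear -id3 pi0; exact: (id3 _ _ _ (lt0r_neq0 pi0)).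
      by rewrite ler_wpM2l// !divr_ge0// ltW.
    rewrite ler_wpM2l//; apply: ler_wpDr; first by rewrite divr_ge0// ltW.
    have x1 : x <= 1 by rewrite (le_trans (ltW xd)).
    rewrite -{1}(sqr_sqrtr (ltW x0)) expr2 ler_piMr ?(ltW s0)//.
    by rewrite -(sqrtr1 R) ler_sqrt.
  rewrite -mulrDl le_eqVlt; apply/orP; left; apply/eqP; congr (_ * _).
  by rewrite /An exprS; field; rewrite gt_eqF.
move=> i x xI; have /andP[x0 xd] := xI; have s0 : 0 < Num.sqrt x by rewrite sqrtr_gt0.
have lim d : 0 < d -> f i x <= 8 * A * (Num.sqrt x + d / Num.sqrt x).
  move=> dp; set Y := Num.sqrt x + d / Num.sqrt x.
  have c : (8 * A + (7 / 8) ^+ n * (B / d)) * Y @[n --> \oo] --> (8 * A + 0 * (B / d)) * Y.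
    apply: cvgM; last exact: cvg_cst.
    apply: cvgD; first exact: cvg_cst.
    apply: cvgM; last exact: cvg_cst.
    by apply: cvg_expr; rewrite ger0_norm//; lra.
  rewrite mul0r addr0 in c.
  by apply: (@ler_cvg_to _ _ _ _ (fun=> f i x) _ _ _ (cvg_cst _) c); apply: nearW => n; exact: step.
apply/ler_addgt0Pr => ep ep0.
(* [d] is such that the singular part costs at most [ep]; the summand 1 covers the case [A = 0]. *)
pose d := ep * Num.sqrt x / (8 * A + 1).
have a1 : 0 < 8 * A + 1 by rewrite ltr_wpDl// mulr_ge0.
have d0' : 0 < d by rewrite divr_gt0// mulr_gt0.
apply: (le_trans (lim d d0')); rewrite mulrDr lerD2l.
have -> : 8 * A * (d / Num.sqrt x) = ep * (8 * A / (8 * A + 1)) by rewrite /d; field; rewrite !gt_eqF.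
by rewrite ler_piMr ?(ltW ep0)// ler_pdivrMr// mul1r lerDl.
Qed.

Variables a k th K : R.
Hypotheses (a0 : 0 < a) (k0 : 0 < k) (th0 : 0 < th) (th1 : th < pi / 2) (K0 : 0 < K).
Hypothesis hK : kernel_bounds a k th K.
Local Notation e := (eith th).
Local Notation h0 := (h0 k th).

Definition l2 (p : R -> C) := cmeas Rp p /\ intg Rp (fun y => cmod (p y) ^+ 2).
Definition nl2 (p : R -> C) : R := \int[mu]_(y in Rp) (cmod (p y) ^+ 2).

Lemma nl2_ge0 p : 0 <= nl2 p.
Proof. by apply: Rintegral_ge0 => y _; rewrite sqr_ge0. Qed.

Lemma amgm (u v lam : R) : 0 < lam -> 2 * (u * v) <= lam * u ^+ 2 + v ^+ 2 / lam.
Proof.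
move=> l0; have : 0 <= (lam * u - v) ^+ 2 / lam by rewrite divr_ge0 ?sqr_ge0// ltW.
rewrite (_ : _ / _ = lam * u ^+ 2 + v ^+ 2 / lam - 2 * (u * v)); first by rewrite subr_ge0.
by field; rewrite gt_eqF.
Qed.

Lemma dist_low0 (x b : R) : dist_low x b 0 x 0.
Proof. by move=> y y0; rewrite !addr0; have := sqr_ge0 b; have := sqr_ge0 x; have := sqr_ge0 y; lra. Qed.

Lemma meas_h0p b x p : offset_ok a b 0 -> 0 < x -> l2 p -> cmeas Rp (fun y => h0 x (displ th b 0 y) * p y).
Proof.
move=> ok x0 [mp _].
have [m0 _ _ _] := @meas_H R k th x b 0 (fun y y0 => let: And5 z _ _ _ _ := kernel_bounds_displ a0 th0 th1 K0 hK ok x0 (@dist_low0 x b) y0 in z).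
exact: cmeasM.
Qed.

(** The inequality of the means with parameter [sqrt x] separates the kernel, whose square is
    integrated explicitly, from the squared data, and gives the singular bound with which
    [bootstrap] starts. *)
Lemma layer_l2 b x p : offset_ok a b 0 -> 0 < x -> l2 p ->
  cintg Rp (fun y => h0 x (displ th b 0 y) * p y) /\
  cmod (layer th h0 p x b 0) <= K * (pi + nl2 p) / Num.sqrt x.
Proof.
move=> ok x0 lp; have [mp ip] := lp.
have s0 : 0 < Num.sqrt x by rewrite sqrtr_gt0.
have [ic ec] := cauchy_int 0 x0.
have bd y : Rp y -> cmod (h0 x (displ th b 0 y) * p y) <=
    K * Num.sqrt x * (x ^+ 2 + (y + 0) ^+ 2)^-1 + K / Num.sqrt x * cmod (p y) ^+ 2.
  move=> /Rp_gt0 y0; have [_ h _ _ _] := kernel_bounds_displ a0 th0 th1 K0 hK ok x0 (@dist_low0 x b) y0.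
  rewrite cmodM; set q := x ^+ 2 + (y + 0) ^+ 2 in h *.
  have q0 : 0 < q by rewrite ltr_pwDl ?sqr_ge0// exprn_gt0.
  have h' : cmod (h0 x (displ th b 0 y)) <= 2 * K * (x / q).
    apply: (le_trans h); rewrite -mulrA ler_wpM2l ?mulr_ge0 ?(ltW K0)// ler_wpM2r ?invr_ge0 ?(ltW q0)//.
    by rewrite gtr0_norm// ler_pdivrMr ?opr2_gt0// ler_peMr ?(ltW x0)// lerDl sqr_ge0.
  apply: (@le_trans _ _ (2 * K * (x / q) * cmod (p y))); first by rewrite ler_wpM2r ?cmod_ge0.
  have -> : 2 * K * (x / q) * cmod (p y) = K * (2 * (x / q * cmod (p y))) by ring.
  have -> : K * Num.sqrt x / q + K / Num.sqrt x * cmod (p y) ^+ 2 = K * (Num.sqrt x / q + cmod (p y) ^+ 2 / Num.sqrt x) by ring.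
  rewrite ler_wpM2l ?(ltW K0)//; apply: (le_trans (amgm _ _ s0)); rewrite lerD2r ler_wpM2l ?(ltW s0)//.
  rewrite expr_div_n [q ^+ 2]expr2 invfM mulrA ler_piMl ?invr_ge0 ?(ltW q0)//.
  by rewrite ler_pdivrMr// mul1r lerDl sqr_ge0.
have ig : intg Rp (fun y => K * Num.sqrt x * (x ^+ 2 + (y + 0) ^+ 2)^-1 + K / Num.sqrt x * cmod (p y) ^+ 2).
  by apply: intgD => //; exact: intgZ.
have ci : cintg Rp (fun y => h0 x (displ th b 0 y) * p y) by apply: (cintg_le mRp (meas_h0p ok x0 lp) ig bd).
split; first exact: ci.
rewrite layerE; apply: (le_trans (cint_le mRp ci ig bd)).
rewrite RintegralD//; [|exact: intgZ..]; rewrite !RintegralZl//.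
have -> : K * (pi + nl2 p) / Num.sqrt x = K * Num.sqrt x * (pi / x) + K / Num.sqrt x * nl2 p.
  by rewrite -{3}(sqr_sqrtr (ltW x0)); field; rewrite gt_eqF.
by rewrite lerD2r ler_wpM2l// mulr_ge0// ltW.
Qed.

Lemma layer_l2_ccont b x p : offset_ok a b 0 -> 0 < x -> l2 p -> ccont (fun x => layer th h0 p x b 0) x.
Proof.
move=> ok x0 lp; have [mp ip] := lp.
have xh : 0 < x / 2 by rewrite divr_gt0.
have near s : `|s - x| < x / 2 -> x / 2 <= s /\ 0 < s.
  rewrite ltr_norml => /andP[h _]; have h' : x / 2 < s by lra.
  by split; [exact: ltW|exact: lt_trans xh h'].
have w s : x / 2 <= s -> dist_low s b 0 (x / 2) 0.
  move=> xs y y0; rewrite !addr0.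
  have : (x / 2) ^+ 2 <= s ^+ 2 by rewrite lerXn2r ?nnegrE ?(ltW xh)// (le_trans (ltW xh)).
  by have := sqr_ge0 b; have := sqr_ge0 s; have := sqr_ge0 y; lra.
have [ic _] := cauchy_int 0 xh.
have x2 : 0 < (x / 2) ^+ 2 by rewrite exprn_gt0.
rewrite (_ : (fun x => _) = fun x => cint Rp (fun y => h0 x (displ th b 0 y) * p y)); last by apply/funext => s; rewrite layerE.
apply: (@cint_ccont R Rp (fun s y => h0 s (displ th b 0 y) * p y) x (x / 2)
  (fun y => K * ((x / 2) ^- 2) * ((x / 2) ^+ 2 + (y + 0) ^+ 2)^-1 + K * cmod (p y) ^+ 2) mRp xh).
- by move=> s /near[_ sp]; exact: meas_h0p.
- move=> y /Rp_gt0 y0; apply: ccontM; last exact: ccont_cst.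
  have [r0 _ _ _ _] := kernel_bounds_displ a0 th0 th1 K0 hK ok x0 (@dist_low0 x b) y0.
  exact: (cder_ccont (d_h0x k r0)).
- by apply: intgD => //; exact: intgZ.
- move=> s y /near[xs s0] /Rp_gt0 y0; have [_ h _ _ _] := kernel_bounds_displ a0 th0 th1 K0 hK ok xh (w s xs) y0.
  rewrite cmodM; set q := (x / 2) ^+ 2 + (y + 0) ^+ 2 in h *.
  have q0 : 0 < q by rewrite ltr_pwDl ?sqr_ge0.
  have h' : cmod (h0 s (displ th b 0 y)) <= 2 * K * q^-1.
    apply: (le_trans h); rewrite ler_wpM2r ?invr_ge0 ?(ltW q0)// ler_piMr ?mulr_ge0 ?(ltW K0)//; exact: xx_le1.
  apply: (@le_trans _ _ (2 * K * q^-1 * cmod (p y))); first by rewrite ler_wpM2r ?cmod_ge0.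
  have -> : 2 * K * q^-1 * cmod (p y) = K * (2 * (q^-1 * cmod (p y))) by ring.
  rewrite -mulrA -mulrDr ler_wpM2l ?(ltW K0)//; have := amgm q^-1 (cmod (p y)) ltr01; rewrite mul1r divr1.
  move/le_trans; apply; rewrite lerD2r expr2 ler_wpM2r ?invr_ge0 ?(ltW q0)// lef_pV2 ?posrE//.
  by rewrite lerDl sqr_ge0.
Qed.

Variables (I : finType) (F : I -> R -> C) (sg sg' : I -> I).
Hypothesis lF : forall i, l2 (F i).
Hypothesis sys : forall i x, 0 < x -> F i x = u0 k th (F (sg i)) (F (sg' i)) x 0 0 (2 * a) 0.

Let N := \sum_i nl2 (F i).

Lemma nl2_le i : nl2 (F i) <= N.
Proof.
rewrite /N (bigD1 i)//= lerDl sumr_ge0// => j _; exact: nl2_ge0.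
Qed.

Lemma N_ge0 : 0 <= N.
Proof. by apply: sumr_ge0 => j _; exact: nl2_ge0. Qed.

Let ok0 : offset_ok a 0 0 := offset_ok0 a 0.
Let ok2 : offset_ok a (2 * a) 0 := offset_ok2a a0 (lexx 0).

Lemma sys_integral i x : 0 < x -> F i x = cint Rp (fun y => e * (h0 x (displ th 0 0 y) * F (sg i) y)) +
  cint Rp (fun y => e * (h0 x (displ th (2 * a) 0 y) * F (sg' i) y)).
Proof.
move=> x0; have [i1 _] := layer_l2 ok0 x0 (lF (sg i)); have [i2 _] := layer_l2 ok2 x0 (lF (sg' i)).
by rewrite (sys i x0) u0E mulrDr layerE; exact: (esym (congr2 +%R (cintZ e mRp i1) (cintZ e mRp i2))).
Qed.

Lemma sys_decay i x : 0 < x -> cmod (F i x) <= 2 * K * (pi + N) / Num.sqrt x.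
Proof.
move=> x0; rewrite (sys i x0) u0E cmod_eM.
have [_ b1] := layer_l2 ok0 x0 (lF (sg i)); have [_ b2] := layer_l2 ok2 x0 (lF (sg' i)).
rewrite (le_trans (ler_cmodD _ _))// (_ : 2 * K * (pi + N) / Num.sqrt x = K * (pi + N) / Num.sqrt x + K * (pi + N) / Num.sqrt x); last by ring.
apply: lerD; [apply: (le_trans b1)|apply: (le_trans b2)].
  by rewrite ler_wpM2r ?invr_ge0 ?sqrtr_ge0// ler_wpM2l ?(ltW K0)// lerD2l nl2_le.
by rewrite ler_wpM2r ?invr_ge0 ?sqrtr_ge0// ler_wpM2l ?(ltW K0)// lerD2l nl2_le.
Qed.

Lemma sys_meas i : cmeas Rp (F i).
Proof. by have [] := lF i. Qed.

(** The size of the corner region: below it the deviation from the Poisson kernel is at most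
    [1 / (6 * pi)] times [x / q], so that [1 / pi + 1 / (6 * pi) = 7 / 6 / pi]. *)
Let D0 : R := (1 + 18 * pi * poisson_const k th)^-1.
Let cA : R := K * (1 + D0 ^- 2) * (pi + N) + K * (1 + (4 * a ^+ 2)^-1) * (pi + N).

Lemma D0_gt0 : 0 < D0.
Proof.
rewrite invr_gt0 ltr_pwDl// mulr_ge0 ?mulr_ge0 ?pi_ge0//; exact: poisson_const_ge0.
Qed.

Lemma D0_le : D0 <= 1 /\ 3 * poisson_const k th * D0 <= (6 * pi)^-1.
Proof.
have c0 := poisson_const_ge0 k th0 th1; have pi0 := @pi_gt0 R.
have h : 1 <= 1 + 18 * pi * poisson_const k th by rewrite lerDl !mulr_ge0// ltW.
have h0' := lt_le_trans ltr01 h.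
split; first by rewrite /D0 invf_le1.
rewrite /D0 ler_pdivrMr// [leRHS]mulrC ler_pdivlMr ?mulr_gt0//.
by rewrite (_ : 3 * poisson_const k th * (6 * pi) = 18 * pi * poisson_const k th); [rewrite lerDr|ring].
Qed.

Lemma cauchy_wt_amgm (c : R) (f : R) (y : R) : 0 <= c -> c * cauchy_wt y * f <= c / 2 * (cauchy_wt y + f ^+ 2).
Proof.
move=> c0; have := amgm (cauchy_wt y) f ltr01; rewrite mul1r divr1 => h.
have w1 := cauchy_wt_le1 y; have w0 := ltW (cauchy_wt_gt0 y).
have w2 : cauchy_wt y ^+ 2 <= cauchy_wt y by rewrite expr2 ler_piMl.
have -> : c * cauchy_wt y * f = c / 2 * (2 * (cauchy_wt y * f)) by field.
by rewrite ler_wpM2l ?divr_ge0//; lra.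
Qed.

Lemma sqrV_le_cauchy_wt (c y : R) : 0 < c -> c <= y ^+ 2 -> (y ^+ 2)^-1 <= (1 + c^-1) * cauchy_wt y.
Proof.
move=> c0 cy; have y0 := lt_le_trans c0 cy.
rewrite -[leLHS]mul1r ler_pdivrMr// mulrAC ler_pdivlMr ?opr2_gt0// mul1r mulrDl mul1r.
by rewrite [leRHS]addrC lerD2r mulrC ler_pdivlMr// mul1r.
Qed.

(** Only sources on the same side with [y < D0] need the comparison with the Poisson kernel. For the
    others the kernel is O(x) times [cauchy_wt], and the [L^2] norm of the data bounds their
    contribution by [cA * x]. *)
Lemma kernel_step i (w : R -> R) x : 0 < x < D0 -> (forall y, 0 < y -> 0 <= w y) ->
  intg Rp (fun y => x * w y / (x ^+ 2 + y ^+ 2)) -> (forall y, 0 < y < D0 -> cmod (F (sg i) y) <= w y) ->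
  cmod (F i x) <= 7 / 6 / pi * \int[mu]_(y in Rp) (x * w y / (x ^+ 2 + y ^+ 2)) + cA * x.
Proof.
move=> /andP[x0 xd] w0 iw Fw; have [d1 d2] := D0_le; have d0 := D0_gt0; have pi0 := @pi_gt0 R.
have [iww eww] := @intg_cauchy_wt R; have x0' := ltW x0; have K0' := ltW K0.
rewrite (sys_integral i x0); set P := F (sg i); set Q := F (sg' i).
have [mP iP] := lF (sg i); have [mQ iQ] := lF (sg' i).
have k1 : 0 <= K * (1 + D0 ^- 2) by have := ltW d0 => ?; nonneg.
have k2 : 0 <= K * (1 + (4 * a ^+ 2)^-1) by have := ltW a0 => ?; nonneg.
have i1 : intg Rp (fun y => cauchy_wt y + cmod (P y) ^+ 2) by exact: intgD.
have i2 : intg Rp (fun y => cauchy_wt y + cmod (Q y) ^+ 2) by exact: intgD.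
have q0 (y : R) : 0 < x ^+ 2 + y ^+ 2 by rewrite ltr_pwDl ?sqr_ge0// exprn_gt0.
have b1 y : Rp y -> cmod (e * (h0 x (displ th 0 0 y) * P y)) <=
    7 / 6 / pi * (x * w y / (x ^+ 2 + y ^+ 2)) + K * (1 + D0 ^- 2) * x * (cauchy_wt y + cmod (P y) ^+ 2).
  move=> /Rp_gt0 y0.
  have s2 : 0 <= K * (1 + D0 ^- 2) * x * (cauchy_wt y + cmod (P y) ^+ 2).
    by have := ltW (cauchy_wt_gt0 y) => ?; apply: mulr_ge0; [apply: mulr_ge0|apply: addr_ge0; nonneg].
  have s1 : 0 <= 7 / 6 / pi * (x * w y / (x ^+ 2 + y ^+ 2)).
    by have := w0 y y0 => ?; have := ltW (q0 y) => ?; nonneg.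
  have [yd|dy] := ltP y D0.
    apply: ler_wpDr => //; rewrite mulrA cmodM.
    apply: (@le_trans _ _ (7 / 6 / pi * (x / (x ^+ 2 + y ^+ 2)) * w y)); last by rewrite le_eqVlt; apply/orP; left; apply/eqP; ring.
    apply: ler_pM; rewrite ?cmod_ge0//; last by apply: Fw; rewrite y0.
    (* With this [lam] both errors in [h0_poisson] are multiples of [x / (x ^+ 2 + y ^+ 2)], with
       the factors [2 * D0] and [(x ^+ 2 + y ^+ 2) / (2 * D0) <= D0]. *)
    pose lam := x * (2 * D0) / (x ^+ 2 + y ^+ 2).
    have l0 : 0 < lam by rewrite divr_gt0// mulr_gt0// mulr_gt0.
    have := h0_poisson k th0 th1 0 y x0 l0; rewrite addr0 => hp.
    have -> : e * h0 x (displ th 0 0 y) = (e * h0 x (displ th 0 0 y) - (x / (pi * (x ^+ 2 + y ^+ 2)))%:C) + (x / (pi * (x ^+ 2 + y ^+ 2)))%:C by rewrite subrK.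
    apply: (le_trans (ler_cmodD _ _)); rewrite cmodC ger0_norm; last by rewrite divr_ge0// mulr_ge0// ltW.
    have hs : poisson_const k th * (lam + x ^+ 2 / lam / (x ^+ 2 + y ^+ 2)) <= 3 * poisson_const k th * D0 * (x / (x ^+ 2 + y ^+ 2)).
      have -> : 3 * poisson_const k th * D0 * (x / (x ^+ 2 + y ^+ 2)) = poisson_const k th * (3 * D0 * (x / (x ^+ 2 + y ^+ 2))) by ring.
      rewrite ler_wpM2l ?poisson_const_ge0//.
      have -> : lam + x ^+ 2 / lam / (x ^+ 2 + y ^+ 2) = (2 * D0 + (x ^+ 2 + y ^+ 2) / (2 * D0)) * (x / (x ^+ 2 + y ^+ 2)).
        have qn := lt0r_neq0 (q0 y); rewrite /lam; move: (x ^+ 2 + y ^+ 2) qn => q qn.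
        by field; rewrite qn !gt_eqF.
      rewrite ler_wpM2r ?divr_ge0 ?(ltW (q0 y))//.
      rewrite -lerBrDl (_ : 3 * D0 - 2 * D0 = D0); last by ring.
      rewrite ler_pdivrMr ?mulr_gt0//.
      have -> : D0 * (2 * D0) = D0 * D0 + D0 * D0 by ring.
      by rewrite !expr2; apply: lerD; apply: ler_pM => //; exact: ltW.
    apply: (le_trans (lerD (le_trans hp hs) (lexx _))).
    have -> : x / (pi * (x ^+ 2 + y ^+ 2)) = pi^-1 * (x / (x ^+ 2 + y ^+ 2)).
      have qn := lt0r_neq0 (q0 y); have pn := lt0r_neq0 pi0; move: (x ^+ 2 + y ^+ 2) (pi : R) qn pn => q p qn pn.
      by field; rewrite qn pn.
    rewrite -mulrDl ler_wpM2r ?divr_ge0 ?(ltW (q0 y))//.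
    apply: (le_trans (lerD d2 (lexx _))).
    rewrite le_eqVlt; apply/orP; left; apply/eqP.
    have pn := lt0r_neq0 pi0; move: (pi : R) pn => p pn; field; exact: pn.
  apply: ler_wpDl => //; rewrite cmod_eM cmodM.
  have [_ h _ _ _] := kernel_bounds_displ a0 th0 th1 K0 hK ok0 x0 (@dist_low0 x 0) y0; rewrite addr0 in h.
  apply: (@le_trans _ _ (2 * K * x * (y ^+ 2)^-1 * cmod (P y))).
    rewrite ler_wpM2r ?cmod_ge0//; apply: (le_trans h).
    apply: ler_pM; rewrite ?invr_ge0 ?(ltW (q0 y))//.
    - by have := ltW (opr2_gt0 x) => ?; nonneg.
    - by rewrite ler_wpM2l ?mulr_ge0// gtr0_norm// ler_pdivrMr ?opr2_gt0// ler_peMr// lerDl sqr_ge0.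
    - by rewrite lef_pV2 ?posrE ?exprn_gt0// lerDr sqr_ge0.
  have yD : D0 ^+ 2 <= y ^+ 2 by rewrite !expr2; apply: ler_pM => //; exact: ltW.
  have := sqrV_le_cauchy_wt (exprn_gt0 2 d0) yD => hw.
  apply: (@le_trans _ _ (2 * K * x * ((1 + D0 ^- 2) * cauchy_wt y) * cmod (P y))).
    by rewrite ler_wpM2r ?cmod_ge0// ler_wpM2l// !mulr_ge0.
  have k3 : 0 <= 2 * K * x * (1 + D0 ^- 2) by have := ltW d0 => ?; nonneg.
  have := cauchy_wt_amgm (cmod (P y)) y k3; rewrite -mulrA.
  have -> : 2 * K * x * ((1 + D0 ^- 2) * cauchy_wt y) * cmod (P y) = 2 * K * x * (1 + D0 ^- 2) * (cauchy_wt y * cmod (P y)) by ring.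
  move/le_trans; apply; rewrite le_eqVlt; apply/orP; left; apply/eqP.
  by field; rewrite gt_eqF.
have b2 y : Rp y -> cmod (e * (h0 x (displ th (2 * a) 0 y) * Q y)) <= K * (1 + (4 * a ^+ 2)^-1) * x * (cauchy_wt y + cmod (Q y) ^+ 2).
  move=> /Rp_gt0 y0; rewrite cmod_eM cmodM.
  have [ad zz im] := displ_admissible a0 th0 th1 ok2 y0; rewrite addr0 in zz im.
  have [qq [h _ _ _]] := hK ad (im x (q0 y)); rewrite (gtr0_norm x0) in h.
  set q := x ^+ 2 + _ in qq h.
  have qy : 4 * a ^+ 2 + y ^+ 2 <= q.
    rewrite (_ : 4 * a ^+ 2 = (2 * a) ^+ 2); last by ring.
    by apply: (le_trans zz); rewrite lerDr sqr_ge0.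
  have a2 : 0 < 4 * a ^+ 2 by rewrite mulr_gt0// exprn_gt0.
  have h' : cmod (h0 x (displ th (2 * a) 0 y)) <= K * x * ((1 + (4 * a ^+ 2)^-1) * cauchy_wt y).
    apply: (le_trans h); rewrite ler_wpM2l ?mulr_ge0//.
    apply: (@le_trans _ _ q^-1).
      have qq1 : 0 < 1 + q by rewrite addr_gt0.
      rewrite lef_pV2 ?posrE//; last exact: mulr_gt0.
      by apply: ler_peMr; [exact: ltW|rewrite lerDl ltW].
    rewrite -[leLHS]mul1r ler_pdivrMr// mulrAC ler_pdivlMr ?opr2_gt0// mul1r.
    apply: (@le_trans _ _ ((1 + (4 * a ^+ 2)^-1) * (4 * a ^+ 2 + y ^+ 2))); last first.
      by rewrite ler_wpM2l// addr_ge0// invr_ge0 ltW.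
    have an := lt0r_neq0 a2; rewrite mulrDl mul1r mulrDr mulVf//.
    have : 0 <= (4 * a ^+ 2)^-1 * y ^+ 2 by rewrite mulr_ge0 ?sqr_ge0// invr_ge0 ltW.
    by move: (ltW a2); lra.
  apply: (@le_trans _ _ (K * x * ((1 + (4 * a ^+ 2)^-1) * cauchy_wt y) * cmod (Q y))); first by rewrite ler_wpM2r ?cmod_ge0.
  have k3 : 0 <= K * x * (1 + (4 * a ^+ 2)^-1) by have := ltW a0 => ?; nonneg.
  have -> : K * x * ((1 + (4 * a ^+ 2)^-1) * cauchy_wt y) * cmod (Q y) = K * x * (1 + (4 * a ^+ 2)^-1) * cauchy_wt y * cmod (Q y) by ring.
  apply: (le_trans (cauchy_wt_amgm (cmod (Q y)) y k3)).
  have -> : K * (1 + (4 * a ^+ 2)^-1) * x = K * x * (1 + (4 * a ^+ 2)^-1) by ring.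
  rewrite ler_wpM2r//; first by have := ltW (cauchy_wt_gt0 y) => ?; apply: addr_ge0; nonneg.
  by rewrite ler_pdivrMr// ler_peMr// ler1n.
have [j1 _] := layer_l2 ok0 x0 (lF (sg i)); have [j2 _] := layer_l2 ok2 x0 (lF (sg' i)).
apply: (le_trans (ler_cmodD _ _)).
have k1x : 0 <= K * (1 + D0 ^- 2) * x by apply: mulr_ge0.
have k2x : 0 <= K * (1 + (4 * a ^+ 2)^-1) * x by apply: mulr_ge0.
have g1 : intg Rp (fun y => 7 / 6 / pi * (x * w y / (x ^+ 2 + y ^+ 2)) + K * (1 + D0 ^- 2) * x * (cauchy_wt y + cmod (P y) ^+ 2)).
  by apply: intgD => //; exact: intgZ.
have g2 : intg Rp (fun y => K * (1 + (4 * a ^+ 2)^-1) * x * (cauchy_wt y + cmod (Q y) ^+ 2)) by exact: intgZ.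
have l1 := cint_le mRp (cintgZ e mRp j1) g1 b1; have l2' := cint_le mRp (cintgZ e mRp j2) g2 b2.
apply: (le_trans (lerD l1 l2')).
rewrite RintegralD//; [|exact: intgZ..].
rewrite !RintegralZl// !RintegralD// -addrA lerD2l.
have m1 : \int[mu]_(y in Rp) cauchy_wt y + \int[mu]_(y in Rp) (cmod (P y) ^+ 2) <= pi + N by apply: lerD => //; exact: nl2_le.
have m2 : \int[mu]_(y in Rp) cauchy_wt y + \int[mu]_(y in Rp) (cmod (Q y) ^+ 2) <= pi + N by apply: lerD => //; exact: nl2_le.
have -> : cA * x = K * (1 + D0 ^- 2) * x * (pi + N) + K * (1 + (4 * a ^+ 2)^-1) * x * (pi + N) by rewrite /cA; ring.
by apply: lerD; apply: ler_wpM2l.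
Qed.

(** [bootstrap] below [D0], the decay of order [sqrt y] inverse beyond it. *)
Lemma sys_good_data : exists M, forall i, good M (F i).
Proof.
have [d1 _] := D0_le; have d0 := D0_gt0; have N0 := N_ge0; have pi0 := @pi_ge0 R; have K0' := ltW K0.
have a0' := ltW a0; have d0' := ltW d0.
have cA0 : 0 <= cA by rewrite /cA; nonneg.
pose B := 2 * K * (pi + N); have B0 : 0 <= B by rewrite /B; nonneg.
have nr := @bootstrap I (fun i y => cmod (F i y)) sg D0 cA B d1 cA0 B0 (fun i x xI => sys_decay i (proj1 (andP xI))) kernel_step.
have s0 : 0 < Num.sqrt D0 by rewrite sqrtr_gt0.
have m1 : 0 <= 8 * cA by rewrite mulr_ge0.
have m2 : 0 <= B / Num.sqrt D0 by rewrite divr_ge0// ltW.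
have m3 : 0 <= B / D0 by rewrite divr_ge0.
exists (8 * cA + B / Num.sqrt D0 + B / D0) => i; split; first exact: sys_meas.
move=> y y0; have sy : 0 < Num.sqrt y by rewrite sqrtr_gt0.
have [yd|dy] := ltP y D0.
  have h : cmod (F i y) <= 8 * cA * Num.sqrt y by apply: nr; rewrite y0.
  have y1 : Num.sqrt y <= 1 by rewrite -(sqrtr1 R) ler_sqrt// (le_trans (ltW yd)).
  split.
    apply: (le_trans h); rewrite -addrA; apply: ler_wpDr; first by rewrite addr_ge0.
    by rewrite ler_piMr.
  apply: (le_trans h); rewrite ler_wpM2r ?(ltW sy)// -addrA; apply: ler_wpDr => //; exact: addr_ge0.
have h : cmod (F i y) <= B / Num.sqrt y by exact: sys_decay.
split.
  apply: (le_trans h); apply: ler_wpDr => //; apply: ler_wpDl => //.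
  by apply: ler_wpM2l => //; rewrite lef_pV2 ?posrE// ler_sqrt ?(ltW y0).
apply: (le_trans h); apply: (@le_trans _ _ (B / D0 * Num.sqrt y)); last first.
  by rewrite ler_wpM2r ?(ltW sy)//; apply: ler_wpDl => //; exact: addr_ge0.
rewrite -mulrA ler_wpM2l// mulrC ler_pdivlMr// mulrC ler_pdivrMr// -expr2 sqr_sqrtr ?(ltW y0)//.
Qed.
End regularity.

(** * From the half-lines to the scaled path *)

Section affine.
Context {R : realType}.
Local Notation C := R[i].
Local Notation Re := (@complex.Re R).
Local Notation Im := (@complex.Im R).
Local Notation mu := (@lebesgue_measure R).
Local Notation Rp := (`]0, +oo[%classic : set R).

Definition isom (f : R -> R) := measurable_fun setT f /\ forall A, measurable A -> mu (f @^-1` A) = mu A.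

Lemma shift_isom (c : R) : isom (fun y => c + y).
Proof.
have mf : measurable_fun setT (fun y : R => c + y) by apply: measurable_funD => //; exact: measurable_cst.
split=> // A mA.
rewrite -[LHS]/(pushforward mu ((fun y => c + y) : _ -> measurableTypeR R) A).
apply/esym/lebesgue_measure_unique => //= _ [[u v]] _ <-.
rewrite /pushforward (_ : _ @^-1` _ = `]u - c, v - c]%classic).
  rewrite !lebesgue_measure_itv/= !lte_fin ltrD2r; case: ifP => // _.
  by rewrite -!EFinB; congr EFin; ring.
by apply/seteqP; split => y /=; rewrite !in_itv /= ltrBlDl lerBrDl.
Qed.

Lemma reflection_isom (c : R) : isom (fun y => c - y).
Proof.
have [m1 h1] := shift_isom c.
split=> [|A mA]; first by apply: measurable_funB => //; exact: measurable_cst.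
rewrite -(h1 _ mA) -[RHS]lebesgue_measureN//; last by rewrite -[X in _ X]setTI; exact: m1.
Qed.

(** Integrability is transported from the preimage to [D]. The extension of [q] by zero outside [D]
    is measurable on the whole line, as the push-forward formula asks. *)
Lemma isom_int (f g : R -> R) (D : set R) (q : R -> R) : isom f -> isom g -> cancel g f -> cancel f g ->
  measurable D -> intg (f @^-1` D) (q \o f) ->
  intg D q /\ \int[mu]_(x in D) q x = \int[mu]_(y in f @^-1` D) q (f y).
Proof.
move=> [mf hf] [mg _] gf fg mD iq.
have mE : measurable (f @^-1` D) by rewrite -[X in measurable X]setTI; exact: mf.
have mq : measurable_fun D q.
  have : measurable_fun D ((q \o f) \o g).
    apply: (measurable_comp mE _ (intg_meas iq)); last exact: measurable_funS mg.
    by move=> _ [y Dy <-] /=; rewrite gf.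
  by rewrite (_ : _ \o _ = q)//; apply/funext => y /=; rewrite gf.
pose qD := q \_ D.
have mqD : measurable_fun setT (EFin \o qD).
  by apply/measurable_EFinP; apply/(measurable_restrictT q mD).
have Q y : (f @^-1` D) y -> qD (f y) = q (f y) by move=> Dy; rewrite /qD patchE mem_set.
have iqD : mu.-integrable (f @^-1` D) ((EFin \o qD) \o f).
  by apply: eq_integrable iq => // y /set_mem Dy /=; rewrite Q.
have e1 : (\int[mu]_(x in D) (q x)%:E = \int[mu]_(y in f @^-1` D) (q (f y))%:E)%E.
  transitivity (\int[mu]_(x in D) (qD x)%:E)%E.
    by apply: eq_integral => x xD; rewrite /qD patchE xD.
  transitivity (\int[pushforward mu (f : _ -> measurableTypeR R)]_(x in D) (qD x)%:E)%E.
    by apply/esym; apply: eq_measure_integral => // A mA _; exact: hf.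
  transitivity (\int[mu]_(y in f @^-1` D) ((EFin \o qD) \o f) y)%E.
    exact: (@integral_pushforward _ _ (measurableTypeR R) (measurableTypeR R) R f mf mu D (EFin \o qD) mqD iqD mD).
  by apply: eq_integral => y /set_mem Dy /=; rewrite Q.
split; last by rewrite /Rintegral e1.
apply/integrableP; split; first exact/measurable_EFinP.
have e2 : (\int[mu]_(x in D) `|(q x)%:E| = \int[mu]_(y in f @^-1` D) `|(q (f y))%:E|)%E.
  transitivity (\int[pushforward mu (f : _ -> measurableTypeR R)]_(x in D) `|(q x)%:E|)%E.
    by apply/esym; apply: eq_measure_integral => // A mA _; exact: hf.
  apply: (@ge0_integral_pushforward _ _ (measurableTypeR R) (measurableTypeR R) R f mf mu D (fun x => `|(q x)%:E|)%E) => //.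
  by apply: measurableT_comp => //; exact/measurable_EFinP.
by rewrite e2; case/integrableP: iq.
Qed.

Lemma isom_ae (f : R -> R) (P : R -> Prop) : isom f ->
  {ae mu, forall t, P t} -> {ae mu, forall y, P (f y)}.
Proof.
move=> [mf hf] [A [mA A0 PA]]; exists (f @^-1` A); split.
- by rewrite -[X in measurable X]setTI; exact: mf.
- by rewrite hf.
- by move=> y /= /PA.
Qed.

Lemma ray_int (a : R) (q : R -> R) : intg Rp (fun y => q (a + y)) ->
  intg `]a, +oo[ q /\ \int[mu]_(x in `]a, +oo[) q x = \int[mu]_(y in Rp) q (a + y).
Proof.
have E : Rp = (fun y => a + y) @^-1` `]a, +oo[.
  by apply/seteqP; split => y /=; rewrite !in_itv /= !andbT ltrDl.
rewrite E; apply: (isom_int (shift_isom a) (shift_isom (- a))) => // y.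
  by rewrite addrA subrr add0r.
by rewrite addrA addNr add0r.
Qed.

Lemma left_ray_int (a : R) (q : R -> R) : intg Rp (fun y => q (- a - y)) ->
  intg `]-oo, - a[ q /\ \int[mu]_(x in `]-oo, - a[) q x = \int[mu]_(y in Rp) q (- a - y).
Proof.
have E : Rp = (fun y => - a - y) @^-1` `]-oo, - a[.
  by apply/seteqP; split => y /=; rewrite !in_itv /= ?andbT gtrDl oppr_lt0.
by rewrite E; apply: (isom_int (reflection_isom (- a)) (reflection_isom (- a))) => // y; rewrite subKr.
Qed.

Lemma intgU (A B : set R) (f : R -> R) : measurable A -> measurable B -> [disjoint A & B] ->
  intg A f -> intg B f -> intg (A `|` B) f.
Proof.
move=> mA mB dAB iA iB; have mf : measurable_fun (A `|` B) (EFin \o f).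
  by apply/measurable_funU => //; split; apply/measurable_EFinP; exact: intg_meas.
apply/integrableP; split=> //.
rewrite ge0_integral_setU//; last exact: measurableT_comp.
by apply: lte_add_pinfty; [case/integrableP: iA|case/integrableP: iB].
Qed.

(** The line is the two open rays, the gap and the null set of the two end points. Measurability on
    the gap is a hypothesis because [f] vanishes there almost everywhere only. *)
Lemma integral_off_gap (a : R) (f : R -> R) : 0 < a -> measurable_fun `]- a, a[ f ->
  {ae mu, forall t, - a < t < a -> f t = 0} ->
  intg Rp (fun y => f (a + y)) -> intg Rp (fun y => f (- a - y)) ->
  \int[mu]_t f t = \int[mu]_(y in Rp) f (a + y) + \int[mu]_(y in Rp) f (- a - y).
Proof.
move=> a0 mm fz /ray_int[i1 <-] /left_ray_int[i2 <-].
set A1 := `]a, +oo[%classic in i1 *; set A2 := `]-oo, - a[%classic in i2 *.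
have mA1 : measurable A1 by exact: measurable_itv.
have mA2 : measurable A2 by exact: measurable_itv.
have dA : [disjoint A1 & A2].
  apply/eqP; rewrite -subset0 => t [/=]; rewrite /A1 /A2 /= !in_itv /= andbT => h1 h2.
  by clear -h1 h2 a0; lra.
have iA : intg (A1 `|` A2) f.
  exact: intgU.
rewrite -(@Rintegral_setU _ _ R mu A1 A2 f mA1 mA2 iA dA) [RHS]Rintegral_mkcond.
have mf : measurable_fun setT f.
  rewrite (_ : setT = (A1 `|` A2) `|` (`]- a, a[%classic `|` ([set a] `|` [set - a]))).
    apply/measurable_funU; [exact: measurableU| |split; first exact: intg_meas iA].
      by apply: measurableU => //; exact: measurableU.
    apply/measurable_funU => //; first exact: measurableU.
    by split=> //; apply/measurable_funU => //; split; exact: measurable_fun_set1.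
  apply/seteqP; split => // t _ /=; rewrite /A1 /A2 /= !in_itv /= andbT.
  case: (ltgtP t a) => [ta|ta|->]; [|by left; left|by right; right; left].
  case: (ltgtP t (- a)) => [ta'|ta'|->]; [by left; right|by right; left|by right; right; right].
have mAA : measurable (A1 `|` A2) by exact: measurableU.
congr fine; rewrite /=; apply: ae_eq_integral => //.
- exact/measurable_EFinP.
- by apply/measurable_EFinP; apply/(measurable_restrictT f mAA); exact: measurable_funS mf.
have n1 : {ae mu, forall t, t != a}.
  exists [set a]; split => //; first exact: lebesgue_measure_set1.
  by move=> t /= /negP; rewrite negbK => /eqP.
have n2 : {ae mu, forall t, t != - a}.
  exists [set - a]; split => //; first exact: lebesgue_measure_set1.
  by move=> t /= /negP; rewrite negbK => /eqP.
have FF := ae_filter_ringOfSetsType mu.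
apply: (@filterS3 _ _ FF _ _ _ _ _ fz n1 n2) => t ft t1 t2 _ /=; rewrite patchE.
case: ifPn => // tA; rewrite ft//; apply/andP; split.
  by rewrite ltNge le_eqVlt (negbTE t2) /=; apply: contra tA => h; rewrite inE; right; rewrite /A2 /= in_itv.
by rewrite ltNge le_eqVlt eq_sym (negbTE t1) /=; apply: contra tA => h; rewrite inE; left; rewrite /A1 /= in_itv /= h.
Qed.

Lemma cintegral_off_gap (a : R) (F : R -> C) : 0 < a -> cmeas `]- a, a[ F ->
  {ae mu, forall t, - a < t < a -> F t = 0} ->
  cintg Rp (fun y => F (a + y)) -> cintg Rp (fun y => F (- a - y)) ->
  cintegral F = cint Rp (fun y => F (a + y)) + cint Rp (fun y => F (- a - y)).
Proof.
move=> a0 [m1 m2] z [i1 i2] [j1 j2]; have FF := ae_filter_ringOfSetsType mu.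
apply: eq_ReIm; rewrite ?ReD ?ImD /=.
  by apply: (@integral_off_gap a (Re \o F)) => //; apply: (@filterS _ _ FF _ _ _ z) => t h /h /= ->.
by apply: (@integral_off_gap a (Im \o F)) => //; apply: (@filterS _ _ FF _ _ _ z) => t h /h /= ->.
Qed.
End affine.

(** * The scaled operators on the half-lines *)

Section scaled.
Context {R : realType}.
Local Notation C := R[i].
Local Notation Re := (@complex.Re R).
Local Notation Im := (@complex.Im R).
Local Notation mu := (@lebesgue_measure R).
Local Notation Rp := (`]0, +oo[%classic : set R).

Lemma isom_l2 (psi : R -> C) (f g : R -> R) : isom f -> isom g -> cancel f g -> cancel g f ->
  L2 psi -> l2 (fun y => psi (f y)).
Proof.
move=> mf mg fg gf [m1 [m2 fin]].
pose q y := Re (psi y) ^+ 2 + Im (psi y) ^+ 2.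
have mq : measurable_fun setT q by apply: measurable_funD; exact: measurable_funX.
have iq : intg setT q.
  apply/integrableP; split; first exact/measurable_EFinP.
  apply: le_lt_trans fin; rewrite le_eqVlt; apply/orP; left; apply/eqP.
  by apply: eq_integral => y _ /=; rewrite ger0_norm// addr_ge0 ?sqr_ge0.
split.
  have mf' : measurable_fun Rp f by exact: measurable_funS (proj1 mf).
  by split; [exact: (measurableT_comp m1 mf')|exact: (measurableT_comp m2 mf')].
rewrite (_ : (fun y => _) = q \o f); last first.
  by apply/funext => y /=; rewrite cmod_sqr.
have mD : measurable (g @^-1` Rp) by rewrite -[X in measurable X]setTI; exact: (proj1 mg).
have [|h _] := @isom_int R g f Rp (q \o f) mg mf fg gf (@mRp R); last exact: h.
rewrite (_ : _ \o g = q); last by apply/funext => y /=; rewrite gf.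
exact: (intg_subset _ _ _ iq).
Qed.

Variables a k th K : R.
Hypotheses (a0 : 0 < a) (k0 : 0 < k) (th0 : 0 < th) (th1 : th < pi / 2) (K0 : 0 < K).
Hypothesis hK : kernel_bounds a k th K.
Local Notation e := (eith th).
Let ok0 : offset_ok a 0 0 := offset_ok0 a 0.
Let ok2 : offset_ok a (2 * a) 0 := offset_ok2a a0 (lexx 0).

(** On the gap [t] is real, so [Im rho] is the constant [Im ((x e)^2) > 0], and the kernel is smooth
    there by its integral representation. *)
Lemma cmeas_hker_gap (x : R) : 0 < x ->
  cmeas `]- a, a[ (fun t => hker k (x%:C * e) (a%:C - t%:C)).
Proof.
move=> x0; pose A := (x%:C * e) ^+ 2 + a%:C ^+ 2 : C; pose B := - (2 * a%:C) : C.
pose rho t := A + B * t%:C + 1 * t%:C ^+ 2 : C.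
have rhoE (t : R) : (x%:C * e) ^+ 2 + (a%:C - t%:C) ^+ 2 = rho t by rewrite /rho /A /B; ring.
have Im0 (t : R) : 0 < Im (rho t).
  rewrite -rhoE -rmorphB -rmorphXn ImD [X in _ + X](_ : _ = 0)// addr0.
  have := Im_krho_displ0 th0 th1 0 0 x0; rewrite /krho /displ.
  by rewrite !rmorph0 mul0r mulr0 !addr0 expr0n /= addr0.
have m1 : cmeas `]- a, a[ (fun t => osc k 0 (rho t)).
  apply: (@cder_cmeas R _ _ (fun t => ic / 4 * (B + 2 * 1 * t%:C) * osc k 1 (rho t))); first exact: interval_open.
  by move=> t _; exact: (@cder_osc_quad R k 0 A B 1 t (Im0 t)).
have := cmeasM (cmeas_cst `]- a, a[ (C0 * (x%:C * e))) m1.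
by congr cmeas; apply/funext => t; rewrite hker_integral// rhoE.
Qed.

(** The part [s > a] of the path is the source with offset 0, the part [s < - a] the source beyond
    the gap [2 * a]; the piece between contributes nothing. *)
Lemma Dop_u0 (psi : R -> C) x : 0 < x -> cmeas setT psi ->
  l2 (fun y => psi (a + y)) -> l2 (fun y => psi (- a - y)) ->
  {ae mu, forall t, - a < t < a -> psi t = 0} ->
  Dop a k th psi (a + x) = u0 k th (fun y => psi (a + y)) (fun y => psi (- a - y)) x 0 0 (2 * a) 0.
Proof.
move=> x0 mpsi lp ln z; rewrite /Dop ltrDl x0.
have tr y : 0 < y -> tau a th (a + y) = a%:C + y%:C * e.
  move=> y0; rewrite /tau; case: ifPn => [|_]; first by rewrite ltNge (le_trans (_ : - a <= a)) ?lerDl ?(ltW y0)// ltW// gtrN.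
  by rewrite ltrDl y0 addrAC subrr add0r.
have tl y : 0 < y -> tau a th (- a - y) = (- a)%:C - y%:C * e.
  by move=> y0; rewrite /tau gtrDl oppr_lt0 y0 addrAC addNr add0r [(- y)%:C]rmorphN mulNr.
have dr y : 0 < y -> dtau a th (a + y) = e by move=> y0; rewrite /dtau ltrDl y0; case: ifP.
have dl y : 0 < y -> dtau a th (- a - y) = e by move=> y0; rewrite /dtau gtrDl oppr_lt0 y0.
pose F s := hker k (tau a th (a + x) - a%:C) (a%:C - tau a th s) * psi s * dtau a th s.
have Fr y : 0 < y -> F (a + y) = e * (h0 k th x (displ th 0 0 y) * psi (a + y)).
  move=> y0; rewrite /F !tr// dr// addrAC subrr add0r.
  (* On the same side the displacement has the opposite sign; the kernel is even in it. *)
  have E : a%:C - (a%:C + y%:C * e) = - displ th 0 0 y by rewrite /displ !mul0r; ring.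
  rewrite E hker_integral//; last by rewrite sqrrN; exact: Im_krho_displ0.
  by rewrite sqrrN /h0 /krho mulrC.
have Fl y : 0 < y -> F (- a - y) = e * (h0 k th x (displ th (2 * a) 0 y) * psi (- a - y)).
  move=> y0; rewrite /F tr// tl// dl// addrAC subrr add0r.
  have E : a%:C - ((- a)%:C - y%:C * e) = displ th (2 * a) 0 y.
    by rewrite /displ rmorphN rmorphM mul0r rmorph_nat; ring.
  rewrite E hker_integral//; last first.
    by have [_ _ h] := displ_admissible a0 th0 th1 ok2 y0; apply: h; rewrite ltr_pwDl ?sqr_ge0// exprn_gt0.
  by rewrite /h0 /krho mulrC.
have mF : cmeas `]- a, a[ F.
  have := cmeasM (cmeas_hker_gap x0) (cmeas_subset measurableT (@subsetT _ _) mpsi).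
  case=> h1 h2; split; [apply: eq_measurable_fun h1|apply: eq_measurable_fun h2] => t /set_mem /=;
    rewrite in_itv /= => /andP[t1 t2]; rewrite /F tr// addrAC subrr add0r /tau /dtau;
    by rewrite !(ltNge t) (ltW t1) (ltNge a) (ltW t2) /= mulr1.
have zF : {ae mu, forall t, - a < t < a -> F t = 0}.
  have FF := ae_filter_ringOfSetsType mu.
  by apply: (@filterS _ _ FF _ _ _ z) => t h /h; rewrite /F => ->; rewrite mulr0 mul0r.
have [i1 _] := layer_l2 a0 th0 th1 K0 hK ok0 x0 lp; have [i2 _] := layer_l2 a0 th0 th1 K0 hK ok2 x0 ln.
rewrite -/F (cintegral_off_gap a0 mF zF).
- have e1 := cintZ e (@mRp R) i1; have e2 := cintZ e (@mRp R) i2.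
  rewrite u0E mulrDr layerE; apply: (etrans _ (congr2 +%R e1 e2)).
  by congr (_ + _); apply: eq_cint => y /Rp_gt0 y0; [exact: Fr|exact: Fl].
- apply: eq_cintg (cintgZ e (@mRp R) i1) => // y /Rp_gt0 y0; by rewrite Fr.
- apply: eq_cintg (cintgZ e (@mRp R) i2) => // y /Rp_gt0 y0; by rewrite Fl.
Qed.
End scaled.

(** * From equations almost everywhere to equations everywhere *)

Section ae_system.
Context {R : realType}.
Local Notation C := R[i].
Local Notation Re := (@complex.Re R).
Local Notation Im := (@complex.Im R).
Local Notation mu := (@lebesgue_measure R).
Local Notation Rp := (`]0, +oo[%classic : set R).

Lemma ae_cint (F G : R -> C) : cmeas Rp F -> cmeas Rp G ->
  {ae mu, forall y, 0 < y -> F y = G y} -> cint Rp F = cint Rp G.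
Proof.
move=> [m1 m2] [n1 n2] h; have FF := ae_filter_ringOfSetsType mu.
apply: eq_ReIm; rewrite /cint /=; congr fine; apply: ae_eq_integral; try exact: mRp; try exact/measurable_EFinP.
  by apply: (@filterS _ _ FF _ _ _ h) => y hy /Rp_gt0 /hy ->.
by apply: (@filterS _ _ FF _ _ _ h) => y hy /Rp_gt0 /hy ->.
Qed.

Lemma ae_l2 (p p' : R -> C) : l2 p -> cmeas Rp p' -> {ae mu, forall y, 0 < y -> p y = p' y} -> l2 p'.
Proof.
move=> [mp ip] mp' h; split=> //.
have FF := ae_filter_ringOfSetsType mu.
have mc : measurable_fun Rp (EFin \o (fun y => cmod (p' y) ^+ 2)).
  by apply/measurable_EFinP; apply: measurable_funX; exact: cmeas_cmod.
have mc0 := measurable_int _ ip.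
apply/integrableP; split=> //; case/integrableP: ip => _; apply: le_lt_trans.
rewrite le_eqVlt; apply/orP; left; apply/eqP; apply: ae_eq_integral; [exact: mRp|exact: measurableT_comp|exact: measurableT_comp|].
by apply: (@filterS _ _ FF _ _ _ h) => y hy /Rp_gt0 /hy /= ->.
Qed.

Variables a k th K : R.
Hypotheses (a0 : 0 < a) (k0 : 0 < k) (th0 : 0 < th) (th1 : th < pi / 2) (K0 : 0 < K).
Hypothesis hK : kernel_bounds a k th K.
Let ok0 : offset_ok a 0 0 := offset_ok0 a 0.
Let ok2 : offset_ok a (2 * a) 0 := offset_ok2a a0 (lexx 0).

Lemma ae_layer (b x : R) (p p' : R -> C) : offset_ok a b 0 -> 0 < x -> l2 p -> l2 p' ->
  {ae mu, forall y, 0 < y -> p y = p' y} -> layer th (h0 k th) p x b 0 = layer th (h0 k th) p' x b 0.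
Proof.
move=> ok x0 lp lp' h; have FF := ae_filter_ringOfSetsType mu.
have m1 := meas_h0p a0 th0 th1 K0 hK ok x0 lp; have m2 := meas_h0p a0 th0 th1 K0 hK ok x0 lp'.
rewrite layerE; apply: ae_cint => //.
by apply: (@filterS _ _ FF _ _ _ h) => y hy /hy ->.
Qed.

(** The right-hand sides define the representatives [G]. Layer potentials depend only on the class
    of the data, so replacing [F] by [G] inside them changes no value, and [G] solves the system at
    every point. *)
Lemma ae_system_good (I : finType) (F : I -> R -> C) (sg sg' : I -> I) :
  (forall i, l2 (F i)) ->
  (forall i, {ae mu, forall x, 0 < x -> F i x = u0 k th (F (sg i)) (F (sg' i)) x 0 0 (2 * a) 0}) ->
  exists G M, [/\ forall i, good M (G i),
    forall i x, 0 < x -> G i x = u0 k th (G (sg i)) (G (sg' i)) x 0 0 (2 * a) 0 &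
    forall i, {ae mu, forall x, 0 < x -> F i x = G i x}].
Proof.
move=> lF sys.
pose G i x := u0 k th (F (sg i)) (F (sg' i)) x 0 0 (2 * a) 0.
have mG i : cmeas Rp (G i).
  apply: ccont_cmeas => x x0.
  rewrite (_ : G i = fun x => eith th * (layer th (h0 k th) (F (sg i)) x 0 0 + layer th (h0 k th) (F (sg' i)) x (2 * a) 0)).
    apply: ccontM; first exact: ccont_cst.
    apply: ccontD; [exact: (layer_l2_ccont a0 th0 th1 K0 hK ok0 x0)|exact: (layer_l2_ccont a0 th0 th1 K0 hK ok2 x0)].
  by apply/funext => s; rewrite /G u0E.
have lG i : l2 (G i) by exact: (ae_l2 (lF i) (mG i) (sys i)).
have sG i x : 0 < x -> G i x = u0 k th (G (sg i)) (G (sg' i)) x 0 0 (2 * a) 0.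
  move=> x0; rewrite /G !u0E; congr (_ * (_ + _)).
    exact: (ae_layer ok0 x0 (lF _) (lG _) (sys _)).
  exact: (ae_layer ok2 x0 (lF _) (lG _) (sys _)).
have [M gM] := sys_good_data a0 th0 th1 K0 hK lG sG.
by exists G, M; split.
Qed.
End ae_system.

Theorem theorem5p2 (R : realType) (a k th : R)
  (ha : 0 < a) (hk : 0 < k) (hth0 : 0 < th) (hth1 : th < pi / 2%:R)
  (phi : 'I_4 -> R -> R[i]) :
  (forall j, L2 (phi j)) ->
  (forall j, {ae (@lebesgue_measure R), forall t,
      t < - a -> phi j t = Sop (Dop a k th (phi (ord_pred j))) t}) ->
  (forall j, {ae (@lebesgue_measure R), forall t,
      a < t -> phi j t = Dop a k th (Sop (phi (ordS j))) t}) ->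
  (forall j, {ae (@lebesgue_measure R), forall t,
      - a < t < a -> phi j t = 0}) ->
  forall j, {ae (@lebesgue_measure R), forall t, phi j t = 0}.
Proof.
move=> hL hl hr hm.
have FF := ae_filter_ringOfSetsType (@lebesgue_measure R).
have [K K0 hK] := kernel_bounds_exist a hk hth0 hth1.
have is1 := shift_isom a; have is2 := shift_isom (- a); have is3 := reflection_isom (- a).
have c1 : cancel (fun y => a + y) (fun y => - a + y) by move=> y; rewrite addKr.
have c2 : cancel (fun y => - a + y) (fun y => a + y) by move=> y; rewrite addNKr.
have c3 : cancel (fun y => - a - y) (fun y => - a - y) by move=> y; rewrite subKr.
have lp j : l2 (fun y => phi j (a + y)) by exact: (isom_l2 is1 is2 c1 c2 (hL j)).
have ln j : l2 (fun y => phi j (- a - y)) by exact: (isom_l2 is3 is3 c3 c3 (hL j)).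
have mphi j : cmeas setT (phi j) by have [? [? _]] := hL j.
(* [true] stands for the ray beyond [a], [false] for the one beyond [- a]. After the reflection
   [Sop], [sg] is the source on the side of the target and [sg'] the one across the gap. *)
pose F (i : 'I_4 * bool) y := if i.2 then phi i.1 (a + y) else phi i.1 (- a - y).
pose sg (i : 'I_4 * bool) := if i.2 then (ordS i.1, false) else (ord_pred i.1, true).
pose sg' (i : 'I_4 * bool) := if i.2 then (ordS i.1, true) else (ord_pred i.1, false).
have lF i : l2 (F i) by case: i => j []; [exact: lp|exact: ln].
have E1 j y : Sop (phi j) (a + y) = phi j (- a - y) by rewrite /Sop opprD.
have E2 j y : Sop (phi j) (- a - y) = phi j (a + y) by rewrite /Sop opprD !opprK.
have F1 j : (fun y => Sop (phi j) (a + y)) = F (j, false) by apply/funext => y; rewrite E1.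
have F2 j : (fun y => Sop (phi j) (- a - y)) = F (j, true) by apply/funext => y; rewrite E2.
have sys i : {ae (@lebesgue_measure R), forall x, 0 < x ->
    F i x = u0 k th (F (sg i)) (F (sg' i)) x 0 0 (2 * a) 0}.
  case: i => j []; rewrite /sg /sg' /=.
    apply: (@filterS _ _ FF _ _ _ (isom_ae is1 (hr j))) => x h x0.
    rewrite [LHS]/F /= h ?ltrDl// (@Dop_u0 R a k th K)//.
    - by rewrite F1 F2.
    - have [h1 h2] := mphi (ordS j); have [m0 _] := reflection_isom (0 : R).
      rewrite (_ : Sop _ = fun t => phi (ordS j) (0 - t)); last by apply/funext => t; rewrite sub0r.
      by split; [exact: (measurableT_comp h1 m0)|exact: (measurableT_comp h2 m0)].
    - by rewrite F1.
    - by rewrite F2.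
    - have is0 := reflection_isom (0 : R); apply: (@filterS _ _ FF _ _ _ (isom_ae is0 (hm (ordS j)))) => t ht tI.
      by rewrite /Sop -sub0r ht// sub0r ltrNl opprK andbC -ltrNl.
  apply: (@filterS _ _ FF _ _ _ (isom_ae is3 (hl j))) => x h x0.
  rewrite [LHS]/F /= h ?gtrDl ?oppr_lt0// /Sop opprD !opprK.
  exact: (Dop_u0 ha hk hth0 hth1 K0 hK x0 (mphi _) (lp _) (ln _) (hm _)).
have [G [M [gM sG aG]]] := ae_system_good ha hth0 hth1 K0 hK lF sys.
have G0 := good_system_zero ha hk hth0 hth1 K0 hK (p := fun j => G (j, true)) (n := fun j => G (j, false)) (M := M)
  (fun j => gM (j, true)) (fun j => gM (j, false)) (fun j => sG (j, true)) (fun j => sG (j, false)).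
move=> j.
(* The end points [a] and [- a] belong to none of the three equations and form a null set. *)
have n1 (c : R) : {ae (@lebesgue_measure R), forall t, t != c}.
  exists [set c]; split => //; first exact: lebesgue_measure_set1.
  by move=> t /= /negP; rewrite negbK => /eqP.
have z1 := isom_ae is2 (aG (j, true)); have z2 := isom_ae is3 (aG (j, false)).
have z12 := @filterI _ _ FF _ _ z1 z2; have n12 := @filterI _ _ FF _ _ (n1 a) (n1 (- a)).
apply: (@filterS3 _ _ FF _ _ _ _ _ z12 n12 (hm j)) => t [/= t1 t2] [/= ta tb] tm.
case: (ltgtP t a) ta => // h _.
  case: (ltgtP t (- a)) tb => // h' _; last by rewrite tm// h h'.
  have y0 : 0 < - a - t by rewrite subr_gt0.
  by have := t2 y0; rewrite /F /= subKr => ->; have [] := G0 j _ y0.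
have y0 : 0 < - a + t by rewrite addrC subr_gt0.
by have := t1 y0; rewrite /F /= addNKr => ->; have [] := G0 j _ y0.
Qed.
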